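(* Let $n\ge 1$ and $k$ be integers with $n+2\le k<2n-1$. If $\alpha:S^n\to \mathbb{H}^n$ and $\beta:S^k\to S^n$ are Lipschitz maps, then $\alpha\circ\beta:S^k\to\mathbb{H}^n$ extends to a Lipschitz map $D^{k+1}\to\mathbb{H}^n$, where $D^{k+1}$ is the closed unit ball in $\mathbb{R}^{k+1}$ with boundary $S^k$.
   Context: The $n$th Heisenberg group $\mathbb{H}^n$ is $\mathbb{R}^n\times\mathbb{R}^n\times\mathbb{R}$ with group law $(x,y,z)\odot(x',y',z')=(x+x',y+y',z+z'+\langle y,x'\rangle)$. Its horizontal subbundle is spanned by the left-invariant vector fields $X_j=\partial_{x_j}+y_j\partial_z$, $Y_j=\partial_{y_j}$, $j=1,\dots,n$. Let $g_0$ be the left-invariant Riemannian metric making $X_j,Y_j,Z=\partial_z$ orthonormal; $\mathbb{H}^n$ carries the Carnot–Carathéodory metric $d(p,q)=\inf$ of $g_0$-lengths of horizontal $C^1$ curves from $p$ to $q$ (or any metric bi-Lipschitz equivalent to it). Spheres $S^m$ carry their standard (e.g. Euclidean) metric. *)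

(* Defs.v *)
From Stdlib Require Import Reals.
From mathcomp Require Import all_boot.
Open Scope R_scope.

Definition Rn (m : nat) : Type := 'I_m -> R.

Definition rsum {m : nat} (f : 'I_m -> R) : R := \big[Rplus/R0]_(i < m) (f i : R).

Definition enorm {m : nat} (u : Rn m) : R := sqrt (rsum (fun i => u i * u i)).
Definition edist {m : nat} (u v : Rn m) : R := enorm (fun i => u i - v i).

Definition sphere (m : nat) (u : Rn m.+1) : Prop := enorm u = 1.
Definition ball (m : nat) (u : Rn m) : Prop := enorm u <= 1.

Record Heis (n : nat) := mkHeis { hx : Rn n; hy : Rn n; hz : R }.
Arguments hx {n}. Arguments hy {n}. Arguments hz {n}. Arguments mkHeis {n}.

Definition hmul {n : nat} (p q : Heis n) : Heis n :=
  mkHeis (fun j => hx p j + hx q j) (fun j => hy p j + hy q j)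
         (hz p + hz q + rsum (fun j => hy p j * hx q j)).

(* A C^1 curve gamma = (gx, gy, gz) : R -> H^n (with derivatives gx', gy')
   which is horizontal: gamma' = sum_j gx'_j X_j + gy'_j Y_j, i.e.
   gz' = sum_j gy_j * gx'_j (X_j = d/dx_j + y_j d/dz, Y_j = d/dy_j). *)
Definition horizontal_C1 {n : nat} (gx gy : 'I_n -> R -> R) (gz : R -> R)
    (gx' gy' : 'I_n -> R -> R) : Prop :=
  (forall j, continuity (gx' j) /\ forall t, derivable_pt_lim (gx j) t (gx' j t)) /\
  (forall j, continuity (gy' j) /\ forall t, derivable_pt_lim (gy j) t (gy' j t)) /\
  (forall t, derivable_pt_lim gz t (rsum (fun j => gy j t * gx' j t))).

(* g_0-speed of a horizontal curve: |sum a_j X_j + b_j Y_j|_{g0} *)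
Definition hspeed {n : nat} (gx' gy' : 'I_n -> R -> R) (t : R) : R :=
  sqrt (rsum (fun j => gx' j t * gx' j t + gy' j t * gy' j t)).

(* cc_dist_le p q l  <->  d_CC(p,q) <= l, where d_CC(p,q) is the infimum of
   g0-lengths of horizontal C^1 curves [0,1] -> H^n from p to q. *)
Definition cc_dist_le {n : nat} (p q : Heis n) (l : R) : Prop :=
  forall eps, 0 < eps ->
  exists (gx gy : 'I_n -> R -> R) (gz : R -> R) (gx' gy' : 'I_n -> R -> R),
    horizontal_C1 gx gy gz gx' gy' /\
    (forall j, gx j 0 = hx p j) /\ (forall j, gy j 0 = hy p j) /\ gz 0 = hz p /\
    (forall j, gx j 1 = hx q j) /\ (forall j, gy j 1 = hy q j) /\ gz 1 = hz q /\
    exists pr : Riemann_integrable (hspeed gx' gy') 0 1,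
      RiemannInt pr <= l + eps.

Definition lipschitz_E {m mm : nat} (A : Rn m -> Prop) (f : Rn m -> Rn mm) : Prop :=
  exists L, forall u v, A u -> A v -> edist (f u) (f v) <= L * edist u v.

Definition lipschitz_H {m n : nat} (A : Rn m -> Prop) (f : Rn m -> Heis n) : Prop :=
  exists L, forall u v, A u -> A v -> cc_dist_le (f u) (f v) (L * edist u v).

(* Main.v *)
(* Spheres and balls are replaced by boundaries of cubes and cubes, and the Carnot-Caratheodory distance
   by an equivalent explicit metric.

   The extension is self-similar.  The cube bounded by the target sphere is cut into [N ^ (n + 2)] boxes, and
   a map [Gam] of the domain cube extending [beta] is found which on disjoint cubes of size [r] is a
   rescaled copy of the cone of [beta] over these boxes, and which maps the rest into the walls between the
   boxes.  Horizontal maps of dimension at most [n] are abundant, so that [alpha] extends over the walls,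
   with Lipschitz constant [O(1 / N)] in box coordinates on the boundary of each box.  As the domain cube
   has dimension [k + 1 > n + 2], one can make [N * r] as large as one likes, so the rescaled extension
   problem on each small cube involves a map [alpha] whose Lipschitz constant is smaller by the factor
   [r / 2].  Iterating, the successive approximations converge to a Lipschitz map.

   [Gam] exists because [beta] is Lipschitz homotopic to a suspension in any pair of coordinate directions:
   for [k < 2 * n - 1] the preimages of two antipodal points can be separated by general position, as in
   Freudenthal's theorem. *)
From Coquelicot Require Import Coquelicot.
From Stdlib Require Import Reals Lra Psatz FunctionalExtensionality Classical ClassicalEpsilon.
From mathcomp Require Import all_boot all_algebra perm Rstruct zify.
Require Import Defs.
Open Scope R_scope.

(** * Sup-norm geometry and Lipschitz maps *)

(** No smooth horizontal map has rank above [n], so the [(n+1)]-dimensional boxes cannot be filled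
    directly: the walls are filled, and each box becomes a smaller copy of the same problem. The
    recursion closes because constants do not accumulate: a hole of size [r] with data of constant
    [L * r / 2] is filled with constant [C' * (L * r / 2)] in its own coordinates, which is only
    [C' * L / 2] in the original ones. The budget is volume. Disjoint cubes of size [r], [N^(n+2)]
    in number, fit into a [(k+1)]-cube when [r] is about [N^(-(n+2)/(k+1))], and then [N * r] is
    unbounded exactly if [k + 1 > n + 2]. The exponent is [n + 2] and not [n + 1] because shrinking
    [alpha] to a point by dilations, in steps of size [O(L / N)], takes [N^2] layers in one of the
    directions. The boxes arise by successive halvings. To halve the target in direction [b] and the
    domain in direction [a] at once, [beta] must copy [u a] into its coordinate [b] and ignore [u a]
    elsewhere; a suspension does this, which is how the Freudenthal range enters. All homotopies are
    normalised straight lines, so that they are Lipschitz. *)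

Lemma rsum_add m (f g : 'I_m -> R) : rsum (fun i => f i + g i) = rsum f + rsum g.
Proof. by rewrite /rsum big_split. Qed.

Lemma rsum_mul m c (f : 'I_m -> R) : rsum (fun i => c * f i) = c * rsum f.
Proof.
rewrite /rsum; elim/big_ind2: _ => [|x x' y y' -> ->|//]; lra.
Qed.

Lemma rsum_sub m (f g : 'I_m -> R) : rsum (fun i => f i - g i) = rsum f - rsum g.
Proof.
have -> : rsum f - rsum g = rsum f + (-1) * rsum g by lra.
rewrite -rsum_mul -rsum_add /rsum; apply: eq_bigr => i _; lra.
Qed.

Lemma rsum_eq m (f g : 'I_m -> R) : (forall i, f i = g i) -> rsum f = rsum g.
Proof. by move=> e; apply: eq_bigr => i _; exact: e. Qed.

Lemma rsum_le m (f g : 'I_m -> R) : (forall i, f i <= g i) -> rsum f <= rsum g.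
Proof.
move=> le_fg; rewrite /rsum.
elim/big_ind2: _ => [|x x' y y' ? ?|i _]; [lra|lra|exact: le_fg].
Qed.

Lemma rsum_const m c : rsum (fun _ : 'I_m => c) = INR m * c.
Proof.
rewrite /rsum; elim: m => [|m IH]; first by rewrite big_ord0 /=; lra.
by rewrite big_ord_recl IH S_INR; lra.
Qed.

Lemma rsum_ge0 m (f : 'I_m -> R) : (forall i, 0 <= f i) -> 0 <= rsum f.
Proof. by move=> f0; have := rsum_le m (fun=> 0) f f0; rewrite rsum_const; lra. Qed.

Lemma rsum_abs m (f : 'I_m -> R) : Rabs (rsum f) <= rsum (fun i => Rabs (f i)).
Proof.
rewrite /rsum; elim/big_ind2: _ => [|x x' y y' le1 le2|i _].
- rewrite Rabs_R0; lra.
- apply: Rle_trans (Rabs_triang _ _) _; lra.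
- lra.
Qed.

Lemma rsum_abs_le m (f : 'I_m -> R) c :
  (forall i, Rabs (f i) <= c) -> Rabs (rsum f) <= INR m * c.
Proof.
move=> le_f; apply: Rle_trans (rsum_abs _ _) _.
by rewrite -rsum_const; exact: rsum_le.
Qed.

Lemma rsum_term m (f : 'I_m -> R) i : (forall j, 0 <= f j) -> f i <= rsum f.
Proof.
move=> f0; have -> : rsum f = f i + \big[Rplus/R0]_(j < m | j != i) f j by rewrite /rsum (bigD1 i).
have h : 0 <= \big[Rplus/R0]_(j < m | j != i) f j.
  apply: big_ind => [|x y ? ?|j _]; [lra|lra|exact: f0].
lra.
Qed.

Lemma rsum_single m (f : 'I_m -> R) i : (forall j, j <> i -> f j = 0) -> rsum f = f i.
Proof.
move=> f0; 
have -> : rsum f = f i + \big[Rplus/R0]_(j < m | j != i) f j by rewrite /rsum (bigD1 i).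
rewrite big1 ?Rplus_0_r // => j /eqP ji; exact: f0.
Qed.

Lemma rsum_recl m (f : 'I_m.+1 -> R) :
  rsum f = f ord0 + rsum (fun i => f (lift ord0 i)).
Proof. by rewrite /rsum big_ord_recl. Qed.

Lemma rsum_exchange m p (f : 'I_m -> 'I_p -> R) :
  rsum (fun i => rsum (fun j => f i j)) = rsum (fun j => rsum (fun i => f i j)).
Proof. exact: exchange_big. Qed.

Definition nrm {m} (u : Rn m) : R := \big[Rmax/R0]_(i < m) Rabs (u i).

Lemma nrm_pos m (u : Rn m) : 0 <= nrm u.
Proof.
rewrite /nrm; elim/big_rec: _ => [|i x _ x0]; first lra.
exact: Rle_trans x0 (Rmax_r _ _).
Qed.

Lemma nrm_coord m (u : Rn m) i : Rabs (u i) <= nrm u.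
Proof.
rewrite /nrm; have := mem_index_enum i.
elim: (index_enum _) => [//|j s IH]; rewrite big_cons inE => /orP[/eqP->|/IH le_s].
- exact: Rmax_l.
- exact: Rle_trans le_s (Rmax_r _ _).
Qed.

Lemma nrm_le m (u : Rn m) r : 0 <= r -> (forall i, Rabs (u i) <= r) -> nrm u <= r.
Proof.
move=> r0 le_u; rewrite /nrm; elim/big_rec: _ => [//|i x _ xr].
exact: Rmax_lub.
Qed.

Lemma nrm_lt m (u : Rn m) r : 0 < r -> (forall i, Rabs (u i) < r) -> nrm u < r.
Proof.
move=> r0 lt_u; rewrite /nrm; elim/big_rec: _ => [//|i x _ xr].
exact: Rmax_lub_lt.
Qed.

Lemma nrm_attained m (u : Rn m.+1) : exists i, nrm u = Rabs (u i).
Proof.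
apply: NNPP => no; have lt_u i : Rabs (u i) < nrm u.
  case: (nrm_coord _ u i) => // e; case: no; by exists i.
have p : 0 < nrm u by apply: Rle_lt_trans (lt_u ord0); exact: Rabs_pos.
by have := nrm_lt _ u _ p lt_u; lra.
Qed.

Lemma nrm_scal m c (u : Rn m) : nrm (fun i => c * u i) = Rabs c * nrm u.
Proof.
have le (c' : R) (v : Rn m) : nrm (fun i => c' * v i) <= Rabs c' * nrm v.
  apply: nrm_le => [|i].
    apply: Rmult_le_pos; [exact: Rabs_pos|exact: nrm_pos].
  rewrite Rabs_mult; apply: Rmult_le_compat_l; [exact: Rabs_pos|exact: nrm_coord].
apply: Rle_antisym; first exact: le.
have [-> | c0] := Req_dec c 0; first by rewrite Rabs_R0 Rmult_0_l; exact: nrm_pos.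
have p := Rabs_pos_lt _ c0; have := le (/ c) (fun i => c * u i).
have -> : (fun i => / c * (c * u i)) = u.
  by apply: functional_extensionality => i; field.
rewrite Rabs_inv => h; apply: (Rmult_le_reg_l (/ Rabs c)); first exact: Rinv_0_lt_compat.
by rewrite -Rmult_assoc Rinv_l ?Rmult_1_l //; lra.
Qed.

Lemma nrm_triang m (u v : Rn m) : nrm (fun i => u i + v i) <= nrm u + nrm v.
Proof.
apply: nrm_le => [|i]; first by have := nrm_pos _ u; have := nrm_pos _ v; lra.
apply: Rle_trans (Rabs_triang _ _) _.
by have := nrm_coord _ u i; have := nrm_coord _ v i; lra.
Qed.

Lemma nrm0 m : nrm (fun _ : 'I_m => 0) = 0.
Proof.
apply: Rle_antisym (nrm_pos _ _); apply: nrm_le => [|i]; [lra|rewrite Rabs_R0; lra].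
Qed.

Lemma nrm_eq0 m (u : Rn m) : nrm u = 0 -> u = fun=> 0.
Proof.
move=> u0; apply: functional_extensionality => i.
have := nrm_coord _ u i; rewrite u0 => h.
case: (Req_dec (u i) 0) => // c; have := Rabs_pos_lt _ c; lra.
Qed.

(** One bundle lets [Lip] and the gluing lemmas serve the reals, sup-norm spaces, products with the
    sum distance and the Heisenberg group alike. *)
Record Met := MkMet {
  car :> Type;
  ds : car -> car -> R;
  ds_refl : forall x, ds x x = 0;
  ds_sym : forall x y, ds x y = ds y x;
  ds_tri : forall x y z, ds x z <= ds x y + ds y z }.

Arguments ds {m} _ _ : simpl never.
Arguments ds_refl {m}.
Arguments ds_sym {m}.
Arguments ds_tri {m}.

Lemma ds_pos (X : Met) (x y : X) : 0 <= ds x y.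
Proof. by have := ds_tri x y x; rewrite ds_refl (ds_sym y x); lra. Qed.

Lemma Rdist_tri' (x y z : R) : Rabs (x - z) <= Rabs (x - y) + Rabs (y - z).
Proof. by have := Rabs_triang (x - y) (y - z); have -> : x - y + (y - z) = x - z by lra. Qed.

Lemma R_dist_refl' (x : R) : Rabs (x - x) = 0.
Proof. by rewrite Rminus_diag Rabs_R0. Qed.

Canonical R_met := @MkMet R (fun x y => Rabs (x - y))
  R_dist_refl' Rabs_minus_sym Rdist_tri'.

Lemma Rds (x y : R) : ds x y = Rabs (x - y).
Proof. by []. Qed.

Definition rn_ds {m} (u v : Rn m) := nrm (fun i => u i - v i).

Lemma rn_ds_refl m (u : Rn m) : rn_ds u u = 0.
Proof.
rewrite -(nrm0 m) /rn_ds; congr nrm; apply: functional_extensionality => i; lra.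
Qed.

Lemma rn_ds_sym m (u v : Rn m) : rn_ds u v = rn_ds v u.
Proof.
rewrite /rn_ds -[RHS]Rmult_1_l -Rabs_R1 -Rabs_Ropp -nrm_scal.
congr nrm; apply: functional_extensionality => i; lra.
Qed.

Lemma rn_ds_tri m (u v w : Rn m) : rn_ds u w <= rn_ds u v + rn_ds v w.
Proof.
apply: Rle_trans (nrm_triang _ _ _); apply: Req_le; congr nrm.
apply: functional_extensionality => i; lra.
Qed.

Canonical Rn_met m := @MkMet (Rn m) rn_ds (rn_ds_refl m) (rn_ds_sym m) (rn_ds_tri m).

Definition prod_ds {X Y : Met} (p q : X * Y) := ds p.1 q.1 + ds p.2 q.2.

Lemma prod_ds_refl (X Y : Met) (p : X * Y) : prod_ds p p = 0.
Proof. by rewrite /prod_ds !ds_refl; lra. Qed.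

Lemma prod_ds_sym (X Y : Met) (p q : X * Y) : prod_ds p q = prod_ds q p.
Proof. by rewrite /prod_ds ds_sym [ds p.2 _]ds_sym. Qed.

Lemma prod_ds_tri (X Y : Met) (p q r : X * Y) : prod_ds p r <= prod_ds p q + prod_ds q r.
Proof.
by rewrite /prod_ds; have := ds_tri p.1 q.1 r.1; have := ds_tri p.2 q.2 r.2; lra.
Qed.

Canonical prod_met (X Y : Met) := @MkMet (X * Y)%type (@prod_ds X Y)
  (@prod_ds_refl X Y) (@prod_ds_sym X Y) (@prod_ds_tri X Y).

Lemma rds_coord m (u v : Rn m) i : Rabs (u i - v i) <= ds u v.
Proof. exact: (nrm_coord _ (fun i => u i - v i)). Qed.

Lemma rds_le m (u v : Rn m) r : 0 <= r -> (forall i, Rabs (u i - v i) <= r) -> ds u v <= r.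
Proof. exact: nrm_le. Qed.

Lemma nrm_lip m (u v : Rn m) : Rabs (nrm u - nrm v) <= ds u v.
Proof.
have h (a b : Rn m) : nrm a <= nrm b + ds a b.
  have := nrm_triang _ b (fun i => a i - b i); rewrite /ds /=.
  by have -> : (fun i => b i + (a i - b i)) = a
    by apply: functional_extensionality => i; lra.
apply: Rabs_le; have := h u v; have := h v u; rewrite (ds_sym v u); lra.
Qed.

Definition Lip {X Y : Met} (D : X -> Prop) (L : R) (f : X -> Y) : Prop :=
  0 <= L /\ forall u v, D u -> D v -> ds (f u) (f v) <= L * ds u v.

Definition lipx {X Y : Met} (D : X -> Prop) (f : X -> Y) : Prop := exists L, Lip D L f.

Definition bnd {X : Met} (D : X -> Prop) (f : X -> R) : Prop :=
  exists M, forall u, D u -> Rabs (f u) <= M.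

Lemma Lip_weak (X Y : Met) (D : X -> Prop) L L' (f : X -> Y) :
  L <= L' -> Lip D L f -> Lip D L' f.
Proof.
move=> le [L0 h]; split; first lra.
move=> u v Du Dv; apply: Rle_trans (h u v Du Dv) _.
by apply: Rmult_le_compat_r => //; exact: ds_pos.
Qed.

Lemma Lip_sub (X Y : Met) (D D' : X -> Prop) L (f : X -> Y) :
  (forall u, D' u -> D u) -> Lip D L f -> Lip D' L f.
Proof. by move=> s [L0 h]; split=> // u v /s Du /s Dv; exact: h. Qed.

Lemma lipx_sub (X Y : Met) (D D' : X -> Prop) (f : X -> Y) :
  (forall u, D' u -> D u) -> lipx D f -> lipx D' f.
Proof. by move=> s [L h]; exists L; exact: Lip_sub h. Qed.

Lemma Lip_eq (X Y : Met) (D : X -> Prop) L (f g : X -> Y) :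
  (forall u, D u -> f u = g u) -> Lip D L f -> Lip D L g.
Proof. by move=> e [L0 h]; split=> // u v Du Dv; rewrite -!e //; exact: h. Qed.

Lemma lipx_eq (X Y : Met) (D : X -> Prop) (f g : X -> Y) :
  (forall u, D u -> f u = g u) -> lipx D f -> lipx D g.
Proof. by move=> e [L h]; exists L; exact: Lip_eq h. Qed.

Lemma Lip_comp (X Y Z : Met) (D : X -> Prop) (E : Y -> Prop) L M (f : X -> Y) (g : Y -> Z) :
  (forall u, D u -> E (f u)) -> Lip D L f -> Lip E M g -> Lip D (M * L) (fun u => g (f u)).
Proof.
move=> DE [L0 hf] [M0 hg]; split; first exact: Rmult_le_pos.
move=> u v Du Dv; apply: Rle_trans (hg _ _ (DE _ Du) (DE _ Dv)) _.
by rewrite Rmult_assoc; apply: Rmult_le_compat_l => //; exact: hf.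
Qed.

Lemma lipx_comp (X Y Z : Met) (D : X -> Prop) (E : Y -> Prop) (f : X -> Y) (g : Y -> Z) :
  (forall u, D u -> E (f u)) -> lipx D f -> lipx E g -> lipx D (fun u => g (f u)).
Proof. by move=> DE [L hf] [M hg]; exists (M * L); exact: Lip_comp hg. Qed.

Lemma lipx_compT (X Y Z : Met) (D : X -> Prop) (f : X -> Y) (g : Y -> Z) :
  lipx D f -> lipx (fun=> True) g -> lipx D (fun u => g (f u)).
Proof. exact: lipx_comp. Qed.

Lemma lipx_id (X : Met) (D : X -> Prop) : lipx D (fun u => u).
Proof. by exists 1; split=> [|u v _ _]; [exact: Rle_0_1|rewrite Rmult_1_l; exact: Rle_refl]. Qed.

Lemma lipx_cst (X Y : Met) (D : X -> Prop) (c : Y) : lipx D (fun=> c).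
Proof. exists 0; split=> [|u v _ _]; [lra|rewrite ds_refl Rmult_0_l; exact: Rle_refl]. Qed.

Lemma lipx_pair (X Y Z : Met) (D : X -> Prop) (f : X -> Y) (g : X -> Z) :
  lipx D f -> lipx D g -> lipx D (fun u => (f u, g u)).
Proof.
move=> [L [L0 hf]] [M [M0 hg]]; exists (L + M); split; first lra.
move=> u v Du Dv.
change (ds (f u) (f v) + ds (g u) (g v) <= (L + M) * ds u v).
by have := hf u v Du Dv; have := hg u v Du Dv; lra.
Qed.

Lemma lipx_fst (X Y : Met) (D : X * Y -> Prop) : lipx D fst.
Proof.
exists 1; split; first lra.
move=> u v _ _; change (ds u.1 v.1 <= 1 * (ds u.1 v.1 + ds u.2 v.2)).
by have := ds_pos Y u.2 v.2; lra.
Qed.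

Lemma lipx_snd (X Y : Met) (D : X * Y -> Prop) : lipx D snd.
Proof.
exists 1; split; first lra.
move=> u v _ _; change (ds u.2 v.2 <= 1 * (ds u.1 v.1 + ds u.2 v.2)).
by have := ds_pos X u.1 v.1; lra.
Qed.

Lemma lipx_coord m (D : Rn m -> Prop) i : lipx D (fun u : Rn m => u i).
Proof. exists 1; split=> [|u v _ _]; first lra; rewrite Rmult_1_l; exact: rds_coord. Qed.

Lemma lipx_nrm m (D : Rn m -> Prop) : lipx D (@nrm m).
Proof. exists 1; split=> [|u v _ _]; first lra; rewrite Rmult_1_l; exact: nrm_lip. Qed.

Lemma lipx_vec (X : Met) m (D : X -> Prop) (f : X -> Rn m) :
  (forall i, lipx D (fun x => f x i)) -> lipx D f.
Proof.
move=> h; pose L i := proj1_sig (constructive_indefinite_description _ (h i)).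
have hL i : Lip D (L i) (fun x => f x i) by rewrite /L; case: constructive_indefinite_description.
have L0 i : 0 <= L i by case: (hL i).
exists (rsum L); split; first exact: rsum_ge0.
move=> u v Du Dv; apply: rds_le => [|i].
  by apply: Rmult_le_pos; [exact: rsum_ge0|exact: ds_pos].
apply: Rle_trans (proj2 (hL i) u v Du Dv) _.
by apply: Rmult_le_compat_r; [exact: ds_pos|exact: rsum_term].
Qed.

Section Scalar.
Variables (X : Met) (D : X -> Prop).
Implicit Types f g : X -> R.

Lemma lipx_add f g : lipx D f -> lipx D g -> lipx D (fun u => f u + g u).
Proof.
move=> [L [L0 hf]] [M [M0 hg]]; exists (L + M); split; first lra.
move=> u v Du Dv; have := hf u v Du Dv; have := hg u v Du Dv; rewrite !Rds.
move=> h1 h2; have -> : f u + g u - (f v + g v) = (f u - f v) + (g u - g v) by lra.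
by apply: Rle_trans (Rabs_triang _ _) _; lra.
Qed.

Lemma lipx_mul f g : lipx D f -> lipx D g -> bnd D f -> bnd D g ->
  lipx D (fun u => f u * g u).
Proof.
move=> [L [L0 hf]] [M [M0 hg]] [A hA] [B hB].
exists (Rabs B * L + Rabs A * M); split.
  by have := Rabs_pos A; have := Rabs_pos B; nra.
move=> u v Du Dv; have := hf u v Du Dv; have := hg u v Du Dv; rewrite !Rds.
set d := ds u v => h1 h2; have d0 : 0 <= d by exact: ds_pos.
have -> : f u * g u - f v * g v = (f u - f v) * g u + f v * (g u - g v) by lra.
apply: Rle_trans (Rabs_triang _ _) _; rewrite !Rabs_mult.
have := hA _ Dv; have := hB _ Du; have := Rle_abs A; have := Rle_abs B.
have := Rabs_pos (f u - f v); have := Rabs_pos (g u - g v).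
have := Rabs_pos (f v); have := Rabs_pos (g u) => ? ? ? ? ? ? ? ?.
have : Rabs (f u - f v) * Rabs (g u) <= L * d * Rabs B by apply: Rmult_le_compat; lra.
have : Rabs (f v) * Rabs (g u - g v) <= Rabs A * (M * d) by apply: Rmult_le_compat; lra.
lra.
Qed.

Lemma lipx_scal c f : lipx D f -> lipx D (fun u => c * f u).
Proof.
move=> [L [L0 hf]]; exists (Rabs c * L); split.
  by apply: Rmult_le_pos => //; exact: Rabs_pos.
move=> u v Du Dv; rewrite Rds -Rmult_minus_distr_l Rabs_mult Rmult_assoc.
by apply: Rmult_le_compat_l; [exact: Rabs_pos|exact: hf].
Qed.

Lemma lipx_opp f : lipx D f -> lipx D (fun u => - f u).
Proof. by move/(lipx_scal (-1)); apply: lipx_eq => u _; lra. Qed.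

Lemma lipx_minus f g : lipx D f -> lipx D g -> lipx D (fun u => f u - g u).
Proof. by move=> hf /lipx_opp hg; exact: lipx_add. Qed.

Lemma lipx_inv c f : 0 < c -> lipx D f -> (forall u, D u -> c <= f u) ->
  lipx D (fun u => / f u).
Proof.
move=> c0 [L [L0 hf]] fc; exists (L / (c * c)); split.
  by apply: Rmult_le_pos => //; apply/Rlt_le/Rinv_0_lt_compat; nra.
move=> u v Du Dv; rewrite !Rds; have fu := fc u Du; have fv := fc v Dv.
have -> : / f u - / f v = (f v - f u) * (/ (f u * f v)) by field; lra.
rewrite Rabs_mult (Rabs_right (/ _)); last first.
  by apply/Rle_ge/Rlt_le/Rinv_0_lt_compat; nra.
have -> : L / (c * c) * ds u v = (L * ds u v) * (/ (c * c)) by field; lra.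
apply: Rmult_le_compat; first exact: Rabs_pos.
- by apply/Rlt_le/Rinv_0_lt_compat; nra.
- by rewrite Rabs_minus_sym; exact: hf.
- by apply: Rinv_le_contravar; nra.
Qed.

Lemma lipx_abs f : lipx D f -> lipx D (fun u => Rabs (f u)).
Proof.
move=> [L [L0 hf]]; exists L; split=> // u v Du Dv.
by apply: Rle_trans (hf u v Du Dv); exact: Rabs_triang_inv2.
Qed.

Lemma lipx_max f g : lipx D f -> lipx D g -> lipx D (fun u => Rmax (f u) (g u)).
Proof.
move=> hf hg; have h := lipx_scal (/2) _ (lipx_add _ _ (lipx_add _ _ hf hg)
  (lipx_abs _ (lipx_minus _ _ hf hg))).
apply: lipx_eq h => u _; rewrite /Rmax /Rabs.
by case: Rcase_abs => ?; case: Rle_dec => ?; lra.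
Qed.

Lemma bnd_mul f g : bnd D f -> bnd D g -> bnd D (fun u => f u * g u).
Proof.
move=> [A hA] [B hB]; exists (A * B) => u Du; rewrite Rabs_mult.
by apply: Rmult_le_compat; try exact: Rabs_pos; [exact: hA|exact: hB].
Qed.

Lemma bnd_cst c : bnd D (fun=> c).
Proof. by exists (Rabs c) => u _; lra. Qed.

Lemma bnd_inv c f : 0 < c -> (forall u, D u -> c <= f u) -> bnd D (fun u => / f u).
Proof.
move=> c0 fc; exists (/ c) => u /fc ?; rewrite Rabs_right.
  exact: Rinv_le_contravar.
by apply/Rle_ge/Rlt_le/Rinv_0_lt_compat; lra.
Qed.

End Scalar.

Lemma bnd_nrm_coord (X : Met) (D : X -> Prop) m (f : X -> Rn m) i :
  bnd D (fun u => nrm (f u)) -> bnd D (fun u => f u i).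
Proof.
move=> [M h]; exists M => u Du; apply: Rle_trans (nrm_coord _ _ _) _.
by apply: Rle_trans (h u Du); exact: Rle_abs.
Qed.

Lemma lipx_app (X : Met) m (D : X -> Prop) (f : X -> Rn m) i :
  lipx D f -> lipx D (fun x => f x i).
Proof. move=> h; exact: (lipx_compT _ _ _ _ _ (fun u : Rn m => u i) h (lipx_coord m _ i)). Qed.

Lemma lipx_nrm_comp (X : Met) m (D : X -> Prop) (f : X -> Rn m) :
  lipx D f -> lipx D (fun x => nrm (f x)).
Proof. move=> h; exact: (lipx_compT _ _ _ _ _ (@nrm m) h (lipx_nrm m _)). Qed.

Lemma lipx_rsum (X : Met) m (D : X -> Prop) (f : X -> Rn m) :
  lipx D f -> lipx D (fun x => rsum (f x)).
Proof.
move=> [L [L0 h]]; exists (INR m * L); split.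
  by apply: Rmult_le_pos => //; exact: pos_INR.
move=> u v Du Dv; rewrite Rds -rsum_sub Rmult_assoc; apply: rsum_abs_le => i.
exact: Rle_trans (rds_coord _ _ _ i) (h u v Du Dv).
Qed.

(** Points of different pieces are compared through a common point [w], whose detour costs a factor
    [C]. Convexity of the cube later provides [C = 1]. *)
Lemma Lip_glue (X Y : Met) (C L M : R) (D D1 D2 : X -> Prop) (f : X -> Y) :
  (forall u, D u -> D1 u \/ D2 u) ->
  (forall u v, D u -> D v -> D1 u -> D2 v ->
     exists w, D w /\ D1 w /\ D2 w /\ ds u w + ds w v <= C * ds u v) ->
  Lip (fun u => D u /\ D1 u) L f -> Lip (fun u => D u /\ D2 u) M f ->
  Lip D ((L + M) * (1 + Rabs C)) f.
Proof.
move=> cov br [L0 h1] [M0 h2]; set K := (L + M) * (1 + Rabs C).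
have K0 : 0 <= K by have := Rabs_pos C; rewrite /K; nra.
have KL : L + M <= K by have := Rabs_pos C; rewrite /K; nra.
have mix u v : D u -> D v -> D1 u -> D2 v -> ds (f u) (f v) <= K * ds u v.
  move=> Du Dv D1u D2v; have [w [Dw [D1w [D2w le]]]] := br u v Du Dv D1u D2v.
  have := h1 u w (conj Du D1u) (conj Dw D1w); have := h2 w v (conj Dw D2w) (conj Dv D2v).
  have := ds_tri (f u) (f w) (f v); have := ds_pos X u w; have := ds_pos X w v.
  move=> p1 p2 t i1 i2; have d0 := ds_pos X u v; have cc := Rle_abs C.
  apply: Rle_trans (_ : (L + M) * (ds u w + ds w v) <= _); first nra.
  rewrite /K Rmult_assoc; apply: Rmult_le_compat_l; first lra.
  by have := Rmult_le_compat_r (ds u v) C (Rabs C) d0 cc; lra.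
split=> // u v Du Dv; have d0 := ds_pos X u v.
case: (cov u Du) => hu; case: (cov v Dv) => hv.
- by have := h1 u v (conj Du hu) (conj Dv hv); nra.
- exact: mix.
- by rewrite ds_sym (ds_sym u); exact: mix.
- by have := h2 u v (conj Du hu) (conj Dv hv); nra.
Qed.

Lemma lipx_glue (X Y : Met) (C : R) (D D1 D2 : X -> Prop) (f : X -> Y) :
  (forall u, D u -> D1 u \/ D2 u) ->
  (forall u v, D u -> D v -> D1 u -> D2 v ->
     exists w, D w /\ D1 w /\ D2 w /\ ds u w + ds w v <= C * ds u v) ->
  lipx (fun u => D u /\ D1 u) f -> lipx (fun u => D u /\ D2 u) f -> lipx D f.
Proof. by move=> cov br [L h1] [M h2]; eexists; exact: Lip_glue cov br h1 h2. Qed.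

Definition clamp (x : R) : R := Rmin 1 (Rmax 0 x).

Lemma clamp_bounds x : 0 <= clamp x <= 1.
Proof. by split; [apply: Rmin_glb; [lra|exact: Rmax_l]|exact: Rmin_l]. Qed.

Lemma clamp_ge1 x : 1 <= x -> clamp x = 1.
Proof. by move=> h; rewrite /clamp Rmax_right ?Rmin_left; lra. Qed.

Lemma clamp_le0 x : x <= 0 -> clamp x = 0.
Proof. by move=> h; rewrite /clamp Rmax_left ?Rmin_right; lra. Qed.

Lemma clamp_id x : 0 <= x <= 1 -> clamp x = x.
Proof. by move=> h; rewrite /clamp Rmax_right ?Rmin_right; lra. Qed.

Lemma clamp_cases x : (x <= 0 /\ clamp x = 0) \/ (1 <= x /\ clamp x = 1) \/ (0 <= x <= 1 /\ clamp x = x).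
Proof.
case: (Rle_dec x 0) => h; first by left; rewrite clamp_le0.
case: (Rle_dec 1 x) => h'; first by right; left; rewrite clamp_ge1.
by right; right; rewrite clamp_id; lra.
Qed.

Lemma clamp_lip x y : Rabs (clamp x - clamp y) <= Rabs (x - y).
Proof.
have := clamp_cases x; have := clamp_cases y; rewrite /Rabs.
by repeat case: Rcase_abs => ?; lra.
Qed.

(** * A metric equivalent to the Carnot-Caratheodory distance *)

(** The height of [p^-1 q] in exponential coordinates: taking the mean of [y] over both points makes
    it antisymmetric and turns the cocycle of the group law into half the symplectic form. *)
Definition hD {n} (p q : Heis n) : R :=
  hz q - hz p - /2 * rsum (fun j => (hy p j + hy q j) * (hx q j - hx p j)).

(** In the triangle inequality the symplectic cross term is at most [n * r * s], which the term
    [2 * cH n * r * s] of [cH n * (r + s)^2] absorbs. Thus [h_ds] is a metric without a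
    quasi-constant. *)
Definition cH (n : nat) : R := INR n + 1.

Lemma cH_pos n : 1 <= cH n.
Proof. by rewrite /cH; have := pos_INR n; lra. Qed.

Definition h_ds {n} (p q : Heis n) : R :=
  Rmax (Rmax (ds (hx p) (hx q)) (ds (hy p) (hy q))) (sqrt (Rabs (hD p q) / cH n)).

Lemma h_ds_le n (p q : Heis n) r : 0 <= r ->
  h_ds p q <= r <->
  ds (hx p) (hx q) <= r /\ ds (hy p) (hy q) <= r /\ Rabs (hD p q) <= cH n * (r * r).
Proof.
move=> r0; have c1 := cH_pos n; have D0 := Rabs_pos (hD p q).
have q0 : 0 <= Rabs (hD p q) / cH n.
  by apply: Rmult_le_pos => //; apply/Rlt_le/Rinv_0_lt_compat; lra.
have e : Rabs (hD p q) = cH n * (Rabs (hD p q) / cH n) by field; lra.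
split=> [h|[h1 [h2 h3]]].
  have h1 := Rle_trans _ _ _ (Rmax_l _ _) h; have h2 := Rle_trans _ _ _ (Rmax_r _ _) h.
  split; first exact: Rle_trans (Rmax_l _ _) h1.
  split; first exact: Rle_trans (Rmax_r _ _) h1.
  rewrite e; apply: Rmult_le_compat_l; first lra.
  rewrite -(sqrt_sqrt _ q0); have := sqrt_pos (Rabs (hD p q) / cH n).
  by move=> ?; apply: Rmult_le_compat.
apply: Rmax_lub; first exact: Rmax_lub.
rewrite -(sqrt_square r) //; apply: sqrt_le_1_alt.
by apply: (Rmult_le_reg_l (cH n)); [lra|rewrite -e].
Qed.

Lemma h_ds_pos n (p q : Heis n) : 0 <= h_ds p q.
Proof. exact: Rle_trans (sqrt_pos _) (Rmax_r _ _). Qed.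

Lemma h_ds_refl n (p : Heis n) : h_ds p p = 0.
Proof.
apply: Rle_antisym (h_ds_pos _ _ _); apply/h_ds_le; first lra.
rewrite !ds_refl; split; first lra; split; first lra.
rewrite /hD (rsum_eq _ _ (fun=> 0)) => [|j]; last lra.
rewrite rsum_const; have -> : hz p - hz p - / 2 * (INR n * 0) = 0 by lra.
rewrite Rabs_R0; lra.
Qed.

Lemma hD_anti n (p q : Heis n) : hD q p = - hD p q.
Proof.
rewrite /hD; set A := rsum _; set B := rsum _.
have -> : A = - 1 * B by rewrite /A /B -rsum_mul; apply: rsum_eq => j; lra.
lra.
Qed.

Lemma h_ds_sym n (p q : Heis n) : h_ds p q = h_ds q p.
Proof. by rewrite /h_ds (hD_anti _ p q) Rabs_Ropp ds_sym (ds_sym (hy p)). Qed.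

Lemma hD_split n (p q t : Heis n) :
  hD p t = hD p q + hD q t +
  / 2 * rsum (fun j => (hy q j - hy p j) * (hx t j - hx q j)
                       - (hy t j - hy q j) * (hx q j - hx p j)).
Proof.
rewrite /hD; set A := rsum _; set B := rsum _; set C := rsum _; set E := rsum _.
have : A = B + C - E by rewrite /A /B /C /E -rsum_add -rsum_sub; apply: rsum_eq => j; lra.
lra.
Qed.

Lemma Rabs_mul_le a b r s : Rabs a <= r -> Rabs b <= s -> Rabs (a * b) <= r * s.
Proof. by move=> ha hb; rewrite Rabs_mult; apply: Rmult_le_compat => //; exact: Rabs_pos. Qed.

Lemma h_ds_tri n (p q t : Heis n) : h_ds p t <= h_ds p q + h_ds q t.
Proof.
have r0 := h_ds_pos n p q; have s0 := h_ds_pos n q t.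
have [] := proj1 (h_ds_le n p q _ r0) (Rle_refl _).
have [] := proj1 (h_ds_le n q t _ s0) (Rle_refl _).
set r := h_ds p q; set s := h_ds q t => x2 [y2 D2] x1 [y1 D1].
have c1 := cH_pos n; apply/h_ds_le; first by rewrite /r /s; lra.
split; first by have := ds_tri (hx p) (hx q) (hx t); lra.
split; first by have := ds_tri (hy p) (hy q) (hy t); lra.
rewrite (hD_split _ p q t); set S := rsum _.
have hS : Rabs S <= INR n * (2 * (r * s)).
  apply: rsum_abs_le => j.
  have a1 := Rle_trans _ _ _ (rds_coord _ _ _ j) x1.
  have a2 := Rle_trans _ _ _ (rds_coord _ _ _ j) x2.
  have b1 := Rle_trans _ _ _ (rds_coord _ _ _ j) y1.
  have b2 := Rle_trans _ _ _ (rds_coord _ _ _ j) y2.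
  rewrite Rabs_minus_sym in a1; rewrite Rabs_minus_sym in a2.
  rewrite Rabs_minus_sym in b1; rewrite Rabs_minus_sym in b2.
  have := Rabs_mul_le _ _ _ _ b1 a2; have := Rabs_mul_le _ _ _ _ b2 a1.
  move=> u1 u2; apply: Rle_trans (Rabs_triang _ _) _; rewrite Rabs_Ropp; lra.
have t1 := Rabs_triang (hD p q + hD q t) (/2 * S).
have t2 := Rabs_triang (hD p q) (hD q t).
have t3 : Rabs (/2 * S) = /2 * Rabs S by rewrite Rabs_mult (Rabs_right (/2)); lra.
have : INR n * (r * s) <= cH n * (r * s).
  by apply: Rmult_le_compat_r; [exact: Rmult_le_pos|rewrite /cH; lra].
have : 0 <= cH n * (r * s) by apply: Rmult_le_pos; [lra|exact: Rmult_le_pos].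
nra.
Qed.

Canonical Heis_met n := @MkMet (Heis n) h_ds (h_ds_refl n) (h_ds_sym n) (h_ds_tri n).

Lemma hds_le n (p q : Heis n) r : 0 <= r ->
  ds p q <= r <->
  ds (hx p) (hx q) <= r /\ ds (hy p) (hy q) <= r /\ Rabs (hD p q) <= cH n * (r * r).
Proof. exact: h_ds_le. Qed.

Lemma is_derive_plim f x l : derivable_pt_lim f x l -> is_derive f x l.
Proof. by move/is_derive_Reals. Qed.

Lemma continuous_rsum (m : nat) (f : 'I_m -> R -> R) x :
  (forall i, continuous (f i) x) -> continuous (fun t => rsum (fun i => f i t)) x.
Proof.
elim: m f => [|m IH] f h.
  by apply: (continuous_ext (fun=> 0)) => [t|]; [rewrite /rsum big_ord0|exact: continuous_const].
apply: (continuous_ext (fun t => f ord0 t + rsum (fun i => f (lift ord0 i) t))) => [t|].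
  by rewrite rsum_recl.
by apply: (continuous_plus (f ord0)); [exact: h|apply: IH => i; exact: h].
Qed.

Lemma continuity_continuous f x : continuity f -> continuous f x.
Proof. by move=> h; apply/continuity_pt_filterlim; exact: h. Qed.

Lemma Rabs_RInt_le f g a b : a <= b ->
  (forall t, continuous f t) -> (forall t, continuous g t) ->
  (forall t, a <= t <= b -> Rabs (f t) <= g t) -> Rabs (RInt f a b) <= RInt g a b.
Proof.
move=> ab cf cg le.
apply: Rle_trans (abs_RInt_le f a b ab _) _; first by apply: ex_RInt_continuous.
apply: RInt_le => //.
- apply: ex_RInt_continuous => t _.
  exact: (continuous_comp f Rabs t (cf t) (continuous_Rabs _)).
- by apply: ex_RInt_continuous.
- by move=> t tt; apply: le; lra.
Qed.

(** * Length of horizontal curves bounds the explicit metric *)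

Section CurveBound.
Variables (n : nat) (gx gy : 'I_n -> R -> R) (gz : R -> R) (gx' gy' : 'I_n -> R -> R).
Hypothesis hor : horizontal_C1 gx gy gz gx' gy'.

Lemma hspeed_continuous t : continuous (hspeed gx' gy') t.
Proof.
have [hx [hy _]] := hor.
apply: (continuous_comp (fun t => rsum (fun j => gx' j t * gx' j t + gy' j t * gy' j t)) sqrt).
  apply: continuous_rsum => i.
  have cx : continuous (gx' i) t by apply: continuity_continuous; case: (hx i).
  have cy : continuous (gy' i) t by apply: continuity_continuous; case: (hy i).
  by apply: (continuous_plus (fun t => gx' i t * gx' i t));
    apply: (continuous_mult (K := R_AbsRing)).
exact: continuous_sqrt.
Qed.

Lemma gx'_continuous j t : continuous (gx' j) t.
Proof. by apply: continuity_continuous; case: hor => h _; case: (h j). Qed.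

Lemma gy'_continuous j t : continuous (gy' j) t.
Proof. by apply: continuity_continuous; case: hor => _ [h _]; case: (h j). Qed.

Lemma gx'_speed j t : Rabs (gx' j t) <= hspeed gx' gy' t.
Proof.
rewrite /hspeed -sqrt_Rsqr_abs; apply: sqrt_le_1_alt; rewrite /Rsqr.
apply: Rle_trans (rsum_term _ (fun j => gx' j t * gx' j t + gy' j t * gy' j t) j _) => [|i].
  by have := Rle_0_sqr (gy' j t); rewrite /Rsqr; lra.
by have := Rle_0_sqr (gy' i t); have := Rle_0_sqr (gx' i t); rewrite /Rsqr; lra.
Qed.

Lemma gy'_speed j t : Rabs (gy' j t) <= hspeed gx' gy' t.
Proof.
rewrite /hspeed -sqrt_Rsqr_abs; apply: sqrt_le_1_alt; rewrite /Rsqr.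
apply: Rle_trans (rsum_term _ (fun j => gx' j t * gx' j t + gy' j t * gy' j t) j _) => [|i].
  by have := Rle_0_sqr (gx' j t); rewrite /Rsqr; lra.
by have := Rle_0_sqr (gy' i t); have := Rle_0_sqr (gx' i t); rewrite /Rsqr; lra.
Qed.

Let len := RInt (hspeed gx' gy') 0 1.

Lemma ex_speed a b : ex_RInt (hspeed gx' gy') a b.
Proof. by apply: ex_RInt_continuous => t _; exact: hspeed_continuous. Qed.

Lemma speed_ge0 t : 0 <= hspeed gx' gy' t. Proof. exact: sqrt_pos. Qed.

Lemma sub_len a b : 0 <= a -> a <= b -> b <= 1 -> RInt (hspeed gx' gy') a b <= len.
Proof.
move=> a0 ab b1; rewrite /len.
rewrite -(RInt_Chasles (hspeed gx' gy') 0 a 1); try exact: ex_speed.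
rewrite -(RInt_Chasles (hspeed gx' gy') a b 1); try exact: ex_speed.
have p1 : 0 <= RInt (hspeed gx' gy') 0 a.
  by apply: RInt_ge_0 => // [|t _]; [exact: ex_speed|exact: speed_ge0].
have p2 : 0 <= RInt (hspeed gx' gy') b 1.
  by apply: RInt_ge_0 => // [|t _]; [exact: ex_speed|exact: speed_ge0].
rewrite /plus /=; lra.
Qed.

Lemma incr_len (g g' : R -> R) a b : (forall t, derivable_pt_lim g t (g' t)) ->
  (forall t, continuous g' t) -> (forall t, Rabs (g' t) <= hspeed gx' gy' t) ->
  0 <= a -> a <= b -> b <= 1 -> Rabs (g b - g a) <= len.
Proof.
move=> dg cg le a0 ab b1; have i : is_RInt g' a b (g b - g a).
  apply: (is_RInt_derive g g') => t _; last exact: cg.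
  by apply: is_derive_plim; exact: dg.
rewrite -(is_RInt_unique _ _ _ _ i).
apply: Rle_trans (sub_len a b a0 ab b1).
apply: Rabs_RInt_le => // t; exact: hspeed_continuous.
Qed.

(** Each coordinate moves by at most the length. Moreover [hD] of the end points is the integral of
    [(y - m) dx], with [m] the mean of the two end values of [y]; both factors are controlled by the
    length, hence [hD] by its square. *)
Lemma curve_ds : ds (mkHeis (fun j => gx j 0) (fun j => gy j 0) (gz 0))
                    (mkHeis (fun j => gx j 1) (fun j => gy j 1) (gz 1)) <= len.
Proof.
have [hx [hy hz]] := hor.
have len0 : 0 <= len.
  by apply: RInt_ge_0; [lra|exact: ex_speed|move=> t _; exact: speed_ge0].
have dx j a b : 0 <= a -> a <= b -> b <= 1 -> Rabs (gx j b - gx j a) <= len.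
  apply: (incr_len (gx j) (gx' j)) => t; [by case: (hx j)|exact: gx'_continuous|exact: gx'_speed].
have dy j a b : 0 <= a -> a <= b -> b <= 1 -> Rabs (gy j b - gy j a) <= len.
  apply: (incr_len (gy j) (gy' j)) => t; [by case: (hy j)|exact: gy'_continuous|exact: gy'_speed].
apply/hds_le => //=; split; first by apply: rds_le => // j; rewrite Rabs_minus_sym; apply: dx; lra.
split; first by apply: rds_le => // j; rewrite Rabs_minus_sym; apply: dy; lra.
rewrite /hD /=.
pose m j := / 2 * (gy j 0 + gy j 1).
pose g t := gz t - rsum (fun j => m j * gx j t).
pose g' t := rsum (fun j => (gy j t - m j) * gx' j t).
have ey j t : ex_derive (gy j) t by exists (gy' j t); apply: is_derive_plim; case: (hy j).
have cg' t : continuous g' t.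
  apply: continuous_rsum => j.
  apply: (continuous_mult (K := R_AbsRing) (fun t => gy j t - m j)); last exact: gx'_continuous.
  apply: (continuous_minus (gy j)); last exact: continuous_const.
  exact: ex_derive_continuous.
have dS m0 (c : 'I_m0 -> R) (f f' : 'I_m0 -> R -> R) t : (forall j, is_derive (f j) t (f' j t)) ->
    is_derive (fun t => rsum (fun j => c j * f j t)) t (rsum (fun j => c j * f' j t)).
  elim: m0 c f f' => [|m0 IH] c f f' h.
    rewrite /rsum big_ord0; apply: (is_derive_ext (fun=> 0)) => [s|]; first by rewrite big_ord0.
    exact: (is_derive_const (K := R_AbsRing) (V := R_NormedModule)).
  rewrite rsum_recl.
  apply: (is_derive_ext (fun t => c ord0 * f ord0 t + rsum (fun i => c (lift ord0 i) * f (lift ord0 i) t))).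
    by move=> s; rewrite rsum_recl.
  apply: (is_derive_plus (fun t => c ord0 * f ord0 t)); last first.
    exact: (IH (fun i => c (lift ord0 i)) (fun i => f (lift ord0 i)) (fun i => f' (lift ord0 i))
              (fun j => h _)).
  by apply: is_derive_scal; exact: h.
have dg t : is_derive g t (g' t).
  have -> : g' t = rsum (fun j => gy j t * gx' j t) - rsum (fun j => m j * gx' j t).
    by rewrite -rsum_sub; apply: rsum_eq => j; lra.
  apply: (is_derive_minus gz); first by apply: is_derive_plim; exact: hz.
  by apply: dS => j; apply: is_derive_plim; case: (hx j).
have i : is_RInt g' 0 1 (g 1 - g 0).
  by apply: (is_RInt_derive g g') => t _; [exact: dg|exact: cg'].
set E := (X in Rabs X); have -> : E = g 1 - g 0.
  rewrite /E /g /m; set A := rsum _; set B := rsum _; set C := rsum _.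
  suff : / 2 * A = B - C by lra.
  by rewrite /A /B /C -rsum_sub -rsum_mul; apply: rsum_eq => j; lra.
rewrite -(is_RInt_unique _ _ _ _ i).
apply: Rle_trans (_ : RInt (fun t => (INR n * len) * hspeed gx' gy' t) 0 1 <= _).
  apply: Rabs_RInt_le; first lra.
  - exact: cg'.
  - move=> t; apply: (continuous_scal_r (K := R_AbsRing) (INR n * len)); exact: hspeed_continuous.
  move=> t tt; rewrite Rmult_assoc; apply: rsum_abs_le => j.
  apply: Rabs_mul_le (gx'_speed j t).
  have h1 := dy j 0 t; have h2 := dy j t 1.
  have {}h1 : Rabs (gy j t - gy j 0) <= len by apply: h1; lra.
  have {}h2 : Rabs (gy j 1 - gy j t) <= len by apply: h2; lra.
  move: h1 h2 => /Rabs_le_between h1 /Rabs_le_between h2.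
  by apply/Rabs_le_between; rewrite /m; lra.
have -> : RInt (fun t => (INR n * len) * hspeed gx' gy' t) 0 1 = INR n * len * len.
  by rewrite (RInt_scal (V := R_CompleteNormedModule)) //; exact: ex_speed.
by rewrite /cH; nra.
Qed.

End CurveBound.

Lemma cc_ds n (p q : Heis n) l : cc_dist_le p q l -> ds p q <= l.
Proof.
move=> h; apply: le_epsilon => eps eps0.
have [gx [gy [gz [gx' [gy' [hor [x0 [y0 [z0 [x1 [y1 [z1 [pr le]]]]]]]]]]]]] := h eps eps0.
apply: Rle_trans le; rewrite -RInt_Reals.
have := curve_ds n gx gy gz gx' gy' hor.
case: p x0 y0 z0 {h} => xp yp zp /= x0 y0 <-; case: q x1 y1 z1 => xq yq zq /= x1 y1 <-.
rewrite (functional_extensionality _ _ x0) (functional_extensionality _ _ x1).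
by rewrite (functional_extensionality _ _ y0) (functional_extensionality _ _ y1).
Qed.

(** * Explicit polynomial curves joining two points *)

Section Polynomial.
Variables (n : nat) (j0 : 'I_n) (p q : Heis n) (A B : R).

Let a (j : 'I_n) := hx q j - hx p j.
Let b (j : 'I_n) := hy q j - hy p j.
Let e (j : 'I_n) : R := if j == j0 then 1 else 0.

(* The bumps multiplied by [A] and [B] vanish at both ends and contribute exactly [A * B / 70] to the
   height of the end point. *)
Let cx j t := hx p j + a j * t + e j * A * (t - 3 * t ^ 2 + 2 * t ^ 3).
Let cy j t := hy p j + b j * t + e j * B * (t - 6 * t ^ 2 + 10 * t ^ 3 - 5 * t ^ 4).
Let cx' j t := a j + e j * A * (1 - 6 * t + 6 * t ^ 2).
Let cy' j t := b j + e j * B * (1 - 12 * t + 30 * t ^ 2 - 20 * t ^ 3).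
Let cz t := hz p + rsum (fun j => hy p j * a j) * t + / 2 * rsum (fun j => b j * a j) * t ^ 2
  + A * hy p j0 * (t - 3 * t ^ 2 + 2 * t ^ 3)
  + A * b j0 * (/ 2 * t ^ 2 - 2 * t ^ 3 + 3 / 2 * t ^ 4)
  + B * a j0 * (/ 2 * t ^ 2 - 2 * t ^ 3 + 5 / 2 * t ^ 4 - t ^ 5)
  + A * B * (/ 2 * t ^ 2 - 4 * t ^ 3 + 13 * t ^ 4 - 101 / 5 * t ^ 5 + 15 * t ^ 6 - 30 / 7 * t ^ 7).

Lemma poly_horizontal : horizontal_C1 cx cy cz cx' cy'.
Proof.
have cont (f : R -> R) : (forall t, ex_derive f t) -> continuity f.
  move=> h t; apply/continuity_pt_filterlim; exact: ex_derive_continuous.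
split=> [j|]; last split=> [j|t].
- split; first by apply: cont => t; rewrite /cx'; auto_derive.
  by move=> t; apply/is_derive_Reals; rewrite /cx /cx'; auto_derive => //; ring.
- split; first by apply: cont => t; rewrite /cy'; auto_derive.
  by move=> t; apply/is_derive_Reals; rewrite /cy /cy'; auto_derive => //; ring.
have -> : rsum (fun j => cy j t * cx' j t) =
    rsum (fun j => hy p j * a j) + t * rsum (fun j => b j * a j)
    + (cy j0 t * cx' j0 t - hy p j0 * a j0 - t * (b j0 * a j0)).
  rewrite -rsum_mul -rsum_add.
  (* Off [j0] there are no bumps, so the whole correction can be written as a sum supported at
     [j0]. *)
  have es : rsum (fun j => e j * (cy j0 t * cx' j0 t - hy p j0 * a j0 - t * (b j0 * a j0)))
      = cy j0 t * cx' j0 t - hy p j0 * a j0 - t * (b j0 * a j0).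
    rewrite (rsum_single _ _ j0) /e ?eqxx => [|j /eqP/negbTE ->]; lra.
  rewrite -es -rsum_add; apply: rsum_eq => j; rewrite /e /cy /cx' /e eqxx.
  by case: eqP => [->|_]; ring.
apply/is_derive_Reals; rewrite /cz /cy /cx' /e eqxx; auto_derive => //; field.
Qed.

Lemma poly_cc M : 0 <= M -> A * B = 70 * hD p q ->
  (forall j, Rabs (a j) <= M) -> (forall j, Rabs (b j) <= M) ->
  Rabs A <= M -> Rabs B <= M -> cc_dist_le p q (64 * M * sqrt (2 * INR n)).
Proof.
move=> M0 AB aM bM AM BM eps eps0.
exists cx, cy, cz, cx', cy'; split; first exact: poly_horizontal.
split; first by move=> j; rewrite /cx; ring.
split; first by move=> j; rewrite /cy; ring.
split; first by rewrite /cz; ring.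
split; first by move=> j; rewrite /cx /a; ring.
split; first by move=> j; rewrite /cy /b; ring.
split.
  rewrite /cz; have -> : hz q = hz p + / 2 * rsum (fun j => (hy p j + hy q j) * a j) + hD p q.
    by rewrite /hD /a; lra.
  have -> : rsum (fun j => (hy p j + hy q j) * a j) =
     2 * rsum (fun j => hy p j * a j) + rsum (fun j => b j * a j).
    by rewrite -rsum_mul -rsum_add; apply: rsum_eq => j; rewrite /b; lra.
  by have : A * B = 70 * hD p q by []; nra.
have ex : ex_RInt (hspeed cx' cy') 0 1 by apply: (ex_speed _ _ _ _ _ _ poly_horizontal).
exists (ex_RInt_Reals_0 _ _ _ ex); rewrite -RInt_Reals.
apply: Rle_trans (_ : RInt (fun=> 64 * M * sqrt (2 * INR n)) 0 1 <= _); last first.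
  by rewrite RInt_const /scal /= /mult /=; lra.
apply: RInt_le => //; [lra|exact: ex_RInt_const|move=> t [t0 t1]].
(* The bound [63 = 1 + 12 + 30 + 20] is the sum of the coefficients of the larger bump derivative,
   and [64] adds the linear part. *)
have le (u v w c : R) : Rabs u <= M -> Rabs v <= M -> Rabs w <= 63 -> c = 0 \/ c = 1 ->
    (u + c * v * w) * (u + c * v * w) <= (64 * M) * (64 * M).
  move=> hu hv hw hc; have hvw := Rabs_mul_le _ _ _ _ hv hw.
  move: hu hvw => /Rabs_le_between hu /Rabs_le_between hvw.
  have h : - (64 * M) <= u + c * v * w <= 64 * M by case: hc => ->; nra.
  nra.
have he j : e j = 0 \/ e j = 1 by rewrite /e; case: eqP; tauto.
have tn i : 0 <= t ^ i <= 1.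
  by split; [apply: pow_le; lra|rewrite -(pow1 i); apply: pow_incr; lra].
have t2 := tn 2%N; have t3 := tn 3%N.
have -> : 64 * M * sqrt (2 * INR n) = sqrt (rsum (fun _ : 'I_n => 2 * ((64 * M) * (64 * M)))).
  rewrite rsum_const; have -> : INR n * (2 * (64 * M * (64 * M))) = (64 * M) * (64 * M) * (2 * INR n) by ring.
  rewrite (sqrt_mult (64 * M * (64 * M))); [|nra|by have := pos_INR n; lra].
  by rewrite sqrt_square //; lra.
apply: sqrt_le_1_alt; apply: rsum_le => j; rewrite /cx' /cy'.
have h1 : Rabs (1 - 6 * t + 6 * t ^ 2) <= 63 by apply: Rabs_le; lra.
have h2 : Rabs (1 - 12 * t + 30 * t ^ 2 - 20 * t ^ 3) <= 63 by apply: Rabs_le; lra.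
have := le _ _ _ _ (aM j) AM h1 (he j); have := le _ _ _ _ (bM j) BM h2 (he j).
lra.
Qed.

End Polynomial.

(** A height [h] is gained by bumps of size [sqrt (70 * |h|)] in one coordinate, and this is [O(r)]
    because [h = O(r^2)]. The bumps need a coordinate to live in, whence [0 < n]. *)
Lemma ds_cc n : (0 < n)%N -> exists C, 0 <= C /\
  forall (p q : Heis n) r, ds p q <= r -> cc_dist_le p q (C * r).
Proof.
move=> n0; pose j0 := Ordinal n0.
pose K := 1 + 70 * cH n; exists (64 * K * sqrt (2 * INR n)).
have K1 : 1 <= K by rewrite /K; have := cH_pos n; lra.
split; first by apply: Rmult_le_pos; [lra|exact: sqrt_pos].
move=> p q r le; have r0 : 0 <= r by apply: Rle_trans (ds_pos _ p q) le.
have [lx [ly ld]] := proj1 (hds_le n p q r r0) le.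
pose A := sqrt (70 * Rabs (hD p q)); pose B := sign (hD p q) * A.
have D0 := Rabs_pos (hD p q).
have AA : A * A = 70 * Rabs (hD p q) by apply: sqrt_sqrt; lra.
have A0 : 0 <= A by exact: sqrt_pos.
have AK : A <= K * r.
  rewrite -(sqrt_square (K * r)); last by apply: Rmult_le_pos; lra.
  apply: sqrt_le_1_alt; rewrite /K.
  have : 0 <= cH n * (r * r) by have := cH_pos n; nra.
  have : 0 <= r * r by nra.
  by have := cH_pos n; nra.
have rK : r <= K * r by nra.
have -> : 64 * K * sqrt (2 * INR n) * r = 64 * (K * r) * sqrt (2 * INR n) by ring.
apply: (poly_cc n j0 p q A B).
- lra.
- rewrite /B; have -> : A * (sign (hD p q) * A) = sign (hD p q) * (A * A) by ring.
  rewrite AA; have -> : sign (hD p q) * (70 * Rabs (hD p q)) = 70 * (sign (hD p q) * Rabs (hD p q)) by ring.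
  congr (_ * _); case: (Rtotal_order (hD p q) 0) => [lt|[->|gt]].
  + by rewrite sign_eq_m1 // Rabs_left //; lra.
  + by rewrite sign_0; lra.
  + by rewrite sign_eq_1 // Rabs_right //; lra.
- by move=> j; have := rds_coord _ _ _ j : Rabs (hx p j - hx q j) <= _; rewrite Rabs_minus_sym; lra.
- by move=> j; have := rds_coord _ _ _ j : Rabs (hy p j - hy q j) <= _; rewrite Rabs_minus_sym; lra.
- by rewrite Rabs_right; lra.
- rewrite /B Rabs_mult; apply: Rle_trans (_ : 1 * A <= _); last lra.
  rewrite (Rabs_right A); last lra; apply: Rmult_le_compat_r => //.
  case: (Rtotal_order (hD p q) 0) => [lt|[->|gt]].
  + by rewrite sign_eq_m1 // Rabs_Ropp Rabs_R1; lra.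
  + by rewrite sign_0 Rabs_R0; lra.
  + by rewrite sign_eq_1 // Rabs_R1; lra.
Qed.

(** * Horizontal simplices *)

Lemma fin_bound m (P : 'I_m -> R -> Prop) :
  (forall i c c', c <= c' -> P i c -> P i c') -> (forall i, exists c, P i c) ->
  exists c, forall i, P i c.
Proof.
move=> mono h; pose c i := proj1_sig (constructive_indefinite_description _ (h i)).
have hc i : P i (c i) by rewrite /c; case: constructive_indefinite_description.
exists (nrm c) => i; apply: mono (hc i); apply: Rle_trans (Rle_abs _) _; exact: nrm_coord.
Qed.

Section Simplex.
Variable n : nat.
Implicit Types w : Rn n.

Definition sq_sum w := rsum (fun l => w l * w l).

(* The derivatives of the weight of a vertex vanish where the weight does, so the horizontal simplex
   below depends to first order only on the vertices of the face that carries [w]. *)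
Definition wt (i : 'I_n.+1) w : R :=
  if unlift ord0 i is Some l then w l * w l * (2 - sq_sum w)
  else (1 - sq_sum w) * (1 - sq_sum w).

Definition dwt (k : 'I_n) (i : 'I_n.+1) w : R :=
  if unlift ord0 i is Some l then
    (if k == l then 2 * w l * (2 - sq_sum w) else 0) - 2 * w k * (w l * w l)
  else - 4 * w k * (1 - sq_sum w).

Lemma wt0 w : wt ord0 w = (1 - sq_sum w) * (1 - sq_sum w).
Proof. by rewrite /wt unlift_none. Qed.

Lemma wtS l w : wt (lift ord0 l) w = w l * w l * (2 - sq_sum w).
Proof. by rewrite /wt liftK. Qed.

Lemma dwt0 k w : dwt k ord0 w = - 4 * w k * (1 - sq_sum w).
Proof. by rewrite /dwt unlift_none. Qed.

Lemma dwtS k l w : dwt k (lift ord0 l) w =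
  (if k == l then 2 * w l * (2 - sq_sum w) else 0) - 2 * w k * (w l * w l).
Proof. by rewrite /dwt liftK. Qed.

(** With [s = sq_sum w] this is [(1 - s)^2 + s * (2 - s) = 1]. *)
Lemma wt_sum w : rsum (fun i => wt i w) = 1.
Proof.
rewrite rsum_recl wt0 (rsum_eq _ _ (fun l => (2 - sq_sum w) * (w l * w l))) => [|l].
  by rewrite rsum_mul -/(sq_sum w); ring.
by rewrite wtS; ring.
Qed.

Lemma dwt_sum k w : rsum (fun i => dwt k i w) = 0.
Proof.
rewrite rsum_recl dwt0 (rsum_eq _ _ (fun l =>
  (if k == l then 2 * w l * (2 - sq_sum w) else 0) - 2 * w k * (w l * w l))) => [|l].
  rewrite rsum_sub rsum_mul -/(sq_sum w) (rsum_single _ _ k) ?eqxx => [|j /eqP].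
    ring.
  by rewrite eq_sym => /negbTE ->.
by rewrite dwtS.
Qed.

Definition cube1 w : Prop := nrm w <= 1.

Lemma bnd_cube1 i : bnd cube1 (fun w => w i).
Proof. by exists 1 => w h; exact: Rle_trans (nrm_coord _ _ i) h. Qed.

Lemma lipx_prod (f g : Rn n -> R) : lipx cube1 f -> lipx cube1 g ->
  bnd cube1 f -> bnd cube1 g -> lipx cube1 (fun w => f w * g w) /\ bnd cube1 (fun w => f w * g w).
Proof. by move=> *; split; [exact: lipx_mul|exact: bnd_mul]. Qed.

Lemma sq_sum_lip : lipx cube1 sq_sum /\ bnd cube1 sq_sum.
Proof.
split.
  apply: (lipx_rsum _ _ _ (fun w l => w l * w l)); apply: lipx_vec => l.
  by apply: lipx_mul; try exact: lipx_coord; exact: bnd_cube1.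
exists (INR n * (1 * 1)) => w h; apply: rsum_abs_le => l.
by apply: Rabs_mul_le; exact: Rle_trans (nrm_coord _ _ l) h.
Qed.

Lemma lipx_affine c (f : Rn n -> R) : lipx cube1 f /\ bnd cube1 f ->
  lipx cube1 (fun w => c - f w) /\ bnd cube1 (fun w => c - f w).
Proof.
move=> [hl hb]; split; first by apply: lipx_minus => //; exact: lipx_cst.
have [M h] := hb; exists (Rabs c + M) => w /h hw.
by apply: Rle_trans (Rabs_triang _ _) _; rewrite Rabs_Ropp; lra.
Qed.

Lemma wt_lip i : lipx cube1 (wt i) /\ bnd cube1 (wt i).
Proof.
have cc j : lipx cube1 (fun w => w j) /\ bnd cube1 (fun w => w j).
  by split; [exact: lipx_coord|exact: bnd_cube1].
have [s1 s1'] := lipx_affine 1 _ sq_sum_lip; have [s2 s2'] := lipx_affine 2 _ sq_sum_lip.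
rewrite /wt; case: unliftP => [l _|_]; last exact: lipx_prod.
have [c1 c2] := cc l; have [p1 p2] := lipx_prod _ _ c1 c1 c2 c2.
exact: lipx_prod.
Qed.

Lemma dwt_lip k i : lipx cube1 (dwt k i) /\ bnd cube1 (dwt k i).
Proof.
have cc c j : lipx cube1 (fun w => c * w j) /\ bnd cube1 (fun w => c * w j).
  split; first by apply: lipx_scal; exact: lipx_coord.
  by apply: bnd_mul; [exact: bnd_cst|exact: bnd_cube1].
have [s1 s1'] := lipx_affine 1 _ sq_sum_lip; have [s2 s2'] := lipx_affine 2 _ sq_sum_lip.
rewrite /dwt; case: unliftP => [l _|_].
  have [c1 c2] := cc 2 l; have [d1 d2] := cc 2 k.
  have e1 : lipx cube1 (fun w => w l) by exact: lipx_coord.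
  have e2 := bnd_cube1 l.
  have [p1 p2] := lipx_prod _ _ e1 e1 e2 e2.
  have [q1 q2] := lipx_prod _ _ d1 p1 d2 p2.
  case: (k == l).
    have [r1 r2] := lipx_prod _ _ c1 s2 c2 s2'.
    split; first exact: lipx_minus.
    have [M hM] := r2; have [M' hM'] := q2; exists (M + M') => w hw.
    apply: Rle_trans (Rabs_triang _ _) _; rewrite Rabs_Ropp.
    by have := hM w hw; have := hM' w hw; lra.
  have := lipx_affine 0 _ (conj q1 q2); by [].
have [d1 d2] := cc (-4) k; exact: lipx_prod.
Qed.

(** The quadratic bound on this Taylor remainder is the form in which [dwt] is used as the
    derivative of [wt]; it replaces calculus in several variables. *)
Definition wt_rem i w w' := wt i w' - wt i w - rsum (fun k => dwt k i w * (w' k - w k)).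

Lemma wt_rem_le i : exists C, forall w w', cube1 w -> cube1 w' ->
  Rabs (wt_rem i w w') <= C * (ds w w' * ds w w').
Proof.
pose N := INR n; have N0 : 0 <= N by exact: pos_INR.
exists (2 * (N + 2) * N + 4 * N * N + (N + 2) + 4 * N) => w w' hw hw'.
pose D k := w' k - w k; pose d := ds w w'.
have d0 : 0 <= d by exact: ds_pos.
have hD k : Rabs (D k) <= d by rewrite /D Rabs_minus_sym; exact: rds_coord.
have hwk k : Rabs (w k) <= 1 by exact: Rle_trans (nrm_coord _ _ k) hw.
have hwk' k : Rabs (w' k) <= 1 by exact: Rle_trans (nrm_coord _ _ k) hw'.
pose sg := rsum (fun k => 2 * w k * D k); pose q := rsum (fun k => D k * D k).
have es : sq_sum w' - sq_sum w = sg + q.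
  by rewrite /sq_sum /sg /q -rsum_sub -rsum_add; apply: rsum_eq => k; rewrite /D; ring.
have hq : Rabs q <= N * (d * d) by apply: rsum_abs_le => k; exact: Rabs_mul_le.
have hds : Rabs (sq_sum w' - sq_sum w) <= N * (2 * d).
  rewrite /sq_sum -rsum_sub; apply: rsum_abs_le => k.
  have -> : w' k * w' k - w k * w k = (w' k + w k) * D k by rewrite /D; ring.
  apply: Rabs_mul_le => //; apply: Rle_trans (Rabs_triang _ _) _.
  by have := hwk k; have := hwk' k; lra.
have hs : 0 <= sq_sum w <= N.
  split; first by apply: rsum_ge0 => k; nra.
  rewrite -[N]Rmult_1_r -rsum_const; apply: rsum_le => k.
  by have := hwk k => /Rabs_le_between; nra.
have hdd : Rabs ((sq_sum w' - sq_sum w) * (sq_sum w' - sq_sum w)) <= (N * (2 * d)) * (N * (2 * d)).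
  exact: Rabs_mul_le.
rewrite /wt_rem /wt /dwt; case: unliftP => [l _|_].
  have -> : rsum (fun k => ((if k == l then 2 * w l * (2 - sq_sum w) else 0) -
       2 * w k * (w l * w l)) * (w' k - w k))
     = 2 * w l * D l * (2 - sq_sum w) - w l * w l * sg.
    rewrite /sg -rsum_mul.
    have -> : 2 * w l * D l * (2 - sq_sum w) =
       rsum (fun k => if k == l then 2 * w l * D l * (2 - sq_sum w) else 0).
      by rewrite (rsum_single _ _ l) ?eqxx // => j /eqP/negbTE ->.
    rewrite -rsum_sub; apply: rsum_eq => k; rewrite /D; case: eqP => [->|_]; ring.
  have -> : w' l * w' l * (2 - sq_sum w') - w l * w l * (2 - sq_sum w) -
     (2 * w l * D l * (2 - sq_sum w) - w l * w l * sg) =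
     D l * D l * (2 - sq_sum w) - w l * w l * q - (w' l + w l) * D l * (sq_sum w' - sq_sum w).
    have -> : w' l = w l + D l by rewrite /D; lra.
    have -> : sq_sum w' = sq_sum w + (sg + q) by lra.
    ring.
  have h1 : Rabs (D l * D l * (2 - sq_sum w)) <= (d * d) * (N + 2).
    by apply: Rabs_mul_le; [exact: Rabs_mul_le|apply: Rabs_le; lra].
  have h2 : Rabs (w l * w l * q) <= (1 * 1) * (N * (d * d)).
    by apply: Rabs_mul_le => //; exact: Rabs_mul_le.
  have h3 : Rabs ((w' l + w l) * D l * (sq_sum w' - sq_sum w)) <= (2 * d) * (N * (2 * d)).
    apply: Rabs_mul_le => //; apply: Rabs_mul_le => //.
    by apply: Rle_trans (Rabs_triang _ _) _; have := hwk l; have := hwk' l; lra.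
  move: h1 h2 h3 => /Rabs_le_between h1 /Rabs_le_between h2 /Rabs_le_between h3.
  by apply: Rabs_le; rewrite -/d; have := Rmult_le_pos _ _ d0 d0; nra.
have -> : rsum (fun k => - 4 * w k * (1 - sq_sum w) * (w' k - w k)) = - 2 * (1 - sq_sum w) * sg.
  by rewrite /sg -rsum_mul; apply: rsum_eq => k; rewrite /D; ring.
have -> : (1 - sq_sum w') * (1 - sq_sum w') - (1 - sq_sum w) * (1 - sq_sum w) -
   - 2 * (1 - sq_sum w) * sg =
   (sq_sum w' - sq_sum w) * (sq_sum w' - sq_sum w) - 2 * (1 - sq_sum w) * q.
  have -> : sq_sum w' = sq_sum w + (sg + q) by lra.
  ring.
have h1 : Rabs (2 * (1 - sq_sum w) * q) <= (2 * (N + 2)) * (N * (d * d)).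
  by apply: Rabs_mul_le => //; apply: Rabs_le; lra.
move: h1 hdd => /Rabs_le_between h1 /Rabs_le_between h2.
by apply: Rabs_le; rewrite -/d; have := Rmult_le_pos _ _ d0 d0; nra.
Qed.

Lemma wt_bounds : exists C, 1 <= C /\ forall w w', cube1 w -> cube1 w' ->
  [/\ forall i, Rabs (wt i w) <= C,
      forall i, Rabs (wt i w' - wt i w) <= C * ds w w',
      forall k i, Rabs (dwt k i w) <= C,
      forall k i, Rabs (dwt k i w' - dwt k i w) <= C * ds w w' &
      forall i, Rabs (wt_rem i w w') <= C * (ds w w' * ds w w')].
Proof.
have le_mul c c' d : 0 <= d -> c <= c' -> c * d <= c' * d by move=> *; exact: Rmult_le_compat_r.
have [C1 h1] := fin_bound _ (fun i c => forall w, cube1 w -> Rabs (wt i w) <= c)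
  (fun i c c' le h w hw => Rle_trans _ _ _ (h w hw) le) (fun i => proj2 (wt_lip i)).
have [C2 h2] : exists c, forall i w w', cube1 w -> cube1 w' ->
    Rabs (wt i w' - wt i w) <= c * ds w w'.
  apply: (fin_bound _ (fun i c => forall w w', cube1 w -> cube1 w' ->
    Rabs (wt i w' - wt i w) <= c * ds w w')) => [i c c' le h w w' hw hw'|i].
    by apply: Rle_trans (h w w' hw hw') _; apply: le_mul => //; exact: ds_pos.
  have [[L [_ h]] _] := wt_lip i; exists L => w w' hw hw'.
  by rewrite (ds_sym w); exact: h.
have [C3 h3] : exists c, forall k i w, cube1 w -> Rabs (dwt k i w) <= c.
  apply: (fin_bound _ (fun k c => forall i w, cube1 w -> Rabs (dwt k i w) <= c)) =>
    [k c c' le h i w hw|k]; first exact: Rle_trans (h i w hw) le.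
  apply: (fin_bound _ (fun i c => forall w, cube1 w -> Rabs (dwt k i w) <= c)) =>
    [i c c' le h w hw|i]; first exact: Rle_trans (h w hw) le.
  exact: (proj2 (dwt_lip k i)).
have [C4 h4] : exists c, forall k i w w', cube1 w -> cube1 w' ->
    Rabs (dwt k i w' - dwt k i w) <= c * ds w w'.
  apply: (fin_bound _ (fun k c => forall i w w', cube1 w -> cube1 w' ->
    Rabs (dwt k i w' - dwt k i w) <= c * ds w w')) => [k c c' le h i w w' hw hw'|k].
    by apply: Rle_trans (h i w w' hw hw') _; apply: le_mul => //; exact: ds_pos.
  apply: (fin_bound _ (fun i c => forall w w', cube1 w -> cube1 w' ->
    Rabs (dwt k i w' - dwt k i w) <= c * ds w w')) => [i c c' le h w w' hw hw'|i].
    by apply: Rle_trans (h w w' hw hw') _; apply: le_mul => //; exact: ds_pos.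
  have [[L [_ h]] _] := dwt_lip k i; exists L => w w' hw hw'.
  by rewrite (ds_sym w); exact: h.
have [C5 h5] := fin_bound _ (fun i c => forall w w', cube1 w -> cube1 w' ->
    Rabs (wt_rem i w w') <= c * (ds w w' * ds w w'))
  (fun i c c' le h w w' hw hw' => Rle_trans _ _ _ (h w w' hw hw')
     (le_mul _ _ _ (Rle_0_sqr (ds w w')) le)) wt_rem_le.
pose C := 1 + Rabs C1 + Rabs C2 + Rabs C3 + Rabs C4 + Rabs C5.
have p1 := Rabs_pos C1; have p2 := Rabs_pos C2; have p3 := Rabs_pos C3.
have p4 := Rabs_pos C4; have p5 := Rabs_pos C5.
have a1 := Rle_abs C1; have a2 := Rle_abs C2; have a3 := Rle_abs C3.
have a4 := Rle_abs C4; have a5 := Rle_abs C5.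
exists C; split; first by rewrite /C; lra.
move=> w w' hw hw'; have d0 := ds_pos _ w w'; split=> [i|i|k i|k i|i].
- by apply: Rle_trans (h1 i w hw) _; rewrite /C; lra.
- by apply: Rle_trans (h2 i w w' hw hw') _; apply: le_mul => //; rewrite /C; lra.
- by apply: Rle_trans (h3 k i w hw) _; rewrite /C; lra.
- by apply: Rle_trans (h4 k i w w' hw hw') _; apply: le_mul => //; rewrite /C; lra.
- apply: Rle_trans (h5 i w w' hw hw') _; apply: le_mul; first exact: Rmult_le_pos.
  by rewrite /C; lra.
Qed.

(** Weights sum to [1], so their derivatives and increments sum to [0]. Only differences of vertices
    then matter, and these are [O(rho)]. *)
Lemma rsum_shift (c v : 'I_n.+1 -> R) v0 : rsum c = 0 ->
  rsum (fun i => v i * c i) = rsum (fun i => (v i - v0) * c i).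
Proof.
move=> c0; suff -> : rsum (fun i => v i * c i) =
  rsum (fun i => (v i - v0) * c i) + v0 * rsum c by rewrite c0; lra.
by rewrite -rsum_mul -rsum_add; apply: rsum_eq => i; lra.
Qed.

(** Half of the diagonal absorbs the off-diagonal part, the other half inverts the system with norm
    [1 / kap]. *)
Lemma diag_dom (dl : 'I_n -> R) (M : 'I_n -> 'I_n -> R) (kap : R) (eta tau : Rn n) :
  0 < kap -> (forall l, 2 * kap <= dl l) -> (forall k l, INR n * Rabs (M k l) <= kap) ->
  (forall k, dl k * eta k + rsum (fun l => M k l * eta l) = tau k) ->
  kap * nrm eta <= nrm tau.
Proof.
move=> k0 hd hM sol; have e0 := nrm_pos _ eta; have t0 := nrm_pos _ tau.
apply: Rnot_lt_le => lt.
have : nrm eta <= (nrm tau + kap * nrm eta) / (2 * kap).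
  apply: nrm_le => [|k]; first by apply: Rmult_le_pos; [nra|apply/Rlt_le/Rinv_0_lt_compat; lra].
  have hS : Rabs (rsum (fun l => M k l * eta l)) <= kap * nrm eta.
    have npos : 0 < INR n by apply: lt_0_INR; have := ltn_ord k; lia.
    apply: Rle_trans (_ : INR n * (kap / INR n * nrm eta) <= _); last first.
      by right; field; lra.
    apply: rsum_abs_le => l; apply: Rabs_mul_le; last exact: nrm_coord.
    by apply: (Rmult_le_reg_l (INR n)) => //; apply: Rle_trans (hM k l) _; right; field; lra.
  have e : dl k * eta k = tau k - rsum (fun l => M k l * eta l) by have := sol k; lra.
  have h : dl k * Rabs (eta k) <= nrm tau + kap * nrm eta.
    have dp : 0 <= dl k by have := hd k; lra.
    rewrite -{1}(Rabs_right (dl k)); last lra.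
    rewrite -Rabs_mult e; apply: Rle_trans (Rabs_triang _ _) _; rewrite Rabs_Ropp.
    by have := nrm_coord _ tau k; lra.
  have := Rabs_pos (eta k) => ?; have := hd k => ?.
  apply: (Rmult_le_reg_l (2 * kap)); first lra.
  have -> : 2 * kap * ((nrm tau + kap * nrm eta) / (2 * kap)) = nrm tau + kap * nrm eta by field; lra.
  nra.
move=> h; have : 2 * kap * nrm eta <= nrm tau + kap * nrm eta.
  have -> : nrm tau + kap * nrm eta = 2 * kap * ((nrm tau + kap * nrm eta) / (2 * kap)) by field; lra.
  by apply: Rmult_le_compat_l => //; lra.
lra.
Qed.

Lemma diag_solve (dl : 'I_n -> R) (M : 'I_n -> 'I_n -> R) (kap : R) (tau : Rn n) :
  0 < kap -> (forall l, 2 * kap <= dl l) -> (forall k l, INR n * Rabs (M k l) <= kap) ->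
  exists eta : Rn n, forall k, dl k * eta k + rsum (fun l => M k l * eta l) = tau k.
Proof.
move=> k0 hd hM.
(* The matrix acts on row vectors, hence the transposed indices. Its kernel is trivial by [diag_dom]
   with [tau = 0]. *)
pose A : 'M[R]_n := (\matrix_(l, k) ((if k == l then dl k else 0) + M k l))%R.
have Av (v : 'rV[R]_n) k : (v *m A)%R ord0 k =
    dl k * v ord0 k + rsum (fun l => M k l * v ord0 l).
  rewrite mxE.
  have -> : dl k * v ord0 k = rsum (fun l => if k == l then dl k * v ord0 k else 0).
    by rewrite (rsum_single _ _ k) ?eqxx // => j /eqP; rewrite eq_sym => /negbTE ->.
  rewrite -rsum_add; apply: eq_bigr => l _; rewrite mxE.
  change (v ord0 l * ((if k == l then dl k else 0) + M k l) =
    (if k == l then dl k * v ord0 k else 0) + M k l * v ord0 l).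
  by case: eqP => [->|_]; ring.
have uA : A \in unitmx.
  rewrite -row_free_unit -kermx_eq0; apply/eqP/row_matrixP => i; rewrite row0.
  set v := row i _; have vA : (v *m A = 0)%R by rewrite -row_mul mulmx_ker row0.
  apply/rowP => k; rewrite [RHS]mxE.
  have h : kap * nrm (fun k => v ord0 k) <= nrm (fun _ : 'I_n => 0).
    apply: (diag_dom dl M) => // k'; by rewrite -Av vA mxE.
  have h2 : Rabs (v ord0 k) <= nrm (fun k => v ord0 k) := nrm_coord _ (fun k => v ord0 k) k.
  rewrite nrm0 in h; apply: NNPP => ne; have h3 : 0 < Rabs (v ord0 k) := Rabs_pos_lt _ ne.
  have : 0 < kap * nrm (fun k => v ord0 k) by apply: Rmult_lt_0_compat; [|exact: Rlt_le_trans h2].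
  lra.
pose t : 'rV[R]_n := (\row_k tau k)%R.
exists (fun k => (t *m invmx A)%R ord0 k) => k.
by rewrite -Av mulmxKV // mxE.
Qed.

End Simplex.

(** * The horizontal simplex spanned by [n + 1] nearby points *)

Section Psi.
Variable n : nat.
Implicit Types (g : 'I_n.+1 -> Heis n) (dl w : Rn n).

(** The average of the vertices may degenerate. With [dl] large against their spread, the second
    term makes the derivative in [w] invertible, so that horizontality can be solved for [y]. *)
Definition psX g dl w : Rn n := fun l => rsum (fun i => wt n i w * hx (g i) l) + dl l * w l.

(** The height over [X] of the horizontal affine [n]-plane through [g i] on which [y] is
    constant. *)
Definition psT g (i : 'I_n.+1) (X : Rn n) : R :=
  hz (g i) + rsum (fun l => hy (g i) l * (X l - hx (g i) l)).

Definition psM g w (k l : 'I_n) : R := rsum (fun i => hx (g i) l * dwt n k i w).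

Definition psTau g dl w : Rn n := fun k => rsum (fun i => psT g i (psX g dl w) * dwt n k i w).

(* [eta] makes the simplex horizontal: it solves [dZ = Y . dX] in the parameter [w]. *)
Definition eta_spec g dl w (eta : Rn n) : Prop :=
  forall k, dl k * eta k + rsum (fun l => psM g w k l * eta l) = psTau g dl w k.

Definition psEta g dl w : Rn n := epsilon (inhabits (fun=> 0)) (eta_spec g dl w).

(** The height averages those of the planes [psT], so that [dZ = sum wt_i y_i . dX + sum T_i dwt_i].
    The average of the [y_i] accounts for the first sum, and [psEta] is added to account for the
    second. *)
Definition psi g dl w : Heis n :=
  mkHeis (psX g dl w) (fun l => rsum (fun i => wt n i w * hy (g i) l) + psEta g dl w l)
         (rsum (fun i => wt n i w * psT g i (psX g dl w))).

Lemma psT_sub g i (X X' : Rn n) :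
  psT g i X' - psT g i X = rsum (fun l => hy (g i) l * (X' l - X l)).
Proof.
rewrite /psT; set a := rsum _; set b := rsum _.
have -> : hz (g i) + a - (hz (g i) + b) = a - b by lra.
by rewrite /a /b -rsum_sub; apply: rsum_eq => l; lra.
Qed.

(** For vertices within [rho] of each other, and [X] within [O(rho)] of them, every term is
    [O(rho^2)], the order that the metric requires of heights. *)
Lemma psT_cross g i j (X : Rn n) : psT g i X - psT g j X =
  hD (g j) (g i) + / 2 * rsum (fun l => (hy (g i) l - hy (g j) l) * (hx (g i) l - hx (g j) l))
  + rsum (fun l => (hy (g i) l - hy (g j) l) * (X l - hx (g i) l)).
Proof.
rewrite /psT /hD; set a := rsum _; set b := rsum _; set c := rsum _; set d := rsum _; set e := rsum _.
suff : a - b = - / 2 * c + / 2 * d + e by lra.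
by rewrite /a /b /c /d /e -!rsum_mul -!rsum_sub -!rsum_add; apply: rsum_eq => l; lra.
Qed.

Variable C : R.
Hypothesis C1 : 1 <= C.
Hypothesis bounds : forall w w', cube1 n w -> cube1 n w' ->
  [/\ forall i, Rabs (wt n i w) <= C,
      forall i, Rabs (wt n i w' - wt n i w) <= C * ds w w',
      forall k i, Rabs (dwt n k i w) <= C,
      forall k i, Rabs (dwt n k i w' - dwt n k i w) <= C * ds w w' &
      forall i, Rabs (wt_rem n i w w') <= C * (ds w w' * ds w w')].

Let N := INR n.
Let N1 := INR n.+1.
(** An entry of [psM] is at most [N1 * C * rho], so [kap rho] dominates a row of [N] of them with
    [rho] to spare. *)
Let kap rho := (1 + N * (N1 * C)) * rho.

Variables (K' rho : R) (g : 'I_n.+1 -> Heis n) (dl : Rn n).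
Hypothesis rho0 : 0 < rho.
Hypothesis g_near : forall i j, ds (g i) (g j) <= rho.
Hypothesis dl_lo : forall l, 2 * kap rho <= dl l.
Hypothesis dl_hi : forall l, dl l <= K' * rho.

Let N0 : 0 <= N. Proof. exact: pos_INR. Qed.
Let N10 : 1 <= N1. Proof. by rewrite /N1 S_INR; have := N0; rewrite /N; lra. Qed.

Let gx i j l : Rabs (hx (g i) l - hx (g j) l) <= rho.
Proof.
have [h _] := proj1 (hds_le n _ _ rho (Rlt_le _ _ rho0)) (g_near i j).
exact: Rle_trans (rds_coord _ _ _ l) h.
Qed.

Let gy i j l : Rabs (hy (g i) l - hy (g j) l) <= rho.
Proof.
have [_ [h _]] := proj1 (hds_le n _ _ rho (Rlt_le _ _ rho0)) (g_near i j).
exact: Rle_trans (rds_coord _ _ _ l) h.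
Qed.

Let gD i j : Rabs (hD (g i) (g j)) <= cH n * (rho * rho).
Proof. by have [_ [_ h]] := proj1 (hds_le n _ _ rho (Rlt_le _ _ rho0)) (g_near i j). Qed.

Let K'0 (l : 'I_n) : 0 < dl l /\ Rabs (dl l) <= K' * rho.
Proof.
have : 0 < kap rho.
  rewrite /kap; apply: Rmult_lt_0_compat => //.
  by have := Rmult_le_pos _ _ N0 (Rmult_le_pos _ _ (Rle_trans _ _ _ Rle_0_1 N10) (Rle_trans _ _ _ Rle_0_1 C1)); lra.
by have := dl_lo l; have := dl_hi l; split; [lra|rewrite Rabs_right; lra].
Qed.

Lemma psM_small w k l : cube1 n w -> Rabs (psM g w k l) <= N1 * (rho * C).
Proof.
move=> hw; rewrite /psM (rsum_shift n _ _ (hx (g ord0) l)); last exact: dwt_sum.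
apply: rsum_abs_le => i; apply: Rabs_mul_le; first exact: gx.
by have [_ _ h _ _] := bounds w w hw hw; exact: h.
Qed.

Lemma psM_dom w k l : cube1 n w -> N * Rabs (psM g w k l) <= kap rho.
Proof.
move=> hw; have h := Rmult_le_compat_l _ _ _ N0 (psM_small w k l hw).
by rewrite /kap; lra.
Qed.

Lemma kap0 : rho <= kap rho.
Proof.
rewrite /kap -{1}[rho]Rmult_1_l; apply: Rmult_le_compat_r; first lra.
by have := Rmult_le_pos _ _ N0 (Rmult_le_pos _ _ (Rle_trans _ _ _ Rle_0_1 N10) (Rle_trans _ _ _ Rle_0_1 C1)); lra.
Qed.

Lemma psEta_spec w : cube1 n w -> eta_spec g dl w (psEta g dl w).
Proof.
move=> hw; apply: epsilon_spec; apply: (diag_solve n dl (psM g w) (kap rho)).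
- by have := kap0; lra.
- exact: dl_lo.
- by move=> k l; exact: psM_dom.
Qed.

Lemma eta_bound w (eta tau : Rn n) r : cube1 n w -> 0 <= r ->
  (forall k, dl k * eta k + rsum (fun l => psM g w k l * eta l) = tau k) ->
  (forall k, Rabs (tau k) <= rho * r) -> forall k, Rabs (eta k) <= r.
Proof.
move=> hw r0 sol ht k; apply: Rle_trans (nrm_coord _ eta k) _.
have k0 := kap0.
have h : kap rho * nrm eta <= nrm tau.
  apply: (diag_dom n dl (psM g w)) => //; first lra.
  by move=> k' l; exact: psM_dom.
have {}ht : nrm tau <= rho * r by apply: nrm_le => //; apply: Rmult_le_pos; lra.
apply: (Rmult_le_reg_l rho) => //.
by have := Rmult_le_compat_r _ _ _ (nrm_pos _ eta) k0; lra.
Qed.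

(** Up to powers of [rho]: [b1] bounds the position and the variation of [X], [b2] the differences
    of the heights [psT], [b3] the size of [eta], [b4] the variation of [tau], [b5] that of [eta],
    [b6] that of [y], and [b7] the vertical error. *)
Let b1 := N1 * C + K'.
Let b2 := cH n + N + N * b1.
Let b3 := N1 * (b2 * C).
Let b4 := N1 * (b2 * C + N * b1 * C).
Let b5 := b4 + N * (N1 * C * b3).
Let b6 := N1 * C + b5.
Let b7 := N1 * (C * (N * b1)) + N1 * (b2 * C) + N * (b3 * (N1 * C)).

Let K0 : 0 <= K' \/ n = 0%N.
Proof.
case: (posnP n) => [?|n0]; [by right|left].
have [h1 h2] := K'0 (Ordinal n0); have := Rabs_pos (dl (Ordinal n0)).
by move=> h; apply: Rnot_lt_le => neg; have := Rmult_lt_gt_compat_neg_l; nra.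
Qed.

Lemma psX_near w j l : cube1 n w -> Rabs (psX g dl w l - hx (g j) l) <= b1 * rho.
Proof.
move=> hw; have [h _ _ _ _] := bounds w w hw hw.
have -> : psX g dl w l - hx (g j) l =
    rsum (fun i => wt n i w * (hx (g i) l - hx (g j) l)) + dl l * w l.
  rewrite /psX; set a := rsum _; set b := rsum _.
  have -> : b = a - hx (g j) l * 1.
    by rewrite -(wt_sum n w) -rsum_mul /a /b -rsum_sub; apply: rsum_eq => i; lra.
  lra.
apply: Rle_trans (Rabs_triang _ _) _; rewrite /b1.
have h1 : Rabs (rsum (fun i => wt n i w * (hx (g i) l - hx (g j) l))) <= N1 * (C * rho).
  by apply: rsum_abs_le => i; exact: Rabs_mul_le.
have h2 : Rabs (dl l * w l) <= (K' * rho) * 1.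
  apply: Rabs_mul_le; first by case: (K'0 l).
  exact: Rle_trans (nrm_coord _ _ l) hw.
lra.
Qed.

Lemma psT_near w i j : cube1 n w ->
  Rabs (psT g i (psX g dl w) - psT g j (psX g dl w)) <= b2 * (rho * rho).
Proof.
move=> hw; rewrite psT_cross.
have h1 := gD j i.
have h2 : Rabs (rsum (fun l => (hy (g i) l - hy (g j) l) * (hx (g i) l - hx (g j) l))) <= N * (rho * rho).
  by apply: rsum_abs_le => l; exact: Rabs_mul_le.
have h3 : Rabs (rsum (fun l => (hy (g i) l - hy (g j) l) * (psX g dl w l - hx (g i) l)))
    <= N * (rho * (b1 * rho)).
  by apply: rsum_abs_le => l; apply: Rabs_mul_le => //; exact: psX_near.
have := Rmult_le_pos _ _ N0 (Rmult_le_pos _ _ (Rlt_le _ _ rho0) (Rlt_le _ _ rho0)).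
move: h1 h2 h3 => /Rabs_le_between h1 /Rabs_le_between h2 /Rabs_le_between h3 p.
by apply: Rabs_le; rewrite /b2; lra.
Qed.

Lemma tau_shift w k : psTau g dl w k =
  rsum (fun i => (psT g i (psX g dl w) - psT g ord0 (psX g dl w)) * dwt n k i w).
Proof. by rewrite /psTau -rsum_shift //; exact: dwt_sum. Qed.

Lemma b2_pos w : cube1 n w -> 0 <= b2.
Proof.
move=> hw; have := psT_near w ord0 ord0 hw; rewrite Rminus_diag Rabs_R0 => h.
by apply: Rnot_lt_le => lt; have := Rmult_lt_0_compat _ _ rho0 rho0; nra.
Qed.

Lemma b3_pos w : cube1 n w -> 0 <= b3.
Proof.
move=> /b2_pos h; rewrite /b3; apply: Rmult_le_pos; first lra.
by apply: Rmult_le_pos; lra.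
Qed.

Lemma psEta_le w l : cube1 n w -> Rabs (psEta g dl w l) <= b3 * rho.
Proof.
move=> hw; apply: (eta_bound w (psEta g dl w) (psTau g dl w)) => //.
- by apply: Rmult_le_pos; [exact: b3_pos hw|lra].
- exact: psEta_spec.
move=> k; rewrite tau_shift; apply: Rle_trans (_ : N1 * (b2 * (rho * rho) * C) <= _).
  apply: rsum_abs_le => i; apply: Rabs_mul_le; first exact: psT_near.
  by have [_ _ h _ _] := bounds w w hw hw; exact: h.
by rewrite /b3; right; ring.
Qed.

Section TwoPoints.
Variables w w' : Rn n.
Hypotheses (hw : cube1 n w) (hw' : cube1 n w').
Let d := ds w w'.
Let d0 : 0 <= d. Proof. exact: ds_pos. Qed.
Let X := psX g dl w.
Let X' := psX g dl w'.
Let Dw i := wt n i w' - wt n i w.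

Let Dw_sum : rsum Dw = 0.
Proof. by rewrite /Dw rsum_sub !wt_sum; lra. Qed.

Let rem_sum : rsum (fun i => wt_rem n i w w') = 0.
Proof.
rewrite /wt_rem rsum_sub -/Dw Dw_sum rsum_exchange (rsum_eq _ _ (fun=> 0)) ?rsum_const; first lra.
move=> k; rewrite (rsum_eq _ _ (fun i => (w' k - w k) * dwt n k i w)) => [|i]; last lra.
by rewrite rsum_mul dwt_sum; lra.
Qed.

Let dwl l : Rabs (w' l - w l) <= d.
Proof. by rewrite Rabs_minus_sym; exact: rds_coord. Qed.

Lemma psX_diff l : Rabs (X' l - X l) <= b1 * (rho * d).
Proof.
have [_ h _ _ _] := bounds w w' hw hw'.
have -> : X' l - X l = rsum (fun i => (hx (g i) l - hx (g ord0) l) * Dw i) + dl l * (w' l - w l).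
  rewrite -rsum_shift // /X /X' /psX /Dw; set a := rsum _; set b := rsum _; set c := rsum _.
  suff -> : c = a - b by lra.
  by rewrite /a /b /c -rsum_sub; apply: rsum_eq => i; lra.
apply: Rle_trans (Rabs_triang _ _) _; rewrite /b1.
have h1 : Rabs (rsum (fun i => (hx (g i) l - hx (g ord0) l) * Dw i)) <= N1 * (rho * (C * d)).
  by apply: rsum_abs_le => i; apply: Rabs_mul_le => //; exact: h.
have h2 : Rabs (dl l * (w' l - w l)) <= (K' * rho) * d.
  by apply: Rabs_mul_le => //; case: (K'0 l).
lra.
Qed.

Lemma psTau_diff k : Rabs (psTau g dl w' k - psTau g dl w k) <= rho * (b4 * (rho * d)).
Proof.
have [_ _ h3 h4 _] := bounds w w' hw hw'.
rewrite !tau_shift -rsum_sub.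
apply: Rle_trans (_ : N1 * (b2 * (rho * rho) * (C * d) + N * (rho * (b1 * (rho * d))) * C) <= _);
  last by rewrite /b4; right; ring.
apply: rsum_abs_le => i; rewrite -/X -/X'.
have -> : (psT g i X' - psT g ord0 X') * dwt n k i w' - (psT g i X - psT g ord0 X) * dwt n k i w =
  (psT g i X' - psT g ord0 X') * (dwt n k i w' - dwt n k i w) +
  ((psT g i X' - psT g i X) - (psT g ord0 X' - psT g ord0 X)) * dwt n k i w by ring.
apply: Rle_trans (Rabs_triang _ _) _; apply: Rplus_le_compat.
  by apply: Rabs_mul_le; [exact: psT_near|exact: h4].
apply: Rabs_mul_le => //; rewrite !psT_sub -rsum_sub; apply: rsum_abs_le => l.
rewrite -Rmult_minus_distr_r; apply: Rabs_mul_le => //; exact: psX_diff.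
Qed.

Lemma b45_pos : 0 <= b4 * (rho * d) /\ 0 <= b5 * (rho * d).
Proof.
case: (posnP n) => [n0|n0].
  have hb2 := b2_pos w hw; have hb3 := b3_pos w hw.
  have N00 : N = 0 by rewrite /N n0.
  have : 0 <= N1 * (b2 * C) by apply: Rmult_le_pos; [lra|apply: Rmult_le_pos; lra].
  have rd : 0 <= rho * d by apply: Rmult_le_pos; lra.
  by move=> p; rewrite /b5 /b4 N00; split; apply: Rmult_le_pos; lra.
have h4 := Rle_trans _ _ _ (Rabs_pos _) (psTau_diff (Ordinal n0)).
have p4 : 0 <= b4 * (rho * d) by apply: Rnot_lt_le => lt; nra.
split=> //; rewrite /b5 Rmult_plus_distr_r; apply: Rplus_le_le_0_compat => //.
apply: Rmult_le_pos; last by apply: Rmult_le_pos; lra.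
apply: Rmult_le_pos => //; apply: Rmult_le_pos; last exact: b3_pos hw.
by apply: Rmult_le_pos; lra.
Qed.

(** The difference solves the system at [w] with right-hand side [tau' - tau - (M' - M) eta'], so
    the a priori bound [eta_bound] applies to it. *)
Lemma psEta_diff l : Rabs (psEta g dl w' l - psEta g dl w l) <= b5 * (rho * d).
Proof.
have [_ _ _ h4 _] := bounds w w' hw hw'; have [p4 p5] := b45_pos.
pose tau k := psTau g dl w' k - psTau g dl w k
  - rsum (fun l => (psM g w' k l - psM g w k l) * psEta g dl w' l).
apply: (eta_bound w (fun l => psEta g dl w' l - psEta g dl w l) tau) => // k.
  rewrite /tau -(psEta_spec w hw k) -(psEta_spec w' hw' k).
  set a := rsum _; set b := rsum _; set c := rsum _; set e := rsum _.
  suff -> : a = b - c - e by ring.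
  by rewrite /a /b /c /e -!rsum_sub; apply: rsum_eq => l'; ring.
rewrite /tau; apply: Rle_trans (Rabs_triang _ _) _; rewrite Rabs_Ropp.
have hS : Rabs (rsum (fun l => (psM g w' k l - psM g w k l) * psEta g dl w' l)) <=
    N * (N1 * (rho * (C * d)) * (b3 * rho)).
  apply: rsum_abs_le => l'; apply: Rabs_mul_le; last exact: psEta_le.
  rewrite /psM -rsum_sub (rsum_eq _ _ (fun i => hx (g i) l' * (dwt n k i w' - dwt n k i w))) => [|i]; last ring.
  rewrite (rsum_shift n _ _ (hx (g ord0) l')) ?rsum_sub ?dwt_sum; last lra.
  by apply: rsum_abs_le => i; apply: Rabs_mul_le => //; exact: h4.
have := psTau_diff k; rewrite /b5; lra.
Qed.

Lemma psY_diff l : Rabs (hy (psi g dl w') l - hy (psi g dl w) l) <= b6 * (rho * d).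
Proof.
have [_ h _ _ _] := bounds w w' hw hw'; have he := psEta_diff l.
have -> : hy (psi g dl w') l - hy (psi g dl w) l =
   rsum (fun i => (hy (g i) l - hy (g ord0) l) * Dw i) + (psEta g dl w' l - psEta g dl w l).
  rewrite -rsum_shift //= /Dw; set a := rsum _; set b := rsum _; set c := rsum _.
  suff -> : c = a - b by lra.
  by rewrite /a /b /c -rsum_sub; apply: rsum_eq => i; lra.
apply: Rle_trans (Rabs_triang _ _) _.
have h1 : Rabs (rsum (fun i => (hy (g i) l - hy (g ord0) l) * Dw i)) <= N1 * (rho * (C * d)).
  by apply: rsum_abs_le => i; apply: Rabs_mul_le => //; exact: h.
rewrite /b6; lra.
Qed.

Let S i := rsum (fun l => hy (g i) l * (X' l - X l)).
Let rv l := rsum (fun i => hx (g i) l * wt_rem n i w w').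

(** The equation for [eta] makes the first-order terms [tD] of [E4] and [E6] equal, and they cancel.
    Each of the three remaining sums is [O(rho^2 * d^2)]. *)
Lemma psZ_diff : hz (psi g dl w') - hz (psi g dl w)
    - rsum (fun l => hy (psi g dl w) l * (X' l - X l)) =
  rsum (fun i => (S i - S ord0) * Dw i)
  + rsum (fun i => (psT g i X - psT g ord0 X) * wt_rem n i w w')
  - rsum (fun l => psEta g dl w l * rv l).
Proof.
rewrite -rsum_shift // -rsum_shift //=.
have E1 : rsum (fun i => wt n i w' * psT g i X') - rsum (fun i => wt n i w * psT g i X)
    = rsum (fun i => psT g i X * Dw i) + rsum (fun i => wt n i w' * S i).
  rewrite -rsum_sub -rsum_add; apply: rsum_eq => i; rewrite /S -psT_sub /Dw; ring.
have E2 : rsum (fun l => (rsum (fun i => wt n i w * hy (g i) l) + psEta g dl w l) * (X' l - X l))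
    = rsum (fun i => wt n i w * S i) + rsum (fun l => psEta g dl w l * (X' l - X l)).
  have -> : rsum (fun i => wt n i w * S i) =
     rsum (fun l => rsum (fun i => wt n i w * hy (g i) l) * (X' l - X l)).
    rewrite (rsum_eq _ (fun i => wt n i w * S i)
      (fun i => rsum (fun l => wt n i w * hy (g i) l * (X' l - X l)))) => [|i].
      rewrite rsum_exchange; apply: rsum_eq => l.
      by rewrite Rmult_comm -rsum_mul; apply: rsum_eq => i; ring.
    by rewrite /S -rsum_mul; apply: rsum_eq => l; ring.
  by rewrite -rsum_add; apply: rsum_eq => l; ring.
pose tD := rsum (fun k => (w' k - w k) * psTau g dl w k).
have E4 : rsum (fun i => psT g i X * Dw i) =
    rsum (fun i => psT g i X * wt_rem n i w w') + tD.
  have -> : tD = rsum (fun i => psT g i X * rsum (fun k => dwt n k i w * (w' k - w k))).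
    rewrite /tD /psTau (rsum_eq _ _ (fun k => rsum (fun i =>
      (w' k - w k) * (psT g i X * dwt n k i w)))) => [|k]; last by rewrite rsum_mul.
    by rewrite rsum_exchange; apply: rsum_eq => i; rewrite -rsum_mul; apply: rsum_eq => k; ring.
  by rewrite -rsum_add; apply: rsum_eq => i; rewrite /wt_rem /Dw; ring.
have E5 l : X' l - X l = rv l + rsum (fun k => (w' k - w k) * psM g w k l) + dl l * (w' l - w l).
  have -> : rsum (fun k => (w' k - w k) * psM g w k l) =
      rsum (fun i => hx (g i) l * rsum (fun k => dwt n k i w * (w' k - w k))).
    rewrite /psM (rsum_eq _ _ (fun k => rsum (fun i =>
      (w' k - w k) * (hx (g i) l * dwt n k i w)))) => [|k]; last by rewrite rsum_mul.
    by rewrite rsum_exchange; apply: rsum_eq => i; rewrite -rsum_mul; apply: rsum_eq => k; ring.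
  rewrite /rv /X' /X /psX; set a := rsum _; set b := rsum _; set c := rsum _; set e := rsum _.
  suff : a - b = c + e by lra.
  by rewrite /a /b /c /e -rsum_sub -rsum_add; apply: rsum_eq => i; rewrite /wt_rem; ring.
have E6 : rsum (fun l => psEta g dl w l * (X' l - X l)) = rsum (fun l => psEta g dl w l * rv l) + tD.
  have -> : tD = rsum (fun l => psEta g dl w l *
      (rsum (fun k => (w' k - w k) * psM g w k l) + dl l * (w' l - w l))).
    rewrite /tD (rsum_eq _ _ (fun k => dl k * psEta g dl w k * (w' k - w k) +
       rsum (fun l => (w' k - w k) * (psM g w k l * psEta g dl w l)))) => [|k]; last first.
      by rewrite rsum_mul -(psEta_spec w hw k); ring.
    rewrite rsum_add rsum_exchange -rsum_add; apply: rsum_eq => l.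
    rewrite Rmult_plus_distr_l -rsum_mul Rplus_comm; congr (_ + _); last ring.
    by apply: rsum_eq => k; ring.
  by rewrite -rsum_add; apply: rsum_eq => l; rewrite {1}E5; ring.
rewrite E1 E2 E4 E6.
have -> : rsum (fun i => S i * Dw i) = rsum (fun i => wt n i w' * S i) - rsum (fun i => wt n i w * S i).
  by rewrite -rsum_sub; apply: rsum_eq => i; rewrite /Dw; ring.
ring.
Qed.

Lemma psD_le : Rabs (hD (psi g dl w) (psi g dl w')) <= (b7 + N * b6 * b1) * (rho * d * (rho * d)).
Proof.
have [_ h2 _ _ h5] := bounds w w' hw hw'.
have -> : hD (psi g dl w) (psi g dl w') = hz (psi g dl w') - hz (psi g dl w)
    - rsum (fun l => hy (psi g dl w) l * (X' l - X l))
    - / 2 * rsum (fun l => (hy (psi g dl w') l - hy (psi g dl w) l) * (X' l - X l)).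
  rewrite /hD [hx (psi g dl w)]/= [hx (psi g dl w')]/= -/X -/X'.
  set a := rsum _; set b := rsum _; set c := rsum _.
  suff : / 2 * a = b + / 2 * c by lra.
  by rewrite /a /b /c -!rsum_mul -rsum_add; apply: rsum_eq => l; lra.
rewrite psZ_diff.
have dd0 := Rmult_le_pos _ _ d0 d0.
have t1 : Rabs (rsum (fun i => (S i - S ord0) * Dw i)) <= N1 * (N * (rho * (b1 * (rho * d))) * (C * d)).
  apply: rsum_abs_le => i; apply: Rabs_mul_le; last exact: h2.
  rewrite /S -rsum_sub; apply: rsum_abs_le => l; rewrite -Rmult_minus_distr_r.
  by apply: Rabs_mul_le => //; exact: psX_diff.
have t2 : Rabs (rsum (fun i => (psT g i X - psT g ord0 X) * wt_rem n i w w')) <=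
    N1 * (b2 * (rho * rho) * (C * (d * d))).
  by apply: rsum_abs_le => i; apply: Rabs_mul_le; [exact: psT_near|exact: h5].
have t3 : Rabs (rsum (fun l => psEta g dl w l * rv l)) <= N * (b3 * rho * (N1 * (rho * (C * (d * d))))).
  apply: rsum_abs_le => l; apply: Rabs_mul_le; first exact: psEta_le.
  rewrite /rv (rsum_shift n _ _ (hx (g ord0) l)) //; apply: rsum_abs_le => i.
  by apply: Rabs_mul_le => //; exact: h5.
have t4 : Rabs (rsum (fun l => (hy (psi g dl w') l - hy (psi g dl w) l) * (X' l - X l))) <=
    N * (b6 * (rho * d) * (b1 * (rho * d))).
  by apply: rsum_abs_le => l; apply: Rabs_mul_le; [exact: psY_diff|exact: psX_diff].
have p4 := Rle_trans _ _ _ (Rabs_pos _) t4.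
move: t1 t2 t3 t4 => /Rabs_le_between t1 /Rabs_le_between t2 /Rabs_le_between t3 /Rabs_le_between t4.
by apply: Rabs_le; rewrite /b7; lra.
Qed.

End TwoPoints.

Let CC := 1 + Rabs b1 + Rabs b6 + Rabs (b7 + N * b6 * b1) + Rabs (N1 * C + b3)
  + Rabs (N1 * (C * b2) + N * ((N1 * C + b3) * b1)).

Lemma psi_lip_near :
  (forall w w', cube1 n w -> cube1 n w' -> ds (psi g dl w) (psi g dl w') <= CC * rho * ds w w') /\
  (forall w j, cube1 n w -> ds (psi g dl w) (g j) <= CC * rho).
Proof.
have p1 := Rabs_pos b1; have p2 := Rabs_pos b6; have p3 := Rabs_pos (b7 + N * b6 * b1).
have p4 := Rabs_pos (N1 * C + b3); have p5 := Rabs_pos (N1 * (C * b2) + N * ((N1 * C + b3) * b1)).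
have a1 := Rle_abs b1; have a2 := Rle_abs b6; have a3 := Rle_abs (b7 + N * b6 * b1).
have a4 := Rle_abs (N1 * C + b3); have a5 := Rle_abs (N1 * (C * b2) + N * ((N1 * C + b3) * b1)).
have CC1 : 1 <= CC by rewrite /CC; lra.
have c1 := cH_pos n.
have sq x y : 0 <= x -> y <= CC -> y * (x * x) <= cH n * (CC * x * (CC * x)).
  move=> x0 yc; have -> : cH n * (CC * x * (CC * x)) = (cH n * (CC * CC)) * (x * x) by ring.
  apply: Rmult_le_compat_r; first exact: Rmult_le_pos.
  have : CC <= CC * CC by nra.
  have : CC * CC <= cH n * (CC * CC) by nra.
  lra.
split=> [w w' hw hw'|w j hw].
  have d0 := ds_pos _ w w'; have rd : 0 <= rho * ds w w' by apply: Rmult_le_pos; lra.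
  rewrite Rmult_assoc; apply/hds_le; first by apply: Rmult_le_pos; lra.
  split; [|split].
  - rewrite ds_sym; apply: rds_le => [|l]; first by apply: Rmult_le_pos; lra.
    apply: Rle_trans (psX_diff w w' hw hw' l) _; apply: Rmult_le_compat_r => //; rewrite /CC; lra.
  - rewrite ds_sym; apply: rds_le => [|l]; first by apply: Rmult_le_pos; lra.
    apply: Rle_trans (psY_diff w w' hw hw' l) _; apply: Rmult_le_compat_r => //; rewrite /CC; lra.
  - by apply: Rle_trans (psD_le w w' hw hw') _; apply: sq => //; rewrite /CC; lra.
have [h _ _ _ _] := bounds w w hw hw.
have hY l : Rabs (hy (psi g dl w) l - hy (g j) l) <= (N1 * C + b3) * rho.
  have -> : hy (psi g dl w) l - hy (g j) l =
      rsum (fun i => wt n i w * (hy (g i) l - hy (g j) l)) + psEta g dl w l.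
    rewrite /=; set a := rsum _; set b := rsum _.
    have -> : b = a - hy (g j) l * 1.
      by rewrite -(wt_sum n w) -rsum_mul /a /b -rsum_sub; apply: rsum_eq => i; lra.
    lra.
  apply: Rle_trans (Rabs_triang _ _) _; have := psEta_le w l hw.
  have : Rabs (rsum (fun i => wt n i w * (hy (g i) l - hy (g j) l))) <= N1 * (C * rho).
    by apply: rsum_abs_le => i; exact: Rabs_mul_le.
  lra.
apply/hds_le; first by apply: Rmult_le_pos; lra.
have rr := Rlt_le _ _ rho0.
split; [|split].
- apply: rds_le => [|l]; first by apply: Rmult_le_pos; lra.
  apply: Rle_trans (psX_near w j l hw) _; apply: Rmult_le_compat_r => //; rewrite /CC; lra.
- apply: rds_le => [|l]; first by apply: Rmult_le_pos; lra.
  apply: Rle_trans (hY l) _; apply: Rmult_le_compat_r => //; rewrite /CC; lra.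
rewrite hD_anti Rabs_Ropp.
have -> : hD (g j) (psi g dl w) =
    rsum (fun i => wt n i w * (psT g i (psX g dl w) - psT g j (psX g dl w)))
    - / 2 * rsum (fun l => (hy (psi g dl w) l - hy (g j) l) * (psX g dl w l - hx (g j) l)).
  rewrite /hD [hz (psi g dl w)]/= [hx (psi g dl w)]/=.
  set a := rsum _; set b := rsum _; set c := rsum _; set e := rsum _.
  have -> : c = a - psT g j (psX g dl w) * 1.
    by rewrite -(wt_sum n w) -rsum_mul /a /c -rsum_sub; apply: rsum_eq => i; lra.
  rewrite /psT; set f := rsum _.
  suff : / 2 * b = f + / 2 * e by lra.
  by rewrite /b /e /f -!rsum_mul -rsum_add; apply: rsum_eq => l; lra.
have t1 : Rabs (rsum (fun i => wt n i w * (psT g i (psX g dl w) - psT g j (psX g dl w))))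
    <= N1 * (C * (b2 * (rho * rho))).
  by apply: rsum_abs_le => i; apply: Rabs_mul_le => //; exact: psT_near.
have t2 : Rabs (rsum (fun l => (hy (psi g dl w) l - hy (g j) l) * (psX g dl w l - hx (g j) l)))
    <= N * ((N1 * C + b3) * rho * (b1 * rho)).
  by apply: rsum_abs_le => l; apply: Rabs_mul_le => //; exact: psX_near.
have p := Rle_trans _ _ _ (Rabs_pos _) t2.
apply: Rle_trans (_ : (N1 * (C * b2) + N * ((N1 * C + b3) * b1)) * (rho * rho) <= _); last first.
  by apply: sq => //; rewrite /CC; lra.
move: t1 t2 => /Rabs_le_between t1 /Rabs_le_between t2.
by apply: Rabs_le; lra.
Qed.

End Psi.

(** Where a weight vanishes so do its derivatives, and the vertex drops out of [psX], [psM] and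
    [psTau]. Where [w l = 0], row [l] of the system reads [dl l * eta l = 0], with the same solution
    for every positive [dl l]. Uniqueness of [eta] concludes. *)
Lemma psi_face n C (C1 : 1 <= C)
  (bounds : forall w w' : Rn n, cube1 n w -> cube1 n w' ->
  [/\ forall i, Rabs (wt n i w) <= C,
      forall i, Rabs (wt n i w' - wt n i w) <= C * ds w w',
      forall k i, Rabs (dwt n k i w) <= C,
      forall k i, Rabs (dwt n k i w' - dwt n k i w) <= C * ds w w' &
      forall i, Rabs (wt_rem n i w w') <= C * (ds w w' * ds w w')])
  rho rho' (g g' : 'I_n.+1 -> Heis n) (dl dl' w : Rn n) :
  cube1 n w -> 0 < rho -> 0 < rho' ->
  (forall i j, ds (g i) (g j) <= rho) -> (forall i j, ds (g' i) (g' j) <= rho') ->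
  (forall l, 2 * ((1 + INR n * (INR n.+1 * C)) * rho) <= dl l) ->
  (forall l, 2 * ((1 + INR n * (INR n.+1 * C)) * rho') <= dl' l) ->
  (forall l, w l <> 0 -> g (lift ord0 l) = g' (lift ord0 l) /\ dl l = dl' l) ->
  (sq_sum n w <> 1 -> g ord0 = g' ord0) -> psi n g dl w = psi n g' dl' w.
Proof.
move=> hw rho0 rho0' gn gn' hd hd' agS ag0.
have agi i : g i = g' i \/ (wt n i w = 0 /\ forall k, dwt n k i w = 0).
  case: (unliftP ord0 i) => [l ->|->].
    have [w0|/agS[]] := Req_dec (w l) 0; last by left.
    right; rewrite wtS w0; split=> [|k]; first ring.
    by rewrite dwtS; case: eqP => [_|_]; rewrite w0; ring.
  have [s1|/ag0] := Req_dec (sq_sum n w) 1; last by left.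
  by right; rewrite wt0 s1; split=> [|k]; rewrite ?dwt0 ?s1; ring.
have agl l : dl l = dl' l \/ (w l = 0 /\ forall i, dwt n l i w = 0).
  have [w0|/agS[]] := Req_dec (w l) 0; last by left.
  right; split=> // i; case: (unliftP ord0 i) => [l' ->|->]; last by rewrite dwt0 w0; ring.
  by rewrite dwtS; case: eqP => [<-|_]; rewrite w0; ring.
have eX : psX n g dl w = psX n g' dl' w.
  apply: functional_extensionality => l; rewrite /psX; congr (_ + _).
    by apply: rsum_eq => i; case: (agi i) => [->//|[-> _]]; ring.
  by case: (agl l) => [->//|[-> _]]; ring.
have eT i X : psT n g i X = psT n g' i X \/ (wt n i w = 0 /\ forall k, dwt n k i w = 0).
  by rewrite /psT; case: (agi i) => [->|]; tauto.
have eM k l : psM n g w k l = psM n g' w k l.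
  by apply: rsum_eq => i; case: (agi i) => [->//|[_ ->]]; ring.
have eTau : psTau n g dl w = psTau n g' dl' w.
  apply: functional_extensionality => k; rewrite /psTau eX.
  by apply: rsum_eq => i; case: (eT i (psX n g' dl' w)) => [->//|[_ ->]]; ring.
have sp := psEta_spec n C C1 bounds rho g dl rho0 gn hd w hw.
have sp' := psEta_spec n C C1 bounds rho' g' dl' rho0' gn' hd' w hw.
have eEta : psEta n g dl w = psEta n g' dl' w.
  apply: functional_extensionality => l.
  have h : forall k, Rabs (psEta n g dl w k - psEta n g' dl' w k) <= 0.
    apply: (eta_bound n C C1 bounds rho' g' dl' rho0' gn' hd' w _ (fun=> 0)) => //; [lra| |].
      move=> k; have e1 := sp k; have e2 := sp' k; rewrite eTau in e1.
      have e3 : rsum (fun l => psM n g' w k l * (psEta n g dl w l - psEta n g' dl' w l)) =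
         rsum (fun l => psM n g w k l * psEta n g dl w l) - rsum (fun l => psM n g' w k l * psEta n g' dl' w l).
        by rewrite -rsum_sub; apply: rsum_eq => l'; rewrite eM; ring.
      case: (agl k) => [e|[w0 dw]]; first by rewrite e3 -e; rewrite -e in e2; lra.
      have t0 : psTau n g' dl' w k = 0.
        by rewrite /psTau (rsum_eq _ _ (fun=> 0)) ?rsum_const => [|i]; [ring|rewrite dw; ring].
      have m0 gg eta : rsum (fun l => psM n gg w k l * eta l) = 0.
        rewrite (rsum_eq _ _ (fun=> 0)) ?rsum_const => [|l']; first ring.
        by rewrite /psM (rsum_eq _ _ (fun=> 0)) ?rsum_const => [|i]; [ring|rewrite dw; ring].
      have posK r : 0 < r -> 0 < 2 * ((1 + INR n * (INR n.+1 * C)) * r).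
        have : 0 <= INR n * (INR n.+1 * C).
          by apply: Rmult_le_pos; [exact: pos_INR|apply: Rmult_le_pos; [exact: pos_INR|lra]].
        by move=> *; nra.
      have p1 := Rlt_le_trans _ _ _ (posK _ rho0) (hd k).
      have p2 := Rlt_le_trans _ _ _ (posK _ rho0') (hd' k).
      rewrite m0 t0 in e1; rewrite m0 t0 in e2.
      have z1 : psEta n g dl w k = 0 by apply: (Rmult_eq_reg_l (dl k)); lra.
      have z2 : psEta n g' dl' w k = 0 by apply: (Rmult_eq_reg_l (dl' k)); lra.
      by rewrite m0 z1 z2; ring.
    by move=> k; rewrite Rabs_R0; lra.
  by have := h l; move=> /Rabs_le_between; lra.
rewrite /psi eX eEta; congr mkHeis.
  apply: functional_extensionality => l; congr (_ + _).
  by apply: rsum_eq => i; case: (agi i) => [->//|[-> _]]; ring.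
by apply: rsum_eq => i; case: (eT i (psX n g' dl' w)) => [->//|[-> _]]; ring.
Qed.

Lemma psi_estimate n : exists K, 0 < K /\
  (forall K', exists C, 0 <= C /\
  forall rho (g : 'I_n.+1 -> Heis n) (dl : Rn n), 0 < rho ->
  (forall i j, ds (g i) (g j) <= rho) -> (forall l, K * rho <= dl l <= K' * rho) ->
  (forall w w', cube1 n w -> cube1 n w' ->
     ds (psi n g dl w) (psi n g dl w') <= C * rho * ds w w') /\
  (forall w j, cube1 n w -> ds (psi n g dl w) (g j) <= C * rho)) /\
  forall rho rho' (g g' : 'I_n.+1 -> Heis n) (dl dl' w : Rn n),
  cube1 n w -> 0 < rho -> 0 < rho' ->
  (forall i j, ds (g i) (g j) <= rho) -> (forall i j, ds (g' i) (g' j) <= rho') ->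
  (forall l, K * rho <= dl l) -> (forall l, K * rho' <= dl' l) ->
  (forall l, w l <> 0 -> g (lift ord0 l) = g' (lift ord0 l) /\ dl l = dl' l) ->
  (sq_sum n w <> 1 -> g ord0 = g' ord0) -> psi n g dl w = psi n g' dl' w.
Proof.
have [C [C1 bounds]] := wt_bounds n.
pose K := 2 * (1 + INR n * (INR n.+1 * C)).
have p : 0 <= INR n * (INR n.+1 * C).
  by apply: Rmult_le_pos; [exact: pos_INR|apply: Rmult_le_pos; [exact: pos_INR|lra]].
have eK r : K * r = 2 * ((1 + INR n * (INR n.+1 * C)) * r) by rewrite /K; ring.
exists K; split; first by rewrite /K; lra.
split; last first.
  move=> rho rho' g g' dl dl' w hw r0 r0' gn gn' hd hd'.
  by apply: (psi_face n C C1 bounds rho rho') => // l; rewrite -eK.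
move=> K'; set goal := (fun c : R => _).
have key rho g dl := psi_lip_near n C C1 bounds K' rho g dl.
eexists; split; last first.
  move=> rho g dl rho0 hg hd; apply: key => // l; last by case: (hd l).
  by rewrite -eK; case: (hd l).
apply: Rplus_le_le_0_compat; last exact: Rabs_pos.
do 4 (apply: Rplus_le_le_0_compat; last exact: Rabs_pos); exact: Rle_0_1.
Qed.

(** * Horizontal maps on walls *)

Delimit Scope Z_scope with ZZ.

(** Even over constant data the simplex is not constant, because of [dl]; but it lies in the plane
    [y = 0], [z = 0], where dilations act linearly and a cutoff is possible. *)
Lemma psi_flat n (dl w : Rn n) : (forall l, 0 < dl l) ->
  psi n (fun=> mkHeis (fun=> 0) (fun=> 0) 0) dl w = mkHeis (fun l => dl l * w l) (fun=> 0) 0.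
Proof.
move=> dl0; set g := fun=> _.
have z0 (f : 'I_n.+1 -> R) : rsum (fun i => f i * 0) = 0.
  by rewrite (rsum_eq _ _ (fun=> 0)) ?rsum_const => [|i]; ring.
have z1 (f : 'I_n -> R) : rsum (fun i => 0 * f i) = 0.
  by rewrite (rsum_eq _ _ (fun=> 0)) ?rsum_const => [|i]; ring.
have T0 i X : psT n g i X = 0 by rewrite /psT /= z1; ring.
have X0 : psX n g dl w = fun l => dl l * w l.
  by apply: functional_extensionality => l; rewrite /psX /= z0; ring.
have M0 k l : psM n g w k l = 0.
  by rewrite /psM /= (rsum_eq _ _ (fun=> 0)) ?rsum_const => [|i]; ring.
have tau0 k : psTau n g dl w k = 0.
  rewrite /psTau (rsum_eq _ _ (fun=> 0)) ?rsum_const => [|i]; first ring.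
  by rewrite T0; ring.
have spec eta : eta_spec n g dl w eta <-> forall k, dl k * eta k = 0.
  have h k : rsum (fun l => psM n g w k l * eta l) = 0.
    rewrite (rsum_eq _ _ (fun=> 0)) ?rsum_const => [|i]; first ring.
    by rewrite M0; ring.
  by split=> e k; have := e k; rewrite tau0 h; lra.
have /spec eta0 : eta_spec n g dl w (psEta n g dl w).
  by apply: epsilon_spec; exists (fun=> 0); apply/spec => k; ring.
rewrite /psi X0; congr mkHeis.
  apply: functional_extensionality => l; rewrite /= z0.
  have := eta0 l; have := dl0 l => p e.
  have -> : psEta n g dl w l = 0 by apply: (Rmult_eq_reg_l (dl l)); lra.
  ring.
rewrite (rsum_eq _ _ (fun=> 0)) ?rsum_const => [|i]; first ring.
by rewrite T0; ring.
Qed.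

(** * Distance to the integers and dyadic levels of time *)

Definition flr (x : R) : Z := Int_part x.

Lemma flr_bounds x : IZR (flr x) <= x < IZR (flr x) + 1.
Proof. by have := base_Int_part x; rewrite /flr; lra. Qed.

Definition dZ (x : R) : R := Rmin (x - IZR (flr x)) (IZR (flr x) + 1 - x).

Lemma dZ_bounds x : 0 <= dZ x <= 1.
Proof. by have := flr_bounds x; rewrite /dZ /Rmin; case: Rle_dec => ?; lra. Qed.

Lemma dZ_same x x' : flr x = flr x' -> Rabs (dZ x - dZ x') <= Rabs (x - x').
Proof.
move=> e; rewrite /dZ e /Rmin /Rabs.
by repeat (case: Rcase_abs => ?); repeat (case: Rle_dec => ?); lra.
Qed.

Lemma dZ_cross x x' : flr x <> flr x' -> dZ x <= Rabs (x - x').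
Proof.
move=> ne; have h := flr_bounds x; have h' := flr_bounds x'.
have [lt|lt] : (flr x + 1 <= flr x' \/ flr x' + 1 <= flr x)%ZZ by lia.
  have := IZR_le _ _ lt; rewrite plus_IZR => l1.
  apply: Rle_trans (Rmin_r _ _) _; rewrite Rabs_left1; lra.
have := IZR_le _ _ lt; rewrite plus_IZR => l1.
apply: Rle_trans (Rmin_l _ _) _; rewrite Rabs_right; lra.
Qed.

Lemma dZ_near x c : dZ x < c -> exists z : Z, Rabs (x - IZR z) < c.
Proof.
have h := flr_bounds x; rewrite /dZ /Rmin; case: Rle_dec => _ lt.
  by exists (flr x); rewrite Rabs_right; lra.
exists (flr x + 1)%ZZ; rewrite plus_IZR Rabs_left; lra.
Qed.

Lemma IZR_small z : Rabs (IZR z) < 1 -> z = 0%ZZ.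
Proof. by move=> /Rabs_def2 h; apply: one_IZR_lt1; lra. Qed.

Definition sc (i : Z) : R := / 2 ^ Z.abs_nat i.

Lemma sc_pos i : 0 < sc i.
Proof. by apply/Rinv_0_lt_compat/pow_lt; lra. Qed.

Lemma exp_pow2 m : exp (INR m * ln 2) = 2 ^ m.
Proof. by rewrite -Rpower_pow; [|lra]. Qed.

(** The quantity [2^y = t / (1 - t)] is comparable to [t] near [0] and to [1 / (1 - t)] near [1], so
    [2^-|i|] measures the distance to the nearer end. *)
Lemma sc_bounds t y i : 0 < t < 1 -> exp (y * ln 2) = t / (1 - t) ->
  IZR i <= y < IZR i + 2 -> Rmin t (1 - t) <= 4 * sc i /\ sc i <= 8 * Rmin t (1 - t).
Proof.
move=> ht ey [iy yi]; have l2 := ln_lt_2.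
have r0 : t = t / (1 - t) * (1 - t) by field; lra.
have e1 : exp (IZR i * ln 2) <= t / (1 - t).
  rewrite -ey; have [->|lt] : IZR i = y \/ IZR i < y by lra.
    exact: Rle_refl.
  by apply/Rlt_le/exp_increasing; nra.
have e2 : t / (1 - t) < 4 * exp (IZR i * ln 2).
  have -> : 4 * exp (IZR i * ln 2) = exp ((IZR i + 2) * ln 2).
    have -> : (IZR i + 2) * ln 2 = ln 2 + ln 2 + IZR i * ln 2 by ring.
    by rewrite !exp_plus exp_ln; lra.
  by rewrite -ey; apply: exp_increasing; nra.
set r := t / (1 - t) in r0 e1 e2.
have p2 := pow_lt 2 (Z.abs_nat i) Rlt_0_2.
have p1 : 1 <= 2 ^ Z.abs_nat i by apply: pow_R1_Rle; lra.
have sq : sc i * 2 ^ Z.abs_nat i = 1 by rewrite /sc; field; lra.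
have s0 := sc_pos i.
have [ge|lt] : (0 <= i \/ i <= -1)%ZZ by lia.
  have ee : exp (IZR i * ln 2) = 2 ^ Z.abs_nat i.
    rewrite -exp_pow2; congr (exp (_ * _)); rewrite INR_IZR_INZ; congr IZR; lia.
  rewrite ee in e1 e2.
  have h1 : sc i * r >= 1 by nra.
  have h2 : sc i * r <= 4 by nra.
  have t2 : / 2 <= t by nra.
  rewrite Rmin_right; last lra.
  by split; nra.
have ee : exp (IZR i * ln 2) = sc i.
  have -> : IZR i = - INR (Z.abs_nat i).
    by rewrite INR_IZR_INZ -opp_IZR; congr IZR; lia.
  by rewrite Ropp_mult_distr_l_reverse exp_Ropp exp_pow2.
have s2 : sc i <= / 2.
  rewrite -ee; have -> : / 2 = exp (- 1 * ln 2).
    by rewrite Ropp_mult_distr_l_reverse Rmult_1_l exp_Ropp exp_ln; lra.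
  have := IZR_le _ _ lt => le; case: (Rle_lt_or_eq_dec _ _ le) => [l|->]; last exact: Rle_refl.
  by apply/Rlt_le/exp_increasing; nra.
rewrite ee in e1 e2; rewrite /Rmin; case: Rle_dec => h; split; nra.
Qed.

Definition tlog (t : R) : R := (ln t - ln (1 - t)) / ln 2.

Lemma exp_tlog t : 0 < t < 1 -> exp (tlog t * ln 2) = t / (1 - t).
Proof.
move=> ht; have l2 := ln_lt_2; rewrite /tlog.
have -> : (ln t - ln (1 - t)) / ln 2 * ln 2 = ln t + - ln (1 - t) by field; lra.
by rewrite exp_plus exp_Ropp !exp_ln; lra.
Qed.

Lemma ln_diff a b e : 0 < e -> e <= a -> e <= b -> Rabs (ln a - ln b) <= Rabs (a - b) / e.
Proof.
move=> e0 ea eb.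
have key x y : e <= x -> e <= y -> ln x - ln y <= Rabs (x - y) / e.
  move=> ex ey; rewrite -ln_div; [|lra|lra].
  have p : 0 < x / y by apply: Rdiv_lt_0_compat; lra.
  have h1 : ln (x / y) <= x / y - 1.
    have := exp_ineq1_le (ln (x / y)); rewrite exp_ln //; lra.
  have -> : Rabs (x - y) / e = Rabs (x - y) * / e by [].
  have h2 : x / y - 1 <= Rabs (x - y) * / y.
    have -> : x / y - 1 = (x - y) * / y by field; lra.
    by apply: Rmult_le_compat_r; [apply/Rlt_le/Rinv_0_lt_compat; lra|exact: Rle_abs].
  have : Rabs (x - y) * / y <= Rabs (x - y) * / e.
    by apply: Rmult_le_compat_l; [exact: Rabs_pos|exact: Rinv_le_contravar].
  lra.
have k1 := key a b ea eb; have k2 := key b a eb ea; rewrite (Rabs_minus_sym b) in k2.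
by apply: Rabs_le; lra.
Qed.

Lemma tlog_diff t t' e : 0 < e -> e <= t <= 1 - e -> e <= t' <= 1 - e ->
  Rabs (tlog t - tlog t') <= 4 * (Rabs (t - t') / e).
Proof.
move=> e0 h h'; have l2 := ln_lt_2; rewrite /tlog.
have -> : (ln t - ln (1 - t)) / ln 2 - (ln t' - ln (1 - t')) / ln 2 =
  ((ln t - ln t') - (ln (1 - t) - ln (1 - t'))) * / ln 2 by field; lra.
have a1 := ln_diff t t' e e0 (proj1 h) (proj1 h').
have a2 : Rabs (ln (1 - t) - ln (1 - t')) <= Rabs (t - t') / e.
  have -> : Rabs (t - t') = Rabs ((1 - t) - (1 - t')).
    by rewrite Rabs_minus_sym; congr Rabs; lra.
  by apply: ln_diff; lra.
have i2 : 0 < / ln 2 <= 2.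
  split; first by apply: Rinv_0_lt_compat; lra.
  have h2 : / ln 2 <= / / 2 by apply: Rinv_le_contravar; lra.
  by rewrite Rinv_inv in h2.
rewrite Rabs_mult (Rabs_right (/ ln 2)); last lra.
set A := ln t - ln t' in a1 *; set B := ln (1 - t) - ln (1 - t') in a2 *.
have tr : Rabs (A - B) <= Rabs A + Rabs B.
  by have := Rabs_triang A (- B); rewrite Rabs_Ropp.
have := Rmult_le_compat_l (Rabs (A - B)) (/ ln 2) 2 (Rabs_pos _) (proj2 i2); lra.
Qed.

Section Wall.
Variable n : nat.

(* Cells of mesh [2 ^ - |i|] that shrink towards [t = 0] and [t = 1], in [n.+1] colours whose grids and
   time levels are mutually shifted.  At a point of the wall some coordinate is an integer and blocks no
   colour; the other [n - 1] coordinates and the time block at most one colour each, so that the point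
   lies deep inside a cell of a remaining colour. *)
Definition shift (j : 'I_n.+1) : R := (3 * INR j + 1) / (3 * INR n.+1).
Definition phase (j : 'I_n.+1) (t : R) : R := tlog t - INR j / INR n.+1.
Definition lev (j : 'I_n.+1) (t : R) : Z := flr (phase j t).
Definition cpos (j : 'I_n.+1) (p : Rn n) (t : R) (l : 'I_n) : R := p l / sc (lev j t) - shift j.
Definition cell (j : 'I_n.+1) (p : Rn n) (t : R) (l : 'I_n) : Z := flr (cpos j p t l).
Definition centre (i : Z) (z : 'I_n -> Z) (j : 'I_n.+1) : Rn n :=
  fun l => sc i * (IZR (z l) + shift j + / 2).
(** The depth of [(p, t)] in its cell of colour [j]. The minimum of the [dZ] over the coordinates is
    written as [1 - nrm (1 - dZ)] to inherit the Lipschitz bound of the sup norm. *)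
Definition om (p : Rn n) (t : R) : Rn n.+1 := fun j =>
  Rmin (dZ (phase j t)) (1 - nrm (fun l => 1 - dZ (cpos j p t l))).

Lemma N1_pos : 1 <= INR n.+1.
Proof. by rewrite S_INR; have := pos_INR n; lra. Qed.

Lemma jN1 (j : 'I_n.+1) : 0 <= INR j / INR n.+1 < 1.
Proof.
have N0 := N1_pos; have i0 : 0 < / INR n.+1 by apply: Rinv_0_lt_compat; lra.
have := pos_INR j => j0; have lt : INR j < INR n.+1 by apply: lt_INR; have := ltn_ord j; lia.
split; first by apply: Rmult_le_pos; lra.
have := Rmult_lt_compat_r _ _ _ i0 lt; rewrite Rinv_r /Rdiv; lra.
Qed.

Lemma lev_bounds j t : IZR (lev j t) <= tlog t < IZR (lev j t) + 2.
Proof. by have := flr_bounds (phase j t); have := jN1 j; rewrite /lev /phase; lra. Qed.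

Lemma lev_sc j t : 0 < t < 1 ->
  Rmin t (1 - t) <= 4 * sc (lev j t) /\ sc (lev j t) <= 8 * Rmin t (1 - t).
Proof. by move=> ht; apply: sc_bounds (exp_tlog t ht) (lev_bounds j t). Qed.

Lemma om_bounds p t j : 0 <= om p t j <= 1.
Proof.
have h := dZ_bounds (phase j t); rewrite /om.
have h2 : nrm (fun l => 1 - dZ (cpos j p t l)) <= 1.
  by apply: nrm_le => [|l]; [lra|have := dZ_bounds (cpos j p t l); move=> ?; apply: Rabs_le; lra].
split; first by apply: Rmin_glb; lra.
by apply: Rle_trans (Rmin_l _ _) _; lra.
Qed.

Lemma om_le_phase p t j : om p t j <= dZ (phase j t).
Proof. exact: Rmin_l. Qed.

Lemma om_le_cpos p t j l : om p t j <= dZ (cpos j p t l).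
Proof.
apply: Rle_trans (Rmin_r _ _) _.
have := nrm_coord _ (fun l => 1 - dZ (cpos j p t l)) l => /=.
by have := dZ_bounds (cpos j p t l) => b; rewrite Rabs_right; lra.
Qed.

Lemma om_small p t j c : c <= 1 -> om p t j < c ->
  dZ (phase j t) < c \/ exists l, dZ (cpos j p t l) < c.
Proof.
move=> c1; rewrite /om /Rmin; case: Rle_dec => _ h; [by left|right].
apply: NNPP => no; have : nrm (fun l => 1 - dZ (cpos j p t l)) <= 1 - c.
  apply: nrm_le => [|l]; first lra.
  have := dZ_bounds (cpos j p t l) => b; apply: Rabs_le.
  have : ~ dZ (cpos j p t l) < c by move=> lt; apply: no; exists l.
  lra.
lra.
Qed.

(** Grid positions of different colours are compared modulo [1 / (3 * INR n.+1)], and a comparison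
    adds up errors of at most [3 * cov]. *)
Definition cov : R := / (12 * INR n.+1).

Lemma cov_pos : 0 < cov <= 1.
Proof.
have := N1_pos => N0; rewrite /cov; split; first by apply: Rinv_0_lt_compat; lra.
by rewrite -Rinv_1; apply: Rinv_le_contravar; lra.
Qed.

Lemma covE : cov * (12 * INR n.+1) = 1.
Proof. by rewrite /cov; have := N1_pos => ?; field; lra. Qed.

Lemma shiftE j : shift j * (3 * INR n.+1) = IZR (3 * Z.of_nat j + 1).
Proof.
rewrite plus_IZR mult_IZR -INR_IZR_INZ /shift; have := N1_pos => ?.
by field; lra.
Qed.

Lemma Ncast (z : Z) : (3 * INR n.+1) * IZR z = IZR (3 * Z.of_nat n.+1 * z).
Proof. by rewrite !mult_IZR -INR_IZR_INZ. Qed.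

Lemma shiftZ (j : 'I_n.+1) z : IZR (3 * Z.of_nat j + 1 + 3 * Z.of_nat n.+1 * z) =
  shift j * (3 * INR n.+1) + 3 * INR n.+1 * IZR z.
Proof. by rewrite plus_IZR -shiftE -Ncast. Qed.

Lemma shiftZ2 (j : 'I_n.+1) z : IZR (2 * (3 * Z.of_nat j + 1) + 3 * Z.of_nat n.+1 * (2 * z)) =
  2 * (shift j * (3 * INR n.+1)) + 3 * INR n.+1 * (2 * IZR z).
Proof. by rewrite plus_IZR (mult_IZR 2) -shiftE -Ncast mult_IZR. Qed.

(** Clearing the denominator of the shifts turns a near coincidence of grid points into an equality
    of integers, to be decided by residues. *)
Lemma int_of_close (a b : Z) (x r : R) : Rabs x < r -> r * (3 * INR n.+1) <= 1 ->
  x * (3 * INR n.+1) = IZR a - IZR b -> a = b.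
Proof.
move=> h hr e; have N0 := N1_pos; suff : (a - b)%ZZ = 0%ZZ by lia.
apply: IZR_small; rewrite minus_IZR -e Rabs_mult (Rabs_right (3 * _)); last lra.
by nra.
Qed.

Lemma ord_residue (j j' : 'I_n.+1) z z' :
  (Z.of_nat j + Z.of_nat n.+1 * z = Z.of_nat j' + Z.of_nat n.+1 * z')%ZZ -> j = j'.
Proof.
move=> eq; have jlt := ltn_ord j; have jlt' := ltn_ord j'; apply: val_inj => /=.
set N := Z.of_nat n.+1 in eq.
have hN : (Z.of_nat j < N /\ Z.of_nat j' < N)%ZZ by rewrite /N; lia.
have [e|[lt|lt]] : (z = z' \/ z + 1 <= z' \/ z' + 1 <= z)%ZZ by lia.
- by rewrite e in eq; lia.
- have := Z.mul_le_mono_nonneg_l (z + 1) z' N; lia.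
- have := Z.mul_le_mono_nonneg_l (z' + 1) z N; lia.
Qed.

Definition wallset (p : Rn n) : Prop := exists l (z : Z), p l = IZR z.

Lemma div_sc x i : x / sc i = x * 2 ^ Z.abs_nat i.
Proof. by rewrite /sc /Rdiv Rinv_inv. Qed.

(** Otherwise each of the [n + 1] colours is blocked by the time or by a coordinate other than the
    integral one. These are [n] obstructions, and no two colours share one. *)
Lemma om_cover p t : wallset p -> exists j, cov <= om p t j.
Proof.
move=> [l0 [z0 pz]]; apply: NNPP => no.
have N0 := N1_pos; have [c0 c1] := cov_pos; have cE := covE.
have small j : om p t j < cov by apply: Rnot_le_lt => le; apply: no; exists j.
pose kill (j : 'I_n.+1) (o : option 'I_n) := match o with
  | None => dZ (phase j t) < cov | Some l => dZ (cpos j p t l) < cov end.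
have ex j : exists o, kill j o.
  by case: (om_small p t j cov c1 (small j)) => [h|[l h]]; [exists None|exists (Some l)].
pose kap j := proj1_sig (constructive_indefinite_description _ (ex j)).
have kapP j : kill j (kap j) by rewrite /kap; case: constructive_indefinite_description.
have avoid j : kap j != Some l0.
  apply/eqP => e; have := kapP j; rewrite e /= => /dZ_near [z hz].
  (* An integral coordinate lies on every unshifted dyadic grid, whereas [3 * j + 1] is not
     divisible by [3]. *)
  have : (3 * Z.of_nat n.+1 * (z0 * 2 ^ Z.of_nat (Z.abs_nat (lev j t))) =
          3 * Z.of_nat j + 1 + 3 * Z.of_nat n.+1 * z)%ZZ.
    apply: (int_of_close _ _ _ cov hz); first lra.
    rewrite /cpos pz div_sc pow_IZR -mult_IZR shiftZ -Ncast; ring.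
  lia.
have inj : injective kap.
  move=> j j' e; have kj := kapP j; have kj' := kapP j'; rewrite -e in kj'.
  have jlt := ltn_ord j; have jlt' := ltn_ord j'.
  case: (kap j) kj kj' => [l|] /= /dZ_near [z hz] /dZ_near [z' hz'].
    have hl := lev_bounds j t; have hl' := lev_bounds j' t.
    have d1 : (lev j t < lev j' t + 2)%ZZ by apply: lt_IZR; rewrite plus_IZR; lra.
    have d2 : (lev j' t < lev j t + 2)%ZZ by apply: lt_IZR; rewrite plus_IZR; lra.
    move: hz hz'; rewrite /cpos !div_sc.
    set a := Z.abs_nat (lev j t); set a' := Z.abs_nat (lev j' t) => hz hz'.
    (* The levels of two colours differ by at most one, so their meshes agree or have ratio [2]. In
       the latter case the shifts clash modulo [3], as [2 * (3 * j + 1)] is [2] and [3 * j' + 1] is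
       [1]. *)
    have [ea|[ea|ea]] : (a' = a \/ a' = a.+1 \/ a = a'.+1)%nat by rewrite /a /a'; lia.
    - have := Rabs_triang (p l * 2 ^ a' - shift j' - IZR z') (- (p l * 2 ^ a - shift j - IZR z)).
      rewrite Rabs_Ropp => tr; rewrite ea in hz' tr.
      have : (3 * Z.of_nat j + 1 + 3 * Z.of_nat n.+1 * z =
              3 * Z.of_nat j' + 1 + 3 * Z.of_nat n.+1 * z')%ZZ.
        apply: (int_of_close _ _ (p l * 2 ^ a - shift j' - IZR z' + - (p l * 2 ^ a - shift j - IZR z)) (2 * cov)); [lra|lra|].
        rewrite !shiftZ; ring.
      by move=> eq; apply: (ord_residue _ _ z z'); lia.
    - exfalso; rewrite ea /= in hz'.
      have := Rabs_triang (p l * (2 * 2 ^ a) - shift j' - IZR z') (- (2 * (p l * 2 ^ a - shift j - IZR z))).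
      rewrite Rabs_Ropp (Rabs_mult 2) (Rabs_right 2) => [tr|]; last lra.
      have : (2 * (3 * Z.of_nat j + 1) + 3 * Z.of_nat n.+1 * (2 * z) =
              3 * Z.of_nat j' + 1 + 3 * Z.of_nat n.+1 * z')%ZZ.
        apply: (int_of_close _ _ (p l * (2 * 2 ^ a) - shift j' - IZR z' + - (2 * (p l * 2 ^ a - shift j - IZR z))) (3 * cov)); [lra|lra|].
        rewrite shiftZ2 shiftZ; ring.
      lia.
    - exfalso; rewrite ea /= in hz.
      have := Rabs_triang (p l * (2 * 2 ^ a') - shift j - IZR z) (- (2 * (p l * 2 ^ a' - shift j' - IZR z'))).
      rewrite Rabs_Ropp (Rabs_mult 2) (Rabs_right 2) => [tr|]; last lra.
      have : (2 * (3 * Z.of_nat j' + 1) + 3 * Z.of_nat n.+1 * (2 * z') =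
              3 * Z.of_nat j + 1 + 3 * Z.of_nat n.+1 * z)%ZZ.
        apply: (int_of_close _ _ (p l * (2 * 2 ^ a') - shift j - IZR z + - (2 * (p l * 2 ^ a' - shift j' - IZR z'))) (3 * cov)); [lra|lra|].
        rewrite shiftZ2 shiftZ; ring.
      lia.
  have := Rabs_triang (phase j t - IZR z) (- (phase j' t - IZR z')).
  rewrite Rabs_Ropp => tr.
  have : (3 * Z.of_nat j' + 3 * Z.of_nat n.+1 * z' =
          3 * Z.of_nat j + 3 * Z.of_nat n.+1 * z)%ZZ.
    apply: (int_of_close _ _ (phase j t - IZR z + - (phase j' t - IZR z')) (2 * cov)); [lra|lra|].
    rewrite !plus_IZR -!Ncast !(mult_IZR 3) -!INR_IZR_INZ /phase; field; lra.
  by move=> eq; apply: (ord_residue _ _ z z'); lia.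
have := subset_leq_card (_ : codom kap \subset predC1 (Some l0)).
have -> : codom kap \subset predC1 (Some l0).
  by apply/subsetP => o /codomP[j ->]; exact: avoid.
rewrite card_codom // cardC1 card_option !card_ord => /(_ isT); lia.
Qed.
End Wall.

Lemma lipx_sqrt (X : Met) (D : X -> Prop) (f : X -> R) c : 0 < c -> lipx D f ->
  (forall u, D u -> c <= f u) -> lipx D (fun u => sqrt (f u)).
Proof.
move=> c0 [L [L0 h]] fc; have s0 : 0 < sqrt c by exact: sqrt_lt_R0.
exists (L / sqrt c); split.
  by apply: Rmult_le_pos => //; apply/Rlt_le/Rinv_0_lt_compat.
move=> u v Du Dv; have := h u v Du Dv; rewrite !Rds => le.
have fu := fc u Du; have fv := fc v Dv.
have su : sqrt c <= sqrt (f u) by exact: sqrt_le_1_alt.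
have sv : sqrt c <= sqrt (f v) by exact: sqrt_le_1_alt.
have e : (sqrt (f u) - sqrt (f v)) * (sqrt (f u) + sqrt (f v)) = f u - f v.
  have := sqrt_sqrt (f u); have := sqrt_sqrt (f v); nra.
apply: (Rmult_le_reg_l (sqrt c)) => //.
have -> : sqrt c * (L / sqrt c * ds u v) = L * ds u v by field; lra.
apply: Rle_trans le; rewrite -e Rabs_mult (Rabs_right (_ + _)); last lra.
by have := Rabs_pos (sqrt (f u) - sqrt (f v)); nra.
Qed.

(** The Euclidean unit vector of [o] without its entry [ord0], which [1 - sq_sum] recovers up to
    sign. The weight of each colour vanishes exactly where its entry of [o] does. *)
Definition nW {n} (o : Rn n.+1) : Rn n :=
  fun l => o (lift ord0 l) * / sqrt (rsum (fun i => o i * o i)).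

Lemma sum_sq_nrm m (o : Rn m.+1) : nrm o * nrm o <= rsum (fun i => o i * o i).
Proof.
have [i ->] := nrm_attained _ o.
have -> : Rabs (o i) * Rabs (o i) = o i * o i by rewrite -Rabs_mult Rabs_right //; apply: Rle_ge; nra.
by apply: (rsum_term _ (fun i => o i * o i)) => j; nra.
Qed.

Lemma nW_sq n (o : Rn n.+1) : 0 < nrm o ->
  sq_sum n (nW o) = 1 - o ord0 * o ord0 / rsum (fun i => o i * o i).
Proof.
move=> o0; have := sum_sq_nrm _ o; set S := rsum _ => hS.
have S0 : 0 < S by nra.
have sS : sqrt S * sqrt S = S by apply: sqrt_sqrt; lra.
have s0 : 0 < sqrt S by exact: sqrt_lt_R0.
have e : S = o ord0 * o ord0 + rsum (fun l => o (lift ord0 l) * o (lift ord0 l)).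
  by rewrite /S rsum_recl.
have -> : sq_sum n (nW o) = / S * rsum (fun l => o (lift ord0 l) * o (lift ord0 l)).
  rewrite /sq_sum -rsum_mul; apply: rsum_eq => l; rewrite /nW -/S.
  by rewrite -[in RHS]sS; field; lra.
have -> : rsum (fun l => o (lift ord0 l) * o (lift ord0 l)) = S - o ord0 * o ord0 by lra.
by field; lra.
Qed.

Lemma nW_cube n (o : Rn n.+1) : 0 < nrm o -> cube1 n (nW o).
Proof.
move=> o0; have := sum_sq_nrm _ o; set S := rsum _ => hS.
have S0 : 0 < S by nra.
have s0 : 0 < sqrt S by exact: sqrt_lt_R0.
apply: nrm_le => [|l]; first lra.
rewrite /nW -/S Rabs_mult (Rabs_right (/ _)); last by apply/Rle_ge/Rlt_le/Rinv_0_lt_compat.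
apply: (Rmult_le_reg_r (sqrt S)) => //; rewrite Rmult_assoc Rinv_l ?Rmult_1_l ?Rmult_1_r; last lra.
rewrite -sqrt_Rsqr_abs; apply: sqrt_le_1_alt; rewrite /Rsqr.
by apply: (rsum_term _ (fun i => o i * o i)) => j; nra.
Qed.

Lemma nW_lip n c : 0 < c -> lipx (fun o : Rn n.+1 => nrm o <= 1 /\ c <= nrm o) (@nW n).
Proof.
move=> c0; set D := fun o => _.
have bc i : bnd D (fun o => o i).
  by exists 1 => o [h _]; exact: Rle_trans (nrm_coord _ _ i) h.
have lS : lipx D (fun o => rsum (fun i => o i * o i)).
  apply: (lipx_rsum (Rn_met n.+1) n.+1 D (fun o i => o i * o i)); apply: lipx_vec => i.
  by apply: lipx_mul => //; exact: lipx_coord.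
have geS o : D o -> c * c <= rsum (fun i => o i * o i).
  by move=> [_ h]; apply: Rle_trans (sum_sq_nrm _ o); nra.
have lQ := lipx_sqrt _ D _ (c * c) (Rmult_lt_0_compat _ _ c0 c0) lS geS.
have geQ o : D o -> c <= sqrt (rsum (fun i => o i * o i)).
  by move=> /geS h; rewrite -(sqrt_square c); [exact: sqrt_le_1_alt|lra].
apply: lipx_vec => l; apply: lipx_mul => //.
- exact: lipx_coord.
- exact: lipx_inv c0 lQ geQ.
- exact: bnd_inv c0 geQ.
Qed.

Lemma Rmin_lip a b a' b' d : Rabs (a - a') <= d -> Rabs (b - b') <= d ->
  Rabs (Rmin a b - Rmin a' b') <= d.
Proof.
move=> /Rabs_le_between h1 /Rabs_le_between h2; apply: Rabs_le.
by rewrite /Rmin; repeat case: Rle_dec => ?; lra.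
Qed.

(** * Interpolating two maps across the walls *)

Section Wall.
Variable n : nat.
Variables K C : R.
Hypothesis K0 : 0 < K.
Hypothesis C0 : 0 <= C.
Hypothesis psi_lip : forall rho (g : 'I_n.+1 -> Heis n) (dl : Rn n), 0 < rho ->
  (forall i j, ds (g i) (g j) <= rho) -> (forall l, K * rho <= dl l <= 32 * K * rho) ->
  (forall w w', cube1 n w -> cube1 n w' ->
     ds (psi n g dl w) (psi n g dl w') <= C * rho * ds w w') /\
  (forall w j, cube1 n w -> ds (psi n g dl w) (g j) <= C * rho).
Hypothesis psi_face : forall rho rho' (g g' : 'I_n.+1 -> Heis n) (dl dl' w : Rn n),
  cube1 n w -> 0 < rho -> 0 < rho' ->
  (forall i j, ds (g i) (g j) <= rho) -> (forall i j, ds (g' i) (g' j) <= rho') ->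
  (forall l, K * rho <= dl l) -> (forall l, K * rho' <= dl' l) ->
  (forall l, w l <> 0 -> g (lift ord0 l) = g' (lift ord0 l) /\ dl l = dl' l) ->
  (sq_sum n w <> 1 -> g ord0 = g' ord0) -> psi n g dl w = psi n g' dl' w.
Variable CW : R.
Hypothesis nW_lip : Lip (fun o : Rn n.+1 => nrm o <= 1 /\ cov n <= nrm o) CW (@nW n).

Variables (el : R) (f0 f1 : Rn n -> Heis n).
Hypothesis el0 : 0 < el.
Hypothesis f0_lip : Lip (fun=> True) el f0.
Hypothesis f1_lip : Lip (fun=> True) el f1.
Hypothesis f01 : forall p, ds (f0 p) (f1 p) <= el.

(** Vertex [j], like the entry of [dldat] that belongs to it, depends only on the level and the cell
    of colour [j]. It jumps only where [om] vanishes, and there [psi_face] makes the jump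
    invisible. *)
Definition gdat (p : Rn n) (t : R) (j : 'I_n.+1) : Heis n :=
  (if (lev n j t <? 0)%ZZ then f0 else f1) (centre n (lev n j t) (cell n j p t) j).
Definition dldat (t : R) : Rn n := fun l => 64 * K * el * sc (lev n (lift ord0 l) t).
Definition wall (q : Rn n * R) : Heis n :=
  if Rle_dec q.2 0 then f0 q.1 else if Rle_dec 1 q.2 then f1 q.1
  else psi n (gdat q.1 q.2) (dldat q.2) (nW (om n q.1 q.2)).

Definition gap (t : R) := Rmin t (1 - t).
(** A discontinuous reference map from which the wall deviates by [O(el * gap t)]. Its jump is at
    most [el], and it occurs where [gap] is largest. *)
Definition base (p : Rn n) (t : R) := if Rle_dec t (/ 2) then f0 p else f1 p.

Lemma gap_pos t : 0 < t < 1 -> 0 < gap t <= / 2.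
Proof. by rewrite /gap /Rmin; case: Rle_dec => ?; lra. Qed.

Lemma gap_le t : gap t <= t /\ gap t <= 1 - t.
Proof. by rewrite /gap /Rmin; case: Rle_dec => ?; lra. Qed.

Lemma gap_lip t t' : gap t' <= gap t + Rabs (t - t').
Proof. by rewrite /gap /Rmin /Rabs; repeat case: Rle_dec => ?; case: Rcase_abs => ?; lra. Qed.

Lemma centre_near p t j : ds (centre n (lev n j t) (cell n j p t) j) p <= / 2 * sc (lev n j t).
Proof.
have s0 := sc_pos (lev n j t); apply: rds_le => [|l]; first lra.
have h := flr_bounds (cpos n j p t l); rewrite /centre -/(cell n j p t l).
have -> : p l = sc (lev n j t) * (cpos n j p t l + shift n j).
  by rewrite /cpos; field; lra.
have -> : sc (lev n j t) * (IZR (cell n j p t l) + shift n j + / 2) -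
   sc (lev n j t) * (cpos n j p t l + shift n j) =
   sc (lev n j t) * (IZR (cell n j p t l) + / 2 - cpos n j p t l) by ring.
rewrite Rmult_comm; apply: Rle_trans (_ : Rabs (IZR (cell n j p t l) + / 2 - cpos n j p t l) * sc (lev n j t) <= _).
  by rewrite Rabs_mult (Rabs_right (sc _)); lra.
apply: Rmult_le_compat_r; first lra.
by apply: Rabs_le; rewrite /cell; lra.
Qed.

Lemma gdat_base p t j : 0 < t < 1 -> ds (gdat p t j) (base p t) <= 7 * (el * gap t).
Proof.
move=> ht; have [ge se] := lev_sc n j t ht; rewrite -/(gap t) in ge se.
have [g0 g2] := gap_pos t ht; have cn := centre_near p t j.
have [l1 l2] := lev_bounds n j t; have ey := exp_tlog t ht.
have lip (f : Rn n -> Heis n) : Lip (fun=> True) el f ->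
    ds (f (centre n (lev n j t) (cell n j p t) j)) (f p) <= 4 * (el * gap t).
  move=> [_ h]; apply: Rle_trans (h _ _ I I) _.
  have := Rmult_le_compat_l el _ _ (Rlt_le _ _ el0) (Rle_trans _ _ _ cn (_ : _ <= 4 * gap t)).
  by move=> /(_ ltac:(lra)); lra.
have eg0 := Rmult_lt_0_compat _ _ el0 g0.
(* If the sign of the level selects the other one of [f0] and [f1] than [base] does, then [t] is
   near [1 / 2] and [gap t] is at least [1 / 3]. *)
have mis : / 3 <= gap t -> el <= 3 * (el * gap t) by nra.
rewrite /gdat /base; case: Z.ltb_spec => hl; case: Rle_dec => hh /=.
- by have := lip f0 f0_lip; lra.
- have : el <= 3 * (el * gap t).
    apply: mis; have yl : tlog t * ln 2 < ln 2.
      have : IZR (lev n j t) <= -1 by apply: (IZR_le _ (-1)); lia.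
      by have := ln_lt_2; nra.
    have := exp_increasing _ _ yl; rewrite ey exp_ln; last lra.
    move=> h; have : t < 2 * (1 - t).
      have e : t / (1 - t) * (1 - t) = t by field; lra.
      by rewrite -{1}e; apply: Rmult_lt_compat_r; lra.
    by rewrite /gap /Rmin; case: Rle_dec => ?; lra.
  have := f01 p; have := lip f0 f0_lip.
  by have := ds_tri (f0 (centre n (lev n j t) (cell n j p t) j)) (f0 p) (f1 p); lra.
- have : el <= 3 * (el * gap t).
    apply: mis; have yl : 0 <= tlog t * ln 2.
      by have := IZR_le _ _ hl; have := ln_lt_2; move=> ? ?; apply: Rmult_le_pos; lra.
    have h : 1 <= t / (1 - t) by rewrite -ey; have := exp_ineq1_le (tlog t * ln 2); lra.
    have : 1 - t <= t.
      have e : t / (1 - t) * (1 - t) = t by field; lra.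
      by rewrite -{2}e -{1}[1 - t]Rmult_1_l; apply: Rmult_le_compat_r; lra.
    by rewrite /gap /Rmin; case: Rle_dec => ?; lra.
  have := f01 p; have := lip f1 f1_lip; rewrite (ds_sym (f0 p)).
  by have := ds_tri (f1 (centre n (lev n j t) (cell n j p t) j)) (f1 p) (f0 p); lra.
- by have := lip f1 f1_lip; lra.
Qed.

Lemma gdat_close p t i j : 0 < t < 1 -> ds (gdat p t i) (gdat p t j) <= 16 * el * gap t.
Proof.
move=> ht; have h1 := gdat_base p t i ht; have h2 := gdat_base p t j ht.
have [g0 _] := gap_pos t ht; have := Rmult_lt_0_compat _ _ el0 g0.
by have := ds_tri (gdat p t i) (base p t) (gdat p t j); rewrite (ds_sym (base p t)); lra.
Qed.

Lemma dldat_bounds t l : 0 < t < 1 ->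
  K * (16 * el * gap t) <= dldat t l <= 32 * K * (16 * el * gap t).
Proof.
move=> ht; have [ge se] := lev_sc n (lift ord0 l) t ht; rewrite -/(gap t) in ge se.
have Ke : 0 < K * el by exact: Rmult_lt_0_compat.
rewrite /dldat; split; nra.
Qed.

Lemma rho_pos t : 0 < t < 1 -> 0 < 16 * el * gap t.
Proof. by move=> /gap_pos[g0 _]; apply: Rmult_lt_0_compat => //; lra. Qed.

Lemma om_nrm p t : nrm (om n p t) <= 1.
Proof. by apply: nrm_le => [|j]; [lra|have := om_bounds n p t j => ?; apply: Rabs_le; lra]. Qed.

Lemma om_cov p t : wallset n p -> cov n <= nrm (om n p t).
Proof.
move=> /(om_cover n p t) [j hj]; apply: Rle_trans hj _.
by apply: Rle_trans (nrm_coord _ _ j); exact: Rle_abs.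
Qed.

Lemma cov_gt0 : 0 < cov n. Proof. by case: (cov_pos n). Qed.

Lemma wall_in p t : 0 < t < 1 ->
  wall (p, t) = psi n (gdat p t) (dldat t) (nW (om n p t)).
Proof. by move=> ht; rewrite /wall /=; case: Rle_dec => h; [lra|case: Rle_dec => h'; [lra|]]. Qed.

Lemma wall_base p t : 0 <= t <= 1 -> (0 < t < 1 -> wallset n p) ->
  ds (wall (p, t)) (base p t) <= (16 * C + 7) * (el * gap t).
Proof.
move=> ht hp; have [hi|[->|->]] : 0 < t < 1 \/ t = 0 \/ t = 1 by lra.
- rewrite wall_in //; have [_ near] := psi_lip _ (gdat p t) (dldat t) (rho_pos t hi)
    (fun i j => gdat_close p t i j hi) (fun l => dldat_bounds t l hi).
  have hw : cube1 n (nW (om n p t)).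
    by apply: nW_cube; apply: Rlt_le_trans cov_gt0 _; apply: om_cov; exact: hp.
  have := near _ ord0 hw; have := gdat_base p t ord0 hi.
  by have := ds_tri (psi n (gdat p t) (dldat t) (nW (om n p t))) (gdat p t ord0) (base p t); lra.
- rewrite /wall /base /=; case: Rle_dec => h /=; last lra; case: Rle_dec => h' /=; last lra.
  by rewrite ds_refl /gap Rmin_left; lra.
- rewrite /wall /base /=; case: Rle_dec => h /=; first lra; case: Rle_dec => h' /=; last lra.
  by case: Rle_dec => h2 /=; [lra|rewrite ds_refl /gap Rmin_right; lra].
Qed.

Definition same_cell (p p' : Rn n) (t t' : R) (j : 'I_n.+1) : Prop :=
  lev n j t = lev n j t' /\ cell n j p t = cell n j p' t'.

(** At distance about [e] from the ends, phases and positions are [4 / e]-Lipschitz. A change of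
    cell means that one of them crosses an integer, which bounds the depth at both points. *)
Lemma om_move p p' t t' j e d : 0 < e -> e <= t <= 1 - e -> e <= t' <= 1 - e ->
  gap t <= 4 * e -> gap t' <= 4 * e -> e <= gap t -> e <= gap t' ->
  ds p p' <= d -> Rabs (t - t') <= d ->
  (same_cell p p' t t' j -> Rabs (om n p t j - om n p' t' j) <= 4 * (d / e)) /\
  (~ same_cell p p' t t' j -> om n p t j <= 4 * (d / e) /\ om n p' t' j <= 4 * (d / e)).
Proof.
move=> e0 te te' ge ge' eg eg' dp dt.
have ie : 0 < / e by exact: Rinv_0_lt_compat.
have dph : Rabs (phase n j t - phase n j t') <= 4 * (d / e).
  rewrite /phase; have -> : tlog t - INR j / INR n.+1 - (tlog t' - INR j / INR n.+1) = tlog t - tlog t' by lra.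
  apply: Rle_trans (tlog_diff t t' e e0 te te') _.
  by have := Rmult_le_compat_r _ _ _ (Rlt_le _ _ ie) dt; rewrite /Rdiv; lra.
have dcp l : lev n j t = lev n j t' -> Rabs (cpos n j p t l - cpos n j p' t' l) <= 4 * (d / e).
  move=> el'; rewrite /cpos -el'.
  have ht : 0 < t < 1 by lra.
  have [gs _] := lev_sc n j t ht.
  rewrite -/(gap t) in gs; have s0 := sc_pos (lev n j t).
  have -> : p l / sc (lev n j t) - shift n j - (p' l / sc (lev n j t) - shift n j) =
     (p l - p' l) * / sc (lev n j t) by field; lra.
  rewrite Rabs_mult (Rabs_right (/ sc _)); last by apply/Rle_ge/Rlt_le/Rinv_0_lt_compat.
  have -> : 4 * (d / e) = d * (4 / e) by field; lra.
  apply: Rmult_le_compat; first exact: Rabs_pos.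
  - exact/Rlt_le/Rinv_0_lt_compat.
  - by apply: Rle_trans dp; exact: rds_coord.
  - have -> : 4 / e = / (e / 4) by field; lra.
    by apply: Rinv_le_contravar; lra.
split=> [[sl sc'] | ns].
  apply: Rmin_lip; first by apply: Rle_trans (dZ_same _ _ sl) dph.
  have -> : forall a b, 1 - a - (1 - b) = - (a - b) by move=> *; lra.
  rewrite Rabs_Ropp; apply: Rle_trans (nrm_lip _ _ _) _; apply: rds_le => [|l].
    by apply: Rle_trans dph; exact: Rabs_pos.
  have -> : forall a b, 1 - a - (1 - b) = - (a - b) by move=> *; lra.
  rewrite Rabs_Ropp; apply: Rle_trans (dZ_same _ _ _) (dcp l sl).
  by have := f_equal (fun z => z l) sc'.
case: (classic (lev n j t = lev n j t')) => [sl|nl].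
  have [l nc] : exists l, cell n j p t l <> cell n j p' t' l.
    apply: NNPP => no; apply: ns; split=> //; apply: functional_extensionality => l.
    by apply: NNPP => ne; apply: no; exists l.
  have b := dcp l sl; split.
    exact: Rle_trans (om_le_cpos _ _ _ _ l) (Rle_trans _ _ _ (dZ_cross _ _ nc) b).
  rewrite Rabs_minus_sym in b.
  exact: Rle_trans (om_le_cpos _ _ _ _ l) (Rle_trans _ _ _ (dZ_cross _ _ (nesym nc)) b).
split.
  exact: Rle_trans (om_le_phase _ _ _ _) (Rle_trans _ _ _ (dZ_cross _ _ nl) dph).
rewrite Rabs_minus_sym in dph.
exact: Rle_trans (om_le_phase _ _ _ _) (Rle_trans _ _ _ (dZ_cross _ _ (nesym nl)) dph).
Qed.

(** Colours that change their cell are shallow at both points. Setting them to [0] gives weights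
    [oz] at which the two simplices agree by [psi_face]; each half of the comparison then stays in
    one simplex. *)
Lemma wall_local p p' t t' d : 0 < t < 1 -> wallset n p -> wallset n p' ->
  ds p p' <= d -> Rabs (t - t') <= d -> d <= cov n / 32 * gap t ->
  ds (wall (p, t)) (wall (p', t')) <= 2 * (C * CW * 512) * (el * d).
Proof.
move=> ht wp wp' dp dt dg; have [g0 g2] := gap_pos t ht.
have [c0 c1] := cov_pos n; have d0 : 0 <= d by apply: Rle_trans dt; exact: Rabs_pos.
have d4 : d <= gap t / 4 by nra.
pose e := gap t / 2; have e0 : 0 < e by rewrite /e; lra.
have gt' := gap_lip t t'; have gt := gap_lip t' t; rewrite Rabs_minus_sym in gt.
have [a1 a2] := gap_le t; have [a1' a2'] := gap_le t'.
have ht' : 0 < t' < 1 by lra.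
have e2 : gap t = 2 * e by rewrite /e; lra.
have [q1 q2] : e <= t <= 1 - e /\ e <= t' <= 1 - e by lra.
have [q3 [q4 [q5 q6]]] : gap t <= 4 * e /\ gap t' <= 4 * e /\ e <= gap t /\ e <= gap t'.
  by rewrite /e; lra.
have mv j : _ := om_move p p' t t' j e d e0 q1 q2 q3 q4 q5 q6 dp dt.
set r := d / e in mv; have r0 : 0 <= r.
  by apply: Rmult_le_pos => //; apply/Rlt_le/Rinv_0_lt_compat.
have re : r * e = d by rewrite /r; field; lra.
have rc : 4 * r <= cov n / 2.
  by apply: (Rmult_le_reg_r e) => //; rewrite Rmult_assoc re; nra.
pose o : Rn n.+1 := om n p t; pose o' : Rn n.+1 := om n p' t'.
have {}mv j : (same_cell p p' t t' j -> Rabs (o j - o' j) <= 4 * r) /\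
  (~ same_cell p p' t t' j -> o j <= 4 * r /\ o' j <= 4 * r) := mv j.
pose oz : Rn n.+1 := fun j => if excluded_middle_informative (same_cell p p' t t' j) then o j else 0.
have ob j : 0 <= o j <= 1 := om_bounds n p t j.
have ob' j : 0 <= o' j <= 1 := om_bounds n p' t' j.
have D1 : ds o oz <= 4 * r.
  apply: rds_le => [|j]; first lra.
  rewrite /oz; case: excluded_middle_informative => h /=; first by rewrite Rminus_diag Rabs_R0; lra.
  by have := proj1 (proj2 (mv j) h); have := ob j; rewrite Rminus_0_r => ? ?; rewrite Rabs_right; lra.
have D2 : ds oz o' <= 4 * r.
  apply: rds_le => [|j]; first lra.
  rewrite /oz; case: excluded_middle_informative => h /=; first exact: (proj1 (mv j) h).
  have := proj2 (proj2 (mv j) h); have := ob' j; rewrite /Rminus Rplus_0_l Rabs_Ropp => ? ?.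
  by rewrite Rabs_right; lra.
have oz1 : nrm oz <= 1.
  apply: nrm_le => [|j]; first lra; have := ob j => ?.
  by rewrite /oz; case: excluded_middle_informative => h /=; apply: Rabs_le; lra.
(* A colour of depth [cov n] keeps its cell, because [4 * r <= cov n / 2], and so it survives in
   [oz]. *)
have ozc : cov n <= nrm oz.
  have [j hj] := om_cover n p t wp; rewrite -/(o j) in hj.
  have sj : same_cell p p' t t' j.
    by apply: NNPP => /(proj2 (mv j)) [h _]; lra.
  apply: Rle_trans (nrm_coord _ _ j); rewrite /oz; case: excluded_middle_informative => //= _.
  by apply: Rle_trans hj _; exact: Rle_abs.
have oc := om_cov p t wp; have oc' := om_cov p' t' wp'.
have cw o1 : cov n <= nrm o1 -> cube1 n (nW o1).
  by move=> h; apply: nW_cube; lra.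
have [L1 _] := psi_lip _ (gdat p t) (dldat t) (rho_pos t ht)
    (fun i j => gdat_close p t i j ht) (fun l => dldat_bounds t l ht).
have [L2 _] := psi_lip _ (gdat p' t') (dldat t') (rho_pos t' ht')
    (fun i j => gdat_close p' t' i j ht') (fun l => dldat_bounds t' l ht').
have eqz : psi n (gdat p t) (dldat t) (nW oz) = psi n (gdat p' t') (dldat t') (nW oz).
  have same j : same_cell p p' t t' j -> gdat p t j = gdat p' t' j.
    by move=> [s1 s2]; rewrite /gdat -s1 -s2.
  apply: (psi_face _ _ _ _ _ _ _ (cw _ ozc) (rho_pos t ht) (rho_pos t' ht')).
  - by move=> i j; exact: gdat_close.
  - by move=> i j; exact: gdat_close.
  - by move=> l; case: (dldat_bounds t l ht).
  - by move=> l; case: (dldat_bounds t' l ht').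
  - move=> l; rewrite /nW /oz; case: excluded_middle_informative => h /= nz.
      by split; [exact: same|rewrite /dldat (proj1 h)].
    by case: nz; ring.
  - rewrite nW_sq; last lra.
    rewrite {1 2}/oz; case: excluded_middle_informative => h /= nz; first exact: same.
    by case: nz; rewrite /Rdiv; ring.
rewrite !wall_in // -/o -/o'.
have CW0 : 0 <= CW by case: nW_lip.
have N1 : ds (nW o) (nW oz) <= CW * (4 * r).
  apply: Rle_trans (proj2 nW_lip o oz (conj (om_nrm _ _) oc) (conj oz1 ozc)) _.
  exact: Rmult_le_compat_l.
have N2 : ds (nW oz) (nW o') <= CW * (4 * r).
  apply: Rle_trans (proj2 nW_lip oz o' (conj oz1 ozc) (conj (om_nrm _ _) oc')) _.
  exact: Rmult_le_compat_l.
have fin t1 x : gap t1 <= 4 * e -> 0 < t1 < 1 -> x <= CW * (4 * r) ->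
    C * (16 * el * gap t1) * x <= C * CW * 512 * (el * d).
  move=> g4 h1 hx; have [gg _] := gap_pos t1 h1.
  have p1 : 0 <= C * (16 * el * gap t1).
    by apply: Rmult_le_pos => //; apply: Rmult_le_pos; lra.
  apply: Rle_trans (Rmult_le_compat_l _ _ _ p1 hx) _.
  have -> : C * CW * 512 * (el * d) = C * (16 * el * (8 * e)) * (CW * (4 * r)) by rewrite -re; ring.
  apply: Rmult_le_compat_r; first by apply: Rmult_le_pos; lra.
  apply: Rmult_le_compat_l => //; apply: Rmult_le_compat_l; lra.
have T := ds_tri (psi n (gdat p t) (dldat t) (nW o)) (psi n (gdat p t) (dldat t) (nW oz))
  (psi n (gdat p' t') (dldat t') (nW o')).
have B1 := Rle_trans _ _ _ (L1 _ _ (cw _ oc) (cw _ ozc)) (fin t _ ltac:(lra) ht N1).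
have B2 := Rle_trans _ _ _ (L2 _ _ (cw _ ozc) (cw _ oc')) (fin t' _ ltac:(lra) ht' N2).
rewrite -/o in B1; rewrite -eqz -/o' in B2; lra.
Qed.

Definition wall_dom (q : Rn n * R) : Prop :=
  0 <= q.2 <= 1 /\ (wallset n q.1 \/ q.2 = 0 \/ q.2 = 1).

Let M := 32 / cov n.
Let CL := 2 * (C * CW * 512) + 2 * (16 * C + 7) * (M + 1) + 3 * M + 10.

(** Pairs much closer to each other than to the ends are covered by [wall_local]. For all others
    [gap] is [O(d)] at both points, and comparing both with [base] is enough. *)
Lemma wall_lip : Lip wall_dom (CL * el) wall.
Proof.
have [c0 c1] := cov_pos n; have M32 : 32 <= M.
  rewrite /M; have := Rinv_le_contravar _ _ c0 c1; rewrite Rinv_1 /Rdiv; lra.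
have CW0 : 0 <= CW by case: nW_lip.
have CC : 0 <= C * CW by exact: Rmult_le_pos.
have CM : 0 <= (16 * C + 7) * (M + 1) by apply: Rmult_le_pos; lra.
have CL0 : 0 <= CL by rewrite /CL; lra.
split; first by apply: Rmult_le_pos; lra.
move=> [p t] [p' t'] [/= ht wp] [/= ht' wp'].
set d := ds _ (p', t'); have ed : d = ds p p' + Rabs (t - t') by [].
have dp0 := ds_pos _ p p'; have dt0 := Rabs_pos (t - t').
have int s q : wallset n q \/ s = 0 \/ s = 1 -> 0 < s < 1 -> wallset n q.
  by move=> [//|[->|->]] ?; lra.
case: (classic (0 < t < 1 /\ 0 < t' < 1 /\ d <= cov n / 32 * gap t)) => [[h [h' hd]]|far].
  apply: Rle_trans (wall_local p p' t t' d h (int _ _ wp h) (int _ _ wp' h') _ _ hd) _; try lra.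
  have -> : CL * el * d = CL * (el * d) by ring.
  apply: Rmult_le_compat_r; first by apply: Rmult_le_pos; lra.
  by rewrite /CL; lra.
have gd : gap t <= M * d.
  have gl := gap_lip t t'; have gl2 := gap_lip t' t; rewrite Rabs_minus_sym in gl2.
  have g1 : 0 <= gap t by rewrite /gap /Rmin; case: Rle_dec => ?; lra.
  have Md : d <= M * d by nra.
  case: (classic (0 < t' < 1)) => [h'|nt']; last first.
    have : gap t' = 0 by rewrite /gap /Rmin; case: Rle_dec => ?; lra.
    lra.
  case: (classic (0 < t < 1)) => [h|nt]; last first.
    have : gap t = 0 by rewrite /gap /Rmin; case: Rle_dec => ?; lra.
    lra.
  have lt : cov n / 32 * gap t < d by apply: Rnot_le_lt => le; apply: far.
  have -> : gap t = M * (cov n / 32 * gap t) by rewrite /M; field; lra.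
  by apply: Rmult_le_compat_l; lra.
have gd' : gap t' <= (M + 1) * d by have := gap_lip t t'; lra.
have b1 := wall_base p t ht (int _ _ wp); have b2 := wall_base p' t' ht' (int _ _ wp').
have bb : ds (base p t) (base p' t') <= (2 * M + 3) * (el * d).
  have ld : el * ds p p' <= el * d by apply: Rmult_le_compat_l; lra.
  have ed0 : 0 <= el * d by apply: Rmult_le_pos; lra.
  have big : gap t + gap t' + d >= 1 -> el <= (2 * M + 2) * (el * d).
    by move=> h; have : 1 <= (2 * M + 2) * d; [lra|nra].
  have h0 := proj2 f0_lip p p' I I; have h1 := proj2 f1_lip p p' I I.
  have [q1 q2] := gap_le t; have [q1' q2'] := gap_le t'.
  rewrite /base; case: Rle_dec => r1 /=; case: Rle_dec => r2 /=; try nra.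
  - have : el <= (2 * M + 2) * (el * d).
      apply: big; rewrite /gap (Rmin_left t) ?(Rmin_right t'); try lra.
      by rewrite ed; have := Rle_abs (t' - t); rewrite Rabs_minus_sym; lra.
    by have := f01 p; have := ds_tri (f0 p) (f1 p) (f1 p'); nra.
  - have : el <= (2 * M + 2) * (el * d).
      apply: big; rewrite /gap (Rmin_right t) ?(Rmin_left t'); try lra.
      by rewrite ed; have := Rle_abs (t - t'); lra.
    by have := f01 p; rewrite ds_sym; have := ds_tri (f1 p) (f0 p) (f0 p'); nra.
have T1 := ds_tri (wall (p, t)) (base p t) (wall (p', t')).
have T2 := ds_tri (base p t) (base p' t') (wall (p', t')).
rewrite (ds_sym (base p' t')) in T2.
have k1 : el * gap t <= el * (M * d) by apply: Rmult_le_compat_l; lra.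
have k2 : el * gap t' <= el * ((M + 1) * d) by apply: Rmult_le_compat_l; lra.
have k3 : (16 * C + 7) * (el * gap t) <= (16 * C + 7) * (el * (M * d)) by apply: Rmult_le_compat_l; lra.
have k4 : (16 * C + 7) * (el * gap t') <= (16 * C + 7) * (el * ((M + 1) * d)).
  by apply: Rmult_le_compat_l; lra.
have fin : (16 * C + 7) * (el * (M * d)) + (16 * C + 7) * (el * ((M + 1) * d)) + (2 * M + 3) * (el * d)
   <= CL * el * d.
  have -> : (16 * C + 7) * (el * (M * d)) + (16 * C + 7) * (el * ((M + 1) * d)) + (2 * M + 3) * (el * d)
    = ((16 * C + 7) * (2 * M + 1) + 2 * M + 3) * (el * d) by ring.
  rewrite Rmult_assoc; apply: Rmult_le_compat_r; first by apply: Rmult_le_pos; lra.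
  by rewrite /CL; nra.
have T2' := Rle_trans _ _ _ T2 (Rplus_le_compat _ _ _ _ bb b2).
have T1' := Rle_trans _ _ _ T1 (Rplus_le_compat _ _ _ _ b1 T2').
by apply: Rle_trans T1' _; lra.
Qed.

Lemma wall_flat p t : 0 < t < 1 -> wallset n p ->
  (forall p', ds p p' <= 4 -> f0 p' = mkHeis (fun=> 0) (fun=> 0) 0 /\
                              f1 p' = mkHeis (fun=> 0) (fun=> 0) 0) ->
  exists x : Rn n, wall (p, t) = mkHeis x (fun=> 0) 0 /\ nrm x <= 512 * K * el.
Proof.
move=> ht wp flat; rewrite wall_in //; have [g0 g2] := gap_pos t ht.
have -> : gdat p t = fun=> mkHeis (fun=> 0) (fun=> 0) 0.
  apply: functional_extensionality => j; rewrite /gdat.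
  have [ge se] := lev_sc n j t ht; rewrite -/(gap t) in ge se.
  have h : ds p (centre n (lev n j t) (cell n j p t) j) <= 4.
    by rewrite ds_sym; apply: Rle_trans (centre_near p t j) _; lra.
  by have [e0 e1] := flat _ h; case: Z.ltb.
have dl0 l : 0 < dldat t l.
  by have := dldat_bounds t l ht; have := Rmult_lt_0_compat _ _ K0 (rho_pos t ht); lra.
rewrite psi_flat //; eexists; split; first reflexivity.
have Ke := Rmult_lt_0_compat _ _ K0 el0.
apply: nrm_le => [|l]; first lra.
have -> : 512 * K * el = (512 * K * el) * 1 by ring.
apply: Rabs_mul_le.
  by have := dldat_bounds t l ht; have := dl0 l => ? ?; rewrite Rabs_right; nra.
apply: Rle_trans (nrm_coord _ _ l) _; apply: nW_cube.
by apply: Rlt_le_trans cov_gt0 _; exact: om_cov.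
Qed.

End Wall.

Theorem wall_extension n : exists C, 0 <= C /\ forall el (f0 f1 : Rn n -> Heis n), 0 < el ->
  Lip (fun=> True) el f0 -> Lip (fun=> True) el f1 -> (forall p, ds (f0 p) (f1 p) <= el) ->
  exists F : Rn n * R -> Heis n, [/\ Lip (wall_dom n) (C * el) F,
    forall p, F (p, 0) = f0 p, forall p, F (p, 1) = f1 p &
    forall p t, 0 < t < 1 -> wallset n p ->
      (forall p', ds p p' <= 4 -> f0 p' = mkHeis (fun=> 0) (fun=> 0) 0 /\
                                  f1 p' = mkHeis (fun=> 0) (fun=> 0) 0) ->
      exists x : Rn n, F (p, t) = mkHeis x (fun=> 0) 0 /\ nrm x <= C * el].
Proof.
have [K [K0 [lip face]]] := psi_estimate n.
have [C [C0 h]] := lip (32 * K).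
have [CW hW] := nW_lip n (cov n) (proj1 (cov_pos n)).
have [CL key] : exists CL, forall el (f0 f1 : Rn n -> Heis n), 0 < el ->
    Lip (fun=> True) el f0 -> Lip (fun=> True) el f1 -> (forall p, ds (f0 p) (f1 p) <= el) ->
    Lip (wall_dom n) (CL * el) (wall n K el f0 f1).
  eexists=> el f0 f1 el0 l0 l1 l01.
  exact: (wall_lip n K C K0 C0 h face CW hW el f0 f1 el0 l0 l1 l01).
exists (Rabs CL + 512 * K); split; first by have := Rabs_pos CL; lra.
move=> el f0 f1 el0 l0 l1 l01; exists (wall n K el f0 f1); split.
- apply: Lip_weak (key el f0 f1 el0 l0 l1 l01); apply: Rmult_le_compat_r; first lra.
  by have := Rle_abs CL; lra.
- by move=> p; rewrite /wall /=; case: Rle_dec => //=; lra.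
- move=> p; rewrite /wall /=; case: Rle_dec => [|_] /=; first lra.
  by case: Rle_dec => //=; lra.
move=> p t ht wp flat.
have [x [e le]] := wall_flat n K K0 el f0 f1 el0 p t ht wp flat.
exists x; split=> //; apply: Rle_trans le _; apply: Rmult_le_compat_r; first lra.
by have := Rabs_pos CL; lra.
Qed.

(** * Extension over the walls of a grid *)

Definition h0 {n} : Heis n := mkHeis (fun=> 0) (fun=> 0) 0.

Definition dil {n} (r : R) (p : Heis n) : Heis n :=
  mkHeis (fun j => r * hx p j) (fun j => r * hy p j) (r * r * hz p).

Lemma dil1 n (p : Heis n) : dil 1 p = p.
Proof.
case: p => x y z; rewrite /dil /= !Rmult_1_l; congr mkHeis;
  by apply: functional_extensionality => j; ring.
Qed.

Lemma dil0 n (p : Heis n) : dil 0 p = h0.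
Proof. by rewrite /dil /h0; congr mkHeis; try apply: functional_extensionality => j; ring. Qed.

Lemma dil_h0 n r : dil r (@h0 n) = h0.
Proof. by rewrite /dil /h0 /=; congr mkHeis; try apply: functional_extensionality => j; ring. Qed.

Lemma hD_dil n r (p q : Heis n) : hD (dil r p) (dil r q) = r * r * hD p q.
Proof.
rewrite /hD /=; set a := rsum _; set b := rsum _.
have -> : a = r * r * b by rewrite /a /b -rsum_mul; apply: rsum_eq => j; ring.
ring.
Qed.

Lemma ds_dil n r (p q : Heis n) : 0 <= r -> ds (dil r p) (dil r q) <= r * ds p q.
Proof.
move=> r0; have d0 := ds_pos _ p q.
have [lx [ly lD]] := proj1 (hds_le n p q _ d0) (Rle_refl _).
have rd : 0 <= r * ds p q by exact: Rmult_le_pos.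
apply/hds_le => //; split; [|split].
- apply: rds_le => // j; rewrite -Rmult_minus_distr_l Rabs_mult Rabs_right; last lra.
  by apply: Rmult_le_compat_l => //; apply: Rle_trans (rds_coord _ _ _ j) lx.
- apply: rds_le => // j; rewrite -Rmult_minus_distr_l Rabs_mult Rabs_right; last lra.
  by apply: Rmult_le_compat_l => //; apply: Rle_trans (rds_coord _ _ _ j) ly.
rewrite hD_dil Rabs_mult (Rabs_right (r * r)); last nra.
have -> : cH n * (r * ds p q * (r * ds p q)) = r * r * (cH n * (ds p q * ds p q)) by ring.
by apply: Rmult_le_compat_l => //; nra.
Qed.

(** The height changes by [O(k^2)], which the metric sees as [O(k)]. *)
Lemma ds_dil_param n (p : Heis n) r r' k M : 0 <= r <= 1 -> 0 <= r' <= 1 -> 0 <= k <= 1 ->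
  Rabs (r - r') <= k * k -> ds h0 p <= M -> ds (dil r p) (dil r' p) <= 2 * k * M.
Proof.
move=> hr hr' hk hrr hM; have M0 : 0 <= M by apply: Rle_trans (ds_pos _ h0 p) hM.
have [lx [ly lD]] := proj1 (hds_le n h0 p _ M0) hM.
have kM : 0 <= k * M by apply: Rmult_le_pos; lra.
have kk : k * k <= k by nra.
have co (v : Rn n) : @ds (Rn_met n) (fun=> 0) v <= M ->
    @ds (Rn_met n) (fun j => r * v j) (fun j => r' * v j) <= 2 * k * M.
  move=> hv; apply: rds_le => [|j]; first lra.
  rewrite -Rmult_minus_distr_r; apply: Rle_trans (_ : k * k * M <= _); last nra.
  apply: Rabs_mul_le => //; have h : Rabs (0 - v j) <= _ := rds_coord _ (fun=> 0) v j.
  by rewrite Rabs_minus_sym Rminus_0_r in h; apply: Rle_trans hv.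
apply/hds_le; first lra.
split; [exact: co|split; [exact: co|]].
have -> : hD (dil r p) (dil r' p) = (r' * r' - r * r) * hD h0 p.
  rewrite /hD /=; set a := rsum _; set b := rsum _.
  have -> : a = (r' * r' - r * r) * b by rewrite /a /b -rsum_mul; apply: rsum_eq => j; ring.
  ring.
apply: Rle_trans (_ : 2 * (k * k) * (cH n * (M * M)) <= _).
  apply: Rabs_mul_le => //; have -> : r' * r' - r * r = (r' - r) * (r' + r) by ring.
  rewrite Rmult_comm [2 * _]Rmult_comm -[k * k * 2]Rmult_comm; apply: Rabs_mul_le.
    by apply: Rabs_le; lra.
  by rewrite Rabs_minus_sym.
have c1 := cH_pos n; have : 0 <= cH n * (k * M * (k * M)) by apply: Rmult_le_pos; [lra|nra].
nra.
Qed.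

Lemma hD_hmul n (g p q : Heis n) : hD (hmul g p) (hmul g q) = hD p q.
Proof.
rewrite /hD /=; set a := rsum _; set b := rsum _; set c := rsum _; set d := rsum _.
suff : a - b - / 2 * c = - / 2 * d by lra.
by rewrite /a /b /c /d -!rsum_mul -!rsum_sub; apply: rsum_eq => j; lra.
Qed.

Lemma ds_hmul n (g p q : Heis n) : ds (hmul g p) (hmul g q) <= ds p q.
Proof.
have d0 := ds_pos _ p q.
have [lx [ly lD]] := proj1 (hds_le n p q _ d0) (Rle_refl _).
apply/hds_le => //; split; [|split]; last by rewrite hD_hmul.
- apply: rds_le => // j /=; have -> : hx g j + hx p j - (hx g j + hx q j) = hx p j - hx q j by ring.
  exact: Rle_trans (rds_coord _ _ _ j) lx.
- apply: rds_le => // j /=; have -> : hy g j + hy p j - (hy g j + hy q j) = hy p j - hy q j by ring.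
  exact: Rle_trans (rds_coord _ _ _ j) ly.
Qed.

Definition hflat {n} (x : Rn n) : Heis n := mkHeis x (fun=> 0) 0.

Lemma ds_flat n (x x' : Rn n) : ds (hflat x) (hflat x') = ds x x'.
Proof.
have D0 : hD (hflat x) (hflat x') = 0.
  by rewrite /hD /= (rsum_eq _ _ (fun=> 0)) ?rsum_const => [|j]; ring.
apply: Rle_antisym; last by have [] := proj1 (hds_le n _ _ _ (ds_pos _ _ _)) (Rle_refl (ds (hflat x) (hflat x'))).
apply/hds_le; first exact: ds_pos.
rewrite D0 Rabs_R0; split; first exact: Rle_refl.
split; first by rewrite ds_refl; exact: ds_pos.
have := cH_pos n; have := ds_pos _ x x'; move=> ? ?; apply: Rmult_le_pos; nra.
Qed.

Definition tl {n} (p : Rn n.+1) : Rn n := fun l => p (lift ord0 l).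
Definition bdy {m} (u : Rn m) : Prop := nrm u = 1.

Lemma tl_ds n (p p' : Rn n.+1) : ds (tl p) (tl p') <= ds p p'.
Proof. by apply: rds_le => [|l]; [exact: ds_pos|exact: (rds_coord _ _ _ (lift ord0 l))]. Qed.

Lemma tl_nrm n (p : Rn n.+1) : nrm (tl p) <= nrm p.
Proof. by apply: nrm_le => [|l]; [exact: nrm_pos|exact: (nrm_coord _ p (lift ord0 l))]. Qed.

(** * The map on the walls between the boxes *)

Section AlphaJ.
Variable n : nat.
Hypothesis n0 : (0 < n)%N.
Variable C : R.
Hypothesis C0 : 0 <= C.
Hypothesis ext : forall el (f0 f1 : Rn n -> Heis n), 0 < el ->
  Lip (fun=> True) el f0 -> Lip (fun=> True) el f1 -> (forall p, ds (f0 p) (f1 p) <= el) ->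
  exists F : Rn n * R -> Heis n, [/\ Lip (wall_dom n) (C * el) F,
    forall p, F (p, 0) = f0 p, forall p, F (p, 1) = f1 p &
    forall p t, 0 < t < 1 -> wallset n p ->
      (forall p', ds p p' <= 4 -> f0 p' = h0 /\ f1 p' = h0) ->
      exists x : Rn n, F (p, t) = hflat x /\ nrm x <= C * el].
Variables (q : nat) (L : R) (a1 : Rn n -> Heis n).
Let N : R := 2 ^ q.
Hypothesis N128 : 128 <= N.
Hypothesis L0 : 0 < L.
Hypothesis a1_lip : Lip (fun=> True) L a1.
Hypothesis a1_out : forall p, / 2 <= nrm p -> a1 p = h0.

(** In the coordinates that [unsc] maps back to [[-1, 1]], the walls sit at the integers and [a1] is
    [el]-Lipschitz. *)
Let el := 2 * L / N.
Let iN : 0 < / N. Proof. by apply: Rinv_0_lt_compat; lra. Qed.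
Let el0 : 0 < el. Proof. by rewrite /el /Rdiv; apply: Rmult_lt_0_compat; lra. Qed.

Lemma a1_bound p : ds h0 (a1 p) <= L.
Proof.
have [ge|lt] : / 2 <= nrm p \/ nrm p < / 2 by lra.
  by rewrite a1_out // ds_refl; lra.
have <- : a1 (fun=> / 2) = h0.
  apply: a1_out; apply: Rle_trans (nrm_coord _ _ (Ordinal n0)); rewrite Rabs_right; lra.
apply: Rle_trans (proj2 a1_lip _ _ I I) _.
rewrite -[X in _ <= X]Rmult_1_r; apply: Rmult_le_compat_l; first lra.
apply: rds_le => [|l]; first lra.
have := nrm_coord _ p l => h; have /Rabs_le_between : Rabs (p l) <= / 2 by lra.
by move=> b; apply: Rabs_le; lra.
Qed.

Definition lam (i : Z) : R := clamp (IZR i / (N * N)).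

Lemma lam_bounds i : 0 <= lam i <= 1.
Proof. exact: clamp_bounds. Qed.

Lemma lam_step i : Rabs (lam i - lam (i + 1)%ZZ) <= / N * / N.
Proof.
have e : IZR (i + 1) / (N * N) = IZR i / (N * N) + / N * / N by rewrite plus_IZR; field; lra.
have p : 0 < / N * / N by exact: Rmult_lt_0_compat.
apply: Rle_trans (clamp_lip _ _) _; rewrite e.
have -> : IZR i / (N * N) - (IZR i / (N * N) + / N * / N) = - (/ N * / N) by ring.
by rewrite Rabs_Ropp Rabs_right; lra.
Qed.

Definition unsc (P : Rn n) : Rn n := fun l => 2 * P l / N - 1.

Lemma unsc_ds P P' : ds (unsc P) (unsc P') <= 2 * / N * ds P P'.
Proof.
have d0 := ds_pos _ P P'; apply: rds_le => [|l]; first by apply: Rmult_le_pos; lra.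
have -> : unsc P l - unsc P' l = 2 * / N * (P l - P' l) by rewrite /unsc; field; lra.
rewrite Rabs_mult Rabs_right; last lra.
by apply: Rmult_le_compat_l; [lra|exact: rds_coord].
Qed.

Definition slice (i : Z) (P : Rn n) : Heis n := dil (lam i) (a1 (unsc P)).

Lemma slice_lip i : Lip (fun=> True) el (slice i).
Proof.
split=> [|P P' _ _]; first lra.
have [l0 l1] := lam_bounds i; have d0 := ds_pos _ (a1 (unsc P)) (a1 (unsc P')).
apply: Rle_trans (ds_dil _ _ _ _ l0) _.
apply: Rle_trans (_ : 1 * ds (a1 (unsc P)) (a1 (unsc P')) <= _).
  exact: Rmult_le_compat_r.
rewrite Rmult_1_l; apply: Rle_trans (proj2 a1_lip _ _ I I) _.
have := Rmult_le_compat_l L _ _ (Rlt_le _ _ L0) (unsc_ds P P').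
by rewrite /el /Rdiv; lra.
Qed.

Lemma slice_step i P : ds (slice i P) (slice (i + 1)%ZZ P) <= el.
Proof.
have iN1 : / N <= 1 by rewrite -Rinv_1; apply: Rinv_le_contravar; lra.
have := ds_dil_param n (a1 (unsc P)) _ _ (/ N) L (lam_bounds i) (lam_bounds (i + 1)%ZZ)
  (conj (Rlt_le _ _ iN) iN1) (lam_step i) (a1_bound _).
by rewrite /el /slice /Rdiv; lra.
Qed.

Lemma slice_bound i P : ds h0 (slice i P) <= L.
Proof.
have [l0 l1] := lam_bounds i; rewrite /slice -(dil_h0 n (lam i)).
apply: Rle_trans (ds_dil _ _ _ _ l0) _; have := a1_bound (unsc P); have := ds_pos _ h0 (a1 (unsc P)).
by nra.
Qed.

Lemma slice_out i P : / 2 <= nrm (unsc P) -> slice i P = h0.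
Proof. by move=> h; rewrite /slice a1_out // dil_h0. Qed.

Definition wF_spec (i : Z) (F : Rn n * R -> Heis n) : Prop :=
  [/\ Lip (wall_dom n) (C * el) F,
    forall p, F (p, 0) = slice i p, forall p, F (p, 1) = slice (i + 1)%ZZ p &
    forall p t, 0 < t < 1 -> wallset n p ->
      (forall p', ds p p' <= 4 -> slice i p' = h0 /\ slice (i + 1)%ZZ p' = h0) ->
      exists x : Rn n, F (p, t) = hflat x /\ nrm x <= C * el].

Definition wF (i : Z) : Rn n * R -> Heis n := epsilon (inhabits (fun=> h0)) (wF_spec i).

Lemma wFP i : wF_spec i (wF i).
Proof.
apply: epsilon_spec; apply: ext => //; try exact: slice_lip.
exact: slice_step.
Qed.

(** Dilating by a variable factor is not Lipschitz in general, but it is on bounded sets of the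
    plane [y = 0], [z = 0]. The factor [cut] varies only where [wF] takes its values there, and it
    contracts the lateral faces to [h0]. *)
Definition cut (P : Rn n) : R := clamp (4 * (7 / 8 - nrm (unsc P))).

Lemma cut_bounds P : 0 <= cut P <= 1.
Proof. exact: clamp_bounds. Qed.

Lemma cut_lip P P' : Rabs (cut P - cut P') <= ds P P'.
Proof.
have h := Rle_trans _ _ _ (nrm_lip _ _ _) (unsc_ds P P').
have d0 := ds_pos _ P P'.
have i128 : / N <= / 128 by apply: Rinv_le_contravar; lra.
have {}h : Rabs (nrm (unsc P) - nrm (unsc P')) <= / 4 * ds P P'.
  by apply: Rle_trans h _; apply: Rmult_le_compat_r; lra.
apply: Rle_trans (clamp_lip _ _) _; move: h => /Rabs_le_between h; apply: Rabs_le; lra.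
Qed.

Definition wG (i : Z) (p : Rn n * R) : Heis n := dil (cut p.1) (wF i p).

Lemma wG_slice i P : wG i (P, 0) = slice i P /\ wG i (P, 1) = slice (i + 1)%ZZ P.
Proof.
have [_ e0 e1 _] := wFP i.
have h j : dil (cut P) (slice j P) = slice j P.
  have [ge|lt] : / 2 <= nrm (unsc P) \/ nrm (unsc P) < / 2 by lra.
    by rewrite slice_out // dil_h0.
  have -> : cut P = 1 by apply: clamp_ge1; lra.
  exact: dil1.
by rewrite /wG /= e0 e1 !h.
Qed.

Lemma wF_flat i P t : wall_dom n (P, t) -> 9 / 16 <= nrm (unsc P) ->
  exists x : Rn n, wF i (P, t) = hflat x /\ nrm x <= C * el.
Proof.
move=> [/= ht hw] hP; have [_ e0 e1 fl] := wFP i.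
have Cel : 0 <= C * el by apply: Rmult_le_pos; lra.
have i128 : / N <= / 128 by apply: Rinv_le_contravar; lra.
(* As [N >= 128], distance [4] becomes at most [1 / 16] under [unsc], and [9 / 16 - 1 / 16] is still
   outside the support of [a1]. *)
have out j P' : ds P P' <= 4 -> slice j P' = h0.
  move=> d; apply: slice_out.
  have := unsc_ds P P' => u; have := nrm_lip _ (unsc P) (unsc P') => /Rabs_le_between v.
  have : 2 * / N * ds P P' <= 2 * / 128 * 4.
    by apply: Rmult_le_compat; [lra|exact: ds_pos|lra|lra].
  lra.
have z : exists x : Rn n, h0 = hflat x /\ nrm x <= C * el.
  by exists (fun=> 0); split=> //; rewrite nrm0.
have self : ds P P <= 4 by rewrite ds_refl; lra.
have [hi|[e|e]] : 0 < t < 1 \/ t = 0 \/ t = 1 by lra.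
- apply: fl => //; last by move=> p' d; split; exact: out.
  by case: hw => [//|[h|h]]; lra.
- by rewrite e e0 out.
- by rewrite e e1 out.
Qed.

Lemma dil_flat r (x : Rn n) : dil r (hflat x) = hflat (fun l => r * x l).
Proof. by rewrite /dil /hflat /=; congr mkHeis; try apply: functional_extensionality => j; ring. Qed.

(** Up to radius [5 / 8] nothing is cut and from [9 / 16] on everything is flat. A pair that
    straddles this overlap is at distance at least [1], where moving the flat point by its own size
    [C * el] is affordable. *)
Lemma wG_lip i : Lip (wall_dom n) (2 * C * el) (wG i).
Proof.
have [[_ lF] _ _ _] := wFP i; have Cel : 0 <= C * el by apply: Rmult_le_pos; lra.
split; first lra.
have i128 : / N <= / 128 by apply: Rinv_le_contravar; lra.
have cut1 P : nrm (unsc P) <= 5 / 8 -> cut P = 1.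
  by move=> h; apply: clamp_ge1; lra.
have dP (u v : Rn n * R) : ds u.1 v.1 <= ds u v.
  by change (ds u.1 v.1 <= ds u.1 v.1 + ds u.2 v.2); have := ds_pos _ u.2 v.2; lra.
have mixed (u v : Rn n * R) : wall_dom n u -> wall_dom n v -> nrm (unsc u.1) <= 9 / 16 ->
    5 / 8 <= nrm (unsc v.1) -> ds (wG i u) (wG i v) <= 2 * C * el * ds u v.
  move=> Du Dv hu hv; have big : 1 <= ds u v.
    apply: Rle_trans (dP u v).
    have := unsc_ds u.1 v.1 => s; have := nrm_lip _ (unsc u.1) (unsc v.1) => /Rabs_le_between w.
    have : 2 * / N * ds u.1 v.1 <= 2 * / 128 * ds u.1 v.1.
      by apply: Rmult_le_compat_r; [exact: ds_pos|lra].
    lra.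
  have l1 := lF u v Du Dv; rewrite {1}/wG cut1 ?dil1; last lra.
  have Dv' : wall_dom n (v.1, v.2) by case: (v) Dv.
  have [x [ex nx]] : exists x : Rn n, wF i v = hflat x /\ nrm x <= C * el.
    by have := wF_flat i v.1 v.2 Dv'; case: (v) hv => [a b] /= hv; apply; lra.
  have l2 : ds (wF i v) (wG i v) <= C * el.
    rewrite /wG ex dil_flat ds_flat; have [k0 k1] := cut_bounds v.1.
    apply: rds_le => // l; have -> : x l - cut v.1 * x l = (1 - cut v.1) * x l by ring.
    rewrite -[C * el]Rmult_1_l; apply: Rabs_mul_le; first by apply: Rabs_le; lra.
    exact: Rle_trans (nrm_coord _ _ l) nx.
  have := ds_tri (wF i u) (wF i v) (wG i v); nra.
suff main (u v : Rn n * R) : wall_dom n u -> wall_dom n v ->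
    ds (wG i u) (wG i v) <= 2 * C * el * ds u v by exact: main.
move=> Du Dv.
have [hu|hu] : nrm (unsc u.1) <= 9 / 16 \/ 9 / 16 < nrm (unsc u.1) by lra.
all: have [hv|hv] : nrm (unsc v.1) <= 9 / 16 \/ 9 / 16 < nrm (unsc v.1) by lra.
- rewrite /wG !cut1 ?dil1; try lra.
  by apply: Rle_trans (lF u v Du Dv) _; have := ds_pos _ u v; nra.
- have [hv'|hv'] : nrm (unsc v.1) <= 5 / 8 \/ 5 / 8 <= nrm (unsc v.1) by lra.
    rewrite /wG !cut1 ?dil1; try lra.
    by apply: Rle_trans (lF u v Du Dv) _; have := ds_pos _ u v; nra.
  exact: mixed.
- have [hu'|hu'] : nrm (unsc u.1) <= 5 / 8 \/ 5 / 8 <= nrm (unsc u.1) by lra.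
    rewrite /wG !cut1 ?dil1; try lra.
    by apply: Rle_trans (lF u v Du Dv) _; have := ds_pos _ u v; nra.
  by rewrite ds_sym (ds_sym u); exact: mixed.
have lu := lF u v Du Dv.
case: u v Du Dv hu hv lu => [P t] [P' t'] Du Dv /= hu hv lu.
have [x [ex nx]] := wF_flat i P t Du (Rlt_le _ _ hu).
have [x' [ex' nx']] := wF_flat i P' t' Dv (Rlt_le _ _ hv).
rewrite ex ex' ds_flat in lu; rewrite /wG /= ex ex' !dil_flat ds_flat.
have [k0 k1] := cut_bounds P; have kl := cut_lip P P'; have dd := dP (P, t) (P', t').
have d0 := ds_pos _ (P, t) (P', t').
apply: rds_le => [|l]; first by apply: Rmult_le_pos; lra.
have -> : cut P * x l - cut P' * x' l = cut P * (x l - x' l) + (cut P - cut P') * x' l by ring.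
apply: Rle_trans (Rabs_triang _ _) _.
have t1 : Rabs (cut P * (x l - x' l)) <= 1 * (C * el * ds (P, t) (P', t')).
  apply: Rabs_mul_le; first by apply: Rabs_le; lra.
  exact: Rle_trans (rds_coord _ _ _ l) lu.
have t2 : Rabs ((cut P - cut P') * x' l) <= ds (P, t) (P', t') * (C * el).
  apply: Rabs_mul_le; first exact: Rle_trans kl dd.
  exact: Rle_trans (nrm_coord _ _ l) nx'.
lra.
Qed.

(* [a1] is dilated to the constant map through [N ^ 2] layers: a dilation moves points like the square
   root of its parameter, so that consecutive layers are [O(L / N)] apart. *)
Definition hgt (p : Rn n.+1) : R := (p ord0 + 1) / 2 * (N * N).
Definition resc (p : Rn n.+1) : Rn n := fun l => N * (tl p l + 1) / 2.
Definition aJ (p : Rn n.+1) : Heis n := wG (flr (hgt p)) (resc p, hgt p - IZR (flr (hgt p))).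

Lemma flr_unique (z : Z) x : IZR z <= x < IZR z + 1 -> flr x = z.
Proof.
move=> h; have h' := flr_bounds x.
have l1 : (z < flr x + 1)%ZZ by apply: lt_IZR; rewrite plus_IZR; lra.
have l2 : (flr x < z + 1)%ZZ by apply: lt_IZR; rewrite plus_IZR; lra.
lia.
Qed.

(** Adjacent layers agree on their common slice, so at an integral height the layer below may be
    used as well. *)
Lemma aJ_layer (p : Rn n.+1) (i : Z) t : hgt p = IZR i + t -> 0 <= t <= 1 ->
  aJ p = wG i (resc p, t).
Proof.
move=> e ht; have [lt|t1] : t < 1 \/ t = 1 by lra.
  have f : flr (hgt p) = i by apply: flr_unique; lra.
  by rewrite /aJ f e; congr (wG _ (_, _)); ring.
have e' : hgt p = IZR (i + 1) by rewrite plus_IZR; lra.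
have f : flr (hgt p) = (i + 1)%ZZ by apply: flr_unique; lra.
rewrite t1 /aJ f e' Rminus_diag.
by rewrite (proj1 (wG_slice _ _)) (proj2 (wG_slice _ _)).
Qed.

Lemma resc_ds p p' : ds (resc p) (resc p') <= N / 2 * ds p p'.
Proof.
apply: rds_le => [|l]; first by apply: Rmult_le_pos; [lra|exact: ds_pos].
have -> : resc p l - resc p' l = N / 2 * (tl p l - tl p' l) by rewrite /resc; field.
rewrite Rabs_mult Rabs_right; last lra.
by apply: Rmult_le_compat_l; [lra|exact: (rds_coord _ _ _ (lift ord0 l))].
Qed.

Lemma unsc_resc p : unsc (resc p) = tl p.
Proof. by apply: functional_extensionality => l; rewrite /unsc /resc; field; lra. Qed.

Definition Jset (p : Rn n.+1) : Prop := nrm p <= 1 /\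
  ((exists z : Z, p ord0 = -1 + 2 * IZR z / (N * N)) \/
   (exists l, exists z : Z, tl p l = -1 + 2 * IZR z / N)).

Lemma Jset_wall p : Jset p -> wall_dom n (resc p, hgt p - IZR (flr (hgt p))).
Proof.
move=> [hp hJ]; have := flr_bounds (hgt p) => fb; split=> /=; first lra.
case: hJ => [[z e]|[l [z e]]].
  right; left; have e' : hgt p = IZR z by rewrite /hgt e; field; lra.
  by rewrite (flr_unique z) e'; lra.
by left; exists l, z; rewrite /resc e; field; lra.
Qed.

(** Points of different layers are joined through the top slice of the lower layer and the bottom
    slice of the upper one. If these slices differ, then [N * N * ds p p' >= 1] and the crude bound
    [2 * L] between slices suffices. *)
Lemma aJ_lip : Lip Jset (4 * (C + 1) * N * N * L) aJ.
Proof.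
have Cel : 0 <= C * el by apply: Rmult_le_pos; lra.
have NNL : 0 <= N * N * L by apply: Rmult_le_pos; nra.
have NN1 : N <= N * N by nra.
split; first by have := Rmult_le_pos _ _ C0 NNL; lra.
have elL : el <= L by rewrite /el; apply: (Rmult_le_reg_r N); [lra|rewrite /Rdiv Rmult_assoc Rinv_l]; nra.
have CelL : C * el <= C * L by apply: Rmult_le_compat_l.
have main p p' : Jset p -> Jset p' -> (flr (hgt p) <= flr (hgt p'))%ZZ ->
    ds (aJ p) (aJ p') <= 4 * (C + 1) * N * N * L * ds p p'.
  move=> Jp Jp' le; have d0 := ds_pos _ p p'.
  have dr := resc_ds p p'.
  have dh : Rabs (hgt p - hgt p') <= N * N / 2 * ds p p'.
    have -> : hgt p - hgt p' = N * N / 2 * (p ord0 - p' ord0) by rewrite /hgt; field.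
    rewrite Rabs_mult Rabs_right; last nra.
    by apply: Rmult_le_compat_l; [nra|exact: rds_coord].
  have wp := Jset_wall p Jp; have wp' := Jset_wall p' Jp'.
  have fb := flr_bounds (hgt p); have fb' := flr_bounds (hgt p').
  set i := flr (hgt p) in le wp fb *; set i' := flr (hgt p') in le wp' fb' *.
  have dr' : ds (resc p) (resc p') <= N * N / 2 * ds p p'.
    by apply: Rle_trans dr _; apply: Rmult_le_compat_r; lra.
  set D := ds p p' in d0 dr dh dr' *; have ND : 0 <= N * N * D by nra.
  have fin x : x <= (2 * C * el + 2 * L) * (N * N * D) -> x <= 4 * (C + 1) * N * N * L * D.
    move=> hx; apply: Rle_trans hx _.
    have -> : 4 * (C + 1) * N * N * L * D = (4 * (C * L) + 4 * L) * (N * N * D) by ring.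
    by apply: Rmult_le_compat_r; lra.
  have [eq|lt] : i = i' \/ (i + 1 <= i')%ZZ by lia.
    apply: fin; rewrite /aJ -/i -/i' -eq; rewrite -eq in wp'.
    apply: Rle_trans (proj2 (wG_lip i) _ _ wp wp') _.
    have e : ds (resc p, hgt p - IZR i) (resc p', hgt p' - IZR i) =
      ds (resc p) (resc p') + Rabs (hgt p - IZR i - (hgt p' - IZR i)) by [].
    have e2 : hgt p - IZR i - (hgt p' - IZR i) = hgt p - hgt p' by ring.
    rewrite e2 in e; have : ds (resc p, hgt p - IZR i) (resc p', hgt p' - IZR i) <= N * N * D by lra.
    move=> h; have := Rmult_le_compat_l (2 * C * el) _ _ ltac:(lra) h.
    by have := Rmult_le_pos _ _ (Rlt_le _ _ L0) ND; lra.
  have le_i := IZR_le _ _ lt; rewrite plus_IZR in le_i.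
  have hd : hgt p' - hgt p <= N * N / 2 * D.
    by apply: Rle_trans dh; rewrite Rabs_minus_sym; exact: Rle_abs.
  have top : wall_dom n (resc p, 1) by split=> /=; [lra|tauto].
  have bot : wall_dom n (resc p', 0) by split=> /=; [lra|tauto].
  have s1 := proj2 (wG_lip i) _ _ wp top; have s3 := proj2 (wG_lip i') _ _ bot wp'.
  have e1 : ds (resc p, hgt p - IZR i) (resc p, 1) = ds (resc p) (resc p) + Rabs (hgt p - IZR i - 1) by [].
  have e3 : ds (resc p', 0) (resc p', hgt p' - IZR i') = ds (resc p') (resc p') + Rabs (0 - (hgt p' - IZR i')) by [].
  rewrite ds_refl Rabs_left1 in e1; last lra.
  rewrite ds_refl Rabs_left1 in e3; last lra.
  rewrite e1 (proj2 (wG_slice _ _)) in s1; rewrite e3 (proj1 (wG_slice _ _)) in s3.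
  have s2 : ds (slice (i + 1)%ZZ (resc p)) (slice i' (resc p')) <= 2 * L * (N * N * D).
    have [eq|lt'] : (i' = i + 1 \/ i + 2 <= i')%ZZ by lia.
      rewrite -eq; apply: Rle_trans (proj2 (slice_lip i') _ _ I I) _.
      apply: Rle_trans (_ : L * (N * N / 2 * D) <= _).
        apply: Rmult_le_compat => //; [lra|exact: ds_pos].
      by have := Rmult_le_pos _ _ (Rlt_le _ _ L0) ND; lra.
    have := IZR_le _ _ lt'; rewrite plus_IZR => l2.
    have one : 1 <= N * N * D by lra.
    have b1 := slice_bound (i + 1)%ZZ (resc p); have b2 := slice_bound i' (resc p').
    rewrite ds_sym in b1; have tr := ds_tri (slice (i + 1)%ZZ (resc p)) h0 (slice i' (resc p')).
    by apply: Rle_trans tr _; have := Rmult_le_compat_l (2 * L) _ _ ltac:(lra) one; lra.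
  apply: fin.
  have t1 := ds_tri (aJ p) (slice (i + 1)%ZZ (resc p)) (aJ p').
  have t2 := ds_tri (slice (i + 1)%ZZ (resc p)) (slice i' (resc p')) (aJ p').
  have sum : (1 + IZR i - hgt p) + (hgt p' - IZR i') <= N * N * D by lra.
  have := Rmult_le_compat_l (2 * C * el) _ _ ltac:(lra) sum => m.
  apply: Rle_trans t1 _; apply: Rle_trans (Rplus_le_compat _ _ _ _ s1 (Rle_trans _ _ _ t2 (Rplus_le_compat _ _ _ _ s2 s3))) _.
  lra.
move=> p p' Jp Jp'; case: (Z.le_ge_cases (flr (hgt p)) (flr (hgt p'))) => h; first exact: main.
by rewrite ds_sym (ds_sym p); exact: main.
Qed.

Lemma aJ_top p : p ord0 = 1 -> aJ p = a1 (tl p).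
Proof.
move=> e; have qN : IZR (Z.of_nat (2 ^ (q + q))%N) = N * N.
  rewrite -INR_IZR_INZ /N -pow_add.
  change (q + q)%coq_nat with (q + q)%N; elim: (q + q)%N => [//|m IH].
  by rewrite expnS mult_INR IH.
have h : hgt p = IZR (Z.of_nat (2 ^ (q + q))%N) + 0 by rewrite qN /hgt e; field.
rewrite (aJ_layer p _ 0 h); last lra.
rewrite (proj1 (wG_slice _ _)) /slice unsc_resc /lam qN.
have -> : N * N / (N * N) = 1 by field; lra.
by rewrite clamp_ge1 ?dil1 //; lra.
Qed.

(** The lateral faces are contracted by [cut], the bottom face by the dilation factor
    [lam 0 = 0]. *)
Lemma aJ_rest p : bdy p -> p ord0 <> 1 -> aJ p = h0.
Proof.
move=> bp p0; have [b eb] := nrm_attained _ p; rewrite bp in eb.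
have := nrm_coord _ p ord0; rewrite bp => /Rabs_le_between p01.
case: (unliftP ord0 b) eb => [l ->|->] eb.
  have n1 : 1 <= nrm (unsc (resc p)).
    by rewrite unsc_resc eb; exact: (nrm_coord _ (tl p) l).
  rewrite /aJ /wG /=; have -> : cut (resc p) = 0 by apply: clamp_le0; lra.
  exact: dil0.
have e : p ord0 = -1 by move: eb; rewrite /Rabs; case: Rcase_abs => ? ?; lra.
have h : hgt p = IZR 0 + 0 by rewrite /hgt e; field.
rewrite (aJ_layer p 0%ZZ 0 h); last lra.
rewrite (proj1 (wG_slice _ _)) /slice /lam.
have -> : 0 / (N * N) = 0 by field; lra.
by rewrite clamp_le0 ?dil0 //; lra.
Qed.

Definition small_box (j : Z) (z : 'I_n -> Z) (w : Rn n.+1) : Rn n.+1 := fun b =>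
  if unlift ord0 b is Some l then -1 + (2 * IZR (z l) + 1 + w b) / N
  else -1 + (2 * IZR j + 1 + w b) / (N * N).

(** A box is one unit cell times one layer, so in box coordinates the constant [2 * C * el] of [wG]
    survives without the factors of [aJ_lip]. *)
Lemma aJ_small j z : Lip bdy (4 * C * L / N) (fun w => aJ (small_box j z w)).
Proof.
have Cel : 0 <= C * el by apply: Rmult_le_pos; lra.
have e4 : 4 * C * L / N = 2 * C * el by rewrite /el; field; lra.
rewrite e4; split; first lra.
have bd (w : Rn n.+1) b : bdy w -> -1 <= w b <= 1.
  by move=> bw; have := nrm_coord _ w b; rewrite bw => /Rabs_le_between.
have ly (w : Rn n.+1) : bdy w -> aJ (small_box j z w) = wG j (resc (small_box j z w), (1 + w ord0) / 2).
  move=> bw; apply: aJ_layer; last by have := bd w ord0 bw; lra.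
  by rewrite /hgt /small_box unlift_none; field; lra.
have rs (w : Rn n.+1) l : resc (small_box j z w) l = IZR (z l) + (1 + tl w l) / 2.
  by rewrite /resc /tl /small_box liftK; field; lra.
have dom (w : Rn n.+1) : bdy w -> wall_dom n (resc (small_box j z w), (1 + w ord0) / 2).
  move=> bw; split=> /=; first by have := bd w ord0 bw; lra.
  have [b eb] := nrm_attained _ w; rewrite bw in eb.
  have hb : w b = 1 \/ w b = -1 by move: eb; rewrite /Rabs; case: Rcase_abs => ? ?; lra.
  case: (unliftP ord0 b) hb => [l ->|->] hb; last by right; lra.
  left; exists l; rewrite rs /tl; case: hb => ->; [exists (z l + 1)%ZZ|exists (z l)].
    by rewrite plus_IZR; lra.
  lra.
move=> w w' bw bw'; rewrite !ly //.
apply: Rle_trans (proj2 (wG_lip j) _ _ (dom w bw) (dom w' bw')) _.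
apply: Rmult_le_compat_l; first lra.
have e : ds (resc (small_box j z w), (1 + w ord0) / 2) (resc (small_box j z w'), (1 + w' ord0) / 2)
  = ds (resc (small_box j z w)) (resc (small_box j z w')) + Rabs ((1 + w ord0) / 2 - (1 + w' ord0) / 2) by [].
have d0 := ds_pos _ w w'.
have h1 : ds (resc (small_box j z w)) (resc (small_box j z w')) <= / 2 * ds w w'.
  apply: rds_le => [|l]; first lra.
  rewrite !rs; have -> : IZR (z l) + (1 + tl w l) / 2 - (IZR (z l) + (1 + tl w' l) / 2) =
    / 2 * (tl w l - tl w' l) by field.
  rewrite Rabs_mult Rabs_right; last lra.
  by apply: Rmult_le_compat_l; [lra|exact: (rds_coord _ _ _ (lift ord0 l))].
have h2 : Rabs ((1 + w ord0) / 2 - (1 + w' ord0) / 2) <= / 2 * ds w w'.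
  have -> : (1 + w ord0) / 2 - (1 + w' ord0) / 2 = / 2 * (w ord0 - w' ord0) by field.
  rewrite Rabs_mult Rabs_right; last lra.
  by apply: Rmult_le_compat_l; [lra|exact: rds_coord].
rewrite e; lra.
Qed.

End AlphaJ.

Theorem grid_extension n : (0 < n)%N -> exists C, 0 <= C /\
  forall q L (a1 : Rn n -> Heis n), 128 <= 2 ^ q -> 0 < L -> Lip (fun=> True) L a1 ->
  (forall p, / 2 <= nrm p -> a1 p = h0) ->
  exists A : Rn n.+1 -> Heis n, [/\ Lip (Jset n q) (C * 2 ^ q * 2 ^ q * L) A,
    forall p, p ord0 = 1 -> A p = a1 (tl p),
    forall p, bdy p -> p ord0 <> 1 -> A p = h0 &
    forall j z, Lip bdy (C * L / 2 ^ q) (fun w => A (small_box n q j z w))].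
Proof.
move=> n0; have [C [C0 ext]] := wall_extension n.
exists (4 * (C + 1)); split; first lra.
move=> q L a1 N128 L0 l1 out.
exists (aJ n C q L a1); split.
- exact: aJ_lip.
- exact: aJ_top.
- exact: aJ_rest.
- move=> j z; apply: Lip_weak (aJ_small n n0 C C0 ext q L a1 N128 L0 l1 out j z).
  have : 0 <= L / 2 ^ q by apply: Rmult_le_pos; [lra|apply/Rlt_le/Rinv_0_lt_compat; lra].
  by rewrite /Rdiv; lra.
Qed.

(** * Lipschitz homotopies *)

Definition cub {m} (u : Rn m) : Prop := nrm u <= 1.
Definition nu {m} (u : Rn m) : Rn m := fun i => u i * / nrm u.

Lemma nu_nrm m (u : Rn m) : 0 < nrm u -> nrm (nu u) = 1.
Proof.
move=> u0; have i0 : 0 < / nrm u by exact: Rinv_0_lt_compat.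
have -> : nu u = fun i => / nrm u * u i by apply: functional_extensionality => i; rewrite /nu; ring.
by rewrite nrm_scal Rabs_right; [rewrite Rinv_l; lra|lra].
Qed.

Lemma nu_bdy m (u : Rn m) : bdy u -> nu u = u.
Proof. by move=> b; apply: functional_extensionality => i; rewrite /nu b; field. Qed.

Lemma nu_scal m c (u : Rn m) : 0 < c -> 0 < nrm u -> nu (fun i => c * u i) = nu u.
Proof.
move=> c0 u0; apply: functional_extensionality => i.
by rewrite /nu nrm_scal (Rabs_right c); [field; lra|lra].
Qed.

(** The factor [nrm u] offsets the blow-up of [nu] at the origin; this is why cones over Lipschitz
    maps are Lipschitz. *)
Lemma nu_diff m (u v : Rn m) : 0 < nrm u -> 0 < nrm v ->
  nrm u * ds (nu u) (nu v) <= 2 * ds u v.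
Proof.
move=> u0 v0; have d0 := ds_pos _ u v.
have h : ds (nu u) (nu v) <= 2 * ds u v * / nrm u.
  have iu := Rinv_0_lt_compat _ u0; apply: rds_le => [|i]; first by apply: Rmult_le_pos; lra.
  have -> : nu u i - nu v i = ((u i - v i) + v i * / nrm v * (nrm v - nrm u)) * / nrm u.
    by rewrite /nu; field; lra.
  rewrite Rabs_mult (Rabs_right (/ nrm u)); last lra.
  apply: Rmult_le_compat_r; first lra.
  apply: Rle_trans (Rabs_triang _ _) _.
  have h1 : Rabs (v i * / nrm v * (nrm v - nrm u)) <= 1 * ds u v.
    apply: Rabs_mul_le; last by rewrite ds_sym; exact: nrm_lip.
    by have := nrm_coord _ (nu v) i; rewrite nu_nrm.
  by have := rds_coord _ u v i; lra.
apply: Rle_trans (Rmult_le_compat_l _ _ _ (Rlt_le _ _ u0) h) _.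
by right; field; lra.
Qed.

Lemma nu_lipx m c : 0 < c -> lipx (fun u : Rn m => c <= nrm u) (@nu m).
Proof.
move=> c0; exists (2 / c); split.
  by apply: Rmult_le_pos; [lra|apply/Rlt_le/Rinv_0_lt_compat].
move=> u v hu hv; have h : nrm u * ds (nu u) (nu v) <= 2 * ds u v by apply: nu_diff; lra.
apply: (Rmult_le_reg_l c) => //; have -> : c * (2 / c * ds u v) = 2 * ds u v by field; lra.
by apply: Rle_trans h; apply: Rmult_le_compat_r => //; exact: ds_pos.
Qed.

Lemma cone_lipx m (f : Rn m -> R) : lipx bdy f -> bnd bdy f ->
  lipx (fun=> True) (fun u => nrm u * f (nu u)).
Proof.
move=> [L [L0 hL]] [M hM]; exists (2 * L + Rabs M); split.
  by have := Rabs_pos M; lra.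
move=> u v _ _; rewrite Rds; have d0 := ds_pos _ u v.
have base w z : nrm w = 0 -> Rabs (nrm w * f (nu w) - nrm z * f (nu z)) <= (2 * L + Rabs M) * ds w z.
  move=> w0; rewrite w0; have := nrm_lip _ z w; rewrite w0 Rminus_0_r ds_sym => h.
  have z0 := nrm_pos _ z; rewrite Rabs_right in h; last lra.
  have [e|p] : nrm z = 0 \/ 0 < nrm z by lra.
    by rewrite e !Rmult_0_l Rminus_diag Rabs_R0; apply: Rmult_le_pos; [have := Rabs_pos M; lra|exact: ds_pos].
  have -> : 0 * f (nu w) - nrm z * f (nu z) = - (nrm z * f (nu z)) by ring.
  rewrite Rabs_Ropp; apply: Rle_trans (_ : ds w z * Rabs M <= _).
    apply: Rabs_mul_le; first by rewrite Rabs_right; lra.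
    by apply: Rle_trans (hM _ (nu_nrm _ _ p)) (Rle_abs _).
  by have := Rabs_pos M; have := ds_pos _ w z; nra.
have u0 := nrm_pos _ u; have v0 := nrm_pos _ v.
have [e|p] : nrm u = 0 \/ 0 < nrm u by lra.
  exact: base.
have [e'|p'] : nrm v = 0 \/ 0 < nrm v by lra.
  by rewrite Rabs_minus_sym ds_sym; exact: base.
have -> : nrm u * f (nu u) - nrm v * f (nu v) =
  nrm u * (f (nu u) - f (nu v)) + (nrm u - nrm v) * f (nu v) by ring.
apply: Rle_trans (Rabs_triang _ _) _; rewrite Rabs_mult (Rabs_right (nrm u)); last lra.
have h1 := hL _ _ (nu_nrm _ _ p) (nu_nrm _ _ p'); rewrite Rds in h1.
have h2 := nu_diff _ u v p p'.
have h3 : nrm u * Rabs (f (nu u) - f (nu v)) <= L * (2 * ds u v).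
  apply: Rle_trans (Rmult_le_compat_l _ _ _ u0 h1) _.
  have -> : nrm u * (L * ds (nu u) (nu v)) = L * (nrm u * ds (nu u) (nu v)) by ring.
  exact: Rmult_le_compat_l.
have h4 : Rabs ((nrm u - nrm v) * f (nu v)) <= ds u v * Rabs M.
  apply: Rabs_mul_le; first exact: nrm_lip.
  by apply: Rle_trans (hM _ (nu_nrm _ _ p')) (Rle_abs _).
lra.
Qed.

Lemma lip_continuity (f : R -> R) L : (forall x y, Rabs (f x - f y) <= L * Rabs (x - y)) ->
  continuity f.
Proof.
move=> h x eps eps0; have L0 : 0 <= Rabs L by exact: Rabs_pos.
exists (eps / (Rabs L + 1)); split; first by apply: Rdiv_lt_0_compat; lra.
move=> y [_]; rewrite /dist /= /R_dist => lt.
apply: Rle_lt_trans (h y x) _; apply: Rle_lt_trans (_ : (Rabs L + 1) * Rabs (y - x) < _).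
  by apply: Rmult_le_compat_r; [exact: Rabs_pos|have := Rle_abs L; lra].
have -> : eps = (Rabs L + 1) * (eps / (Rabs L + 1)) by field; lra.
by apply: Rmult_lt_compat_l; lra.
Qed.

Definition lerp {m} (u v : Rn m) (s : R) : Rn m := fun i => u i + s * (v i - u i).

(** Distance is additive along a segment, so the point supplied by the intermediate value theorem is
    no detour at all. *)
Lemma seg_bridge m (g : Rn m -> R) L (u v : Rn m) c : (forall x y, Rabs (g x - g y) <= L * ds x y) ->
  (g u <= c <= g v \/ g v <= c <= g u) ->
  exists s, 0 <= s <= 1 /\ g (lerp u v s) = c /\
    ds u (lerp u v s) + ds (lerp u v s) v <= ds u v.
Proof.
move=> gl hc; pose w s : Rn m := lerp u v s.
have dw s s' : ds (w s) (w s') = Rabs (s - s') * ds u v.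
  have -> : ds (w s) (w s') = nrm (fun i => (s - s') * (v i - u i)).
    by rewrite /ds /=; congr nrm; apply: functional_extensionality => i; rewrite /w /lerp; ring.
  by rewrite nrm_scal (ds_sym u).
have w0 : w 0 = u by apply: functional_extensionality => i; rewrite /w /lerp; ring.
have w1 : w 1 = v by apply: functional_extensionality => i; rewrite /w /lerp; ring.
have cont : continuity (fun s => g (w s)).
  apply: (lip_continuity _ (L * ds u v)) => s s'; apply: Rle_trans (gl _ _) _.
  by rewrite dw; right; ring.
have [s [hs gs]] : {s | Rmin 0 1 <= s <= Rmax 0 1 /\ g (w s) = c}.
  apply: (IVT_gen (fun s => g (w s)) 0 1 c cont); rewrite w0 w1.
  by case: hc => h; [rewrite Rmin_left ?Rmax_right|rewrite Rmin_right ?Rmax_left]; lra.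
rewrite Rmin_left ?Rmax_right in hs; try lra.
exists s; split=> //; split=> //; rewrite -/(w s).
have e0 := dw 0 s; have e1 := dw s 1; rewrite w0 in e0; rewrite w1 in e1.
by rewrite e0 e1 Rabs_left1 ?(Rabs_left1 (s - 1)); lra.
Qed.

Lemma cub_seg m (u v : Rn m) s : cub u -> cub v -> 0 <= s <= 1 ->
  cub (lerp u v s).
Proof.
move=> hu hv hs; apply: nrm_le => [|i]; first lra.
have := Rle_trans _ _ _ (nrm_coord _ u i) hu => /Rabs_le_between a.
have := Rle_trans _ _ _ (nrm_coord _ v i) hv => /Rabs_le_between b.
by apply: Rabs_le; rewrite /lerp; nra.
Qed.

Lemma cub_glue (Y : Met) m (g : Rn m -> R) L c (f : Rn m -> Y) :
  (forall x y, Rabs (g x - g y) <= L * ds x y) ->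
  lipx (fun u => cub u /\ g u <= c) f -> lipx (fun u => cub u /\ c <= g u) f -> lipx cub f.
Proof.
move=> gl h1 h2; apply: (lipx_glue _ _ 1 _ (fun u => g u <= c) (fun u => c <= g u)) => //.
  by move=> u _; lra.
move=> u v cu cv hu hv.
have [s [hs [gs le]]] := seg_bridge _ g L u v c gl (or_introl (conj hu hv)).
exists (lerp u v s); split; first exact: cub_seg.
by rewrite gs; split; [lra|split; [lra|rewrite Rmult_1_l]].
Qed.

(** * Lipschitz homotopies into the boundary of a cube *)

Definition cyl {X : Met} (D : X -> Prop) (q : X * R) : Prop := D q.1 /\ 0 <= q.2 <= 1.

Definition htpy {X : Met} {m} (D : X -> Prop) (f g : X -> Rn m) : Prop :=
  exists H : X * R -> Rn m, [/\ lipx (cyl D) H, forall q, cyl D q -> bdy (H q),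
    forall u, D u -> H (u, 0) = f u & forall u, D u -> H (u, 1) = g u].

Section Htpy.
Variables (X : Met) (m : nat) (D : X -> Prop).
Implicit Types f g h : X -> Rn m.

Lemma cyl_lin (a b : R) : lipx (cyl D) (fun q : X * R => (q.1, a * q.2 + b)).
Proof.
apply: lipx_pair; first exact: lipx_fst.
apply: lipx_add; last exact: lipx_cst.
by apply: lipx_scal; exact: lipx_snd.
Qed.

Lemma htpy_sym f g : htpy D f g -> htpy D g f.
Proof.
move=> [H [lH bH H0 H1]]; exists (fun q => H (q.1, -1 * q.2 + 1)); split.
- apply: (lipx_comp _ _ _ _ (cyl D) _ H _ (cyl_lin (-1) 1)) => // q [/= Dq hq].
  by split=> //=; lra.
- by move=> q [Dq hq]; apply: bH; split=> //=; lra.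
- by move=> u Du /=; rewrite -H1 //; congr (H (_, _)); ring.
- by move=> u Du /=; rewrite -H0 //; congr (H (_, _)); ring.
Qed.

Lemma htpy_trans f g h : htpy D f g -> htpy D g h -> htpy D f h.
Proof.
move=> [H [lH bH H0 H1]] [K [lK bK K0 K1]].
pose J q := if Rle_dec q.2 (/ 2) then H (q.1, 2 * q.2 + 0) else K (q.1, 2 * q.2 + -1).
have J1 q : q.2 <= / 2 -> J q = H (q.1, 2 * q.2 + 0) by rewrite /J; case: Rle_dec.
have J2 q : D q.1 -> / 2 <= q.2 -> J q = K (q.1, 2 * q.2 + -1).
  rewrite /J => Dq le; case: Rle_dec => //= le'; have -> : q.2 = / 2 by lra.
  have -> : 2 * / 2 + 0 = 1 by lra.
  have -> : 2 * / 2 + -1 = 0 by lra.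
  by rewrite H1 // K0.
exists J; split.
- apply: (lipx_glue _ _ 1 _ (fun q => q.2 <= / 2) (fun q => / 2 <= q.2)).
  + by move=> [u s] _ /=; lra.
  + move=> [u s] [v t] [/= Du hs] [/= Dv ht] h1 h2; exists (u, / 2); split; first by split=> //=; lra.
    split=> [/=|]; first lra; split=> [/=|]; first lra.
    change (ds u u + Rabs (s - / 2) + (ds u v + Rabs (/ 2 - t)) <= 1 * (ds u v + Rabs (s - t))).
    rewrite ds_refl !Rabs_left1; lra.
  + apply: (lipx_eq _ _ _ (fun q => H (q.1, 2 * q.2 + 0))) => [q [_ h1]|]; first by rewrite J1.
    apply: (lipx_comp _ _ _ _ (cyl D) _ H) lH => [q [[Dq hq] /= h1]|]; first by split=> //=; lra.
    by apply: lipx_sub (cyl_lin 2 0) => q [].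
  + apply: (lipx_eq _ _ _ (fun q => K (q.1, 2 * q.2 + -1))) => [q [[Dq _] h1]|]; first by rewrite J2.
    apply: (lipx_comp _ _ _ _ (cyl D) _ K) lK => [q [[Dq hq] /= h1]|]; first by split=> //=; lra.
    by apply: lipx_sub (cyl_lin 2 (-1)) => q [].
- move=> q [Dq hq]; case: (Rle_dec q.2 (/ 2)) => le.
    by rewrite J1 //; apply: bH; split=> //=; lra.
  by rewrite J2 //; [apply: bK; split=> //=; lra|lra].
- by move=> u Du; rewrite J1 /=; [rewrite -H0 //; congr (H (_, _)); ring|lra].
- by move=> u Du; rewrite J2 //=; [rewrite -K1 //; congr (K (_, _)); ring|lra].
Qed.

Lemma htpy_post p (E : Rn m -> Rn p) f g : lipx bdy E -> (forall u, bdy u -> bdy (E u)) ->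
  htpy D f g -> htpy D (fun u => E (f u)) (fun u => E (g u)).
Proof.
move=> lE bE [H [lH bH H0 H1]]; exists (fun q => E (H q)); split.
- exact: (lipx_comp _ _ _ _ bdy H E bH lH lE).
- by move=> q cq; apply/bE/bH.
- by move=> u Du; rewrite H0.
- by move=> u Du; rewrite H1.
Qed.

Lemma htpy_pre (Y : Met) (D' : Y -> Prop) (phi : Y -> X) f g : lipx D' phi ->
  (forall u, D' u -> D (phi u)) -> htpy D f g -> htpy D' (fun u => f (phi u)) (fun u => g (phi u)).
Proof.
move=> lp dp [H [lH bH H0 H1]]; exists (fun q => H (phi q.1, q.2)); split.
- apply: (lipx_comp _ _ _ _ (cyl D) _ H) lH => [q [Dq hq]|]; first by split=> //=; exact: dp.
  apply: lipx_pair; last exact: lipx_snd.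
  by apply: (lipx_comp _ _ _ _ D' fst phi) lp; [move=> q []|exact: lipx_fst].
- by move=> q [Dq hq]; apply: bH; split=> //=; exact: dp.
- by move=> u Du; rewrite H0 //; exact: dp.
- by move=> u Du; rewrite H1 //; exact: dp.
Qed.

Lemma htpy_eq f g f' g' : (forall u, D u -> f u = f' u) -> (forall u, D u -> g u = g' u) ->
  htpy D f g -> htpy D f' g'.
Proof.
move=> ef eg [H [lH bH H0 H1]]; exists H; split=> //.
- by move=> u Du; rewrite H0 // ef.
- by move=> u Du; rewrite H1 // eg.
Qed.

Lemma htpy_line f g c : 0 < c -> lipx D f -> lipx D g ->
  bnd D (fun u => nrm (f u)) -> bnd D (fun u => nrm (g u)) ->
  (forall u s, D u -> 0 <= s <= 1 -> c <= nrm (fun i => (1 - s) * f u i + s * g u i)) ->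
  htpy D (fun u => nu (f u)) (fun u => nu (g u)).
Proof.
move=> c0 lf lg bf bg far.
pose G (q : X * R) : Rn m := fun i => (1 - q.2) * f q.1 i + q.2 * g q.1 i.
have b2 : bnd (cyl D) (fun q => q.2).
  by exists 1 => q [_ h] /=; apply: Rabs_le; lra.
have b2' : bnd (cyl D) (fun q => 1 - q.2).
  by exists 1 => q [_ h] /=; apply: Rabs_le; lra.
have l2 : lipx (cyl D) (fun q : X * R => q.2) by exact: lipx_snd.
have l2' : lipx (cyl D) (fun q : X * R => 1 - q.2) by apply: lipx_minus => //; exact: lipx_cst.
have comp (k : X -> Rn m) i : lipx D k -> bnd D (fun u => nrm (k u)) ->
    lipx (cyl D) (fun q : X * R => k q.1 i) /\ bnd (cyl D) (fun q => k q.1 i).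
  move=> lk bk; split.
    apply: (lipx_app _ _ _ (fun q : X * R => k q.1) i).
    apply: (lipx_comp _ _ _ _ D fst k) lk; first by move=> q [].
    exact: lipx_fst.
  by have [M hM] := bnd_nrm_coord _ _ _ _ i bk; exists M => q [Dq _]; exact: hM.
have lG : lipx (cyl D) G.
  apply: lipx_vec => i; have [f1 f2] := comp f i lf bf; have [g1 g2] := comp g i lg bg.
  by apply: lipx_add; exact: lipx_mul.
have gG q : cyl D q -> c <= nrm (G q) by move=> [Dq hq]; exact: far.
exists (fun q => nu (G q)); split.
- exact: (lipx_comp _ _ _ _ (fun u => c <= nrm u) G (@nu m) gG lG (nu_lipx m c c0)).
- by move=> q /gG h; apply: nu_nrm; lra.
- by move=> u Du; congr nu; apply: functional_extensionality => i; rewrite /G /=; ring.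
- by move=> u Du; congr nu; apply: functional_extensionality => i; rewrite /G /=; ring.
Qed.

End Htpy.

Lemma nrm_lip1 m (x y : Rn m) : Rabs (nrm x - nrm y) <= 1 * ds x y.
Proof. by rewrite Rmult_1_l; exact: nrm_lip. Qed.

Lemma scal_lipx m (D : Rn m -> Prop) c : lipx D (fun u : Rn m => (fun i => c * u i) : Rn m).
Proof. by apply: lipx_vec => i; apply: lipx_scal; exact: lipx_coord. Qed.

(* Inserting a homotopy in the collar th <= |u| <= 1 changes the boundary map. *)
Lemma collar_ext m p (f g Q : Rn m -> Rn p) th : 0 < th < 1 -> htpy bdy f g ->
  lipx cub Q -> (forall u, bdy u -> Q u = g u) ->
  exists Q' : Rn m -> Rn p, [/\ lipx cub Q', forall u, bdy u -> Q' u = f u,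
    forall v, cub v -> Q' (fun i => th * v i) = Q v &
    forall u, th <= nrm u <= 1 -> bdy (Q' u)].
Proof.
move=> hth [H [lH bH H0 H1]] lQ Qg; have ith : 0 < / th by apply: Rinv_0_lt_compat; lra.
have i1 : 0 < / (1 - th) by apply: Rinv_0_lt_compat; lra.
pose par (u : Rn m) := (nu u, / (1 - th) * (1 - nrm u)).
pose Q' u := if Rle_dec th (nrm u) then H (par u) else Q (fun i => / th * u i).
have par_dom u : th <= nrm u <= 1 -> cyl bdy (par u).
  move=> hu; split; first by apply: nu_nrm; lra.
  have h : / (1 - th) * (1 - th) = 1 by rewrite Rinv_l; lra.
  by split=> /=; [apply: Rmult_le_pos; lra|nra].
have Qin u : nrm u <= th -> Q' u = Q (fun i => / th * u i).
  move=> hu; rewrite /Q'; case: Rle_dec => //= h; have e : nrm u = th by lra.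
  have -> : par u = ((fun i => / th * u i) : Rn m, 1).
    rewrite /par e; congr (_, _); last by rewrite Rinv_l; lra.
    by apply: functional_extensionality => i; rewrite /nu e; ring.
  have b : bdy ((fun i => / th * u i) : Rn m).
    by rewrite /bdy nrm_scal e Rabs_right; [rewrite Rinv_l|]; lra.
  by rewrite H1 // Qg.
have Qout u : th <= nrm u -> Q' u = H (par u) by move=> hu; rewrite /Q'; case: Rle_dec.
exists Q'; split.
- apply: (cub_glue _ _ (@nrm m) 1 th _ (nrm_lip1 m)).
    apply: (lipx_eq (Rn_met m) (Rn_met p) _ (fun u => Q (fun i => / th * u i))) => [u [_ hu]|]; first by rewrite Qin.
    apply: (lipx_comp (Rn_met m) (Rn_met m) (Rn_met p) _ cub _ Q) lQ; last exact: scal_lipx.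
    move=> u [_ hu]; rewrite /cub nrm_scal Rabs_right; last lra.
    have := Rmult_le_compat_l _ _ _ (Rlt_le _ _ ith) hu; rewrite Rinv_l; lra.
  apply: (lipx_eq (Rn_met m) (Rn_met p) _ (fun u => H (par u))) => [u [_ hu]|]; first by rewrite Qout.
  apply: (lipx_comp (Rn_met m) (prod_met (Rn_met m) R_met) (Rn_met p) _ (cyl bdy) _ H) lH.
    by move=> u [cu hu]; exact: par_dom.
  apply: lipx_pair.
    by apply: lipx_sub (nu_lipx m th _) => [u []|]; lra.
  by apply: lipx_scal; apply: lipx_minus; [exact: lipx_cst|exact: lipx_nrm].
- move=> u bu; rewrite Qout; last by rewrite bu; lra.
  by rewrite /par bu Rminus_diag Rmult_0_r nu_bdy // H0.
- move=> v cv; rewrite Qin.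
    congr Q; apply: functional_extensionality => i; field; lra.
  rewrite nrm_scal Rabs_right; last lra.
  have := Rmult_le_compat_l th _ _ ltac:(lra) cv; lra.
- by move=> u hu; rewrite Qout; [apply/bH/par_dom|lra].
Qed.

(** * Self-similar subdivision *)

Section Subdivision.
Variables (k n : nat) (beta : Rn k.+1 -> Rn n.+1) (th : R).
Hypothesis hth : 0 < th < 1.
Hypothesis beta_lip : lipx bdy beta.
Hypothesis beta_bdy : forall u, bdy u -> bdy (beta u).
(** Such an [S] is a suspension along the directions [a] and [b]: all slices [u a = const] are
    mapped in the same way, so [S] is compatible with halving both cubes. *)
Hypothesis levelled : forall a b, exists S : Rn k.+1 -> Rn n.+1,
  [/\ lipx cub S, forall u, bdy u -> bdy (S u), forall u, cub u -> S u b = u a,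
   forall u u', cub u -> cub u' -> (forall i, i != a -> u i = u' i) ->
     forall c, c != b -> S u c = S u' c & htpy bdy beta S].

Definition betahat (u : Rn k.+1) : Rn n.+1 := fun i => nrm u * beta (nu u) i.

Lemma betahat_lip : lipx cub betahat.
Proof.
apply: lipx_vec => i; apply: (lipx_sub _ _ (fun=> True)) => //.
apply: (cone_lipx _ (fun u => beta u i)); first exact: (lipx_app _ _ _ beta).
by exists 1 => u bu; apply: Rle_trans (nrm_coord _ _ i) _; rewrite beta_bdy //; lra.
Qed.

Lemma betahat_bdy u : bdy u -> betahat u = beta u.
Proof.
by move=> bu; apply: functional_extensionality => i; rewrite /betahat bu nu_bdy // Rmult_1_l.
Qed.

Lemma betahat_cub u : cub u -> cub (betahat u).
Proof.
move=> cu; have u0 := nrm_pos _ u; rewrite /cub /betahat nrm_scal Rabs_right; last lra.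
have [->|p] : nrm u = 0 \/ 0 < nrm u by lra.
  by rewrite Rmult_0_l; lra.
by rewrite beta_bdy; [move: cu; rewrite /cub; lra|exact: nu_nrm].
Qed.

Definition eps (s : bool) : R := if s then 1 else -1.

Lemma epsE s : eps s = 1 \/ eps s = -1.
Proof. by case: s; [left|right]. Qed.

Definition half {m} (s : bool) (c : 'I_m) (v : Rn m) : Rn m :=
  fun i => if i == c then (eps s + v i) / 2 else v i.
Definition dbl {m} (s : bool) (c : 'I_m) (v : Rn m) : Rn m :=
  fun i => if i == c then 2 * v i - eps s else v i.

Lemma half_lip m s (c : 'I_m) D : lipx D (half s c).
Proof.
apply: lipx_vec => i; rewrite /half; case: (i == c); last exact: lipx_coord.
apply: (lipx_eq (Rn_met m) R_met D (fun u => eps s / 2 + / 2 * u i)) => [u _ /=|]; first by field.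
by apply: lipx_add; [exact: lipx_cst|apply: lipx_scal; exact: lipx_coord].
Qed.

Lemma dbl_lip m s (c : 'I_m) D : lipx D (dbl s c).
Proof.
apply: lipx_vec => i; rewrite /dbl; case: (i == c); last exact: lipx_coord.
by apply: lipx_minus; [apply: lipx_scal; exact: lipx_coord|exact: lipx_cst].
Qed.

Lemma half_cub m s (c : 'I_m) v : cub v -> cub (half s c v).
Proof.
move=> cv; apply: nrm_le => [|i]; first lra.
have := Rle_trans _ _ _ (nrm_coord _ v i) cv => /Rabs_le_between h.
rewrite /half; case: (i == c); apply: Rabs_le => //.
by case: (epsE s) => ->; lra.
Qed.

Lemma dblK m s (c : 'I_m) v : dbl s c (half s c v) = v.
Proof.
by apply: functional_extensionality => i; rewrite /dbl /half; case: (i == c) => //=; field.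
Qed.

Lemma halfK m s (c : 'I_m) v : half s c (dbl s c v) = v.
Proof.
by apply: functional_extensionality => i; rewrite /dbl /half; case: (i == c) => //=; field.
Qed.

Lemma dbl_cub m s (c : 'I_m) v : cub v -> 0 <= eps s * v c -> cub (dbl s c v).
Proof.
move=> cv hs; apply: nrm_le => [|i]; first lra.
have := Rle_trans _ _ _ (nrm_coord _ v i) cv => /Rabs_le_between h.
rewrite /dbl; case: eqP => [e|_]; apply: Rabs_le => //; rewrite e in h *.
by case: (epsE s) hs => -> hs; lra.
Qed.

Lemma dbl_bdy m s (c : 'I_m.+1) v : bdy v -> 0 <= eps s * v c -> bdy (dbl s c v).
Proof.
move=> bv hs; have cv : cub v by rewrite /cub bv; lra.
apply: Rle_antisym; first exact: dbl_cub.
have [i ei] := nrm_attained _ v; apply: Rle_trans (nrm_coord _ _ i); rewrite -bv ei /dbl.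
case: eqP => [e|_]; last exact: Rle_refl.
rewrite e in ei *; rewrite bv in ei; rewrite -ei; move: ei hs.
by case: (epsE s) => ->; rewrite /Rabs; repeat case: Rcase_abs => ?; lra.
Qed.

(** The half-side of the holes. Every step puts in two collars, whence [th * th], and halves one
    direction. *)
Definition sizeD (ps : seq ('I_k.+1 * 'I_n.+1)) (a : 'I_k.+1) : R :=
  (th * th) ^ size ps * / 2 ^ count (fun p => p.1 == a) ps.
Definition sizeT (ps : seq ('I_k.+1 * 'I_n.+1)) (b : 'I_n.+1) : R :=
  / 2 ^ count (fun p => p.2 == b) ps.

Definition affine {m} (c s u : Rn m) : Rn m := fun i => c i + s i * u i.

Lemma sizeD_pos ps a : 0 < sizeD ps a.
Proof.
apply: Rmult_lt_0_compat; first by apply: pow_lt; nra.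
by apply/Rinv_0_lt_compat/pow_lt; lra.
Qed.

Lemma sizeD_cons p ps a : sizeD (p :: ps) a =
  if a == p.1 then th * th / 2 * sizeD ps a else th * th * sizeD ps a.
Proof.
rewrite /sizeD /= eq_sym; set c := count _ ps; have h := pow_lt 2 c Rlt_0_2.
case: eqP => _; rewrite /= ?add0n; field; lra.
Qed.

Lemma sizeT_cons p ps b : sizeT (p :: ps) b = if b == p.2 then sizeT ps b / 2 else sizeT ps b.
Proof.
rewrite /sizeT /= eq_sym; set c := count _ ps; have h := pow_lt 2 c Rlt_0_2.
case: eqP => _; rewrite /= ?add0n; field; lra.
Qed.

(** As [sizeT] is a half-side, grid planes sit at even multiples of it and box centres at odd ones,
    counted from [-1]. *)
Record subdivision ps (Gam : Rn k.+1 -> Rn n.+1) (I : Type)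
    (cD : I -> Rn k.+1) (cT : I -> Rn n.+1) : Prop := Subdivision {
  sub_lip : lipx cub Gam;
  sub_bdy : forall u, bdy u -> Gam u = beta u;
  sub_hole : forall i u, cub u ->
    Gam (affine (cD i) (sizeD ps) u) = affine (cT i) (sizeT ps) (betahat u);
  sub_in : forall i a, Rabs (cD i a) + sizeD ps a <= 1;
  sub_disj : forall i j, i <> j -> exists a, 2 * sizeD ps a <= Rabs (cD i a - cD j a);
  sub_cub : forall u, cub u -> cub (Gam u);
  sub_grid : forall u, cub u -> (forall i, ~ forall a, Rabs (u a - cD i a) < sizeD ps a) ->
    exists b, exists z : Z, Gam u b = -1 + 2 * IZR z * sizeT ps b;
  sub_centre : forall i b, exists z : Z, cT i b = -1 + (2 * IZR z + 1) * sizeT ps b }.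

Lemma sizeT_int ps b : exists z : Z, 1 = IZR z * sizeT ps b.
Proof.
exists (Z.of_nat (2 ^ count (fun p => p.2 == b) ps)%N); rewrite /sizeT -INR_IZR_INZ.
elim: (count _ _) => [|m IH]; first by rewrite /=; field.
have p := pow_lt 2 m Rlt_0_2.
by rewrite expnS mult_INR /= [1 in LHS]IH; field; lra.
Qed.

Lemma on_bdy_grid ps (v : Rn n.+1) : bdy v -> exists b, exists z : Z, v b = -1 + 2 * IZR z * sizeT ps b.
Proof.
move=> bv; have [b eb] := nrm_attained _ v; exists b; have [z ez] := sizeT_int ps b.
rewrite bv in eb; have : v b = 1 \/ v b = -1 by move: eb; rewrite /Rabs; case: Rcase_abs => ? ?; lra.
by case=> ->; [exists z; lra|exists 0%ZZ; lra].
Qed.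

Lemma sub_nil : subdivision [::] betahat unit (fun _ _ => 0) (fun _ _ => 0).
Proof.
have aff m (u : Rn m) (s : Rn m) : (forall i, s i = 1) -> affine (fun=> 0) s u = u.
  by move=> h; apply: functional_extensionality => i; rewrite /affine h; ring.
have s1 a : sizeD [::] a = 1 by rewrite /sizeD /=; field.
have s2 b : sizeT [::] b = 1 by rewrite /sizeT /=; field.
split.
- exact: betahat_lip.
- exact: betahat_bdy.
- by move=> _ u cu; rewrite !aff.
- by move=> _ a; rewrite s1 Rabs_R0; lra.
- by move=> [] [].
- exact: betahat_cub.
- move=> u cu no; apply: on_bdy_grid; rewrite betahat_bdy; last first.
    have [|lt] : nrm u = 1 \/ nrm u < 1 by move: cu; rewrite /cub; lra.
      by [].
    case: (no tt) => a; rewrite s1 Rminus_0_r.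
    exact: Rle_lt_trans (nrm_coord _ u a) lt.
  apply: beta_bdy; have [//|lt] : nrm u = 1 \/ nrm u < 1 by move: cu; rewrite /cub; lra.
  case: (no tt) => a; rewrite s1 Rminus_0_r.
  exact: Rle_lt_trans (nrm_coord _ u a) lt.
- by move=> _ b; exists 0%ZZ; rewrite s2; lra.
Qed.

Section Step.
Variables (a : 'I_k.+1) (b : 'I_n.+1) (ps : seq ('I_k.+1 * 'I_n.+1)).
Variables (Gam : Rn k.+1 -> Rn n.+1) (I : Type) (cD : I -> Rn k.+1) (cT : I -> Rn n.+1).
Hypothesis sub : subdivision ps Gam I cD cT.

Let cD' (x : bool * I) : Rn k.+1 := fun i =>
  if i == a then th * (eps x.1 + th * cD x.2 i) / 2 else th * th * cD x.2 i.
Let cT' (x : bool * I) : Rn n.+1 := fun i =>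
  if i == b then (eps x.1 + cT x.2 i) / 2 else cT x.2 i.

Let hole_map x u : affine (cD' x) (sizeD ((a, b) :: ps)) u =
  fun i => th * half x.1 a (fun i => th * affine (cD x.2) (sizeD ps) u i) i.
Proof.
apply: functional_extensionality => i; rewrite /affine /cD' /half sizeD_cons /=.
by case: (i == a) => /=; field.
Qed.

Let target_map x w : affine (cT' x) (sizeT ((a, b) :: ps)) w =
  half x.1 b (affine (cT x.2) (sizeT ps) w).
Proof.
apply: functional_extensionality => i; rewrite /affine /cT' /half sizeT_cons /=.
by case: (i == b) => /=; field.
Qed.

(** A first collar turns the boundary map of [Gam] into the suspension [S]. Two copies, squeezed
    into the halves of the domain in direction [a] and of the target in direction [b], then fit
    together along the middle wall and form a map that is [S] on the boundary. A second collar turns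
    [S] back into [beta]. *)
Lemma sub_step : exists Gam', subdivision ((a, b) :: ps) Gam' (bool * I)%type cD' cT'.
Proof.
have [lG bG hG iG dG cG gG ctG] := sub.
have [S [lS bS levS indS hS]] := levelled a b.
have [G [lQ bQ hQ oQ]] := collar_ext k.+1 n.+1 S beta Gam th hth (htpy_sym _ _ _ _ _ hS) lG bG.
pose side (v : Rn k.+1) : bool := if Rle_dec 0 (v a) then true else false.
pose Kf s (v : Rn k.+1) := half s b (G (dbl s a v)).
have side_eps v : 0 <= eps (side v) * v a.
  by rewrite /side /eps; case: Rle_dec => /= h; lra.
pose K v := Kf (side v) v.
(* On the boundary of a half the value does not depend on [s]: in coordinate [b], where [S] copies
   [u a], halving undoes doubling, and the other coordinates of [S] ignore [u a]. *)
have onwall s v : cub v -> 0 <= eps s * v a -> bdy (dbl s a v) ->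
    forall c, Kf s v c = if c == b then v a else S v c.
  move=> cv hs bv c; rewrite /Kf bQ // /half; case: eqP => [->|/eqP cb].
    by rewrite levS ?/dbl ?eqxx; [field|exact: dbl_cub].
  apply: indS => //; first exact: dbl_cub.
  by move=> i /negbTE ia; rewrite /dbl ia.
have zero_bdy s v : cub v -> v a = 0 -> bdy (dbl s a v).
  move=> cv v0; apply: Rle_antisym; first by apply: dbl_cub => //; rewrite v0; lra.
  apply: Rle_trans (nrm_coord _ _ a); rewrite /dbl eqxx v0.
  by case: (epsE s) => ->; rewrite /Rabs; case: Rcase_abs => ?; lra.
have KS s v : cub v -> 0 <= eps s * v a -> K v = Kf s v.
  move=> cv hs; have [v0|v0] := Req_dec (v a) 0.
    apply: functional_extensionality => c.
    by rewrite /K !onwall //; try exact: zero_bdy.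
  suff -> : s = side v by [].
  move: hs v0; rewrite /side /eps; case: s; case: Rle_dec => /= ? ? ?; try by [].
    lra.
  lra.
have coordL m (i : 'I_m) (x y : Rn m) : Rabs (x i - y i) <= 1 * ds x y.
  by rewrite Rmult_1_l; exact: rds_coord.
have lK : lipx cub K.
  have piece s : lipx (fun v => cub v /\ 0 <= eps s * v a) K.
    apply: (lipx_eq (Rn_met k.+1) (Rn_met n.+1) _ (Kf s)) => [v [cv hv]|]; first by rewrite (KS s).
    apply: (lipx_comp (Rn_met k.+1) (Rn_met n.+1) (Rn_met n.+1) _ (fun=> True) (fun v => G (dbl s a v))) => //.
      apply: (lipx_comp (Rn_met k.+1) (Rn_met k.+1) (Rn_met n.+1) _ cub _ G) lQ; last exact: dbl_lip.
      by move=> v [cv hv]; exact: dbl_cub.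
    exact: half_lip.
  apply: (cub_glue _ _ (fun v => v a) 1 0 _ (coordL _ a)).
    by apply: lipx_sub (piece false) => v [cv hv]; split=> //; rewrite /eps; lra.
  by apply: lipx_sub (piece true) => v [cv hv]; split=> //; rewrite /eps; lra.
have bK v : bdy v -> K v = S v.
  move=> bv; have cv : cub v by rewrite /cub bv; lra.
  apply: functional_extensionality => c; rewrite /K onwall //; last exact: dbl_bdy.
  by case: eqP => [->|//]; rewrite levS.
have [Gam' [lP bP hP oP]] := collar_ext k.+1 n.+1 beta S K th hth hS lK bK.
have th1 (v : Rn k.+1) : nrm (fun i => th * v i) = th * nrm v by rewrite nrm_scal Rabs_right; lra.
have aff_cub i u : cub u -> cub (affine (cD i) (sizeD ps) u).
  move=> cu; apply: nrm_le => [|c]; first lra.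
  have := iG i c; have := sizeD_pos ps c.
  have := Rle_trans _ _ _ (nrm_coord _ u c) cu => /Rabs_le_between h p q.
  rewrite /affine; apply: Rle_trans (Rabs_triang _ _) _; rewrite Rabs_mult (Rabs_right (sizeD ps c)); last lra.
  have : Rabs (u c) <= 1 by apply: Rabs_le; lra.
  nra.
have sc_cub (v : Rn k.+1) : cub v -> cub (fun i => th * v i).
  by rewrite /cub th1; have := nrm_pos _ v; nra.
have grid' s (v : Rn n.+1) : (exists c, exists z : Z, v c = -1 + 2 * IZR z * sizeT ps c) ->
    exists c, exists z : Z, half s b v c = -1 + 2 * IZR z * sizeT ((a, b) :: ps) c.
  move=> [c [z e]]; exists c; rewrite /half sizeT_cons /=; case: eqP => [cb|_]; last by exists z.
  have [z1 e1] := sizeT_int ps c; rewrite /eps; case: s.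
    by exists (z + z1)%ZZ; rewrite e plus_IZR; lra.
  by exists z; rewrite e; lra.
have GamE x u : cub u -> Gam' (affine (cD' x) (sizeD ((a, b) :: ps)) u) =
    half x.1 b (Gam (affine (cD x.2) (sizeD ps) u)).
  move=> cu; rewrite hole_map; case: x => [s i] /=.
  set w : Rn k.+1 := affine (cD i) (sizeD ps) u.
  have cw : cub w by exact: aff_cub.
  rewrite hP; last by apply: half_cub; exact: sc_cub.
  rewrite (KS s).
  - by rewrite /Kf dblK hQ.
  - by apply: half_cub; exact: sc_cub.
  rewrite /half eqxx; have := Rle_trans _ _ _ (nrm_coord _ w a) cw => /Rabs_le_between h.
  by case: (epsE s) => ->; nra.
exists Gam'; split.
- exact: lP.
- exact: bP.
- by move=> x u cu; rewrite GamE // hG // target_map.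
- move=> [s i] c; rewrite sizeD_cons /cD' /=; have := iG i c; have p := sizeD_pos ps c.
  have q := Rabs_pos (cD i c); case: (c == a) => h.
    have -> : th * (eps s + th * cD i c) / 2 = th / 2 * (eps s + th * cD i c) by field.
    rewrite Rabs_mult (Rabs_right (th / 2)); last lra.
    have t : Rabs (eps s + th * cD i c) <= 1 + th * Rabs (cD i c).
      apply: Rle_trans (Rabs_triang _ _) _; rewrite Rabs_mult (Rabs_right th); last lra.
      by apply: Rplus_le_compat_r; case: (epsE s) => ->; rewrite ?Rabs_Ropp Rabs_R1; lra.
    have : th / 2 * Rabs (eps s + th * cD i c) <= th / 2 * (1 + th * Rabs (cD i c)).
      by apply: Rmult_le_compat_l; lra.
    have : th * (Rabs (cD i c) + sizeD ps c) <= 1 * 1 by apply: Rmult_le_compat; lra.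
    nra.
  rewrite Rabs_mult (Rabs_right (th * th)); last nra.
  have : th * th * (Rabs (cD i c) + sizeD ps c) <= 1 * 1 by apply: Rmult_le_compat; nra.
  lra.
- move=> [s i] [s' j] ne; case: (classic (s = s')) => [es|ns].
    have ij : i <> j by move=> e; apply: ne; rewrite es e.
    have [c hc] := dG i j ij; exists c; rewrite sizeD_cons /cD' /= -es; case: (c == a).
      have -> : th * (eps s + th * cD i c) / 2 - th * (eps s + th * cD j c) / 2 =
        th * th / 2 * (cD i c - cD j c) by field.
      rewrite Rabs_mult (Rabs_right (th * th / 2)); last nra.
      have := Rmult_le_compat_l (th * th / 2) _ _ ltac:(nra) hc; lra.
    have -> : th * th * cD i c - th * th * cD j c = th * th * (cD i c - cD j c) by ring.
    rewrite Rabs_mult (Rabs_right (th * th)); last nra.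
    have := Rmult_le_compat_l (th * th) _ _ ltac:(nra) hc; lra.
  exists a; rewrite sizeD_cons /cD' /= eqxx.
  have ki := iG i a; have kj := iG j a; have p := sizeD_pos ps a.
  have -> : th * (eps s + th * cD i a) / 2 - th * (eps s' + th * cD j a) / 2 =
      th / 2 * ((eps s - eps s') + th * (cD i a - cD j a)) by field.
  rewrite Rabs_mult (Rabs_right (th / 2)); last lra.
  have -> : 2 * (th * th / 2 * sizeD ps a) = th / 2 * (2 * (th * sizeD ps a)) by field.
  apply: Rmult_le_compat_l; first lra.
  have key : 2 * (th * sizeD ps a) + th * Rabs (cD i a - cD j a) <= 2.
    have t : Rabs (cD i a - cD j a) <= Rabs (cD i a) + Rabs (cD j a).
      by apply: Rle_trans (Rabs_triang _ _) _; rewrite Rabs_Ropp; lra.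
    have : th * (2 * sizeD ps a + Rabs (cD i a - cD j a)) <= 1 * 2.
      by apply: Rmult_le_compat; have := Rabs_pos (cD i a - cD j a); lra.
    lra.
  have kk : - (th * Rabs (cD i a - cD j a)) <= th * (cD i a - cD j a) <= th * Rabs (cD i a - cD j a).
    have := Rle_abs (cD i a - cD j a); have := Rle_abs (- (cD i a - cD j a)); rewrite Rabs_Ropp; nra.
  have [e|e] : eps s - eps s' = 2 \/ eps s - eps s' = -2.
    by move: ns; rewrite /eps; clear; case: s; case: s' => //= _; lra.
  + by rewrite e; apply: Rle_trans (Rle_abs _); lra.
  + by rewrite e -Rabs_Ropp; apply: Rle_trans (Rle_abs _); lra.
- move=> u cu; have [ge|lt] : th <= nrm u \/ nrm u < th by lra.
    by rewrite /cub oP; [lra|move: cu; rewrite /cub; lra].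
  pose v : Rn k.+1 := fun i => / th * u i.
  have ev : u = fun i => th * v i.
    by apply: functional_extensionality => i; rewrite /v; field; lra.
  have cv : cub v by move: lt; rewrite /cub {1}ev th1; nra.
  rewrite ev hP // /K /Kf; apply: half_cub.
  set w := dbl _ _ _; have cw : cub w by apply: dbl_cub.
  have [ge|lt'] : th <= nrm w \/ nrm w < th by lra.
    by rewrite /cub oQ; [lra|move: cw; rewrite /cub; lra].
  pose y : Rn k.+1 := fun i => / th * w i.
  have ey : w = fun i => th * y i.
    by apply: functional_extensionality => i; rewrite /y; field; lra.
  have cy : cub y by move: lt'; rewrite /cub {1}ey th1; nra.
  by rewrite ey hQ //; exact: cG.
- move=> u cu no; have [ge|lt] : th <= nrm u \/ nrm u < th by lra.
    by apply: on_bdy_grid; apply: oP; move: cu; rewrite /cub; lra.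
  pose v : Rn k.+1 := fun i => / th * u i.
  have ev : u = fun i => th * v i.
    by apply: functional_extensionality => i; rewrite /v; field; lra.
  have cv : cub v by move: lt; rewrite /cub {1}ev th1; nra.
  have -> : Gam' u = half (side v) b (G (dbl (side v) a v)) by rewrite {1}ev hP.
  apply: grid'; set w := dbl _ _ _; have cw : cub w by apply: dbl_cub.
  have [ge|lt'] : th <= nrm w \/ nrm w < th by lra.
    by apply: on_bdy_grid; apply: oQ; move: cw; rewrite /cub; lra.
  pose y : Rn k.+1 := fun i => / th * w i.
  have ey : w = fun i => th * y i.
    by apply: functional_extensionality => i; rewrite /y; field; lra.
  have cy : cub y by move: lt'; rewrite /cub {1}ey th1; nra.
  rewrite ey hQ //; apply: gG => // i hi; apply: (no (side v, i)) => c.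
  have uE : u c = th * half (side v) a (fun i => th * y i) c.
    by rewrite -ey /w halfK ev.
  rewrite uE sizeD_cons /cD' /half /=; have := hi c; case: (c == a) => h.
    have -> : th * ((eps (side v) + th * y c) / 2) - th * (eps (side v) + th * cD i c) / 2 =
      th * th / 2 * (y c - cD i c) by field.
    by rewrite Rabs_mult (Rabs_right (th * th / 2)); [apply: Rmult_lt_compat_l; nra|nra].
  have -> : th * (th * y c) - th * th * cD i c = th * th * (y c - cD i c) by ring.
  by rewrite Rabs_mult (Rabs_right (th * th)); [apply: Rmult_lt_compat_l; nra|nra].
- move=> [s i] c; have [z e] := ctG i c; rewrite sizeT_cons /cT' /=; case: eqP => [cb|_].
    have [z1 e1] := sizeT_int ps c; rewrite /eps; case: s.
      by exists (z + z1)%ZZ; rewrite e plus_IZR; lra.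
    by exists z; rewrite e; lra.
  by exists z.
Qed.

End Step.

Lemma subdivide ps : exists Gam I cD cT, subdivision ps Gam I cD cT.
Proof.
elim: ps => [|[a b] ps [Gam [I [cD [cT h]]]]].
  by exists betahat, unit, (fun _ _ => 0), (fun _ _ => 0); exact: sub_nil.
have [Gam' h'] := sub_step a b ps Gam I cD cT h.
by eexists Gam', _, _, _; exact: h'.
Qed.

End Subdivision.

(** * General position *)

Lemma window_card (n p W : nat) (x : Rn n) (w : R) (A : {set {ffun 'I_n -> 'I_p}}) :
  0 <= w -> 2 * w + 1 < INR W ->
  (forall v, v \in A -> forall l, Rabs (INR (v l) - x l) <= w) -> (#|A| <= W ^ n)%N.
Proof.
move=> w0 hW hA; case: W hW => [|W] hW; first by rewrite /= in hW; lra.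
pose base l := Z.to_nat (flr (x l - w)).
have hb v l : v \in A -> (base l <= v l)%N /\ (v l - base l < W.+1)%N.
  move=> /hA /(_ l) /Rabs_le_between h; have fb := flr_bounds (x l - w).
  have h1 : (flr (x l - w) < Z.of_nat (v l) + 1)%ZZ.
    by apply: lt_IZR; rewrite plus_IZR -INR_IZR_INZ; lra.
  have h5 : (Z.of_nat (v l) - flr (x l - w) < Z.of_nat W.+1)%ZZ.
    by apply: lt_IZR; rewrite minus_IZR -!INR_IZR_INZ; lra.
  by rewrite /base; split; lia.
pose g (v : {ffun 'I_n -> 'I_p}) : {ffun 'I_n -> 'I_W.+1} := [ffun l => inord (v l - base l)].
have inj : {in A &, injective g}.
  move=> v v' vA vA' e; apply/ffunP => l; apply: val_inj => /=.
  have := congr1 (fun z : {ffun 'I_n -> 'I_W.+1} => val (z l)) e; rewrite !ffunE /=.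
  have [a1 a2] := hb v l vA; have [b1 b2] := hb v' l vA'.
  rewrite !inordK //.
  move: (nat_of_ord (v l)) (nat_of_ord (v' l)) (base l) a1 b1 => a c d; clear; lia.
rewrite -(card_in_imset inj); apply: leq_trans (max_card _) _.
by rewrite card_ffun !card_ord.
Qed.

Lemma cover_card (T U : finType) (B : {set T}) (X : {set U}) (r : U -> T -> bool) M :
  (forall t, t \in B -> exists2 u, u \in X & r u t) ->
  (forall u, u \in X -> (#|[set t | r u t]| <= M)%N) -> (#|B| <= #|X| * M)%N.
Proof.
move=> cov le; apply: (@leq_trans (\sum_(t in B) \sum_(u in X) r u t)%N).
  rewrite -sum1_card; apply: leq_sum => t /cov [u uX ru].
  by rewrite (bigD1 u) //= ru.
apply: (@leq_trans (\sum_(u in X) \sum_(t in B) r u t)%N).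
  by rewrite exchange_big.
rewrite -sum_nat_const; apply: leq_sum => u /le; apply: leq_trans.
rewrite -sum1_card big_mkcond [X in (_ <= X)%N]big_mkcond /=; apply: leq_sum => t _.
by rewrite inE; case: (t \in B); case: (r u t).
Qed.

Lemma pigeonhole (T U : finType) (r : T -> U -> bool) M : (0 < #|U|)%N ->
  (forall t, (#|[set u | r t u]| <= M)%N) ->
  exists u, (#|[set t | r t u]| * #|U| <= #|T| * M)%N.
Proof.
move=> U0 le; apply: NNPP => no.
have gt u : (#|T| * M < #|[set t | r t u]| * #|U|)%N.
  by rewrite ltnNge; apply/negP => h; apply: no; exists u.
have tot : (\sum_(u : U) #|[set t | r t u]| <= #|T| * M)%N.
  have -> : (\sum_(u : U) #|[set t | r t u]| = \sum_(t : T) #|[set u | r t u]|)%N.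
    have cnt (V : finType) (P : pred V) : #|[set x | P x]| = (\sum_(x : V) P x)%N.
      rewrite -sum1_card big_mkcond /=.
      by apply: eq_bigr => x _; rewrite inE; case: (P x).
    under eq_bigr do rewrite cnt; rewrite exchange_big /=.
    by apply: eq_bigr => t _; rewrite cnt.
  by rewrite -sum_nat_const; apply: leq_sum => t _.
have : (#|U| * (#|T| * M).+1 <= #|T| * M * #|U|)%N.
  apply: leq_trans (leq_mul tot (leqnn #|U|)).
  rewrite big_distrl /= -sum_nat_const; apply: leq_sum => u _; exact: gt.
by rewrite mulnS (mulnC #|U|); lia.
Qed.

Lemma nat_above r : exists m : nat, r < INR m.
Proof.
exists (Z.to_nat (Z.max 0 (flr r) + 1)); have := flr_bounds r => h.
rewrite INR_IZR_INZ Znat.Z2Nat.id; last lia.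
rewrite plus_IZR; have := IZR_le (flr r) (Z.max 0 (flr r)) ltac:(lia); lra.
Qed.

Definition asb (P : Prop) : bool := if excluded_middle_informative P then true else false.

Lemma asbP P : reflect P (asb P).
Proof. by rewrite /asb; case: excluded_middle_informative => h; constructor. Qed.

(* On a grid of mesh [1 / m] some [v] has only [O(m ^ (k - n))] grid points mapped near one of the two
   points over [v] on the opposite faces.  Hence only [O(m ^ (2 * (k - n) + 1))] of the [m ^ k] candidates
   for [o] see a point over one of them behind a point over the other. *)
Section GeneralPosition.
Variables (k n : nat).
Hypotheses (n0 : (0 < n)%N) (nk : (n <= k)%N) (kn : (k + 2 <= 2 * n)%N).
Variables (f : Rn k -> Rn n.+1) (st : Rn n.+1) (Lf : R).
Hypothesis Lf1 : 1 <= Lf.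
Hypothesis f_lip : Lip (fun=> True) Lf f.
Hypothesis f_bdy : forall x, bdy (f x).
Hypothesis f_out : forall x, / 2 <= nrm x -> f x = st.

(** If [tl (f x)] is within [1 / m] of [v], then a grid point within [1 / m] of [x] has its value
    within [kap / m] of [v]. *)
Let kap := 1 + Lf.
Let del := / (16 * Lf).
(** Signs opposite to those of [tl st] keep the candidates for [v] away from the value of [f]
    outside the ball. *)
Let sg (l : 'I_n) : R := if Rle_dec 0 (tl st l) then -1 else 1.

Let sgE l : sg l = 1 \/ sg l = -1.
Proof. by rewrite /sg; case: Rle_dec => h /=; [right|left]. Qed.

Section Mesh.
Variable m : nat.
Let mr := INR m.
Hypothesis m_big : 256 * kap <= mr.

Definition vpos (v : {ffun 'I_n -> 'I_m}) : Rn n := fun l => sg l * (/ 8 + INR (v l) / (8 * mr)).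
Definition ypos (c : {ffun 'I_k -> 'I_m.+1}) : Rn k := fun l => - / 2 + INR (c l) / mr.
Definition opos (d : {ffun 'I_k -> 'I_m}) : Rn k := fun l => INR (d l) / (2 * mr).

Let mr0 : 256 <= mr. Proof. by have : 1 <= kap; [rewrite /kap|]; lra. Qed.
Let imr : 0 < / mr. Proof. by apply: Rinv_0_lt_compat; lra. Qed.

Let frac_le (p : nat) (i : 'I_p) q : (p <= q.+1)%N -> 0 <= INR i <= INR q.
Proof.
move=> pq; split; first exact: pos_INR.
by apply: le_INR; have := ltn_ord i; lia.
Qed.

Lemma vpos_bounds v l : / 8 <= sg l * vpos v l <= / 4.
Proof.
have h := frac_le m (v l) m (leqnSn m); rewrite -/mr in h.
have -> : sg l * vpos v l = sg l * sg l * (/ 8 + INR (v l) / (8 * mr)) by rewrite /vpos; ring.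
have -> : sg l * sg l = 1 by case: (sgE l) => ->; lra.
have e : INR (v l) / (8 * mr) = INR (v l) * / mr / 8 by field; lra.
have : INR (v l) * / mr <= mr * / mr by apply: Rmult_le_compat_r; lra.
rewrite Rinv_r; last lra.
have : 0 <= INR (v l) * / mr by apply: Rmult_le_pos; lra.
by rewrite e; lra.
Qed.

Lemma vpos_nrm v : nrm (vpos v) <= / 4.
Proof.
apply: nrm_le => [|l]; first lra.
by have := vpos_bounds v l; case: (sgE l) => -> h; apply: Rabs_le; lra.
Qed.

Lemma vpos_far v : / 8 <= ds (tl st) (vpos v).
Proof.
pose l := Ordinal n0; apply: Rle_trans (rds_coord _ (tl st) (vpos v) l).
have := vpos_bounds v l; rewrite {1 2}/sg; case: Rle_dec => h /= b.
  by rewrite Rabs_right; lra.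
by rewrite Rabs_left; lra.
Qed.

Lemma ypos_nrm c : nrm (ypos c) <= / 2.
Proof.
apply: nrm_le => [|l]; first lra.
have h := frac_le m.+1 (c l) m (leqnn _); rewrite -/mr in h.
have : INR (c l) * / mr <= mr * / mr by apply: Rmult_le_compat_r; lra.
rewrite Rinv_r; last lra.
have : 0 <= INR (c l) * / mr by apply: Rmult_le_pos; lra.
by move=> *; apply: Rabs_le; rewrite /ypos /Rdiv; lra.
Qed.

Lemma opos_bounds d l : 0 <= opos d l <= / 2.
Proof.
have h := frac_le m (d l) m (leqnSn m); rewrite -/mr in h.
have : INR (d l) * / mr <= mr * / mr by apply: Rmult_le_compat_r; lra.
rewrite Rinv_r; last lra.
have : 0 <= INR (d l) * / mr by apply: Rmult_le_pos; lra.
have -> : opos d l = INR (d l) * / mr / 2 by rewrite /opos; field; lra.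
lra.
Qed.

Lemma ypos_net x : nrm x <= / 2 -> exists c, ds x (ypos c) <= / mr.
Proof.
move=> hx; pose c := [ffun l => inord (Z.to_nat (flr ((x l + / 2) * mr)))] : {ffun 'I_k -> 'I_m.+1}.
exists c; apply: rds_le => [|l]; first lra.
have /Rabs_le_between h := Rle_trans _ _ _ (nrm_coord _ x l) hx.
set y := (x l + / 2) * mr; have y0 : 0 <= y <= mr by rewrite /y; nra.
have fb := flr_bounds y.
have z0 : (0 <= flr y)%ZZ.
  have : (-1 < flr y)%ZZ by apply: lt_IZR; lra.
  lia.
have z1 : (flr y < Z.of_nat m + 1)%ZZ.
  by apply: lt_IZR; rewrite plus_IZR -INR_IZR_INZ -/mr; lra.
have e : INR (c l) = IZR (flr y).
  rewrite /c ffunE -/y inordK; last by lia.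
  by rewrite INR_IZR_INZ Znat.Z2Nat.id.
have -> : x l - ypos c l = (y - IZR (flr y)) * / mr.
  by rewrite /ypos e /y; field; lra.
rewrite Rabs_mult (Rabs_right (/ mr)); last lra.
rewrite -[X in _ <= X]Rmult_1_l; apply: Rmult_le_compat_r; first lra.
by apply: Rabs_le; lra.
Qed.

Definition flag (c : {ffun 'I_k -> 'I_m.+1}) (v : {ffun 'I_n -> 'I_m}) : bool :=
  asb (ds (tl (f (ypos c))) (vpos v) <= kap / mr).

Lemma flag_card W c : 16 * kap + 1 < INR W -> (#|[set v | flag c v]| <= W ^ n)%N.
Proof.
move=> hW; pose x : Rn n := fun l => 8 * mr * (sg l * tl (f (ypos c)) l - / 8).
have k0 : 1 <= kap by rewrite /kap; lra.
apply: (window_card n m W x (8 * kap)); [lra|lra|].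
move=> v; rewrite inE => /asbP h l.
have {}h := Rle_trans _ _ _ (rds_coord _ _ _ l) h.
have ss : sg l * sg l = 1 by case: (sgE l) => ->; lra.
have -> : INR (v l) - x l = 8 * mr * sg l * (vpos v l - tl (f (ypos c)) l).
  rewrite /x /vpos; have -> : 8 * mr * sg l * (sg l * (/ 8 + INR (v l) / (8 * mr)) - tl (f (ypos c)) l)
    = (sg l * sg l) * (mr + INR (v l)) - 8 * mr * sg l * tl (f (ypos c)) l by field; lra.
  by rewrite ss; field.
rewrite Rabs_minus_sym in h.
have -> : 8 * kap = 8 * mr * (kap / mr) by field; lra.
apply: Rabs_mul_le => //; rewrite Rabs_mult (Rabs_right (8 * mr)); last lra.
have -> : Rabs (sg l) = 1; last lra.
by case: (sgE l) => ->; rewrite ?Rabs_Ropp Rabs_R1.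
Qed.

Variable v : {ffun 'I_n -> 'I_m}.

Let c0 : {ffun 'I_k -> 'I_m.+1} := [ffun => ord0].

(** Adding the corner [c0] makes the set nonempty, so that it can be indexed by ['I_N.+1]. The value
    there is [st], which is far from [v], so [c0] too is separated from [PS]. *)
Definition PN : {set {ffun 'I_k -> 'I_m.+1}} :=
  c0 |: [set c | flag c v && asb (0 < f (ypos c) ord0)].
Definition PS : {set {ffun 'I_k -> 'I_m.+1}} :=
  [set c | flag c v && asb (f (ypos c) ord0 < 0)].

Lemma PN_card : (#|PN| <= #|[set c | flag c v]| + 1)%N.
Proof.
rewrite /PN cardsU1 addnC; apply: leq_add; last by case: (_ \notin _).
by apply/subset_leq_card/subsetP => c; rewrite !inE => /andP[].
Qed.

Lemma PS_card : (#|PS| <= #|[set c | flag c v]|)%N.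
Proof. by apply/subset_leq_card/subsetP => c; rewrite !inE => /andP[]. Qed.

Let kapm : kap / mr <= / 256.
Proof.
have -> : kap / mr = (256 * kap) * / mr / 256 by field; lra.
have : (256 * kap) * / mr <= mr * / mr by apply: Rmult_le_compat_r; lra.
rewrite Rinv_r; lra.
Qed.

(** A boundary point whose tail is near [v] has a tail of norm at most [1 / 2], so it lies on the
    top or the bottom face. *)
Lemma flag_sign c : flag c v -> f (ypos c) ord0 = 1 \/ f (ypos c) ord0 = -1.
Proof.
move=> /asbP h; have hv := vpos_nrm v.
have ht : nrm (tl (f (ypos c))) <= / 2.
  have /Rabs_le_between := nrm_lip _ (tl (f (ypos c))) (vpos v); lra.
have [i ei] := nrm_attained _ (f (ypos c)); rewrite f_bdy in ei.
case: (unliftP ord0 i) ei => [l ->|->] ei.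
  have := nrm_coord _ (tl (f (ypos c))) l.
  by rewrite /tl -ei; move: ht; rewrite /tl; lra.
by move: ei; rewrite /Rabs; case: Rcase_abs => ? ?; lra.
Qed.

Lemma PN_PS_far c c' : c \in PN -> c' \in PS -> del <= ds (ypos c) (ypos c').
Proof.
move=> hc; rewrite inE => /andP[fl' /asbP neg].
have e' : f (ypos c') ord0 = -1 by case: (flag_sign c' fl') => e; lra.
have lf := proj2 f_lip (ypos c) (ypos c') I I.
suff h : / 16 <= Lf * ds (ypos c) (ypos c').
  apply: (Rmult_le_reg_l Lf); first lra.
  by have -> : Lf * del = / 16 by rewrite /del; field; lra.
apply: Rle_trans lf; move: hc; rewrite !inE => /orP[/eqP ->|/andP[fl /asbP pos]].
  have [k0|k0] := posnP k; first by exfalso; lia.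
  have -> : f (ypos c0) = st.
    apply: f_out; apply: Rle_trans (nrm_coord _ _ (Ordinal k0)).
    by rewrite /ypos ffunE /= /Rdiv Rmult_0_l Rplus_0_r Rabs_left; lra.
  move/asbP: fl' => fl'; have t := ds_tri (tl st) (tl (f (ypos c'))) (vpos v).
  by have := vpos_far v; have := tl_ds _ st (f (ypos c')); lra.
have e : f (ypos c) ord0 = 1 by case: (flag_sign c fl) => e; lra.
apply: Rle_trans (rds_coord _ _ _ ord0); rewrite e e' Rabs_right; lra.
Qed.

Definition bad (d : {ffun 'I_k -> 'I_m}) : Prop := exists c c' t,
  [/\ c \in PN, c' \in PS, 0 <= t <= 1 &
   ds (lerp (opos d) (ypos c) t) (ypos c') <= 8 / mr].

Lemma bad_card (S W : nat) : 2 / del <= INR S -> 16 / del <= mr ->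
  4 * (1 + 16 / del) + 1 < INR W ->
  (#|[set d | asb (bad d)]| <= #|PN| * #|PS| * (S * m).+1 * W ^ k)%N.
Proof.
move=> hS hm hW.
have d0 : 0 < del by rewrite /del; apply: Rinv_0_lt_compat; lra.
have ideal : 0 < 16 / del by apply: Rdiv_lt_0_compat; lra.
pose ctr (u : {ffun 'I_k -> 'I_m.+1} * {ffun 'I_k -> 'I_m.+1} * 'I_(S * m).+1) : Rn k :=
  fun l => ypos u.1.1 l + INR u.2 / mr * (ypos u.1.2 l - ypos u.1.1 l).
pose r u d := asb (ds (opos d) (ctr u) <= (1 + 16 / del) / mr).
pose X := setX (setX PN PS) [set: 'I_(S * m).+1].
have -> : (#|PN| * #|PS| * (S * m).+1 = #|X|)%N by rewrite !cardsX cardsT card_ord.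
apply: (cover_card _ _ _ _ r) => [d|u _]; last first.
  apply: (window_card k m W (fun l => 2 * mr * ctr u l) (2 * (1 + 16 / del))); [lra|lra|].
  move=> d; rewrite inE => /asbP h l; have {}h := Rle_trans _ _ _ (rds_coord _ _ _ l) h.
  have -> : INR (d l) - 2 * mr * ctr u l = 2 * mr * (opos d l - ctr u l).
    rewrite Rmult_minus_distr_l; congr (_ - _).
    by rewrite /opos /Rdiv; field_simplify; last lra.
  have -> : 2 * (1 + 16 / del) = 2 * mr * ((1 + 16 / del) / mr) by field; lra.
  by apply: Rabs_mul_le => //; rewrite Rabs_right; lra.
rewrite inE => /asbP [c [c' [t [hc hc' ht hd]]]].
have far := PN_PS_far c c' hc hc'.
pose e : Rn k := fun l => lerp (opos d) (ypos c) t l - ypos c' l.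
have ne : nrm e <= 8 / mr by [].
have y1 := ypos_nrm c.
have oy : ds (opos d) (ypos c) <= 1.
  apply: rds_le => [|l]; first lra.
  have := opos_bounds d l; have /Rabs_le_between := Rle_trans _ _ _ (nrm_coord _ _ l) y1.
  by move=> *; apply: Rabs_le; lra.
have e8 : 8 / mr <= del / 2.
  apply: (Rmult_le_reg_r (2 * mr)); first lra.
  have -> : 8 / mr * (2 * mr) = 16 by field; lra.
  have -> : del / 2 * (2 * mr) = del * mr by field.
  have -> : 16 = del * (16 / del) by field; lra.
  by apply: Rmult_le_compat_l; lra.
have t1 : del / 2 <= 1 - t.
  have h1 : ds (ypos c) (ypos c') <= (1 - t) * ds (opos d) (ypos c) + nrm e.
    apply: rds_le => [|l].
      by apply: Rplus_le_le_0_compat; [apply: Rmult_le_pos; [lra|exact: ds_pos]|exact: nrm_pos].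
    have -> : ypos c l - ypos c' l = e l - (1 - t) * (opos d l - ypos c l).
      by rewrite /e /lerp; ring.
    apply: Rle_trans (Rabs_triang _ _) _; rewrite Rabs_Ropp Rabs_mult (Rabs_right (1 - t)); last lra.
    have := nrm_coord _ e l; have := Rmult_le_compat_l (1 - t) _ _ ltac:(lra) (rds_coord _ (opos d) (ypos c) l).
    lra.
  have : (1 - t) * ds (opos d) (ypos c) <= (1 - t) * 1 by apply: Rmult_le_compat_l; lra.
  lra.
pose s := / (1 - t); have t0 : 0 < 1 - t by lra.
have s0 : 0 < s by exact: Rinv_0_lt_compat.
have s1 : s <= 2 / del.
  have -> : 2 / del = / (del / 2) by field; lra.
  by apply: Rinv_le_contravar; lra.
have fb := flr_bounds (s * mr).
have smr : 0 <= s * mr by apply: Rmult_le_pos; lra.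
have z0 : (0 <= flr (s * mr))%ZZ.
  have : (-1 < flr (s * mr))%ZZ by apply: lt_IZR; lra.
  lia.
have z1 : (flr (s * mr) < Z.of_nat (S * m) + 1)%ZZ.
  apply: lt_IZR; rewrite plus_IZR -INR_IZR_INZ mult_INR -/mr.
  have : s * mr <= INR S * mr by apply: Rmult_le_compat_r; lra.
  lra.
pose i : 'I_(S * m).+1 := inord (Z.to_nat (flr (s * mr))).
have ei : INR i = IZR (flr (s * mr)).
  by rewrite /i inordK; [rewrite INR_IZR_INZ Znat.Z2Nat.id|lia].
exists ((c, c'), i); first by rewrite /X !in_setX in_setT /= hc hc'.
apply/asbP; apply: rds_le => [|l]; first by apply: Rmult_le_pos; lra.
rewrite /ctr /= ei.
have -> : opos d l - (ypos c l + IZR (flr (s * mr)) / mr * (ypos c' l - ypos c l)) =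
    s * e l + (s * mr - IZR (flr (s * mr))) * / mr * (ypos c' l - ypos c l).
  have h : s * (1 - t) = 1 by rewrite /s Rinv_l; lra.
  have -> : opos d l - (ypos c l + IZR (flr (s * mr)) / mr * (ypos c' l - ypos c l)) =
    s * (1 - t) * opos d l - (s * (1 - t) * ypos c l + IZR (flr (s * mr)) / mr * (ypos c' l - ypos c l)).
    by rewrite h; ring.
  by rewrite /e /lerp; field; lra.
apply: Rle_trans (Rabs_triang _ _) _.
have b1 : Rabs (s * e l) <= 2 / del * (8 / mr).
  apply: Rabs_mul_le; first by rewrite Rabs_right; lra.
  exact: Rle_trans (nrm_coord _ e l) ne.
have b2 : Rabs ((s * mr - IZR (flr (s * mr))) * / mr * (ypos c' l - ypos c l)) <= 1 * / mr * 1.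
  apply: Rabs_mul_le; first apply: Rabs_mul_le.
  - by apply: Rabs_le; lra.
  - by rewrite Rabs_right; lra.
  have /Rabs_le_between := Rle_trans _ _ _ (nrm_coord _ _ l) y1.
  have /Rabs_le_between := Rle_trans _ _ _ (nrm_coord _ _ l) (ypos_nrm c').
  by move=> *; apply: Rabs_le; lra.
have -> : (1 + 16 / del) / mr = 1 * / mr * 1 + 2 / del * (8 / mr) by field; lra.
lra.
Qed.

End Mesh.

Lemma general_position : exists e (v : Rn n) (o : Rn k) (N : nat) (p : 'I_N.+1 -> Rn k),
  [/\ 0 < e <= / 256, nrm v <= / 4, / 8 <= ds (tl st) v, nrm o <= / 2 & forall i, nrm (p i) <= / 2] /\
  (forall x, ds (tl (f x)) v < e -> 0 < f x ord0 -> exists i, ds x (p i) <= e) /\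
  (forall x, ds (tl (f x)) v < e -> f x ord0 < 0 -> forall i t, 0 <= t <= 1 ->
     7 * e < ds x (lerp o (p i) t)).
Proof.
have d0 : 0 < del by rewrite /del; apply: Rinv_0_lt_compat; lra.
have kap1 : 2 <= kap by rewrite /kap; lra.
have [W hW] := nat_above (16 * kap + 1); have [S hS] := nat_above (2 / del).
have [W' hW'] := nat_above (4 * (1 + 16 / del) + 1).
have [m1 hm1] := nat_above (256 * kap + 16 / del).
pose A := (2 ^ k * W ^ n)%N.
pose A' := ((A + 1) * A * (S + 1) * W' ^ k)%N.
pose m := (m1 + A' + 1)%N.
have m0 : (0 < m)%N by rewrite /m; lia.
have mm : INR m1 <= INR m by apply: le_INR; rewrite /m; lia.
have i16 : 0 < 16 / del by apply: Rdiv_lt_0_compat; lra.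
have mb : 256 * kap <= INR m by lra.
have mb' : 16 / del <= INR m by lra.
have T0 : (0 < #|{ffun 'I_n -> 'I_m}|)%N by rewrite card_ffun !card_ord expn_gt0 m0.
have [v hv] := pigeonhole _ _ (flag m) (W ^ n)%N T0 (fun c => flag_card m mb W c hW).
rewrite !card_ffun !card_ord in hv.
have mk0 : (0 < m ^ (k - n))%N by rewrite expn_gt0 m0.
have Fle : (#|[set c | flag m c v]| <= A * m ^ (k - n))%N.
  have mn0 : (0 < m ^ n)%N by rewrite expn_gt0 m0.
  rewrite -(leq_pmul2r mn0); apply: leq_trans hv _.
  rewrite -mulnA -expnD subnK // /A mulnAC; apply: leq_mul => //.
  (* The factor [2 ^ k] in [A] pays for the [(m + 1) ^ k] points of the closed grid. *)
  by rewrite -expnMn leq_exp2r; [rewrite /m; lia|lia].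
have PNle : (#|PN m v| <= (A + 1) * m ^ (k - n))%N.
  by apply: leq_trans (PN_card m v) _; rewrite mulnDl mul1n; apply: leq_add.
have PSle : (#|PS m v| <= A * m ^ (k - n))%N by apply: leq_trans (PS_card m v) Fle.
have badle := bad_card m mb v S W' (Rlt_le _ _ hS) mb' hW'.
have lt : (#|[set d | asb (bad m v d)]| < #|{ffun 'I_k -> 'I_m}|)%N.
  rewrite card_ffun !card_ord; apply: leq_ltn_trans badle _.
  apply: (@leq_ltn_trans (A' * m ^ (k - n + (k - n) + 1))%N).
    rewrite !expnD expn1 /A'.
    apply: (@leq_trans ((A + 1) * m ^ (k - n) * (A * m ^ (k - n)) * ((S + 1) * m) * W' ^ k)%N).
      apply: leq_mul => //; apply: leq_mul; first exact: leq_mul.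
      by rewrite mulnDl mul1n -addn1; apply: leq_add.
    by move: (m ^ (k - n))%N (W' ^ k)%N => e w; clear; lia.
  apply: (@leq_trans (m * m ^ (k - n + (k - n) + 1))%N).
    by rewrite ltn_pmul2r ?expn_gt0 ?m0 // /m; lia.
  (* The exponent [2 * (k - n) + 2] is at most [k] because [k + 2 <= 2 * n]. *)
  by rewrite -expnS leq_pexp2l //; lia.
have [d hd] : exists d, ~ bad m v d.
  apply: NNPP => no; move: lt; rewrite ltnNge; apply/negP; rewrite negbK.
  have -> : [set d | asb (bad m v d)] = setT.
    apply/setP => d; rewrite !inE; apply/asbP; apply: NNPP => nb; apply: no; by exists d.
  by rewrite cardsT.
have PN0 : (0 < #|PN m v|)%N by apply/card_gt0P; exists [ffun=> ord0]; rewrite !inE eqxx.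
pose N := #|PN m v|.-1; have eN : N.+1 = #|PN m v| by rewrite /N prednK.
pose p (i : 'I_N.+1) := ypos m (enum_val (cast_ord eN i)).
have im : 0 < / INR m by apply: Rinv_0_lt_compat; lra.
have near x : ds (tl (f x)) (vpos m v) < / INR m ->
    exists c, flag m c v /\ ds x (ypos m c) <= / INR m /\
      (Rabs (f x ord0 - f (ypos m c) ord0) <= / 128).
  move=> hx; have xs : nrm x <= / 2.
    apply: Rnot_lt_le => gt; rewrite f_out in hx; last lra.
    have := vpos_far m mb v.
    have : / INR m <= / 256 by apply: Rinv_le_contravar; lra.
    lra.
  have [c hc] := ypos_net m mb x xs; exists c.
  have lf := proj2 f_lip x (ypos m c) I I.
  have l2 : ds (f x) (f (ypos m c)) <= Lf * / INR m.
    by apply: Rle_trans lf _; apply: Rmult_le_compat_l; lra.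
  split; last split=> //.
    apply/asbP; have t := ds_tri (tl (f (ypos m c))) (tl (f x)) (vpos m v).
    have := tl_ds _ (f (ypos m c)) (f x); rewrite (ds_sym (f (ypos m c))) /kap /Rdiv; lra.
  apply: Rle_trans (rds_coord _ _ _ ord0) _; apply: Rle_trans l2 _.
  apply: (Rmult_le_reg_r (INR m)); first lra.
  rewrite Rmult_assoc Rinv_l; last lra.
  by move: mb; rewrite /kap; lra.
exists (/ INR m), (vpos m v), (opos m d), N, p.
split; [split|split].
- by split=> //; apply: Rinv_le_contravar; lra.
- exact: vpos_nrm mb v.
- exact: vpos_far m mb v.
- apply: nrm_le => [|l]; first lra.
  by have := opos_bounds m mb d l => ?; apply: Rabs_le; lra.
- by move=> i; exact: ypos_nrm.
- move=> x hx pos; have [c [fl [dc fc]]] := near x hx.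
  have cP : c \in PN m v.
    rewrite !inE fl /=; apply/orP; right; apply/asbP.
    by case: (flag_sign m mb v c fl) => e; move: fc => /Rabs_le_between; lra.
  exists (cast_ord (esym eN) (enum_rank_in cP c)); rewrite /p cast_ordKV.
  by rewrite enum_rankK_in.
move=> x hx neg i t ht; have [c [fl [dc fc]]] := near x hx.
have cP : c \in PS m v.
  rewrite !inE fl /=; apply/asbP.
  by case: (flag_sign m mb v c fl) => e; move: fc => /Rabs_le_between; lra.
(* With [e = 1 / m], the mesh error [e] is subtracted from [8 * e]. *)
have h8 : 8 / INR m < ds (lerp (opos m d) (p i) t) (ypos m c).
  apply: Rnot_le_lt => le; apply: hd; exists (enum_val (cast_ord eN i)), c, t.
  by split=> //; exact: enum_valP.
have := ds_tri (lerp (opos m d) (p i) t) x (ypos m c); rewrite (ds_sym (lerp _ _ _) x).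
rewrite /Rdiv in h8.
lra.
Qed.

End GeneralPosition.

(** * Deformation to a suspension *)

Definition mk {n} (a : R) (x : Rn n) : Rn n.+1 := fun i => if unlift ord0 i is Some l then x l else a.

Lemma mk0 n a (x : Rn n) : mk a x ord0 = a.
Proof. by rewrite /mk unlift_none. Qed.

Lemma tl_mk n a (x : Rn n) : tl (mk a x) = x.
Proof. by apply: functional_extensionality => l; rewrite /tl /mk liftK. Qed.

Lemma mk_eta n (u : Rn n.+1) : mk (u ord0) (tl u) = u.
Proof. by apply: functional_extensionality => i; rewrite /mk; case: unliftP => [l ->|->]. Qed.

Lemma head_nrm n (u : Rn n.+1) : Rabs (u ord0) <= nrm u.
Proof. exact: nrm_coord. Qed.

Lemma nrm_mk n (u : Rn n.+1) : nrm u = Rmax (Rabs (u ord0)) (nrm (tl u)).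
Proof.
apply: Rle_antisym; last by apply: Rmax_lub; [exact: head_nrm|exact: tl_nrm].
apply: nrm_le => [|i]; first by apply: Rle_trans (Rmax_r _ _); exact: nrm_pos.
case: (unliftP ord0 i) => [l ->|->]; last exact: Rmax_l.
by apply: Rle_trans (Rmax_r _ _); exact: (nrm_coord _ (tl u)).
Qed.

Lemma bdy_cases n (u : Rn n.+1) : bdy u ->
  [/\ -1 <= u ord0 <= 1, 0 <= nrm (tl u) <= 1 & u ord0 = 1 \/ u ord0 = -1 \/ nrm (tl u) = 1].
Proof.
rewrite /bdy => b; have := head_nrm _ u; have := tl_nrm _ u; rewrite b => h1 /Rabs_le_between h2.
split=> //; first by have := nrm_pos _ (tl u).
move: b; rewrite nrm_mk /Rmax; case: Rle_dec => h b; first by right; right.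
by move: b; rewrite /Rabs; case: Rcase_abs => ? b; [right; left; lra|left].
Qed.

Lemma bdy_mk n a (x : Rn n) : Rabs a <= 1 -> nrm x <= 1 -> Rabs a = 1 \/ nrm x = 1 -> bdy (mk a x).
Proof.
move=> ha hx; rewrite /bdy nrm_mk mk0 tl_mk => -[->|->]; first by rewrite Rmax_left.
by rewrite Rmax_right.
Qed.

Lemma mk_lipx (X : Met) n (D : X -> Prop) (f : X -> R) (g : X -> Rn n) :
  lipx D f -> lipx D g -> lipx D (fun x => mk (f x) (g x)).
Proof.
move=> lf lg; apply: lipx_vec => i; rewrite /mk.
by case: (unlift ord0 i) => [l|//]; exact: lipx_app.
Qed.

Lemma tl_lipx n (D : Rn n.+1 -> Prop) : lipx D (@tl n).
Proof. by apply: lipx_vec => l; exact: lipx_coord. Qed.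

Lemma clamp_lipx (X : Met) (D : X -> Prop) (f : X -> R) : lipx D f -> lipx D (fun x => clamp (f x)).
Proof.
move=> lf; apply: (lipx_compT _ _ _ _ _ clamp lf); exists 1; split; first lra.
by move=> x y _ _; rewrite Rmult_1_l; exact: clamp_lip.
Qed.

Lemma clamp_bnd (X : Met) (D : X -> Prop) (f : X -> R) : bnd D (fun x => clamp (f x)).
Proof. by exists 1 => x _; have := clamp_bounds (f x) => ?; apply: Rabs_le; lra. Qed.

Lemma scale_nrm m a (x : Rn m) : 0 <= a -> nrm (fun i => a * x i) = a * nrm x.
Proof. by move=> a0; rewrite nrm_scal Rabs_right //; lra. Qed.

Lemma nrm_rev m (x y : Rn m) : nrm x - nrm y <= nrm (fun i => x i + y i).
Proof.
have /Rabs_le_between := nrm_lip _ x (fun i => - 1 * y i).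
rewrite /ds /= /rn_ds nrm_scal Rabs_Ropp Rabs_R1 Rmult_1_l.
have -> : (fun i => x i - -1 * y i) = (fun i => x i + y i).
  by apply: functional_extensionality => i; ring.
lra.
Qed.

Definition spole {m} : Rn m.+1 := mk (-1) (fun=> 0).

Lemma nu_spole m (a : R) (x : Rn m) : a < 0 -> (forall i, x i = 0) -> nu (mk a x) = spole.
Proof.
move=> a0 x0; have -> : x = fun=> 0 by exact: functional_extensionality.
have e : nrm (mk a ((fun=> 0) : Rn m)) = - a.
  by rewrite nrm_mk mk0 tl_mk nrm0 Rabs_left // Rmax_left; lra.
apply: functional_extensionality => i; rewrite /nu e /spole /mk.
by case: (unlift ord0 i) => [_|]; field; lra.
Qed.

(* Collapsing all but the middle of the top face turns maps of spheres into maps of [Rn m] that are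
   constant off a ball. *)
Lemma collapse m : exists psi : Rn m.+1 -> Rn m.+1, [/\ lipx bdy psi,
  forall u, bdy u -> bdy (psi u), htpy bdy (fun u => u) psi &
  forall u, bdy u -> u ord0 <> 1 \/ / 2 <= nrm (tl u) -> psi u = spole].
Proof.
(* On the top face the head falls from [1] to [-1] at radius [1 / 2], where the tail has faded to
   [0]. Further out, and on all other faces, the tail is [0] and the head negative. *)
pose G (u : Rn m.+1) : Rn m.+1 := mk (u ord0 - 4 * nrm (tl u))
  (fun i => clamp (1 - 2 * nrm (tl u)) * clamp (u ord0) * tl u i).
have ltl : lipx bdy (fun u : Rn m.+1 => nrm (tl u)) by apply: lipx_nrm_comp; exact: tl_lipx.
have l0 : lipx bdy (fun u : Rn m.+1 => u ord0) by exact: lipx_coord.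
have lG : lipx bdy G.
  apply: mk_lipx; first by apply: lipx_minus => //; exact: lipx_scal.
  apply: lipx_vec => i; apply: lipx_mul.
  - apply: lipx_mul; [apply: clamp_lipx|exact: clamp_lipx|exact: clamp_bnd|exact: clamp_bnd].
    by apply: lipx_minus; [exact: lipx_cst|exact: lipx_scal].
  - exact: lipx_coord.
  - by apply: bnd_mul; exact: clamp_bnd.
  by exists 1 => u b; have := nrm_coord _ u (lift ord0 i); rewrite b.
have tG u s i : tl (fun i => (1 - s) * u i + s * G u i) i =
    ((1 - s) + s * (clamp (1 - 2 * nrm (tl u)) * clamp (u ord0))) * tl u i.
  by rewrite /tl /G /mk liftK /tl; ring.
have far u s : bdy u -> 0 <= s <= 1 -> / 16 <= nrm (fun i => (1 - s) * u i + s * G u i).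
  move=> b hs; have [h0 h1 cs] := bdy_cases _ u b.
  set w := (fun i => _); have hw : w ord0 = u ord0 - 4 * (s * nrm (tl u)) by rewrite /w /G mk0; ring.
  have c1 := clamp_bounds (1 - 2 * nrm (tl u)); have c2 := clamp_bounds (u ord0).
  have tw : nrm (tl w) = ((1 - s) + s * (clamp (1 - 2 * nrm (tl u)) * clamp (u ord0))) * nrm (tl u).
    rewrite -scale_nrm; first by congr nrm; apply: functional_extensionality => i; exact: tG.
    have : 0 <= clamp (1 - 2 * nrm (tl u)) * clamp (u ord0) by apply: Rmult_le_pos; lra.
    by move=> h; apply: Rplus_le_le_0_compat; [lra|apply: Rmult_le_pos; lra].
  have /Rabs_le_between a1 := head_nrm _ w; have a2 := tl_nrm _ w.
  move: c1 c2 tw a1 a2 h1 cs; rewrite hw; set r := nrm (tl u); set c := clamp (1 - _).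
  set c' := clamp _; set N := nrm w => c1 c2 tw a1 a2 h1 cs.
  have cc : 0 <= c * c' by apply: Rmult_le_pos; lra.
  have tw1 : (1 - s) * r <= N.
    apply: Rle_trans a2; rewrite tw; apply: Rmult_le_compat_r; first lra.
    have : 0 <= s * (c * c') by apply: Rmult_le_pos; lra.
    lra.
  case: cs => [e|[e|e]].
  - have e1 : c' = 1 by rewrite /c' e clamp_ge1; lra.
    case: (Rle_dec r (/ 2)) => hr.
      have e2 : c = 1 - 2 * r by rewrite /c clamp_id //; lra.
      rewrite e1 e2 in tw; rewrite e in a1.
      (* The head [1 - 4 * s * r] is small only for [s * r] near [1 / 4], and there the tail
         [(1 - 2 * s * r) * r] is bounded below. *)
      case: (Rle_dec (/ 64) (Rabs (s * r - / 4))) => [|/Rnot_le_lt] h.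
        by move: h; rewrite /Rabs; case: Rcase_abs; lra.
      have /Rabs_le_between h' := Rlt_le _ _ h; apply: Rle_trans a2; rewrite tw; nra.
    by rewrite e in a1; nra.
  - have : 0 <= s * r by apply: Rmult_le_pos; lra.
    rewrite e in a1; lra.
  - by rewrite e in tw1; nra.
have G1 u : bdy u -> / 16 <= nrm (G u).
  move=> b; have := far u 1 b ltac:(lra).
  by congr (_ <= nrm _); apply: functional_extensionality => i; ring.
exists (fun u => nu (G u)); split.
- apply: (lipx_comp (Rn_met m.+1) (Rn_met m.+1) (Rn_met m.+1) _ (fun u => / 16 <= nrm u) G) => //.
  by apply: nu_lipx; lra.
- by move=> u /G1 h; apply: nu_nrm; lra.
- apply: (htpy_eq _ _ _ (fun u => nu u) (fun u => nu (G u))) => //.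
    exact: nu_bdy.
  apply: (htpy_line _ _ _ _ _ (/ 16)) => //; first lra.
  + exact: lipx_id.
  + by exists 1 => u b; rewrite b Rabs_R1; lra.
  exists 6 => u b; have [h0 h1 _] := bdy_cases _ u b.
  have c1 := clamp_bounds (1 - 2 * nrm (tl u)); have c2 := clamp_bounds (u ord0).
  rewrite Rabs_right; last by apply/Rle_ge/nrm_pos.
  rewrite nrm_mk /G mk0 tl_mk scale_nrm; last by apply: Rmult_le_pos; lra.
  apply: Rmax_lub; first by apply: Rabs_le; lra.
  have : clamp (1 - 2 * nrm (tl u)) * clamp (u ord0) * nrm (tl u) <= 1 * 1 * 1.
    apply: Rmult_le_compat; [|lra| |lra]; first by apply: Rmult_le_pos; lra.
    by apply: Rmult_le_compat; lra.
  lra.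
move=> u b hu; have [h0 h1 cs] := bdy_cases _ u b; apply: nu_spole.
  by case: hu => hu; [case: cs => [//|[e|e]]|]; lra.
move=> i; case: hu => hu; last by rewrite clamp_le0; lra.
by case: cs => [//|[e|e]]; [rewrite (clamp_le0 (u ord0))|rewrite (clamp_le0 (1 - _))]; lra.
Qed.

(* Away from the preimages of the two poles, which lie on different sides of a collar of the top
   face, [g] is normalised linearly to the suspension of its direction on that collar. *)
Lemma suspension_criterion k n (g : Rn k.+1 -> Rn n.+1) ro e :
  / 2 <= ro < 1 -> 0 < e <= 1 -> lipx bdy g -> (forall u, bdy u -> bdy (g u)) ->
  (forall u, bdy u -> u ord0 <> 1 \/ ro <= nrm (tl u) -> nrm (tl (g u)) < e -> g u ord0 <= 0) ->
  (forall u, bdy u -> u ord0 = 1 -> nrm (tl (g u)) < e -> 0 <= g u ord0) ->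
  (forall u, bdy u -> u ord0 = 1 -> ro <= nrm (tl u) ->
     g u = g (mk 1 (fun i => ro * nu (tl u) i))) ->
  exists bhat : Rn k -> Rn n, [/\ lipx (fun=> True) bhat, forall x, nrm (bhat x) = nrm x &
    htpy bdy g (fun u => mk (u ord0) (bhat (tl u)))].
Proof.
move=> hro he lg bg gN gS gC.
pose top (th : Rn k) : Rn k.+1 := mk 1 (fun i => ro * th i).
have top_bdy th : bdy th -> bdy (top th).
  move=> b; apply: bdy_mk; [rewrite Rabs_R1; lra| |by left; exact: Rabs_R1].
  by rewrite scale_nrm ?b; lra.
pose bt th := tl (g (top th)).
(* Points over [ro * th] on the top face fall under both sign hypotheses. With a tail shorter than
   [e] the head would be [0], impossible on the boundary since [e <= 1]. *)
have bt_ge th : bdy th -> e <= nrm (bt th).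
  move=> b; apply: Rnot_lt_le => lt; have b' := top_bdy _ b.
  have r : ro <= nrm (tl (top th)) by rewrite tl_mk scale_nrm ?b; lra.
  have h1 := gN _ b' (or_intror r) lt; have h2 := gS _ b' (mk0 _ _ _) lt.
  have [_ _] := bdy_cases _ _ (bg _ b'); rewrite -/(bt th); lra.
have lbt : lipx bdy (fun th => nu (bt th)).
  apply: (lipx_comp (Rn_met k) (Rn_met n) (Rn_met n) _ (fun u => e <= nrm u) bt) => //; last by apply: nu_lipx; lra.
  apply: (lipx_compT (Rn_met k) (Rn_met n.+1)); last exact: tl_lipx.
  apply: (lipx_comp (Rn_met k) (Rn_met k.+1) (Rn_met n.+1) _ bdy top) => //.
  by apply: mk_lipx; [exact: lipx_cst|exact: scal_lipx].
pose bhat (y : Rn k) : Rn n := fun l => nrm y * nu (bt (nu y)) l.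
have bhat_nrm y : nrm (bhat y) = nrm y.
  have y0 := nrm_pos _ y; rewrite scale_nrm //.
  have [->|p] : nrm y = 0 \/ 0 < nrm y by lra.
    by rewrite Rmult_0_l.
  by rewrite nu_nrm; [ring|have := bt_ge _ (nu_nrm _ y p); lra].
have lbhat : lipx (fun=> True) bhat.
  apply: lipx_vec => l; apply: (cone_lipx k (fun th => nu (bt th) l)); first exact: (lipx_app _ _ _ (fun th => nu (bt th)) l lbt).
  exists 1 => th b; apply: Rle_trans (nrm_coord _ _ l) _; rewrite nu_nrm; first lra.
  by have := bt_ge _ b; lra.
(* As [tau] is [1] on the core of the top face and [0] off that face, [g1] below travels between the
   two poles across the collar. *)
pose tau (u : Rn k.+1) := clamp (/ (1 - ro) * (1 - nrm (tl u))) * clamp (u ord0).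
have ir : 0 < / (1 - ro) by apply: Rinv_0_lt_compat; lra.
have tau_b u : 0 <= tau u <= 1.
  have h1 := clamp_bounds (/ (1 - ro) * (1 - nrm (tl u))); have h2 := clamp_bounds (u ord0).
  split; first by apply: Rmult_le_pos; lra.
  by rewrite -(Rmult_1_r 1); apply: Rmult_le_compat; lra.
have tau1 u : u ord0 = 1 -> nrm (tl u) <= ro -> tau u = 1.
  move=> e1 h; rewrite /tau e1 (clamp_ge1 1); last lra.
  rewrite clamp_ge1 ?Rmult_1_r //; have := Rinv_l (1 - ro) ltac:(lra).
  have := Rmult_le_compat_l (/ (1 - ro)) (1 - ro) (1 - nrm (tl u)); lra.
have tau0 u : bdy u -> u ord0 <> 1 -> tau u = 0.
  move=> b h; have [_ _ [//|[e1|e1]]] := bdy_cases _ u b; rewrite /tau.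
    by rewrite e1 (clamp_le0 (-1)) ?Rmult_0_r; lra.
  by rewrite e1 Rminus_diag Rmult_0_r clamp_le0 ?Rmult_0_l; lra.
have ltau : lipx bdy tau.
  apply: lipx_mul; [| |exact: clamp_bnd|exact: clamp_bnd].
    apply: clamp_lipx; apply: lipx_scal; apply: lipx_minus; first exact: lipx_cst.
    by apply: lipx_nrm_comp; exact: tl_lipx.
  by apply: clamp_lipx; exact: lipx_coord.
have lbt' : lipx bdy (fun u : Rn k.+1 => bhat (tl u)).
  by apply: (lipx_compT (Rn_met k.+1) (Rn_met k)) lbhat; exact: tl_lipx.
pose g1 (u : Rn k.+1) : Rn n.+1 := mk (2 * tau u - 1) (fun l => tau u * (1 - tau u) * bhat (tl u) l).
have bt1 : bnd bdy (fun u => tau u) by exists 1 => u _; have := tau_b u => ?; apply: Rabs_le; lra.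
have bt2 : bnd bdy (fun u => 1 - tau u) by exists 1 => u _; have := tau_b u => ?; apply: Rabs_le; lra.
have lt2 : lipx bdy (fun u => 1 - tau u) by apply: lipx_minus => //; exact: lipx_cst.
have lg1 : lipx bdy g1.
  apply: mk_lipx; first by apply: lipx_minus; [exact: lipx_scal|exact: lipx_cst].
  apply: lipx_vec => l; apply: lipx_mul; first exact: lipx_mul.
  - exact: (lipx_app _ _ _ (fun u => bhat (tl u)) l lbt').
  - exact: bnd_mul.
  exists 1 => u b; apply: Rle_trans (nrm_coord _ _ l) _; rewrite bhat_nrm.
  by have [] := bdy_cases _ u b; lra.
pose sus (u : Rn k.+1) : Rn n.+1 := mk (u ord0) (bhat (tl u)).
have lsus : lipx bdy sus by apply: mk_lipx => //; exact: lipx_coord.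
have bsus u : bdy u -> bdy (sus u).
  move=> b; rewrite /bdy /sus nrm_mk mk0 tl_mk bhat_nrm -nrm_mk //.
have tt u : 0 <= tau u * (1 - tau u) by have := tau_b u => ?; apply: Rmult_le_pos; lra.
have g1_bnd : bnd bdy (fun u => nrm (g1 u)).
  exists 1 => u b; rewrite Rabs_right; last by apply/Rle_ge/nrm_pos.
  have := tau_b u => tb; rewrite /g1 nrm_mk mk0 tl_mk scale_nrm // bhat_nrm.
  apply: Rmax_lub; first by apply: Rabs_le; lra.
  have [_ h _] := bdy_cases _ u b.
  have := Rmult_le_compat _ _ _ _ (tt u) (proj1 h) (_ : tau u * (1 - tau u) <= 1) (proj2 h).
  by rewrite Rmult_1_r; apply; nra.
have id_bnd (f : Rn k.+1 -> Rn n.+1) : (forall u, bdy u -> bdy (f u)) -> bnd bdy (fun u => nrm (f u)).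
  by move=> bf; exists 1 => u b; rewrite bf // Rabs_R1; lra.
(* Off the top face [g1] is the lower pole and [g] stays away from the upper one; on the core the
   roles are exchanged. In the collar both tails are non-negative multiples of the same vector and
   cannot cancel. *)
have farA u s : bdy u -> 0 <= s <= 1 -> e / 16 <= nrm (fun i => (1 - s) * g u i + s * g1 u i).
  move=> b hs; set w := (fun i => _ : R).
  have w0 : w ord0 = (1 - s) * g u ord0 + s * (2 * tau u - 1) by rewrite /w /g1 mk0.
  have /Rabs_le_between a1 := head_nrm _ w; have a2 := tl_nrm _ w; rewrite w0 in a1.
  have [h0 h1 cs] := bdy_cases _ _ (bg _ b).
  have tb := tau_b u.
  have flat : tau u * (1 - tau u) = 0 -> nrm (tl w) = (1 - s) * nrm (tl (g u)).
    move=> z; rewrite -scale_nrm; last lra.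
    congr nrm; apply: functional_extensionality => i.
    by rewrite /w /g1 /tl /mk liftK z; ring.
  case: (classic (u ord0 = 1)) => u0; last first.
    have t0 := tau0 u b u0; rewrite t0 in a1 flat.
    rewrite flat in a2; last ring.
    case: (Rlt_dec (nrm (tl (g u))) e) => lt; last first.
      by have : (1 - s) * e <= (1 - s) * nrm (tl (g u)) by [apply: Rmult_le_compat_l; lra]; nra.
    have := gN u b (or_introl u0) lt => h; case: cs => [|[c|]]; [lra|rewrite c in a1; nra|lra].
  case: (Rle_dec (nrm (tl u)) ro) => hr.
    have t1 := tau1 u u0 hr; rewrite t1 in a1 flat.
    rewrite flat in a2; last ring.
    case: (Rlt_dec (nrm (tl (g u))) e) => lt; last first.
      by have : (1 - s) * e <= (1 - s) * nrm (tl (g u)) by [apply: Rmult_le_compat_l; lra]; nra.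
    have := gS u b u0 lt => h; case: cs => [c|[c|]]; [rewrite c in a1; nra|lra|lra].
  have r0 : ro <= nrm (tl u) by lra.
  have gu := gC u b u0 r0; have nb : bdy (nu (tl u)) by apply: nu_nrm; lra.
  have be := bt_ge _ nb; have be' : nrm (tl (g u)) = nrm (bt (nu (tl u))) by rewrite gu.
  have tw : nrm (tl w) = (1 - s) * nrm (tl (g u)) + s * (tau u * (1 - tau u)) * nrm (tl u).
    set N := nrm (tl (g u)) in be'; set r := nrm (tl u).
    have -> : (1 - s) * N + s * (tau u * (1 - tau u)) * r =
      ((1 - s) + s * (tau u * (1 - tau u)) * r * / N) * nrm (tl (g u)).
      by rewrite -/N; field; lra.
    rewrite -scale_nrm.
      congr nrm; apply: functional_extensionality => l.
      rewrite /w /g1 /tl /mk liftK /bhat -/(tl u) -/r /nu -/(nu (tl u)) -be'.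
      have -> : bt (nu (tl u)) l = tl (g u) l by rewrite gu.
      by rewrite /tl; ring.
    apply: Rplus_le_le_0_compat; first lra.
    apply: Rmult_le_pos; last by apply/Rlt_le/Rinv_0_lt_compat; lra.
    by apply: Rmult_le_pos; [apply: Rmult_le_pos => //; lra|exact: nrm_pos].
  rewrite tw in a2; set T := tau u in a1 a2 tb *; set N := nrm (tl (g u)) in a2 be'.
  have p1 : (1 - s) * e <= (1 - s) * N by apply: Rmult_le_compat_l; lra.
  have p2 : s * (T * (1 - T)) * / 2 <= s * (T * (1 - T)) * nrm (tl u).
    apply: Rmult_le_compat_l; last lra.
    by apply: Rmult_le_pos; [lra|exact: tt].
  case: (Rle_dec s (3 / 4)) => hs'; first by have := tt u; rewrite -/T; nra.
  case: (Rle_dec (/ 2) (Rabs (2 * T - 1))) => hT.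
    by move: hT; rewrite /Rabs; case: Rcase_abs => ? ?; nra.
  have /Rabs_le_between hT' := Rlt_le _ _ (Rnot_le_lt _ _ hT).
  have : 3 / 16 <= T * (1 - T) by nra.
  nra.
(* Both tails are non-negative multiples of [bhat (tl u)], so that only the heads can cancel. *)
have farB u s : bdy u -> 0 <= s <= 1 -> / 16 <= nrm (fun i => (1 - s) * g1 u i + s * sus u i).
  move=> b hs; set w := (fun i => _ : R).
  have w0 : w ord0 = (1 - s) * (2 * tau u - 1) + s * u ord0 by rewrite /w /g1 /sus !mk0.
  have /Rabs_le_between a1 := head_nrm _ w; have a2 := tl_nrm _ w; rewrite w0 in a1.
  have [h0 h1 cs] := bdy_cases _ _ b; have tb := tau_b u; have tp := tt u.
  have tw : nrm (tl w) = ((1 - s) * (tau u * (1 - tau u)) + s) * nrm (tl u).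
    rewrite -bhat_nrm -scale_nrm; last by apply: Rplus_le_le_0_compat; [apply: Rmult_le_pos|]; lra.
    congr nrm; apply: functional_extensionality => l.
    by rewrite /w /g1 /sus {1}/tl /mk !liftK; ring.
  rewrite tw in a2.
  case: (classic (u ord0 = 1)) => u0; last first.
    have t0 := tau0 u b u0; rewrite t0 in a1 a2; case: cs => [//|[c|c]]; first by rewrite c in a1; lra.
    by rewrite c in a2; nra.
  case: (Rle_dec (nrm (tl u)) ro) => hr; first by rewrite (tau1 u u0 hr) u0 in a1; nra.
  rewrite u0 in a1; set T := tau u in a1 a2 tb tp *.
  have p2 : ((1 - s) * (T * (1 - T)) + s) * / 2 <= ((1 - s) * (T * (1 - T)) + s) * nrm (tl u).
    apply: Rmult_le_compat_l; last lra.
    by apply: Rplus_le_le_0_compat; [apply: Rmult_le_pos|]; lra.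
  case: (Rle_dec s (/ 4)) => hs'; last first.
    by have : 0 <= (1 - s) * (T * (1 - T)) by [apply: Rmult_le_pos; lra]; lra.
  case: (Rle_dec (/ 2) (Rabs (2 * T - 1))) => hT.
    by move: hT; rewrite /Rabs; case: Rcase_abs => ? ?; nra.
  have /Rabs_le_between hT' := Rlt_le _ _ (Rnot_le_lt _ _ hT).
  have : 3 / 16 <= T * (1 - T) by nra.
  nra.
exists bhat; split=> //; apply: (htpy_trans _ _ _ _ (fun u => nu (g1 u))).
  apply: (htpy_eq _ _ _ (fun u => nu (g u)) (fun u => nu (g1 u))) => //.
    by move=> u b; exact/nu_bdy/bg.
  by apply: (htpy_line _ _ _ _ _ (e / 16)) => //; [lra|exact: id_bnd].
apply: (htpy_eq _ _ _ (fun u => nu (g1 u)) (fun u => nu (sus u))) => //.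
  by move=> u b; exact/nu_bdy/bsus.
by apply: (htpy_line _ _ _ _ _ (/ 16)) => //; [lra|exact: id_bnd].
Qed.

(** Subtracting [v] from the tail moves the two points over [v] to the poles. The shift is faded out
    by [cl] towards the side faces, and [nrm v <= 1 / 4] keeps the image in the boundary. *)
Lemma pole_shift n (v : Rn n) : nrm v <= / 4 -> exists h : Rn n.+1 -> Rn n.+1,
  [/\ lipx bdy h, forall p, bdy p -> bdy (h p), htpy bdy (fun p => p) h,
      forall p, h p ord0 = p ord0 &
      forall p, nrm (tl (h p)) < / 8 -> ds (tl p) v <= nrm (tl (h p))].
Proof.
move=> hv; pose cl (p : Rn n.+1) := clamp (2 * (1 - nrm (tl p))).
pose h (p : Rn n.+1) : Rn n.+1 := mk (p ord0) (fun i => tl p i - cl p * v i).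
have cb p : 0 <= cl p <= 1 by exact: clamp_bounds.
have line p s : bdy p -> 0 <= s <= 1 -> bdy (mk (p ord0) (fun i => tl p i - s * (cl p * v i))).
  move=> b hs; have [h0 h1 cs] := bdy_cases _ _ b.
  have [e|lt] : nrm (tl p) = 1 \/ nrm (tl p) < 1 by lra.
    have -> : mk (p ord0) (fun i => tl p i - s * (cl p * v i)) = p; last by [].
    rewrite -[RHS]mk_eta; congr mk; apply: functional_extensionality => i.
    by rewrite /cl clamp_le0; [ring|lra].
  apply: bdy_mk; first by apply: Rabs_le.
    have sc : 0 <= s * cl p by apply: Rmult_le_pos; have := cb p; lra.
    have : nrm (fun i => tl p i + s * cl p * (-1 * v i)) <= nrm (tl p) + s * cl p * nrm v.
      apply: Rle_trans (nrm_triang _ _ _) _.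
      by rewrite (scale_nrm _ (s * cl p)) // nrm_scal Rabs_Ropp Rabs_R1; lra.
    have -> : (fun i => tl p i + s * cl p * (-1 * v i)) = (fun i => tl p i - s * (cl p * v i)).
      by apply: functional_extensionality => i; ring.
    have : s * cl p * nrm v <= 1 * cl p * / 4.
      apply: Rmult_le_compat => //; first exact: nrm_pos.
      by apply: Rmult_le_compat_r; [have := cb p|]; lra.
    by rewrite /cl; case: (clamp_cases (2 * (1 - nrm (tl p)))) => [|[|]] [? ->]; lra.
  by left; case: cs => [->|[->|]]; rewrite ?Rabs_Ropp ?Rabs_R1 //; lra.
have h1 p : h p = mk (p ord0) (fun i => tl p i - 1 * (cl p * v i)).
  by rewrite /h; congr mk; apply: functional_extensionality => i; ring.
have bh p : bdy p -> bdy (h p) by move=> b; rewrite h1; apply: line => //; lra.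
have lh : lipx bdy h.
  apply: mk_lipx; first exact: lipx_coord.
  apply: lipx_vec => i; apply: lipx_minus; first by exact: (lipx_app _ _ _ (@tl n) i (tl_lipx _ _)).
  apply: lipx_mul; [|exact: lipx_cst|exact: clamp_bnd|exact: bnd_cst].
  apply: clamp_lipx; apply: lipx_scal; apply: lipx_minus; first exact: lipx_cst.
  by apply: lipx_nrm_comp; exact: tl_lipx.
have one_bnd (q : Rn n.+1 -> Rn n.+1) : (forall u, bdy u -> bdy (q u)) -> bnd bdy (fun u => nrm (q u)).
  by move=> bq; exists 1 => u b; rewrite bq // Rabs_R1; lra.
exists h; split=> //.
- apply: (htpy_eq _ _ _ (fun u => nu u) (fun u => nu (h u))).
  + exact: nu_bdy.
  + by move=> u /bh /nu_bdy.
  apply: (htpy_line _ _ _ _ _ 1) => //; [lra|exact: lipx_id|exact: one_bnd|exact: one_bnd|].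
  move=> u s b hs.
  have -> : (fun i => (1 - s) * u i + s * h u i) = mk (u ord0) (fun i => tl u i - s * (cl u * v i)).
    apply: functional_extensionality => i; rewrite /h -{1}(mk_eta _ u) /mk.
    by case: (unlift ord0 i) => [l|]; ring.
  by right; rewrite (line u s b hs).
- by move=> p; rewrite /h mk0.
move=> p; rewrite /h tl_mk => lt.
have [le|gt] : nrm (tl p) <= / 2 \/ / 2 < nrm (tl p) by lra.
  right; rewrite /ds /= /rn_ds; congr nrm; apply: functional_extensionality => i.
  by rewrite /cl clamp_ge1; [ring|lra].
exfalso; have := nrm_rev _ (tl p) (fun i => - cl p * v i).
rewrite nrm_scal Rabs_Ropp Rabs_right; last by have := cb p; lra.
have : cl p * nrm v <= 1 * / 4 by apply: Rmult_le_compat => //; [have := cb p; lra|exact: nrm_pos|have := cb p; lra].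
have -> : (fun i => tl p i + - cl p * v i) = (fun i => tl p i - cl p * v i).
  by apply: functional_extensionality => i; ring.
lra.
Qed.

(* The map [x |-> o + Rd x * x] takes the unit ball onto a thin star around the segments from [o] to
   the [p i]. *)
Lemma radial_star k e (o : Rn k) N (p : 'I_N.+1 -> Rn k) :
  0 < e <= / 256 -> nrm o <= / 2 -> (forall i, nrm (p i) <= / 2) ->
  exists Rd : Rn k -> R, [/\ lipx (fun=> True) (fun x => (fun i => Rd x * x i) : Rn k),
    forall x, e <= Rd x <= 2, forall x c, 0 < c -> Rd (fun i => c * x i) = Rd x,
    forall x i, @ds (Rn_met k) (fun l => o l + Rd x * x l) (p i) <= e -> nrm x < 1 - e / 4 &
    forall x, nrm x <= 1 -> exists i s, 0 <= s <= 1 /\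
      @ds (Rn_met k) (fun l => o l + Rd x * x l) (lerp o (p i) s) <= 7 * e].
Proof.
move=> he ho hp; have ie : 0 < / (2 * e) by apply: Rinv_0_lt_compat; lra.
pose d i := ds (p i) o.
pose dev i (th : Rn k) := nrm (fun l => d i * th l - (p i l - o l)).
(* A spike reaches [2 * e] beyond [p i]; it has full height for [dev <= 2 * e] and is gone for
   [dev >= 4 * e]. [Rt] is the upper envelope of the spikes and of the constant [e]. *)
pose spike (th : Rn k) : Rn N.+1 := fun i => (d i + 2 * e) * clamp (2 - / (2 * e) * dev i th).
pose Rt th := Rmax e (nrm (spike th)).
have d0 i : 0 <= d i <= 1.
  split; first exact: ds_pos.
  have := ds_tri (p i) ((fun=> 0) : Rn k) o; rewrite -/(d i).
  have z (x : Rn k) : nrm x <= / 2 -> ds x ((fun=> 0) : Rn k) <= / 2.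
    move=> h; apply: rds_le => [|l]; first lra.
    by rewrite Rminus_0_r; apply: Rle_trans h; exact: nrm_coord.
  by have := z _ (hp i); have := z _ ho; rewrite (ds_sym _ o); lra.
have sp0 th i : 0 <= spike th i <= d i + 2 * e.
  have c := clamp_bounds (2 - / (2 * e) * dev i th); have := d0 i => h.
  by rewrite /spike; split; [apply: Rmult_le_pos; lra|rewrite -[X in _ <= X]Rmult_1_r; apply: Rmult_le_compat_l; lra].
have Rt_b th : e <= Rt th <= 2.
  split; first exact: Rmax_l.
  apply: Rmax_lub; first lra.
  apply: nrm_le => [|i]; first lra.
  by have := sp0 th i; have := d0 i => ? ?; apply: Rabs_le; lra.
have lRt : lipx (fun=> True) Rt.
  apply: lipx_max; first exact: lipx_cst.
  apply: lipx_nrm_comp; apply: lipx_vec => i; apply: lipx_scal; apply: clamp_lipx.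
  apply: lipx_minus; first exact: lipx_cst.
  apply: lipx_scal; apply: lipx_nrm_comp; apply: lipx_vec => l.
  by apply: lipx_minus; [apply: lipx_scal; exact: lipx_coord|exact: lipx_cst].
exists (fun x => Rt (nu x)); split.
- apply: lipx_vec => i.
  apply: (lipx_eq (Rn_met k) R_met _ (fun x => nrm x * (Rt (nu x) * nu x i))).
    move=> x _; have x0 := nrm_pos _ x.
    have [z|z] : nrm x = 0 \/ 0 < nrm x by lra.
      by rewrite z Rmult_0_l (nrm_eq0 _ _ z) Rmult_0_r.
    have e1 : nrm x * nu x i = x i by rewrite /nu; field; lra.
    by rewrite -[in RHS]e1 -!Rmult_assoc (Rmult_comm (nrm x)).
  apply: (cone_lipx k (fun th => Rt th * th i)).
    apply: lipx_mul; [by apply: lipx_sub lRt|exact: lipx_coord| |].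
      by exists 2 => th _; have := Rt_b th => ?; apply: Rabs_le; lra.
    by exists 1 => th b; have := nrm_coord _ th i; rewrite b.
  exists (2 * 1) => th b; apply: Rabs_mul_le.
    by have := Rt_b th => ?; apply: Rabs_le; lra.
  by have := nrm_coord _ th i; rewrite b.
- by move=> x; exact: Rt_b.
- move=> x c c0; have x0 := nrm_pos _ x.
  have [z|z] : nrm x = 0 \/ 0 < nrm x by lra.
    by rewrite (nrm_eq0 _ _ z); congr Rt; apply: functional_extensionality => i; rewrite /nu !Rmult_0_r !Rmult_0_l.
  by rewrite nu_scal.
- move=> x i; set r := Rt (nu x) => near; apply: Rnot_le_lt => ge.
  have x0 : 0 < nrm x by lra.
  have b : bdy (nu x) by exact: nu_nrm.
  have ex l : r * x l = r * nrm x * nu x l by rewrite /nu; field; lra.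
  have near' : nrm (fun l => r * nrm x * nu x l - (p i l - o l)) <= e.
    apply: Rle_trans near; right; rewrite /ds /= /rn_ds; congr nrm.
    by apply: functional_extensionality => l; rewrite ex; ring.
  have rb := Rt_b (nu x); rewrite -/r in rb.
  have rn0 : 0 <= r * nrm x by apply: Rmult_le_pos; lra.
  have td : Rabs (r * nrm x - d i) <= e.
    apply: Rle_trans near'.
    have /(_ (fun l => r * nrm x * nu x l) (fun l => p i l - o l)) := nrm_lip k.
    by rewrite scale_nrm // b Rmult_1_r.
  have dv : dev i (nu x) <= 2 * e.
    rewrite /dev; have -> : (fun l => d i * nu x l - (p i l - o l)) =
      (fun l => (r * nrm x * nu x l - (p i l - o l)) + (d i - r * nrm x) * nu x l).
      by apply: functional_extensionality => l; ring.
    apply: Rle_trans (nrm_triang _ _ _) _; rewrite nrm_scal b Rmult_1_r Rabs_minus_sym; lra.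
  have sp : spike (nu x) i = d i + 2 * e.
    rewrite /spike clamp_ge1 ?Rmult_1_r //.
    have := Rmult_le_compat_l (/ (2 * e)) _ _ (Rlt_le _ _ ie) dv.
    by rewrite Rinv_l; lra.
  have rge : d i + 2 * e <= r.
    rewrite -sp; apply: Rle_trans (Rmax_r _ _); apply: Rle_trans (nrm_coord _ _ i).
    exact: Rle_abs.
  move: td => /Rabs_le_between td.
  have di0 := d0 i; have r0 : 0 <= r by lra.
  (* As [r <= 2], a norm of at least [1 - e / 4] gives [r * nrm x >= r - e / 2 >= d i + 3 / 2 * e],
     more than the [d i + e] allowed by [td]. *)
  have := Rmult_le_compat_l r _ _ r0 ge; nra.
move=> x x1; set r := Rt (nu x); have x0 := nrm_pos _ x; have rb := Rt_b (nu x).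
rewrite -/r in rb; pose y : Rn k := fun l => o l + r * x l.
have [le|gt] : r * nrm x <= 2 * e \/ 2 * e < r * nrm x by lra.
  exists ord0, 0; split; first lra.
  apply: (@Rle_trans _ (2 * e)); last lra.
  have <- : nrm (fun l => r * x l) = ds y (lerp o (p ord0) 0).
    by rewrite /ds /= /rn_ds; congr nrm; apply: functional_extensionality => l; rewrite /y /lerp; ring.
  by rewrite scale_nrm; lra.
have xp : 0 < nrm x by nra.
have rr : r * nrm x <= r by nra.
have [i [ri di]] : exists i, r <= d i + 2 * e /\ dev i (nu x) <= 4 * e.
  have [i ei] := nrm_attained _ (spike (nu x)); exists i.
  have er : r = spike (nu x) i.
    have s0 := sp0 (nu x) i; rewrite Rabs_right in ei; last lra.
    by move: rr gt; rewrite /r /Rt ei /Rmax; case: Rle_dec => // ? ? ?; lra.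
  have s0 := sp0 (nu x) i; split; first lra.
  apply: Rnot_lt_le => lt; move: er; rewrite /spike clamp_le0; first by lra.
  have := Rmult_le_compat_l (/ (2 * e)) _ _ (Rlt_le _ _ ie) (Rlt_le _ _ lt).
  have -> : / (2 * e) * (4 * e) = 2 by field; lra.
  lra.
have di0 := d0 i.
have [s [hs se]] : exists s, 0 <= s <= 1 /\ Rabs (r * nrm x - s * d i) <= 2 * e.
  have [le|lt] : d i <= r * nrm x \/ r * nrm x < d i by lra.
    by exists 1; split; [lra|apply: Rabs_le; lra].
  have dp : 0 < d i by lra.
  exists (r * nrm x / d i); split.
    split; first by apply: Rmult_le_pos; [lra|apply/Rlt_le/Rinv_0_lt_compat].
    by apply: (Rmult_le_reg_r (d i)) => //; have -> : r * nrm x / d i * d i = r * nrm x by [field; lra]; lra.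
  have -> : r * nrm x - r * nrm x / d i * d i = 0 by field; lra.
  by rewrite Rabs_R0; lra.
exists i, s; split=> //.
have -> : ds y (lerp o (p i) s) =
  nrm (fun l => (r * nrm x - s * d i) * nu x l + s * (d i * nu x l - (p i l - o l))).
  rewrite /ds /= /rn_ds; congr nrm; apply: functional_extensionality => l.
  by rewrite /y /lerp /nu; field; lra.
apply: Rle_trans (nrm_triang _ _ _) _; rewrite nrm_scal nu_nrm // Rmult_1_r scale_nrm; last lra.
have : s * dev i (nu x) <= 1 * (4 * e) by apply: Rmult_le_compat => //; [lra|exact: nrm_pos|lra].
by rewrite /dev; lra.
Qed.

(** The coordinatewise retraction onto the cube; it extends maps of the top face to the whole
    space. *)
Definition trunc {m} (x : Rn m) : Rn m := fun i => 2 * clamp (/ 2 * (x i + 1)) - 1.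

Lemma trunc_cub m (x : Rn m) : cub (trunc x).
Proof.
apply: nrm_le => [|i]; first lra.
by have := clamp_bounds (/ 2 * (x i + 1)) => ?; apply: Rabs_le; rewrite /trunc; lra.
Qed.

Lemma trunc_id m (x : Rn m) : cub x -> trunc x = x.
Proof.
move=> c; apply: functional_extensionality => i; rewrite /trunc.
have /Rabs_le_between := Rle_trans _ _ _ (nrm_coord _ x i) c.
by move=> h; rewrite clamp_id; lra.
Qed.

Lemma trunc_lip m : Lip (fun=> True) 1 (@trunc m).
Proof.
split=> [|u v _ _]; first lra.
rewrite Rmult_1_l; apply: rds_le => [|i]; first exact: ds_pos.
have := clamp_lip (/ 2 * (u i + 1)) (/ 2 * (v i + 1)).
have -> : / 2 * (u i + 1) - / 2 * (v i + 1) = / 2 * (u i - v i) by ring.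
rewrite Rabs_mult (Rabs_right (/ 2)); last lra.
have -> : trunc u i - trunc v i = 2 * (clamp (/ 2 * (u i + 1)) - clamp (/ 2 * (v i + 1))).
  by rewrite /trunc; ring.
rewrite Rabs_mult (Rabs_right 2); last lra.
by have := rds_coord _ u v i; lra.
Qed.

Lemma trunc_half m (x : Rn m) : / 2 <= nrm x -> / 2 <= nrm (trunc x).
Proof.
move=> h; case: (Rle_dec (nrm x) 1) => le; first by rewrite trunc_id.
have [i hi] : exists i, 1 < Rabs (x i).
  apply: NNPP => no; apply: le; apply: nrm_le => [|i]; first lra.
  by apply: Rnot_lt_le => lt; apply: no; exists i.
apply: Rle_trans (nrm_coord _ (trunc x) i); rewrite /trunc; move: hi; rewrite /Rabs.
case: (Rcase_abs (x i)) => s hi; first by rewrite clamp_le0; last lra; case: Rcase_abs; lra.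
by rewrite clamp_ge1; last lra; case: Rcase_abs; lra.
Qed.

Lemma top_lift m (x : Rn m) : bdy (mk 1 (trunc x)).
Proof. by apply: bdy_mk; [rewrite Rabs_R1; lra|exact: trunc_cub|left; exact: Rabs_R1]. Qed.

Lemma top_lift_lip m : Lip (fun=> True) 1 (fun x : Rn m => mk 1 (trunc x)).
Proof.
split=> [|u v _ _]; first lra.
rewrite Rmult_1_l; apply: rds_le => [|i]; first exact: ds_pos.
rewrite /mk; case: (unlift ord0 i) => [l|]; last by rewrite Rminus_diag Rabs_R0; exact: ds_pos.
apply: Rle_trans (rds_coord _ (trunc u) (trunc v) l) _.
by have := proj2 (trunc_lip m) u v I I; rewrite Rmult_1_l.
Qed.

(** After the collapse, [beta] amounts to a map [f] of the top face that is constant off a ball.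
    General position gives a star that contains the points over [v] on the upper face and misses
    those on the lower one. The self-map [nu o Phi], homotopic to the identity, spreads the top face
    over this star, with the upper points reached only inside radius [ro]; this is the situation of
    [suspension_criterion]. *)
Lemma suspension_normal_form k n (beta : Rn k.+1 -> Rn n.+1) :
  (0 < n)%N -> (n <= k)%N -> (k + 2 <= 2 * n)%N -> lipx bdy beta -> (forall u, bdy u -> bdy (beta u)) ->
  exists bhat : Rn k -> Rn n, [/\ lipx (fun=> True) bhat, forall x, nrm (bhat x) = nrm x &
    htpy bdy beta (fun u => mk (u ord0) (bhat (tl u)))].
Proof.
move=> n0 nk kn lb bb; have [psi [lpsi bpsi hpsi psiE]] := collapse k.
pose f (x : Rn k) := beta (psi (mk 1 (trunc x))); pose st := beta spole.
have bsp : bdy (@spole k).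
  apply: bdy_mk; [rewrite Rabs_Ropp Rabs_R1; lra|rewrite nrm0; lra|left].
  by rewrite Rabs_Ropp Rabs_R1.
have bf x : bdy (f x) by apply/bb/bpsi/top_lift.
have [Lf lf] : lipx (fun=> True) f.
  apply: (lipx_comp _ _ _ _ bdy (fun x => psi (mk 1 (trunc x))) beta) => //.
    by move=> x _; apply/bpsi/top_lift.
  apply: (lipx_comp _ _ _ _ bdy (fun x : Rn k => mk 1 (trunc x)) psi) => //.
    by move=> x _; exact: top_lift.
  by exists 1; exact: top_lift_lip.
have fout x : / 2 <= nrm x -> f x = st.
  move=> h; rewrite /f psiE //; first exact: top_lift.
  by right; rewrite tl_mk; exact: trunc_half.
have lf' : Lip (fun=> True) (Rmax 1 Lf) f by apply: Lip_weak lf; exact: Rmax_r.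
have [e [v [o [N [p [[he hv hst ho hp] [near far]]]]]]] :=
  general_position k n n0 nk kn f st (Rmax 1 Lf) (Rmax_l _ _) lf' bf fout.
have [h [lh bh hh h0 hnear]] := pole_shift n v hv.
have [Rd [lRd Rb Rh RN RS]] := radial_star k e o N p he ho hp.
(* [ro] is the radius from [radial_star]. [Q] is so large that on the sides [star (z u)] is far out
   even where [Rd] is only [e]: for [u ord0 <= 1 / 4] one has [Rd * (1 - u ord0) * Q >= 3]. *)
pose ro := 1 - e / 4; pose Q := 4 / e.
have ro0 : / 2 <= ro < 1 by rewrite /ro; lra.
have ie : 0 < / e by apply: Rinv_0_lt_compat; lra.
have eQ : e * Q = 4 by rewrite /Q; field; lra.
have Q0 : 0 < Q by rewrite /Q /Rdiv; lra.
(* The factor is [1] on the core of the top face and inverse to the radius on its collar, where [z]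
   thus depends only on the direction; down the sides it grows. *)
pose mm (u : Rn k.+1) := ro * / Rmax (nrm (tl u)) ro + (1 - u ord0) * Q.
pose z (u : Rn k.+1) : Rn k := fun i => mm u * tl u i.
pose star (x : Rn k) : Rn k := fun i => o i + Rd x * x i.
pose Phi (u : Rn k.+1) : Rn k.+1 := mk (2 * clamp (u ord0 + / 2) - 1) (star (z u)).
have mx (u : Rn k.+1) : ro <= Rmax (nrm (tl u)) ro by exact: Rmax_r.
have m_b (u : Rn k.+1) : bdy u -> (1 - u ord0) * Q <= mm u /\ 0 < mm u <= 1 + 2 * Q.
  move=> b; have [h1 h2 _] := bdy_cases _ u b; have := mx u => mu.
  have i0 : 0 < / Rmax (nrm (tl u)) ro by apply: Rinv_0_lt_compat; lra.
  have i1 : ro * / Rmax (nrm (tl u)) ro <= 1.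
    rewrite -(Rinv_r (Rmax (nrm (tl u)) ro)); last by lra.
    by apply: Rmult_le_compat_r; lra.
  have i2 : 0 < ro * / Rmax (nrm (tl u)) ro by apply: Rmult_lt_0_compat; lra.
  rewrite /mm; nra.
have z_top (u : Rn k.+1) : u ord0 = 1 -> nrm (tl u) <= ro -> z u = tl u.
  move=> e1 le; apply: functional_extensionality => i; rewrite /z /mm e1 Rmax_right //.
  by field; lra.
have z_collar (u : Rn k.+1) : u ord0 = 1 -> ro <= nrm (tl u) -> z u = fun i => ro * nu (tl u) i.
  move=> e1 le; apply: functional_extensionality => i; rewrite /z /mm e1 Rmax_left // /nu.
  by field; move: le; lra.
have z_side (u : Rn k.+1) : bdy u -> u ord0 <> 1 -> / 2 <= u ord0 -> ro <= nrm (z u).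
  move=> b ne hu; have [h1 _ [//|[|e1]]] := bdy_cases _ u b; first lra.
  have [_ m0] := m_b u b; rewrite scale_nrm ?e1; last lra.
  rewrite /mm e1 Rmax_left; last by lra.
  have : 0 <= (1 - u ord0) * Q by apply: Rmult_le_pos; lra.
  by rewrite Rinv_1; lra.
have Phi_line (u : Rn k.+1) s : bdy u -> 0 <= s <= 1 -> / 4 <= nrm (fun i => (1 - s) * u i + s * Phi u i).
  move=> b hs; set w := (fun i => _ : R); have [h1 h2 cs] := bdy_cases _ u b.
  have [big|small] : / 4 <= Rabs (u ord0) \/ Rabs (u ord0) < / 4 by lra.
    apply: Rle_trans (head_nrm _ w); rewrite /w /Phi mk0; move: big; rewrite /Rabs.
    case: (Rcase_abs (u ord0)) => sg big; case: Rcase_abs;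
      by case: (clamp_cases (u ord0 + / 2)) => [|[|]] [? ->]; nra.
  have /Rabs_le_between sm := Rlt_le _ _ small.
  have e1 : nrm (tl u) = 1 by case: cs => [|[|]] //; lra.
  have [m1 m0] := m_b u b; have rb := Rb (z u).
  apply: Rle_trans (tl_nrm _ w).
  have -> : tl w = fun i => ((1 - s) + s * (Rd (z u) * mm u)) * tl u i + s * o i.
    by apply: functional_extensionality => i; rewrite /w /Phi /tl /mk liftK /star /z /tl; ring.
  have c0 : 3 <= Rd (z u) * mm u.
    apply: (@Rle_trans _ (e * (3 / 4 * Q))); first lra.
    by apply: Rmult_le_compat; nra.
  apply: Rle_trans (nrm_rev _ _ _); rewrite !scale_nrm ?e1; [|lra|nra].
  nra.
have Phi1 (u : Rn k.+1) : bdy u -> / 4 <= nrm (Phi u).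
  move=> b; have := Phi_line u 1 b ltac:(lra).
  by congr (_ <= nrm _); apply: functional_extensionality => i; ring.
have ltl : lipx bdy (fun u : Rn k.+1 => nrm (tl u)) by apply: lipx_nrm_comp; exact: tl_lipx.
have lz : lipx bdy z.
  apply: lipx_vec => i; apply: lipx_mul.
  - apply: lipx_add.
      apply: lipx_scal; apply: (lipx_inv _ _ ro) => [||u _]; [lra| |exact: mx].
      by apply: lipx_max => //; exact: lipx_cst.
    apply: (lipx_eq _ R_met _ (fun u : Rn k.+1 => Q * (1 - u ord0))) => [u _|]; first exact: Rmult_comm.
    by apply: lipx_scal; apply: lipx_minus; [exact: lipx_cst|exact: lipx_coord].
  - exact: lipx_coord.
  - by exists (1 + 2 * Q) => u b; have [_ ?] := m_b u b; apply: Rabs_le; lra.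
  by exists 1 => u b; have := nrm_coord _ u (lift ord0 i); rewrite b.
have lstar : lipx bdy (fun u => star (z u)).
  apply: (lipx_compT (Rn_met k.+1) (Rn_met k)) lz _.
  apply: lipx_vec => i; apply: lipx_add; first exact: lipx_cst.
  exact: (lipx_app _ _ _ (fun x => (fun i => Rd x * x i) : Rn k) i lRd).
have lPhi : lipx bdy Phi.
  apply: mk_lipx lstar; apply: lipx_minus; last exact: lipx_cst.
  apply: lipx_scal; apply: clamp_lipx; apply: lipx_add; [exact: lipx_coord|exact: lipx_cst].
have bPhi (u : Rn k.+1) : bdy u -> bdy (nu (Phi u)) by move=> /Phi1 ?; apply: nu_nrm; lra.
pose g0 (u : Rn k.+1) := h (beta (psi u)); pose g u := g0 (nu (Phi u)).
have lg0 : lipx bdy g0.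
  apply: (lipx_comp _ _ _ _ bdy (fun u => beta (psi u)) h) => //; first by move=> u b; exact/bb/bpsi.
  by apply: (lipx_comp _ _ _ _ bdy psi beta).
have bg0 (u : Rn k.+1) : bdy u -> bdy (g0 u) by move=> b; apply/bh/bb/bpsi.
have hg : htpy bdy beta g.
  apply: (htpy_trans _ _ _ _ (fun u => beta (psi u))); first exact: htpy_post hpsi.
  apply: (htpy_trans _ _ _ _ g0).
    by apply: (htpy_pre _ _ bdy _ bdy (fun u => beta (psi u)) (fun q => q) h) => //;
      [apply: (lipx_comp _ _ _ _ bdy psi beta)|move=> u b; exact/bb/bpsi].
  apply: (htpy_post _ _ _ _ g0 (fun u => u) (fun u => nu (Phi u))) => //.
  apply: (htpy_eq _ _ _ (fun u => nu u) (fun u => nu (Phi u))) => //; first exact: nu_bdy.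
  apply: (htpy_line _ _ _ _ _ (/ 4)) => //; [lra|exact: lipx_id| |].
    by exists 1 => u b; rewrite b Rabs_R1; lra.
  have [M hM] : bnd bdy (fun u => nrm (Phi u)).
    exists (1 + (/ 2 + 2 * (1 + 2 * Q))) => u b; rewrite Rabs_right; last by apply/Rle_ge/nrm_pos.
    rewrite /Phi nrm_mk mk0 tl_mk; apply: Rmax_lub.
      by have := clamp_bounds (u ord0 + / 2) => ?; apply: Rabs_le; lra.
    have := nrm_triang _ o (fun i => Rd (z u) * z u i); rewrite -/(star (z u)) => t.
    have rb := Rb (z u); rewrite (scale_nrm _ (Rd (z u))) in t; last lra.
    have [_ m0] := m_b u b; have [_ t1 _] := bdy_cases _ u b.
    have zz : nrm (z u) <= (1 + 2 * Q) * 1.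
      by rewrite scale_nrm; [apply: Rmult_le_compat|]; lra.
    have : Rd (z u) * nrm (z u) <= 2 * ((1 + 2 * Q) * 1).
      by apply: Rmult_le_compat => //; [lra|exact: nrm_pos|lra].
    lra.
  by exists M.
have lg : lipx bdy g.
  apply: (lipx_comp _ _ _ _ bdy (fun u => nu (Phi u)) g0) => //.
  apply: (lipx_comp _ _ _ _ (fun u => / 4 <= nrm u) Phi (@nu k.+1)) => //.
  by apply: nu_lipx; lra.
(* If the star point is outside the cube, [nu] takes [Phi u] off the top face, and both sides are
   [h st]. *)
have g_top (u : Rn k.+1) : bdy u -> / 2 <= u ord0 -> g u = h (f (star (z u))).
  move=> b hu; rewrite /g /g0; congr h.
  have eP : Phi u = mk 1 (star (z u)) by rewrite /Phi clamp_ge1; [congr mk; ring|lra].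
  have [le|gt] : nrm (star (z u)) <= 1 \/ 1 < nrm (star (z u)) by lra.
    rewrite /f trunc_id // eP nu_bdy //.
    by apply: bdy_mk; [rewrite Rabs_R1; lra| |left; exact: Rabs_R1].
  rewrite fout; last lra.
  rewrite psiE //; [exact: bPhi|left].
  have nP : 1 < nrm (Phi u) by rewrite eP; apply: Rlt_le_trans gt _; rewrite -[X in nrm X <= _](tl_mk _ 1); exact: tl_nrm.
  have : / nrm (Phi u) < 1 by rewrite -Rinv_1; apply: Rinv_lt_contravar; lra.
  by rewrite /nu [in X in X * _]eP mk0 Rmult_1_l; lra.
have g_low (u : Rn k.+1) : bdy u -> u ord0 < / 2 -> g u = h st.
  move=> b hu; rewrite /g /g0 psiE //; [exact: bPhi|left => e1].
  have nP := Phi1 u b; set w := 2 * clamp (u ord0 + / 2) - 1.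
  have ew : w = nrm (Phi u).
    by move: e1; rewrite {1}/nu {1}/Phi mk0 -/w => e1; rewrite -(Rmult_1_l (nrm _)) -e1; field; lra.
  have w1 : w < 1 /\ 0 < u ord0.
    by move: ew; rewrite /w; case: (clamp_cases (u ord0 + / 2)) => [|[|]] [? ->]; lra.
  have [_ _ [|[|e2]]] := bdy_cases _ u b; [lra|lra|].
  have := tl_nrm _ (Phi u); rewrite tl_mk -ew.
  have [m1 m0] := m_b u b; have rb := Rb (z u).
  have -> : star (z u) = fun i => (Rd (z u) * mm u) * tl u i + o i.
    by apply: functional_extensionality => i; rewrite /star /z; ring.
  have := nrm_rev _ (fun i => (Rd (z u) * mm u) * tl u i) o; rewrite scale_nrm ?e2; last by apply: Rmult_le_pos; lra.
  have c0 : 2 <= Rd (z u) * mm u.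
    apply: (@Rle_trans _ (e * (/ 2 * Q))); first lra.
    by apply: Rmult_le_compat; nra.
  lra.
have st_far : e <= nrm (tl (h st)).
  apply: Rnot_lt_le => lt; have lt8 : nrm (tl (h st)) < / 8 by lra.
  by have := hnear st lt8; lra.
have hf_near x : nrm (tl (h (f x))) < e -> ds (tl (f x)) v < e.
  move=> lt; have lt8 : nrm (tl (h (f x))) < / 8 by lra.
  by have := hnear (f x) lt8; lra.
have [bhat [bh1 bh2 bh3]] : exists bhat : Rn k -> Rn n, [/\ lipx (fun=> True) bhat,
    forall x, nrm (bhat x) = nrm x & htpy bdy g (fun u => mk (u ord0) (bhat (tl u)))].
  apply: (suspension_criterion k n g ro e) => //; [lra| | | |].
  - by move=> u /bPhi /bg0.
  - move=> u b hu lt; apply: Rnot_lt_le => pos.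
    have [lo|hi] : u ord0 < / 2 \/ / 2 <= u ord0 by lra.
      by rewrite g_low // in lt; lra.
    rewrite g_top // h0 in lt pos; have [i hi'] := near _ (hf_near _ lt) pos.
    have zs := RN (z u) i hi'; suff : ro <= nrm (z u) by rewrite /ro; lra.
    case: (classic (u ord0 = 1)) => e1; last exact: z_side.
    case: hu => // r; rewrite z_collar // scale_nrm ?nu_nrm; lra.
  - move=> u b e1 lt; apply: Rnot_lt_le => neg.
    rewrite g_top // ?h0 in lt neg; try lra.
    have [|i [s [hs le]]] := RS (z u).
      have [_ t1 _] := bdy_cases _ u b.
      case: (Rle_dec (nrm (tl u)) ro) => r; first by rewrite z_top //; lra.
      rewrite z_collar; [|by []|lra]; rewrite scale_nrm ?nu_nrm; lra.
    by have := far _ (hf_near _ lt) neg i s hs; rewrite /star; lra.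
  move=> u b e1 r; rewrite g_top //; last lra.
  have nt : nrm (nu (tl u)) = 1 by apply: nu_nrm; lra.
  have rr : nrm (fun i => ro * nu (tl u) i) = ro by rewrite scale_nrm ?nt; lra.
  rewrite g_top; last by rewrite mk0; lra.
    by rewrite z_collar // z_top ?mk0 ?tl_mk ?rr //; lra.
  apply: bdy_mk; [rewrite Rabs_R1; lra|rewrite rr; lra|left; exact: Rabs_R1].
by exists bhat; split=> //; exact: htpy_trans hg bh3.
Qed.

(** * The refinement step *)

Definition sw {m} (a : 'I_m.+1) (u : Rn m.+1) : Rn m.+1 := fun i => u (tperm ord0 a i).

Lemma swK m (a : 'I_m.+1) u : sw a (sw a u) = u.
Proof. by apply: functional_extensionality => i; rewrite /sw tpermK. Qed.

Lemma sw_nrm m (a : 'I_m.+1) u : nrm (sw a u) = nrm u.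
Proof.
have le w : nrm (sw a w) <= nrm w.
  by apply: nrm_le => [|i]; [exact: nrm_pos|exact: (nrm_coord _ w (tperm ord0 a i))].
by apply: Rle_antisym (le u) _; have := le (sw a u); rewrite swK.
Qed.

Lemma sw_lipx m (a : 'I_m.+1) D : lipx D (sw a).
Proof. by apply: lipx_vec => i; exact: lipx_coord. Qed.

(** Transpositions move the suspension directions from [ord0] to [a] and [b]. Since [bh] preserves
    norms, the suspension maps boundary to boundary. *)
Lemma levelled_map k n (beta : Rn k.+1 -> Rn n.+1) (a : 'I_k.+1) (b : 'I_n.+1) :
  (0 < n)%N -> (n <= k)%N -> (k + 2 <= 2 * n)%N -> lipx bdy beta ->
  (forall u, bdy u -> bdy (beta u)) ->
  exists S : Rn k.+1 -> Rn n.+1,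
  [/\ lipx cub S, forall u, bdy u -> bdy (S u), forall u, cub u -> S u b = u a,
   forall u u', cub u -> cub u' -> (forall i, i != a -> u i = u' i) ->
     forall c, c != b -> S u c = S u' c & htpy bdy beta S].
Proof.
move=> n0 nk kn lb bb; pose beta' u := sw b (beta (sw a u)).
have bsw m (c : 'I_m.+1) u : bdy u -> bdy (sw c u) by rewrite /bdy sw_nrm.
have lb1 : lipx bdy (fun u => beta (sw a u)).
  apply: (lipx_comp (Rn_met k.+1) (Rn_met k.+1) (Rn_met n.+1) _ bdy (sw a)) => //; last exact: sw_lipx.
  by move=> u; exact: bsw.
have lb' : lipx bdy beta'.
  by apply: (lipx_compT (Rn_met k.+1) (Rn_met n.+1)) lb1 _; exact: sw_lipx.
have bb' u : bdy u -> bdy (beta' u) by move=> h; apply/bsw/bb/bsw.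
have [bh [lbh nbh hbh]] := suspension_normal_form k n beta' n0 nk kn lb' bb'.
pose sus (u : Rn k.+1) : Rn n.+1 := mk (u ord0) (bh (tl u)).
have sus_nrm u : nrm (sus u) = nrm u by rewrite /sus nrm_mk mk0 tl_mk nbh -nrm_mk.
exists (fun u => sw b (sus (sw a u))); split.
- apply: (lipx_compT (Rn_met k.+1) (Rn_met n.+1)); last exact: sw_lipx.
  apply: (lipx_compT (Rn_met k.+1) (Rn_met k.+1) _ _ (sw a) sus); first exact: sw_lipx.
  apply: mk_lipx; first exact: lipx_coord.
  by apply: (lipx_compT (Rn_met k.+1) (Rn_met k)) lbh; exact: tl_lipx.
- by move=> u h; rewrite /bdy sw_nrm sus_nrm sw_nrm.
- by move=> u _; rewrite /sw tpermR /sus mk0 tpermL.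
- move=> u u' _ _ e c cb; rewrite /sw /sus /mk; case: unliftP => [l _|E].
    congr (bh _ l); apply: functional_extensionality => i; rewrite /tl; apply: e.
    by apply/eqP => h; have := neq_lift ord0 i; rewrite -(tpermK ord0 a (lift ord0 i)) h tpermR eqxx.
  by move: cb; rewrite -(tpermK ord0 b c) E tpermL eqxx.
apply: (htpy_eq _ _ _ (fun u => sw b (beta' (sw a u))) (fun u => sw b (sus (sw a u)))) => //.
  by move=> u _; rewrite /beta' !swK.
apply: (htpy_post _ _ _ _ (sw b) (fun u => beta' (sw a u)) (fun u => sus (sw a u))).
- exact: sw_lipx.
- by move=> u; exact: bsw.
by apply: (htpy_pre _ _ bdy _ bdy (sw a)) hbh; [exact: sw_lipx|move=> u; exact: bsw].
Qed.

Lemma multiset_seq (T : finType) (mult : T -> nat) :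
  exists s : seq T, size s = (\sum_x mult x)%N /\ forall t, count (pred1 t) s = mult t.
Proof.
exists (flatten [seq nseq (mult x) x | x <- enum T]); split.
  rewrite size_flatten /shape -map_comp sumnE big_map big_enum /=.
  by apply: eq_bigr => x _; rewrite size_nseq.
move=> t; rewrite count_flatten -map_comp sumnE big_map big_enum /= (bigD1 t) //= big1 => [|x xt].
  by rewrite count_nseq /= eqxx mul1n addn0.
by rewrite count_nseq /= (negPf xt).
Qed.

Lemma bernoulli x m : 0 <= x <= 1 -> 1 - INR m * x <= (1 - x) ^ m.
Proof.
move=> hx; elim: m => [|m IH]; first by rewrite /=; lra.
rewrite S_INR -[(1 - x) ^ m.+1]/((1 - x) * (1 - x) ^ m).
by have := pos_INR m; have := Rmult_le_compat_l (1 - x) _ _ ltac:(lra) IH; nra.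
Qed.

Lemma pow2_above m : INR m <= 2 ^ m.
Proof.
elim: m => [|m IH]; first by rewrite /=; lra.
by rewrite S_INR -[2 ^ m.+1]/(2 * 2 ^ m); have := pow_R1_Rle 2 m ltac:(lra); lra.
Qed.

Lemma hmul_inv n (g : Heis n) : exists gi : Heis n,
  hmul gi g = h0 /\ forall p, hmul g (hmul gi p) = p.
Proof.
exists (mkHeis (fun j => -1 * hx g j) (fun j => -1 * hy g j)
  (- hz g + rsum (fun j => hy g j * hx g j))); split.
  rewrite /hmul /h0 /=; congr mkHeis; try by apply: functional_extensionality => j; ring.
  have -> : rsum (fun j => -1 * hy g j * hx g j) = -1 * rsum (fun j => hy g j * hx g j).
    by rewrite -rsum_mul; apply: rsum_eq => j; ring.
  by ring.
move=> [px py pz]; rewrite /hmul /=; congr mkHeis; try by apply: functional_extensionality => j; ring.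
have -> : rsum (fun j => -1 * hy g j * px j) = -1 * rsum (fun j => hy g j * px j).
  by rewrite -rsum_mul; apply: rsum_eq => j; ring.
have -> : rsum (fun j => hy g j * (-1 * hx g j + px j)) =
    rsum (fun j => hy g j * px j) - rsum (fun j => hy g j * hx g j).
  by rewrite -rsum_sub; apply: rsum_eq => j; ring.
by ring.
Qed.

(* The first target direction is halved twice as often because the layers of [grid_extension] have
   height [1 / N ^ 2]. *)
Lemma halving_schedule k n q' : exists ps : seq ('I_k.+1 * 'I_n.+1),
  [/\ forall a, count (fun p => p.1 == a) ps = (q' * (n + 2))%N,
   count (fun p => p.2 == ord0) ps = (2 * (k.+1 * q'))%N &
   forall l, count (fun p => p.2 == lift ord0 l) ps = (k.+1 * q')%N].
Proof.
have [s [ss sc]] := multiset_seq 'I_k.+1 (fun=> (q' * (n + 2))%N).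
have [t [ts tc]] := multiset_seq 'I_n.+1 (fun b => if b == ord0 then (2 * (k.+1 * q'))%N else (k.+1 * q')%N).
have st : size s = size t.
  have cst m c : (\sum_(i < m) c = m * c)%N by rewrite sum_nat_const card_ord.
  rewrite ss cst ts big_ord_recl /= (eq_bigr (fun=> (k.+1 * q')%N)) // cst; nia.
exists (zip s t); split=> [a||l].
- by rewrite -(sc a) -[s in RHS](unzip1_zip (_ : size s <= size t)%N) ?st // count_map.
- by rewrite -[RHS](tc ord0) -[t in RHS](unzip2_zip (_ : size t <= size s)%N) ?st // count_map.
by rewrite -[RHS](tc (lift ord0 l)) -[t in RHS](unzip2_zip (_ : size t <= size s)%N) ?st // count_map.
Qed.

(** The grid extension asks for data that are [h0] off the middle of the top face. An outermost
    collar therefore replaces [beta] by [psi o beta], and a left translation moves the common value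
    [alpha spole] to [h0]. *)
Lemma refinement_step k n (beta : Rn k.+1 -> Rn n.+1) :
  (0 < n)%N -> (n + 2 <= k)%N -> (k + 2 <= 2 * n)%N -> lipx bdy beta ->
  (forall u, bdy u -> bdy (beta u)) ->
  exists r C' (Ix : Type) (c : Ix -> Rn k.+1), [/\ 0 < r < 1, 0 <= C',
    forall i a, Rabs (c i a) + r <= 1,
    forall i j, i <> j -> exists a, 2 * r <= Rabs (c i a - c j a) &
    forall L (alpha : Rn n.+1 -> Heis n), 0 < L -> Lip bdy L alpha ->
    exists (G : Rn k.+1 -> Heis n) (al : Ix -> Rn n.+1 -> Heis n),
    [/\ forall i, Lip bdy (L * r / 2) (al i),
      forall i x, bdy x -> G (fun a => c i a + r * x a) = al i (beta x),
      forall u, bdy u -> G u = alpha (beta u) &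
      Lip (fun u => cub u /\ forall i, r <= ds u (c i)) (C' * L) G]].
Proof.
move=> n0 nk kn lb bb; have [C [C0 ext]] := grid_extension n n0.
have nk' : (n <= k)%N by lia.
have [psi [[Lp lpsi] bpsi hpsi psiE]] := collapse n.
pose K := Rmax 1 Lp; have K1 : 1 <= K by exact: Rmax_l.
have {}lpsi : Lip bdy K psi by apply: Lip_weak lpsi; exact: Rmax_r.
(* The term [4 * C * K] leaves [N * r >= 2 * C * K] after the loss to the collars, and [7] ensures
   [N >= 128]. *)
have [q' hq'] := nat_above (4 * C * K + 7).
have CK : 0 <= C * K by apply: Rmult_le_pos; lra.
have p2 := Rlt_le_trans _ _ _ hq' (pow2_above q').
have q7 : (7 <= q')%N.
  have : 7 < INR q' by nra.
  rewrite -[7]/(IZR (Z.of_nat 7)) -INR_IZR_INZ => /INR_lt; lia.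
pose q := (k.+1 * q')%N; pose N : R := 2 ^ q.
have N128 : 128 <= N.
  have -> : 128 = 2 ^ 7 by rewrite /=; ring.
  by apply: Rle_pow; [lra|rewrite /q; nia].
have iN : 0 < / N by apply: Rinv_0_lt_compat; lra.
have [ps [psD psT0 psT]] := halving_schedule k n q'.
(* The collars are so thin that all [2 * m + 1] of them together shrink lengths at most by the
   factor [3 / 4]. *)
pose m := size ps; pose x := / (16 * (INR m + 1)).
have m1 := pos_INR m.
have x0 : 0 < x <= / 16.
  split; first by apply: Rinv_0_lt_compat; lra.
  by apply: Rinv_le_contravar; lra.
have mx : INR m * x <= / 16.
  have : 16 * (INR m + 1) * x = 1 by rewrite /x Rinv_r; lra.
  by nra.
pose th := 1 - x; have hth : 0 < th < 1 by rewrite /th; lra.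
have thm : 15 / 16 <= th ^ m by have := bernoulli x m ltac:(lra); rewrite -/th; lra.
have [Gam [Ix [cD [cT sub]]]] := subdivide k n beta th hth lb bb
  (fun a b => levelled_map k n beta a b n0 nk' kn lb bb) ps.
pose P2 : R := 2 ^ (q' * (n + 2))%N; have P20 : 1 <= P2 by apply: pow_R1_Rle; lra.
pose s := (th * th) ^ m * / P2.
have eD a : sizeD k n th ps a = s by rewrite /sizeD psD.
have thth : (th * th) ^ m = th ^ m * th ^ m by exact: Rpow_mult_distr.
have thm1 : th ^ m <= 1 by rewrite -(pow1 m); apply: pow_incr; lra.
have iP : 0 < / P2 <= 1.
  by split; [apply: Rinv_0_lt_compat; lra|rewrite -Rinv_1; apply: Rinv_le_contravar; lra].
have s0 : 0 < s <= 1.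
  by rewrite /s thth; split; [apply: Rmult_lt_0_compat; nra|have := iP; nra].
have eT0 : sizeT k n ps ord0 = / (N * N).
  by rewrite /sizeT psT0 /N -pow_add; congr (/ 2 ^ _); rewrite /q; nia.
have eT l : sizeT k n ps (lift ord0 l) = / N by rewrite /sizeT psT.
(* The additional [th] belongs to the outermost collar. *)
pose r := th * s; have r0 : 0 < r < 1 by rewrite /r; nra.
have Nr : 2 * C * K <= N * r.
  have e : N = P2 * 2 ^ (q - q' * (n + 2))%N.
    by rewrite /N /P2 -pow_add; congr (2 ^ _); rewrite /q; nia.
  have e' : N * r = 2 ^ (q - q' * (n + 2))%N * (th * ((th ^ m) * (th ^ m))).
    by rewrite e /r /s thth; field; lra.
  (* Here [n + 2 <= k] enters: [q - q' * (n + 2) = q' * (k - n - 1) >= q']. *)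
  have hp : 2 ^ q' <= 2 ^ (q - q' * (n + 2))%N by apply: Rle_pow; [lra|rewrite /q; nia].
  have h1 : 15 / 16 * (15 / 16) <= th ^ m * th ^ m by apply: Rmult_le_compat; lra.
  have h2 : 3 / 4 <= th * (th ^ m * th ^ m).
    have t1 : 15 / 16 <= th by rewrite /th; lra.
    by move: (th ^ m * th ^ m) h1 => w; nra.
  rewrite e'; move: (th * _) h2 => w h2.
  have : 2 ^ q' * (3 / 4) <= 2 ^ (q - q' * (n + 2))%N * w by apply: Rmult_le_compat; lra.
  lra.
pose c (i : Ix) : Rn k.+1 := fun a => th * cD i a.
have c_in i a : Rabs (c i a) + r <= th.
  have := sub_in _ _ _ _ _ _ _ _ _ sub i a; rewrite eD => h.
  rewrite /c Rabs_mult (Rabs_right th); last lra.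
  by rewrite /r; nra.
have lG := sub_lip _ _ _ _ _ _ _ _ _ sub; case: lG => LG [LG0 lG].
have [H [[LH lH] bH H0 H1]] : htpy bdy beta (fun u => psi (beta u)).
  by apply: (htpy_pre _ _ bdy _ bdy beta (fun q => q) psi).
have ith : 0 < / th by apply: Rinv_0_lt_compat; lra.
have i1 : 0 < / (1 - th) by apply: Rinv_0_lt_compat; lra.
pose par (u : Rn k.+1) := (nu u, / (1 - th) * (1 - nrm u)).
have [LP lP] : lipx (fun u : Rn k.+1 => cub u /\ th <= nrm u) par.
  apply: lipx_pair; first by apply: lipx_sub (nu_lipx _ th _) => [u []|]; lra.
  by apply: lipx_scal; apply: lipx_minus; [exact: lipx_cst|exact: lipx_nrm].
have par_dom (u : Rn k.+1) : cub u /\ th <= nrm u -> cyl bdy (par u).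
  move=> [cu hu]; split; first by apply: nu_nrm; lra.
  have h : / (1 - th) * (1 - th) = 1 by rewrite Rinv_l; lra.
  by move: cu; rewrite /cub => cu; split=> /=; [apply: Rmult_le_pos; lra|nra].
have [zz hzz] : exists zz : Ix -> 'I_n.+1 -> Z, forall i b,
    cT i b = -1 + (2 * IZR (zz i b) + 1) * sizeT k n ps b.
  exists (fun i b => proj1_sig (constructive_indefinite_description _ (sub_centre _ _ _ _ _ _ _ _ _ sub i b))).
  by move=> i b; case: constructive_indefinite_description.
pose box i := small_box n q (zz i ord0) (fun l => zz i (lift ord0 l)).
have boxE i w : affine (cT i) (sizeT k n ps) w = box i w.
  apply: functional_extensionality => b; rewrite /affine hzz /box /small_box.
  by case: (unliftP ord0 b) => [l ->|->]; rewrite ?eT ?eT0 /Rdiv -/N; ring.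
have off_grid (u : Rn k.+1) : cub u -> (forall i, r <= ds u (c i)) -> nrm u <= th ->
    Jset n q (Gam (fun a => / th * u a)).
  move=> cu off le; have cv : cub (fun a => / th * u a).
    rewrite /cub scale_nrm; last lra.
    by rewrite -(Rinv_l th); [apply: Rmult_le_compat_l|]; lra.
  split; first exact: (sub_cub _ _ _ _ _ _ _ _ _ sub).
  have [i h|b [z]] := sub_grid _ _ _ _ _ _ _ _ _ sub _ cv.
    have := off i; apply: Rlt_not_le; apply: nrm_lt => [|a]; first lra.
    have := h a; rewrite eD => ha.
    have -> : u a - c i a = th * (/ th * u a - cD i a) by rewrite /c; field; lra.
    by rewrite Rabs_mult (Rabs_right th) /r; [apply: Rmult_lt_compat_l|]; lra.
  case: (unliftP ord0 b) => [l ->|->] e; [right; exists l|left]; exists z.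
    by rewrite /tl e eT.
  by rewrite e eT0.
pose C' := (C * N * N * K * (LG * / th) + LH * LP) * (1 + Rabs 1).
have LP0 := proj1 lP; have LH0 := proj1 lH.
have C'0 : 0 <= C'.
  have : 0 <= C * N * N * K * (LG * / th).
    by repeat (apply: Rmult_le_pos; try lra).
  have : 0 <= LH * LP by apply: Rmult_le_pos.
  by move=> h1 h2; apply: Rmult_le_pos; [|have := Rabs_pos 1]; lra.
exists r, C', Ix, c; split=> //.
- by move=> i a; have := c_in i a; lra.
- move=> i j /(sub_disj _ _ _ _ _ _ _ _ _ sub) [a]; rewrite eD => h; exists a.
  have -> : c i a - c j a = th * (cD i a - cD j a) by rewrite /c; ring.
  by rewrite Rabs_mult (Rabs_right th) /r; nra.
move=> L alpha L0 la; pose g := alpha spole; have [gi [gig ggi]] := hmul_inv n g.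
pose a1 (p : Rn n) := hmul gi (alpha (psi (mk 1 (trunc p)))).
have la1 : Lip (fun=> True) (L * K) a1.
  have h1 : Lip (fun=> True) (K * 1) (fun p : Rn n => psi (mk 1 (trunc p))).
    by apply: (Lip_comp _ _ _ _ bdy) (top_lift_lip n) lpsi => u _; exact: top_lift.
  have [_ h2] : Lip (fun=> True) (L * (K * 1)) (fun p : Rn n => alpha (psi (mk 1 (trunc p)))).
    by apply: (Lip_comp _ _ _ _ bdy) h1 la => u _; apply/bpsi/top_lift.
  split=> [|u v _ _]; first by apply: Rmult_le_pos; lra.
  by apply: Rle_trans (ds_hmul _ _ _ _) _; have := h2 u v I I; rewrite Rmult_1_r.
have a1_out p : / 2 <= nrm p -> a1 p = h0.
  move=> h; rewrite /a1 psiE //; first exact: top_lift.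
  by right; rewrite tl_mk; exact: trunc_half.
have LK : 0 < L * K by apply: Rmult_lt_0_compat; lra.
have [A [lA Atop Arest Asmall]] := ext q (L * K) a1 N128 LK la1 a1_out.
have Abdy (p : Rn n.+1) : bdy p -> hmul g (A p) = alpha (psi p).
  move=> b; have [h1 h2 _] := bdy_cases _ p b.
  case: (classic (p ord0 = 1)) => e.
    rewrite Atop // /a1 ggi trunc_id; last by case: h2.
    by rewrite -e mk_eta.
  rewrite Arest // psiE //; last by left.
  by rewrite -gig ggi.
pose G (u : Rn k.+1) := if Rle_dec (nrm u) th then hmul g (A (Gam (fun a => / th * u a))) else alpha (H (par u)).
have Gin (u : Rn k.+1) : nrm u <= th -> G u = hmul g (A (Gam (fun a => / th * u a))).
  by rewrite /G; case: Rle_dec.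
have Gout (u : Rn k.+1) : cub u -> th <= nrm u -> G u = alpha (H (par u)).
  move=> cu ge; rewrite /G; case: Rle_dec => //= le; have e : nrm u = th by lra.
  have -> : par u = (nu u, 1) by rewrite /par e Rinv_l //; lra.
  have bn : bdy (nu u) by apply: nu_nrm; lra.
  rewrite H1 //; have -> : (fun a => / th * u a) = nu u.
    by apply: functional_extensionality => a; rewrite /nu e; ring.
  by rewrite (sub_bdy _ _ _ _ _ _ _ _ _ sub) // Abdy //; exact: bb.
exists G, (fun i w => hmul g (A (box i w))); split.
- move=> i; have [_ h] := Asmall (zz i ord0) (fun l => zz i (lift ord0 l)).
  split=> [|u v bu bv]; first by rewrite /Rdiv; apply: Rmult_le_pos; [apply: Rmult_le_pos|]; lra.
  apply: Rle_trans (ds_hmul _ _ _ _) _; apply: Rle_trans (h u v bu bv) _.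
  apply: Rmult_le_compat_r; first exact: ds_pos.
  apply: (Rmult_le_reg_r N); first lra.
  have -> : C * (L * K) / 2 ^ q * N = L * (C * K) by rewrite -/N; field; lra.
  by have := Rmult_le_compat_l L _ _ (Rlt_le _ _ L0) Nr; lra.
- move=> i w bw; rewrite Gin.
    have -> : (fun a => / th * (c i a + r * w a)) = affine (cD i) (sizeD k n th ps) w.
      by apply: functional_extensionality => a; rewrite /affine eD /c /r; field; lra.
    rewrite (sub_hole _ _ _ _ _ _ _ _ _ sub) ?boxE ?betahat_bdy //.
    by move: bw; rewrite /bdy /cub => ->; lra.
  apply: nrm_le => [|a]; first lra.
  apply: Rle_trans (Rabs_triang _ _) _; apply: Rle_trans (c_in i a).
  have := nrm_coord _ w a; rewrite bw Rabs_mult (Rabs_right r); last lra.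
  by nra.
- move=> u b; rewrite Gout; [|by rewrite /cub b; lra|by rewrite b; lra].
  by rewrite /par b Rminus_diag Rmult_0_r nu_bdy // H0.
have -> : C' * L = (C * N * N * (L * K) * (LG * / th) + L * (LH * LP)) * (1 + Rabs 1).
  by rewrite /C'; ring.
apply: (Lip_glue _ _ 1 _ _ _ (fun u => nrm u <= th) (fun u => th <= nrm u)).
- by move=> u _; lra.
- move=> u v [cu ou] [cv ov] hu hv.
  have [t [ht [gt le]]] := seg_bridge _ (@nrm _) 1 u v th (nrm_lip1 _) (or_introl (conj hu hv)).
  exists (lerp u v t); rewrite gt Rmult_1_l; split; last by split; [lra|split; [lra|]].
  split; first exact: cub_seg.
  (* The crossing point has norm [th], while by [c_in] the holes lie inside the cube of that
     radius. *)
  move=> i; apply: Rnot_lt_le => lt; have [a ea] := nrm_attained _ (lerp u v t).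
  have := rds_coord _ (lerp u v t) (c i) a; have := c_in i a; rewrite -gt ea.
  by move=> h1 h2; have := Rabs_triang_inv (lerp u v t a) (c i a); lra.
- apply: (Lip_eq (Rn_met k.+1) (Heis_met n) _ _ (fun u => hmul g (A (Gam (fun a => / th * u a))))) => [u [_ h]|].
    by rewrite Gin.
  have [h1 h2] : Lip (fun u : Rn k.+1 => (cub u /\ (forall i, r <= ds u (c i))) /\ nrm u <= th)
      (C * N * N * (L * K) * (LG * / th)) (fun u => A (Gam (fun a => / th * u a))).
    apply: (Lip_comp (Rn_met k.+1) (Rn_met n.+1) (Heis_met n) _ (Jset n q)) lA => [u [[cu off] le]|]; first exact: off_grid.
    apply: (Lip_comp (Rn_met k.+1) (Rn_met k.+1) (Rn_met n.+1) _ cub _ _ (fun u => (fun a => / th * u a) : Rn k.+1) Gam) (conj LG0 lG).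
      move=> u [_ le]; rewrite /cub scale_nrm; last lra.
      by rewrite -(Rinv_l th); [apply: Rmult_le_compat_l|]; lra.
    split=> [|u v _ _]; first lra.
    right; rewrite -(Rabs_right (/ th)); last lra.
    rewrite /ds /= /rn_ds -nrm_scal; congr nrm.
    by apply: functional_extensionality => a; rewrite Rabs_right; [ring|lra].
  by split=> // u v Du Dv; apply: Rle_trans (ds_hmul _ _ _ _) _; exact: h2.
apply: (Lip_eq (Rn_met k.+1) (Heis_met n) _ _ (fun u => alpha (H (par u)))) => [u [[cu _] h]|]; first by rewrite Gout.
apply: (Lip_comp (Rn_met k.+1) (Rn_met n.+1) (Heis_met n) _ bdy) la => [u [[cu _] h]|]; first by apply/bH/par_dom.
apply: (Lip_comp (Rn_met k.+1) (prod_met (Rn_met k.+1) R_met) (Rn_met n.+1) _ (cyl bdy)) lH => [u [[cu _] h]|]; first exact: par_dom.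
by apply: Lip_sub lP => u [[]].
Qed.

(** * Iteration and limit *)

Lemma real_limit (u E : nat -> R) :
  (forall m M, (m <= M)%N -> Rabs (u m - u M) <= E m) ->
  (forall d, 0 < d -> exists m0, forall m, (m0 <= m)%N -> E m < d) ->
  exists l, forall m, Rabs (u m - l) <= E m.
Proof.
move=> hu hE; have cau : Cauchy_crit u.
  move=> d d0; have d20 : 0 < d / 2 by lra.
  have [m0 h] := hE (d / 2) d20; exists m0 => p q hp hq.
  have h0 := h m0 (leqnn _); have h1 := hu m0 p ltac:(lia); have h2 := hu m0 q ltac:(lia).
  rewrite /R_dist; move: h1 h2 => /Rabs_le_between h1 /Rabs_le_between h2.
  by apply: Rabs_def1; lra.
have [l hl] := R_complete u cau; exists l => m; apply: le_epsilon => d d0.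
have [N hN] := hl d d0; pose M := maxn m N.
have h1 := hu m M (leq_maxl _ _); have h2 := hN M ltac:(rewrite /M; lia).
rewrite /R_dist in h2; have -> : u m - l = (u m - u M) + (u M - l) by ring.
by apply: Rle_trans (Rabs_triang _ _) _; lra.
Qed.

(** The horizontal coordinates converge at rate [e]. The heights follow because they differ from
    [hD] by products of the bounded [y] with increments of [x]; the weaker rate so obtained is
    improved to [e] by comparing with a far term of the sequence. *)
Lemma heis_complete n (P : nat -> Heis n) (e : nat -> R) : (forall m, 0 <= e m) ->
  (forall d, 0 < d -> exists m0, forall m, (m0 <= m)%N -> e m < d) ->
  (forall m M, (m <= M)%N -> ds (P m) (P M) <= e m) ->
  exists p, forall m, ds (P m) p <= e m.
Proof.
move=> e0 he hP.
have parts m M : (m <= M)%N -> ds (hx (P m)) (hx (P M)) <= e m /\ ds (hy (P m)) (hy (P M)) <= e m /\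
    Rabs (hD (P m) (P M)) <= cH n * (e m * e m).
  by move=> mM; apply/hds_le => //; exact: hP.
pose Y := nrm (hy (P 0%N)) + e 0%N.
have c1 := cH_pos n; have n0 := pos_INR n.
have Y0 : 0 <= Y by have := nrm_pos _ (hy (P 0%N)); have := e0 0%N; rewrite /Y; lra.
have nY : 0 <= INR n * Y by apply: Rmult_le_pos.
have yb m j : Rabs (hy (P m) j) <= Y.
  have [_ [h _]] := parts 0%N m (leq0n _); have hj := rds_coord _ (hy (P 0%N)) (hy (P m)) j; have := nrm_coord _ (hy (P 0%N)) j.
  by move: hj h; rewrite /Y /Rabs; repeat case: Rcase_abs => ?; lra.
have [x hx'] : exists x : Rn n, forall m j, Rabs (hx (P m) j - x j) <= e m.
  have h j : exists l, forall m, Rabs (hx (P m) j - l) <= e m.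
    apply: real_limit he => m M mM; have [h _] := parts m M mM.
    exact: Rle_trans (rds_coord _ _ _ j) h.
  exists (fun j => proj1_sig (constructive_indefinite_description _ (h j))) => m j.
  by case: constructive_indefinite_description.
have [y hy'] : exists y : Rn n, forall m j, Rabs (hy (P m) j - y j) <= e m.
  have h j : exists l, forall m, Rabs (hy (P m) j - l) <= e m.
    apply: real_limit he => m M mM; have [_ [h _]] := parts m M mM.
    exact: Rle_trans (rds_coord _ _ _ j) h.
  exists (fun j => proj1_sig (constructive_indefinite_description _ (h j))) => m j.
  by case: constructive_indefinite_description.
have yb' j : Rabs (y j) <= Y + e 0%N.
  have := yb 0%N j; have := hy' 0%N j.
  by rewrite /Rabs; repeat case: Rcase_abs => ?; lra.
have sum_b (a b : Rn n) B d : (forall j, Rabs (a j) <= B) -> (forall j, Rabs (b j) <= d) ->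
    Rabs (rsum (fun j => a j * b j)) <= INR n * (B * d).
  by move=> ha hb; apply: rsum_abs_le => j; exact: Rabs_mul_le.
have small d : 0 < d -> exists m0, forall m, (m0 <= m)%N ->
    cH n * (e m * e m) + INR n * ((2 * Y + e 0%N) * e m) < d.
  move=> d0; pose B := cH n + INR n * (2 * Y + e 0%N).
  have B1 : 1 <= B.
    have : 0 <= INR n * (2 * Y + e 0%N) by apply: Rmult_le_pos => //; have := e0 0%N; lra.
    by rewrite /B; lra.
  have iB : 0 < / B by apply: Rinv_0_lt_compat; lra.
  have [m0 h] := he (Rmin 1 (d * / B)) (Rmin_pos _ _ Rlt_0_1 (Rmult_lt_0_compat _ _ d0 iB)).
  exists m0 => m /h lt; have e1 := Rlt_le_trans _ _ _ lt (Rmin_l _ _).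
  have e2 := Rlt_le_trans _ _ _ lt (Rmin_r _ _); have em := e0 m.
  have e3 : e m * B < d.
    have := Rmult_lt_compat_r B _ _ ltac:(lra) e2.
    by rewrite Rmult_assoc Rinv_l; lra.
  have e4 : cH n * (e m * e m) <= cH n * e m by apply: Rmult_le_compat_l; nra.
  by move: e3; rewrite /B; nra.
have [z hz'] : exists z, forall m, Rabs (hz (P m) - z) <=
    cH n * (e m * e m) + INR n * ((2 * Y + e 0%N) * e m).
  apply: real_limit small => m M mM; have [h1 [h2 h3]] := parts m M mM.
  have h4 : Rabs (rsum (fun j => (hy (P m) j + hy (P M) j) * (hx (P M) j - hx (P m) j))) <=
      INR n * ((2 * Y) * e m).
    apply: (sum_b (fun j => hy (P m) j + hy (P M) j) (fun j => hx (P M) j - hx (P m) j)) => j.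
      by apply: Rle_trans (Rabs_triang _ _) _; have := yb m j; have := yb M j; lra.
    by rewrite Rabs_minus_sym; exact: Rle_trans (rds_coord _ _ _ j) h1.
  have h5 : INR n * (2 * Y * e m) <= INR n * ((2 * Y + e 0%N) * e m).
    by apply: Rmult_le_compat_l => //; apply: Rmult_le_compat_r => //; have := e0 0%N; lra.
  have h6 : 0 <= INR n * (2 * Y * e m).
    by apply: Rmult_le_pos => //; apply: Rmult_le_pos => //; lra.
  move: h3 h4; rewrite /hD; set S := rsum _ => /Rabs_le_between h3 /Rabs_le_between h4.
  by apply: Rabs_le; lra.
exists (mkHeis x y z) => m; apply: le_epsilon => d d0.
have c0 : 0 < d * d by nra.
have [m1 k1] := he d d0; have [m2 k2] := small (d * d / 2) ltac:(lra).
pose M := maxn m (maxn m1 m2).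
apply: Rle_trans (ds_tri _ (P M) _) _; apply: Rplus_le_compat; first by apply: hP; rewrite /M; lia.
have {}k1 := k1 M ltac:(rewrite /M; lia); have {}k2 := k2 M ltac:(rewrite /M; lia).
apply/hds_le; first lra.
split; first by apply: rds_le => [|j]; [lra|have := hx' M j; rewrite /=; lra].
split; first by apply: rds_le => [|j]; [lra|have := hy' M j; rewrite /=; lra].
have h4 : Rabs (rsum (fun j => (hy (P M) j + y j) * (x j - hx (P M) j))) <=
    INR n * ((2 * Y + e 0%N) * e M).
  apply: (sum_b (fun j => hy (P M) j + y j) (fun j => x j - hx (P M) j)) => j.
    by apply: Rle_trans (Rabs_triang _ _) _; have := yb M j; have := yb' j; lra.
  by rewrite Rabs_minus_sym.
have h3 := hz' M.
have h5 : 0 <= cH n * (e M * e M) by apply: Rmult_le_pos; [lra|apply: Rmult_le_pos].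
have h6 : d * d <= cH n * (d * d) by nra.
rewrite /hD /=; move: h3 h4; set S := rsum _ => /Rabs_le_between h3 /Rabs_le_between h4.
by apply: Rabs_le; lra.
Qed.

Section Recursion.
Variables (k n : nat) (beta : Rn k.+1 -> Rn n.+1) (r C' : R) (Ix : Type) (c : Ix -> Rn k.+1).
Hypothesis beta_bdy : forall u, bdy u -> bdy (beta u).
Hypothesis hr : 0 < r < 1.
Hypothesis C'0 : 0 <= C'.
Hypothesis c_in : forall i a, Rabs (c i a) + r <= 1.
Hypothesis c_disj : forall i j, i <> j -> exists a, 2 * r <= Rabs (c i a - c j a).

Let off (u : Rn k.+1) : Prop := forall i, r <= ds u (c i).

Definition refines L (alpha : Rn n.+1 -> Heis n)
    (Gal : (Rn k.+1 -> Heis n) * (Ix -> Rn n.+1 -> Heis n)) : Prop :=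
  [/\ forall i, Lip bdy (L * r / 2) (Gal.2 i),
      forall i x, bdy x -> Gal.1 (fun a => c i a + r * x a) = Gal.2 i (beta x),
      forall u, bdy u -> Gal.1 u = alpha (beta u) &
      Lip (fun u => cub u /\ off u) (C' * L) Gal.1].

Hypothesis refine : forall L alpha, 0 < L -> Lip bdy L alpha -> exists Gal, refines L alpha Gal.

Definition step L (alpha : Rn n.+1 -> Heis n) :=
  epsilon (inhabits ((fun=> h0), (fun _ _ => h0))) (refines L alpha).

Lemma stepP L alpha : 0 < L -> Lip bdy L alpha -> refines L alpha (step L alpha).
Proof. by move=> L0 la; apply: epsilon_spec; exact: refine. Qed.

(** The value at the centre is an arbitrary boundary point. The discontinuity there is paid for by
    the additive term of [approx_lip]. *)
Definition radial (u : Rn k.+1) : Rn k.+1 := if Req_EM_T (nrm u) 0 then fun=> 1 else nu u.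

Lemma radial_bdy u : bdy (radial u).
Proof.
rewrite /radial; case: Req_EM_T => /= h.
  by rewrite /bdy; have [i ->] := nrm_attained _ ((fun=> 1) : Rn k.+1); exact: Rabs_R1.
by apply: nu_nrm; have := nrm_pos _ u; lra.
Qed.

Lemma radial_id u : bdy u -> radial u = u.
Proof. by rewrite /radial /bdy => b; case: Req_EM_T => h; [lra|exact: nu_bdy]. Qed.

Definition hole (u : Rn k.+1) : option Ix :=
  match excluded_middle_informative (exists i, ds u (c i) < r) with
  | left h => Some (proj1_sig (constructive_indefinite_description _ h))
  | right _ => None
  end.

Lemma holeP u : (exists i, hole u = Some i /\ ds u (c i) < r) \/ (hole u = None /\ off u).
Proof.
rewrite /hole; case: excluded_middle_informative => h.
  by left; case: constructive_indefinite_description => i hi /=; exists i.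
by right; split=> // i; apply: Rnot_lt_le => lt; apply: h; exists i.
Qed.

Lemma hole_uniq u i j : ds u (c i) < r -> ds u (c j) <= r -> i = j.
Proof.
move=> hi hj; apply: NNPP => /c_disj [a]; apply: Rlt_not_le.
have -> : c i a - c j a = (u a - c j a) - (u a - c i a) by ring.
apply: Rle_lt_trans (Rabs_triang _ _) _; rewrite Rabs_Ropp.
by have := rds_coord _ u (c i) a; have := rds_coord _ u (c j) a; lra.
Qed.

Lemma rim_off u i : ds u (c i) = r -> off u.
Proof.
move=> e j; apply: Rnot_lt_le => lt; have ji := hole_uniq u j i lt (Req_le _ _ e).
by move: lt; rewrite ji e; lra.
Qed.

Lemma bdy_off u : bdy u -> off u.
Proof.
move=> b i; have [a ea] := nrm_attained _ u; rewrite b in ea.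
have := rds_coord _ u (c i) a; have := c_in i a; have := Rabs_triang_inv (u a) (c i a); lra.
Qed.

Definition loc i (u : Rn k.+1) : Rn k.+1 := fun a => / r * (u a - c i a).

Let ir : 0 < / r. Proof. by apply: Rinv_0_lt_compat; lra. Qed.

Lemma loc_nrm i u : nrm (loc i u) = / r * ds u (c i).
Proof. by rewrite /loc (scale_nrm _ (/ r) (fun a => u a - c i a)) //; lra. Qed.

Lemma loc_ds i u v : ds (loc i u) (loc i v) = / r * ds u v.
Proof.
rewrite -scale_nrm; last lra.
by rewrite /ds /= /rn_ds; congr nrm; apply: functional_extensionality => a; rewrite /loc; ring.
Qed.

Lemma locK i u : (fun a => c i a + r * loc i u a) = u.
Proof. by apply: functional_extensionality => a; rewrite /loc; field; lra. Qed.

Lemma loc_cub i u : ds u (c i) <= r -> cub (loc i u).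
Proof.
by move=> h; rewrite /cub loc_nrm -(Rinv_l r); [apply: Rmult_le_compat_l|]; lra.
Qed.

Fixpoint approx m L (alpha : Rn n.+1 -> Heis n) (u : Rn k.+1) : Heis n :=
  match m with
  | O => alpha (beta (radial u))
  | S m' => match hole u with
            | Some i => approx m' (L * r / 2) ((step L alpha).2 i) (loc i u)
            | None => (step L alpha).1 u
            end
  end.

Let half_pos L : 0 < L -> 0 < L * r / 2.
Proof. by move=> L0; have : 0 < L * r by [apply: Rmult_lt_0_compat; lra]; lra. Qed.

Lemma approx_off m L alpha u : off u -> approx m.+1 L alpha u = (step L alpha).1 u.
Proof. by move=> o /=; case: (holeP u) => [[i [-> lt]]|[-> //]]; have := o i; lra. Qed.

Lemma approx_bdy m L alpha u : 0 < L -> Lip bdy L alpha -> bdy u -> approx m L alpha u = alpha (beta u).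
Proof.
move=> L0 la b; case: m => [|m]; first by rewrite /= radial_id.
by have [_ _ h _] := stepP L alpha L0 la; rewrite approx_off ?h //; exact: bdy_off.
Qed.

Lemma approx_hole m L alpha i u : 0 < L -> Lip bdy L alpha -> ds u (c i) <= r ->
  approx m.+1 L alpha u = approx m (L * r / 2) ((step L alpha).2 i) (loc i u).
Proof.
move=> L0 la hu /=; case: (holeP u) => [[j [-> lt]]|[-> o]].
  by rewrite (hole_uniq u j i lt hu).
have [h1 h2 _ _] := stepP L alpha L0 la.
have b : bdy (loc i u).
  by rewrite /bdy loc_nrm (Rle_antisym _ _ hu (o i)) Rinv_l; lra.
by rewrite approx_bdy //; [rewrite -h2 // locK|exact: half_pos].
Qed.

Lemma hole_exit u v i : cub u -> cub v -> ds u (c i) <= r -> r <= ds v (c i) ->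
  exists w, [/\ cub w, ds w (c i) = r & ds u w + ds w v <= ds u v].
Proof.
move=> cu cv hu hv.
have gl (x y : Rn k.+1) : Rabs (ds x (c i) - ds y (c i)) <= 1 * ds x y.
  have := ds_tri x y (c i); have := ds_tri y x (c i); rewrite (ds_sym y x) => h1 h2.
  by apply: Rabs_le; lra.
have [t [ht [gt le]]] := seg_bridge _ (fun x => ds x (c i)) 1 u v r gl (or_introl (conj hu hv)).
by exists (lerp u v t); split=> //; exact: cub_seg.
Qed.

Let cub_ds (u v : Rn k.+1) : cub u -> cub v -> ds u v <= 2.
Proof.
move=> cu cv; apply: rds_le => [|a]; first lra.
have /Rabs_le_between := Rle_trans _ _ _ (nrm_coord _ u a) cu.
have /Rabs_le_between := Rle_trans _ _ _ (nrm_coord _ v a) cv.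
by move=> *; apply: Rabs_le; lra.
Qed.

Let bdy_cub (m : nat) (u : Rn m) : bdy u -> cub u.
Proof. by rewrite /bdy /cub; lra. Qed.

(** Only the holes containing [u] and [v] contribute an error, and by induction each gives
    [2 * (L * r / 2) * r ^ m], half of what is allowed: this is the purpose of the factor [1 / 2] in
    [refines]. The slope in a hole is [C' * (L * r / 2) / r], below [C' * L]. *)
Lemma approx_lip m : forall L alpha, 0 < L -> Lip bdy L alpha -> forall u v, cub u -> cub v ->
  ds (approx m L alpha u) (approx m L alpha v) <= C' * L * ds u v + 2 * L * r ^ m.
Proof.
elim: m => [|m IH] L alpha L0 la u v cu cv.
  have [_ h] := la; have b1 := radial_bdy u; have b2 := radial_bdy v.
  rewrite /= Rmult_1_r; apply: Rle_trans (h _ _ (beta_bdy _ b1) (beta_bdy _ b2)) _.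
  have d2 : ds (beta (radial u)) (beta (radial v)) <= 2.
    apply: rds_le => [|a]; first lra.
    have /Rabs_le_between := Rle_trans _ _ _ (nrm_coord _ _ a) (Req_le _ _ (beta_bdy _ b1)).
    have /Rabs_le_between := Rle_trans _ _ _ (nrm_coord _ _ a) (Req_le _ _ (beta_bdy _ b2)).
    by move=> *; apply: Rabs_le; lra.
  have : 0 <= C' * L * ds u v by apply: Rmult_le_pos; [apply: Rmult_le_pos; lra|exact: ds_pos].
  by have := Rmult_le_compat_l L _ _ (Rlt_le _ _ L0) d2; lra.
have [h1 h2 h3 [_ h4]] := stepP L alpha L0 la; pose T := L * r ^ m.+1.
have CL : 0 <= C' * L by apply: Rmult_le_pos; lra.
have T0 : 0 <= T by apply: Rmult_le_pos; [lra|apply: pow_le; lra].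
have inside i x y : ds x (c i) <= r -> ds y (c i) <= r ->
    ds (approx m.+1 L alpha x) (approx m.+1 L alpha y) <= C' * L * ds x y + T.
  move=> hx hy; rewrite !(approx_hole _ _ _ i) //.
  apply: Rle_trans (IH _ _ (half_pos _ L0) (h1 i) _ _ (loc_cub _ _ hx) (loc_cub _ _ hy)) _.
  rewrite loc_ds; have -> : C' * (L * r / 2) * (/ r * ds x y) = C' * L * ds x y / 2 by field; lra.
  have -> : 2 * (L * r / 2) * r ^ m = T by rewrite /T /=; field.
  by have : 0 <= C' * L * ds x y by [apply: Rmult_le_pos => //; exact: ds_pos]; lra.
have outside x y : cub x -> cub y -> off x -> off y ->
    ds (approx m.+1 L alpha x) (approx m.+1 L alpha y) <= C' * L * ds x y.
  by move=> cx cy ox oy; rewrite !approx_off //; exact: h4.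
have mixed x y : cub x -> cub y -> off y ->
    ds (approx m.+1 L alpha x) (approx m.+1 L alpha y) <= C' * L * ds x y + T.
  move=> cx cy oy; case: (holeP x) => [[i [_ hi]]|[_ ox]]; last first.
    by have := outside x y cx cy ox oy; lra.
  have [w [cw rw le]] := hole_exit x y i cx cy (Rlt_le _ _ hi) (oy i).
  have e1 := inside i x w (Rlt_le _ _ hi) (Req_le _ _ rw).
  have e2 := outside w y cw cy (rim_off w i rw) oy.
  have := ds_tri (approx m.+1 L alpha x) (approx m.+1 L alpha w) (approx m.+1 L alpha y).
  by have := Rmult_le_compat_l _ _ _ CL le; lra.
have -> : 2 * L * r ^ m.+1 = 2 * T by rewrite /T; ring.
case: (holeP v) => [[j [_ hj]]|[_ ov]]; last by have := mixed u v cu cv ov; lra.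
case: (Rle_dec r (ds u (c j))) => hu; last first.
  by have := inside j u v ltac:(lra) (Rlt_le _ _ hj); lra.
have [w [cw rw le]] := hole_exit v u j cv cu (Rlt_le _ _ hj) hu.
have e1 := inside j v w (Rlt_le _ _ hj) (Req_le _ _ rw).
have e2 := mixed u w cu cw (rim_off w j rw).
have := ds_tri (approx m.+1 L alpha u) (approx m.+1 L alpha w) (approx m.+1 L alpha v).
rewrite (ds_sym (approx m.+1 L alpha w) (approx m.+1 L alpha v)).
by have := Rmult_le_compat_l _ _ _ CL le; rewrite (ds_sym v u) (ds_sym w u); lra.
Qed.

(** At depth [0] both sides are values of the same map, Lipschitz off the holes, at points of the
    cube at distance at most [2]. Each further level replaces [L] by [L * r / 2]. *)
Lemma approx_step m : forall L alpha, 0 < L -> Lip bdy L alpha -> forall u, cub u ->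
  ds (approx m L alpha u) (approx m.+1 L alpha u) <= 2 * C' * L * r ^ m.
Proof.
elim: m => [|m IH] L alpha L0 la u cu; have [h1 h2 h3 [_ h4]] := stepP L alpha L0 la;
  have CL : 0 <= C' * L by apply: Rmult_le_pos; lra.
  have b := radial_bdy u; have o := bdy_off _ b.
  have e0 : approx 0 L alpha u = (step L alpha).1 (radial u) by rewrite /= h3.
  suff [w [cw ow ->]] : exists w, [/\ cub w, off w & approx 1 L alpha u = (step L alpha).1 w].
    rewrite e0 Rmult_1_r; apply: Rle_trans (h4 _ _ (conj (bdy_cub _ _ b) o) (conj cw ow)) _.
    by have := Rmult_le_compat_l _ _ _ CL (cub_ds _ _ (bdy_cub _ _ b) cw); lra.
  case: (holeP u) => [[i [_ hi]]|[_ ou]]; last by exists u; split=> //; exact: approx_off.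
  have bl := radial_bdy (loc i u).
  have rim : ds ((fun a => c i a + r * radial (loc i u) a) : Rn k.+1) (c i) = r.
    have -> : ds ((fun a => c i a + r * radial (loc i u) a) : Rn k.+1) (c i) = nrm (fun a => r * radial (loc i u) a).
      by rewrite /ds /= /rn_ds; congr nrm; apply: functional_extensionality => a; ring.
    by rewrite scale_nrm ?bl; lra.
  exists (fun a => c i a + r * radial (loc i u) a); split.
  - apply: nrm_le => [|a]; first lra.
    apply: Rle_trans (Rabs_triang _ _) _; apply: Rle_trans (c_in i a).
    have := nrm_coord _ (radial (loc i u)) a; rewrite bl Rabs_mult (Rabs_right r); last lra.
    by nra.
  - exact: rim_off rim.
  by rewrite (approx_hole _ _ _ i) //; [rewrite /= h2|lra].
have p0 : 0 <= r ^ m by apply: pow_le; lra.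
have CLr : 0 <= C' * L * r * r ^ m by apply: Rmult_le_pos => //; apply: Rmult_le_pos; lra.
case: (holeP u) => [[i [_ hi]]|[_ ou]]; last first.
  by rewrite !approx_off // ds_refl /=; lra.
rewrite (approx_hole m L alpha i u) ?(approx_hole m.+1 L alpha i u) //; try lra.
apply: Rle_trans (IH _ _ (half_pos _ L0) (h1 i) _ (loc_cub _ _ (Rlt_le _ _ hi))) _.
by rewrite /=; lra.
Qed.

Lemma approx_limit L alpha : 0 < L -> Lip bdy L alpha ->
  exists F : Rn k.+1 -> Heis n, Lip cub (C' * L) F /\ forall u, bdy u -> F u = alpha (beta u).
Proof.
(* The sum of the geometric series of the bounds in [approx_step]. *)
move=> L0 la; pose K := 2 * C' * L / (1 - r).
have CL : 0 <= C' * L by apply: Rmult_le_pos; lra.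
have i1 : 0 < / (1 - r) by apply: Rinv_0_lt_compat; lra.
have K0 : 0 <= K by apply: Rmult_le_pos; lra.
have KE : K * (1 - r) = 2 * C' * L by rewrite /K; field; lra.
have rm m : 0 <= r ^ m by apply: pow_le; lra.
have dist m M u : (m <= M)%N -> cub u -> ds (approx m L alpha u) (approx M L alpha u) <= K * r ^ m.
  move=> mM cu; rewrite -(subnKC mM); move: (M - m)%N => j {M mM}.
  suff : ds (approx m L alpha u) (approx (m + j) L alpha u) <= K * r ^ m - K * r ^ (m + j)%N.
    by have := Rmult_le_pos _ _ K0 (rm (m + j)%N); lra.
  elim: j => [|j IH]; first by rewrite addn0 ds_refl; lra.
  have s := approx_step (m + j) L alpha L0 la u cu.
  have := ds_tri (approx m L alpha u) (approx (m + j) L alpha u) (approx (m + j).+1 L alpha u).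
  rewrite addnS -[r ^ (m + j).+1]/(r * r ^ (m + j)) -KE in s *.
  by lra.
have tends B d : 0 <= B -> 0 < d -> exists m0, forall m, (m0 <= m)%N -> B * r ^ m < d.
  move=> B0 d0; have iB : 0 < / (B + 1) by apply: Rinv_0_lt_compat; lra.
  have [m0 h] := pow_lt_1_zero r ltac:(rewrite Rabs_right; lra) (d * / (B + 1)) (Rmult_lt_0_compat _ _ d0 iB).
  exists m0 => m mm; have {h} := h m ltac:(lia); rewrite Rabs_right; last by apply: Rle_ge.
  move=> h; have := Rmult_lt_compat_r (B + 1) _ _ ltac:(lra) h.
  by rewrite Rmult_assoc Rinv_l; have := rm m; lra.
(* On the boundary the limit is prescribed, so that [F u = alpha (beta u)] holds as an equality and
   not merely up to distance [0]. *)
have lim u : exists p, (cub u -> forall m, ds (approx m L alpha u) p <= K * r ^ m) /\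
    (bdy u -> p = alpha (beta u)).
  case: (classic (bdy u)) => b.
    exists (alpha (beta u)); split=> // _ m; rewrite approx_bdy // ds_refl.
    exact: Rmult_le_pos.
  case: (classic (cub u)) => cu; last by exists h0.
  have [p hp] := heis_complete n (fun m => approx m L alpha u) (fun m => K * r ^ m)
    (fun m => Rmult_le_pos _ _ K0 (rm m)) (tends K ^~ K0) (fun m M mM => dist m M u mM cu).
  by exists p.
exists (fun u => proj1_sig (constructive_indefinite_description _ (lim u))); split; last first.
  by move=> u b; case: constructive_indefinite_description => p [_ h] /=; exact: h.
split=> // u v cu cv; case: constructive_indefinite_description => p [/(_ cu) hp _] /=.
case: constructive_indefinite_description => p' [/(_ cv) hp' _] /=.
apply: le_epsilon => d d0; have [m0 h] := tends (2 * L + 2 * K) d ltac:(lra) d0.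
have := h m0 (leqnn _); have := hp m0; have := hp' m0; have := approx_lip m0 L alpha L0 la u v cu cv.
have := ds_tri p (approx m0 L alpha u) p'; rewrite (ds_sym p (approx m0 L alpha u)).
have := ds_tri (approx m0 L alpha u) (approx m0 L alpha v) p'.
lra.
Qed.

End Recursion.

(** * From cubes to round spheres *)

Lemma cube_extension k n (beta : Rn k.+1 -> Rn n.+1) (alpha : Rn n.+1 -> Heis n) :
  (0 < n)%N -> (n + 2 <= k)%N -> (k + 2 <= 2 * n)%N -> lipx bdy beta ->
  (forall u, bdy u -> bdy (beta u)) -> lipx bdy alpha ->
  exists F : Rn k.+1 -> Heis n, lipx cub F /\ forall u, bdy u -> F u = alpha (beta u).
Proof.
move=> n0 nk kn lb bb [L la].
have [r [C' [Ix [c [hr C'0 c_in c_disj ref]]]]] := refinement_step k n beta n0 nk kn lb bb.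
have la' : Lip bdy (L + 1) alpha by apply: Lip_weak la; lra.
have L0 : 0 < L + 1 by case: la; lra.
have ref' L' alpha' : 0 < L' -> Lip bdy L' alpha' -> exists Gal, refines k n beta r C' Ix c L' alpha' Gal.
  by move=> h1 h2; have [G [al h]] := ref L' alpha' h1 h2; exists (G, al).
have [F [lF bF]] := approx_limit k n beta r C' Ix c bb hr C'0 c_in c_disj ref' (L + 1) alpha L0 la'.
by exists F; split=> //; eexists; exact: lF.
Qed.

Lemma sqr_sum_ge0 m (u : Rn m) : 0 <= rsum (fun i => u i * u i).
Proof. by apply: rsum_ge0 => i; nra. Qed.

Lemma nrm_enorm m (u : Rn m) : nrm u <= enorm u.
Proof.
apply: nrm_le => [|i]; first exact: sqrt_pos.
rewrite /enorm -sqrt_Rsqr_abs; apply: sqrt_le_1_alt.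
by apply: (rsum_term _ (fun i => u i * u i)) => j; nra.
Qed.

Lemma enorm_nrm m (u : Rn m) : enorm u <= (INR m + 1) * nrm u.
Proof.
have m0 := pos_INR m; have n0 := nrm_pos _ u.
have p : 0 <= (INR m + 1) * nrm u by apply: Rmult_le_pos; lra.
rewrite /enorm -(sqrt_square ((INR m + 1) * nrm u)) //; apply: sqrt_le_1_alt.
apply: (@Rle_trans _ (INR m * (nrm u * nrm u))).
  rewrite -rsum_const; apply: rsum_le => i.
  have h := nrm_coord _ u i; have := Rabs_pos (u i) => a.
  have -> : u i * u i = Rabs (u i) * Rabs (u i).
    by rewrite -Rabs_mult Rabs_right //; nra.
  by apply: Rmult_le_compat.
have : 0 <= nrm u * nrm u by apply: Rmult_le_pos.
by nra.
Qed.

Definition enormalize {m} (u : Rn m) : Rn m := fun i => u i * / enorm u.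

Lemma enorm_scale m c (u : Rn m) : 0 <= c -> enorm (fun i => c * u i) = c * enorm u.
Proof.
move=> c0; rewrite /enorm -[X in X * _](sqrt_square c) // -sqrt_mult_alt; last by nra.
by congr sqrt; rewrite -rsum_mul; apply: rsum_eq => i; ring.
Qed.

Lemma enormalize_sphere m (u : Rn m.+1) : bdy u -> sphere m (enormalize u).
Proof.
move=> b; have := nrm_enorm _ u; rewrite b => e1.
have ie : 0 < / enorm u by apply: Rinv_0_lt_compat; lra.
have -> : enormalize u = fun i => / enorm u * u i.
  by apply: functional_extensionality => i; exact: Rmult_comm.
by rewrite /sphere enorm_scale ?Rinv_l; lra.
Qed.

Lemma enormalize_nu m (u : Rn m.+1) : sphere m u -> enormalize (nu u) = u.
Proof.
rewrite /sphere => e1; have p : 0 < nrm u.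
  have := enorm_nrm _ u; rewrite e1 => h; apply: Rnot_le_lt => le.
  by have := pos_INR m.+1; have := nrm_pos _ u; nra.
have ip : 0 < / nrm u by exact: Rinv_0_lt_compat.
have e : enorm (nu u) = / nrm u.
  rewrite -[RHS]Rmult_1_r -e1 -enorm_scale; last lra.
  by congr enorm; apply: functional_extensionality => i; rewrite /nu; ring.
by apply: functional_extensionality => i; rewrite /enormalize e /nu; field; lra.
Qed.

Lemma enormalize_lipx m : lipx bdy (@enormalize m).
Proof.
have co (i : 'I_m) : lipx bdy (fun u : Rn m => u i) by exact: lipx_coord.
have cb (i : 'I_m) : bnd bdy (fun u : Rn m => u i).
  by exists 1 => u b; have := nrm_coord _ u i; rewrite b.
have e1 (u : Rn m) : bdy u -> 1 <= enorm u by move=> <-; exact: nrm_enorm.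
have lS : lipx bdy (fun u : Rn m => rsum (fun i => u i * u i)).
  apply: (lipx_rsum (Rn_met m) m bdy (fun u : Rn m => (fun i => u i * u i) : Rn m)).
  by apply: lipx_vec => i; exact: lipx_mul.
have le : lipx bdy (@enorm m).
  apply: (lipx_sqrt _ _ _ 1 _ lS) => [|u b]; first lra.
  have -> : rsum (fun i => u i * u i) = enorm u * enorm u.
    by rewrite /enorm sqrt_sqrt //; exact: sqr_sum_ge0.
  by have := e1 u b; nra.
apply: lipx_vec => i; apply: lipx_mul => //.
  by apply: (lipx_inv _ _ 1) => //; lra.
by apply: (bnd_inv _ _ 1) => //; lra.
Qed.

Theorem theorem1 (n k : nat) (hn : (1 <= n)%nat) (hk1 : (n + 2 <= k)%nat)
  (hk2 : (k < 2 * n - 1)%nat)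
  (alpha : Rn n.+1 -> Heis n) (beta : Rn k.+1 -> Rn n.+1)
  (hbeta_S : forall u, sphere k u -> sphere n (beta u))
  (halpha : lipschitz_H (@sphere n) alpha)
  (hbeta : lipschitz_E (@sphere k) beta) :
  exists F : Rn k.+1 -> Heis n,
    lipschitz_H (@ball k.+1) F /\
    (forall u, sphere k u -> F u = alpha (beta u)).
Proof.
have n0 : (0 < n)%N by lia.
have kn : (k + 2 <= 2 * n)%N by lia.
have edist_ds m (u v : Rn m) : edist u v <= (INR m + 1) * ds u v by exact: (enorm_nrm _ (fun i => u i - v i)).
have ds_edist m (u v : Rn m) : ds u v <= edist u v by exact: (nrm_enorm _ (fun i => u i - v i)).
have const_le L m (u v : Rn m) : L * edist u v <= Rabs L * (INR m + 1) * ds u v.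
  apply: Rle_trans (_ : Rabs L * edist u v <= _).
    by apply: Rmult_le_compat_r; [exact: sqrt_pos|exact: Rle_abs].
  by rewrite Rmult_assoc; apply: Rmult_le_compat_l; [exact: Rabs_pos|exact: edist_ds].
have const_pos L m : 0 <= Rabs L * (INR m + 1).
  by apply: Rmult_le_pos; [exact: Rabs_pos|have := pos_INR m; lra].
have la : lipx (@sphere n) alpha.
  have [L hL] := halpha; exists (Rabs L * (INR n.+1 + 1)); split=> // u v su sv.
  exact: Rle_trans (cc_ds _ _ _ _ (hL u v su sv)) (const_le L _ u v).
have lb : lipx (@sphere k) beta.
  have [L hL] := hbeta; exists (Rabs L * (INR k.+1 + 1)); split=> // u v su sv.
  exact: Rle_trans (ds_edist _ _ _) (Rle_trans _ _ _ (hL u v su sv) (const_le L _ u v)).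
pose cmin := / (INR n.+1 + 1); pose cmin' := / (INR k.+1 + 1).
have nrm_low m (u : Rn m.+1) : sphere m u -> / (INR m.+1 + 1) <= nrm u.
  move=> e; have := enorm_nrm _ u; rewrite (e : enorm u = 1) => h; have p := pos_INR m.+1.
  apply: (Rmult_le_reg_l (INR m.+1 + 1)); first lra.
  by rewrite Rinv_r; lra.
have cp m : 0 < / (INR m.+1 + 1) by apply: Rinv_0_lt_compat; have := pos_INR m.+1; lra.
(* On round spheres [enormalize] inverts [nu], so [alphac o betac] is [alpha o beta] read on the
   boundary of the cube. *)
pose betac u := nu (beta (enormalize u)); pose alphac w := alpha (enormalize w).
have bbc u : bdy u -> bdy (betac u).
  move=> b; apply: nu_nrm; have := nrm_low _ _ (hbeta_S _ (enormalize_sphere _ u b)).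
  by have := cp n; lra.
have lbc : lipx bdy betac.
  apply: (lipx_comp (Rn_met k.+1) (Rn_met n.+1) (Rn_met n.+1) _ (fun u => / (INR n.+1 + 1) <= nrm u)
    (fun u => beta (enormalize u))) (nu_lipx _ _ (cp n)).
    by move=> u b; exact/nrm_low/hbeta_S/enormalize_sphere.
  apply: (lipx_comp (Rn_met k.+1) (Rn_met k.+1) (Rn_met n.+1) _ (@sphere k) (@enormalize _) beta) => //.
    exact: enormalize_sphere.
  exact: enormalize_lipx.
have lac : lipx bdy alphac.
  apply: (lipx_comp (Rn_met n.+1) (Rn_met n.+1) (Heis_met n) _ (@sphere n) (@enormalize _) alpha) => //.
    exact: enormalize_sphere.
  exact: enormalize_lipx.
have [F0 [lF0 F0b]] := cube_extension k n betac alphac n0 hk1 kn lbc bbc lac.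
pose c := / (INR k.+1 + 1).
(* It agrees with [nu] on the sphere, where [nrm u >= c], and the maximum keeps it Lipschitz near
   the origin. *)
pose phi (u : Rn k.+1) : Rn k.+1 := fun i => u i * / Rmax (nrm u) c.
have phi_cub u : cub (phi u).
  have m0 : 0 < Rmax (nrm u) c by apply: Rlt_le_trans (cp k) (Rmax_r _ _).
  have im := Rinv_0_lt_compat _ m0.
  have -> : phi u = fun i => / Rmax (nrm u) c * u i by apply: functional_extensionality => i; exact: Rmult_comm.
  rewrite /cub scale_nrm; last lra.
  by rewrite -(Rinv_l (Rmax (nrm u) c)); [apply: Rmult_le_compat_l; [lra|exact: Rmax_l]|lra].
have lphi : lipx (@ball k.+1) phi.
  apply: lipx_vec => i; apply: lipx_mul.
  - exact: lipx_coord.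
  - apply: (lipx_inv _ _ c); [exact: cp| |by move=> u _; exact: Rmax_r].
    by apply: lipx_max; [exact: lipx_nrm|exact: lipx_cst].
  - by exists 1 => u b; apply: Rle_trans (nrm_coord _ u i) (Rle_trans _ _ _ (nrm_enorm _ u) b).
  by apply: (bnd_inv _ _ c); [exact: cp|move=> u _; exact: Rmax_r].
have [M [M0 lF]] : lipx (@ball k.+1) (fun u => F0 (phi u)).
  exact: (lipx_comp (Rn_met k.+1) (Rn_met k.+1) (Heis_met n) _ cub phi F0).
have [C [C0 cc]] := ds_cc n n0.
exists (fun u => F0 (phi u)); split.
  exists (C * M) => u v bu bv; rewrite Rmult_assoc; apply: cc.
  apply: Rle_trans (lF u v bu bv) _.
  by apply: Rmult_le_compat_l => //; exact: ds_edist.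
move=> u su; have low := nrm_low _ u su; have := cp k => p.
have -> : phi u = nu u.
  by apply: functional_extensionality => i; rewrite /phi Rmax_left.
rewrite F0b; last by apply: nu_nrm; lra.
by rewrite /alphac /betac enormalize_nu // enormalize_nu //; exact: hbeta_S.
Qed.
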